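(* Let $A$ be a separable stable homotopy symmetric real $C^*$-algebra. Then the suspension map $\Sigma:[[A,B]]\to E(A,B)$ is an isomorphism for all separable stable real $C^*$-algebras $B$.
   Context: A real $C^*$-algebra is a real Banach $*$-algebra $D$ with $\|a^*a\|=\|a\|^2$ and with $1+a^*a$ invertible in the unitization for all $a\in D$. $\mathcal K^{\mathbb R}$ is the real $C^*$-algebra of compact operators on a separable infinite-dimensional real Hilbert space; $B$ is stable if $B\cong B\otimes\mathcal K^{\mathbb R}$. An asymptotic morphism $(\varphi_t):A\to B$ of real $C^*$-algebras is a family of maps $\varphi_t:A\to B$, $t\in[1,\infty)$, such that $t\mapsto\varphi_t(a)$ is bounded and continuous for every $a\in A$ and $(\varphi_t)$ is asymptotically (as $t\to\infty$, in norm, for fixed elements) $\mathbb R$-linear, multiplicative and $*$-preserving. $[[A,B]]$ is the set of homotopy classes of asymptotic morphisms $A\to B$, a homotopy being an asymptotic morphism $A\to C([0,1],B)$. If $B$ is stable, direct sum makes $[[A,B]]$ an abelian semigroup with identity the class of $0$. $SA=C_0((0,1),A)$, and $\Sigma:[[A,B]]\to[[SA,SB]]$ is the suspension map. $E(A,B)=[[SA,SB\otimes\mathcal K^{\mathbb R}]]$, which is identified with $[[SA,SB]]$ when $B$ is stable. $A$ is homotopy symmetric if the class of the homomorphism $A\to A\otimes\mathcal K^{\mathbb R}$, $a\mapsto a\otimes e$ ($e\in\mathcal K^{\mathbb R}$ a rank one projection), is invertible in $[[A,A\otimes\mathcal K^{\mathbb R}]]$. *)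

(* Defs.v *)
From HB Require Import structures.
From mathcomp Require Import all_boot all_order all_algebra generic_quotient.
From mathcomp Require Import all_classical all_reals topology normedtype ring lra.

Set Implicit Arguments.
Unset Strict Implicit.
Unset Printing Implicit Defensive.

Import Order.TTheory GRing.Theory Num.Theory.
Import numFieldNormedType.Exports.

Local Open Scope classical_set_scope.
Local Open Scope ring_scope.

(* [(x, s)] stands for [x + s 1] in the unitization. *)
Definition unitization_mul (R : pzRingType) (D : lmodType R) (mul : D -> D -> D)
    (u v : D * R) : D * R :=
  (mul u.1 v.1 + u.2 *: v.1 + v.2 *: u.1, u.2 * v.2).

Definition unitization_invertible (R : pzRingType) (D : lmodType R)
    (mul : D -> D -> D) (u : D * R) : Prop :=
  exists v, unitization_mul mul u v = (0, 1) /\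
            unitization_mul mul v u = (0, 1).

HB.mixin Record CompleteNormedModule_isRealCstar (R : realType) D
    & CompleteNormedModule R D := {
  cmul : D -> D -> D;
  cstar : D -> D;
  cmulA : associative cmul;
  cmulDl : left_distributive cmul +%R;
  cmulDr : right_distributive cmul +%R;
  cmulZl : forall (k : R) x y, cmul (k *: x) y = k *: cmul x y;
  cmulZr : forall (k : R) x y, cmul x (k *: y) = k *: cmul x y;
  cnormM : forall x y, `|cmul x y| <= `|x| * `|y|;
  cstarK : involutive cstar;
  cstarD : {morph cstar : x y / x + y};
  cstarZ : forall (k : R) x, cstar (k *: x) = k *: cstar x;
  cstarM : forall x y, cstar (cmul x y) = cmul (cstar y) (cstar x);
  cnorm_star_mul : forall x, `|cmul (cstar x) x| = `|x| ^+ 2;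
  cunit_star_mul : forall x,
    unitization_invertible cmul (cmul (cstar x) x, 1)
}.

#[short(type="realCstarType")]
HB.structure Definition RealCstar (R : realType) :=
  {D of CompleteNormedModule_isRealCstar R D & CompleteNormedModule R D}.

Notation "x ** y" := (cmul x y) (at level 40, left associativity).

Definition separable (T : topologicalType) : Prop :=
  exists D : set T, countable D /\ dense D.

Section cstar_theory.
Variables (R : realType) (D : realCstarType R).
Implicit Types x y z : D.

Lemma cmul0r x : 0 ** x = 0.
Proof. by have := cmulZl 0 (0 : D) x; rewrite !scale0r. Qed.

Lemma cmulr0 x : x ** 0 = 0.
Proof. by have := cmulZr 0 x (0 : D); rewrite !scale0r. Qed.

Lemma cmulNr x y : (- x) ** y = - (x ** y).
Proof. by rewrite -scaleN1r cmulZl scaleN1r. Qed.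

Lemma cmulrN x y : x ** (- y) = - (x ** y).
Proof. by rewrite -scaleN1r cmulZr scaleN1r. Qed.

Lemma cmulBl x y z : (x - y) ** z = x ** z - y ** z.
Proof. by rewrite cmulDl cmulNr. Qed.

Lemma cmulBr x y z : z ** (x - y) = z ** x - z ** y.
Proof. by rewrite cmulDr cmulrN. Qed.

Lemma cstar0 : cstar (0 : D) = 0.
Proof. by have := cstarZ 0 (0 : D); rewrite !scale0r. Qed.

Lemma cstarN x : cstar (- x) = - cstar x.
Proof. by rewrite -scaleN1r cstarZ scaleN1r. Qed.

Lemma cstarB x y : cstar (x - y) = cstar x - cstar y.
Proof. by rewrite cstarD cstarN. Qed.

Lemma cnorm_star x : `|cstar x| = `|x|.
Proof.
have le y : `|y| <= `|cstar y|.
  have [->|y0] := eqVneq y 0; first by rewrite cstar0.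
  have yp : 0 < `|y| by rewrite normr_gt0.
  by rewrite -(ler_pM2r yp) -expr2 -cnorm_star_mul cnormM.
by apply/eqP; rewrite eq_le le andbT; have := le (cstar x); rewrite cstarK.
Qed.

Lemma cstar_mul_eq0 x : cstar x ** x = 0 -> x = 0.
Proof.
by move=> x0; apply/eqP; rewrite -normr_eq0 -sqrf_eq0 -cnorm_star_mul x0 normr0.
Qed.

Lemma cmul_inj x y : (forall z, cstar z ** x = cstar z ** y) -> x = y.
Proof.
move=> xy; apply/eqP; rewrite -subr_eq0; apply/eqP/cstar_mul_eq0.
by rewrite cmulBr xy subrr.
Qed.

Lemma cmul_injr x y : (forall z, x ** z = y ** z) -> x = y.
Proof.
move=> xy; apply: (can_inj cstarK); apply: cmul_inj => z.
by rewrite -!cstarM xy.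
Qed.

(* (1 + x)(1 + y) = (1 + y)(1 + x) = 1, without the unit. *)
Definition quasi_inverse x y := y + x ** y + x = 0 /\ y + y ** x + x = 0.

Lemma unitization_invertibleP x :
  unitization_invertible (@cmul R D) (x, 1) <-> exists y, quasi_inverse x y.
Proof.
have E u v (s : R) : unitization_mul (@cmul R D) (u, 1) (v, s) =
    (v + u ** v + s *: u, s).
  by rewrite /unitization_mul/= scale1r mul1r (addrC (u ** v)).
have F u v (s : R) : unitization_mul (@cmul R D) (v, s) (u, 1) =
    (v + v ** u + s *: u, s).
  by rewrite /unitization_mul/= scale1r mulr1 addrAC (addrC (v ** u)).
split=> [[[y s]]|[y [xy yx]]].
  rewrite E F => -[[xy s1] [yx _]]; subst s.
  by exists y; rewrite /quasi_inverse; move: xy yx; rewrite scale1r.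
by exists (y, 1); rewrite E F scale1r xy yx.
Qed.

Lemma quasi_inverseB x y x' y' : quasi_inverse x y -> quasi_inverse x' y' ->
  y' - y = (x - x') + y' ** (x - x') + (x - x') ** y + y' ** (x - x') ** y.
Proof.
move=> [xy _] [_ yx'].
have {}xy : x ** y = - (y + x).
  by apply/eqP; rewrite -addr_eq0 addrA (addrC _ y) xy.
have {}yx' : y' ** x' = - (y' + x').
  by apply/eqP; rewrite -addr_eq0 addrA (addrC _ y') yx'.
rewrite !cmulBr !cmulBl -(cmulA y' x y) xy yx' cmulNr cmulrN cmulDl cmulDr.
rewrite !opprD !opprK !addrA.
by rewrite [RHS](ACl (4*6*1*7*5*2*3*10*12*8*11*9))/= !addrK.
Qed.

End cstar_theory.

Definition unit_itv (R : realType) : Type := set_type `[0 : R, 1].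
HB.instance Definition _ (R : realType) :=
  Topological.copy (unit_itv R) (set_type `[0 : R, 1]).

Section unit_itv.
Variable R : realType.

Lemma clamp_subproof (x : R) : Num.max 0 (Num.min x 1) \in `[0 : R, 1]%classic.
Proof.
by rewrite inE/= in_itv/= le_max lexx/= ge_max ler01 ge_min lexx orbT.
Qed.

Definition clamp (x : R) : unit_itv R := 
  exist (fun y => y \in `[0 : R, 1]%classic) _ (clamp_subproof x).

Lemma val_itv_ge0 (x : unit_itv R) : 0 <= set_val x.
Proof. by have := set_mem (valP x); rewrite /= in_itv/= => /andP[]. Qed.

Lemma val_itv_le1 (x : unit_itv R) : set_val x <= 1.
Proof. by have := set_mem (valP x); rewrite /= in_itv/= => /andP[]. Qed.

Lemma clampK (x : unit_itv R) : clamp (set_val x) = x.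
Proof.
apply/val_inj => /=; rewrite set_valE.
by rewrite min_l ?val_itv_le1// max_r// val_itv_ge0.
Qed.

Lemma clamp_continuous : continuous clamp.
Proof.
apply: continuous_comp_initial => x.
have -> : set_val \o clamp = (cst (0 : R)) \max (@id R \min (cst (1 : R))).
  by apply/funext => y /=; rewrite set_valE.
apply: continuous_max; first exact: cvg_cst.
by apply: continuous_min; [exact: cvg_id|exact: cvg_cst].
Qed.

Lemma unit_itv_bounded (V : normedModType R) (f : unit_itv R -> V) :
  continuous f -> exists M, forall x, `|f x| <= M.
Proof.
move=> cf.
have cg : continuous (f \o clamp).
  by move=> x; apply: continuous_comp; [exact: clamp_continuous|exact: cf].
have /compact_bounded[M [_ /(_ (M + 1))]] :
    compact ((f \o clamp) @` `[0 : R, 1]%classic).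
  apply: continuous_compact; last exact: segment_compact.
  exact: continuous_subspaceT.
rewrite ltrDl ltr01 => /(_ isT) Mf; exists (M + 1) => x; apply: Mf.
exists (set_val x); last by rewrite /= clampK.
by rewrite /= in_itv/= val_itv_ge0 val_itv_le1.
Qed.

End unit_itv.

(* [itv_algebra Z B] is the algebra of the continuous functions [0, 1] -> B
   that vanish on Z, i.e. C_0([0, 1] \ Z, B), with the sup norm. *)
Section itv_algebra.
Variables (R : realType) (Z : set (unit_itv R)).
Local Notation I := (unit_itv R).

Definition itv_pred (V : normedModType R) : {pred I -> V} :=
  fun f => `[< continuous f /\ forall x, Z x -> f x = 0 >].

Record itv_algebra (V : normedModType R) := ItvAlgebra {
  itv_fun :> I -> V;
  _ : itv_fun \in @itv_pred V
}.

Section normed_module.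
Variable V : normedModType R.
Local Notation C := (itv_algebra V).

HB.instance Definition _ := [isSub for @itv_fun V].
HB.instance Definition _ := [Choice of C by <:].

Lemma itv_submod_closed : submod_closed (@itv_pred V).
Proof.
split=> [|k f g /asboolP[cf f0] /asboolP[cg g0]]; apply/asboolP; split=> [x|x Zx].
- exact: cst_continuous.
- by [].
- apply: (continuousD _ (cg x)).
  by apply: (@continuousZ _ _ _ (cst k) f x _ (cf x)); exact: cst_continuous.
- by rewrite /= !fctE f0// g0// scaler0 addr0.
Qed.

HB.instance Definition _ :=
  GRing.isSubmodClosed.Build R (I -> V) (@itv_pred V) itv_submod_closed.
HB.instance Definition _ := [SubChoice_isSubLmodule of C by <:].

Lemma itv_continuous (f : C) : continuous f.
Proof. by case: f => f /= /asboolP[]. Qed.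

Lemma itv_vanish (f : C) x : Z x -> f x = 0.
Proof. by case: f => f /= /asboolP[_ ]; apply. Qed.

Definition mk_itv (f : I -> V) (cf : continuous f)
  (f0 : forall x, Z x -> f x = 0) : C := ItvAlgebra (asboolT (conj cf f0)).

Lemma itv_eqP (f g : C) : f = g <-> f =1 g.
Proof. by split=> [->//|fg]; apply/val_inj/funext. Qed.

Lemma itvDE (f g : C) x : (f + g) x = f x + g x. Proof. by []. Qed.
Lemma itvZE (k : R) (f : C) x : (k *: f) x = k *: f x. Proof. by []. Qed.
Lemma itvNE (f : C) x : (- f) x = - f x. Proof. by []. Qed.
Lemma itv0E x : (0 : C) x = 0. Proof. by []. Qed.

Definition itv_norm (f : C) : R := sup (range (fun x => `|f x|)).

Lemma itv_norm_has_sup (f : C) : has_sup (range (fun x => `|f x|)).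
Proof.
split; first by exists `|f (clamp 0)|; exists (clamp 0).
have [M fM] := unit_itv_bounded (@itv_continuous f).
by exists M => _ [x _ <-].
Qed.

Lemma itv_norm_ge (f : C) x : `|f x| <= itv_norm f.
Proof. by apply: (sup_upper_bound (itv_norm_has_sup f)); exists x. Qed.

Lemma itv_norm_le (f : C) M : (forall x, `|f x| <= M) -> itv_norm f <= M.
Proof.
move=> fM; apply: ge_sup; first by case: (itv_norm_has_sup f).
by move=> _ [x _ <-].
Qed.

Lemma itv_normD (f g : C) : itv_norm (f + g) <= itv_norm f + itv_norm g.
Proof.
apply: itv_norm_le => x; rewrite itvDE (le_trans (ler_normD _ _))//.
by rewrite lerD// itv_norm_ge.
Qed.

Lemma itv_normZ (k : R) (f : C) : itv_norm (k *: f) = `|k| * itv_norm f.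
Proof.
have le (l : R) (g : C) : itv_norm (l *: g) <= `|l| * itv_norm g.
  apply: itv_norm_le => x; rewrite itvZE normrZ ler_wpM2l// itv_norm_ge//.
apply/eqP; rewrite eq_le le/=; have [->|k0] := eqVneq k 0.
  by rewrite normr0 mul0r (le_trans _ (itv_norm_ge _ (clamp 0))).
rewrite -ler_pdivlMl ?normr_gt0// -normfV (le_trans _ (le _ _))//.
by rewrite scalerA mulVf// scale1r.
Qed.

Lemma itv_norm_eq0 (f : C) : itv_norm f = 0 -> f = 0.
Proof.
move=> f0; apply/itv_eqP => x; apply/eqP; rewrite -normr_eq0 eq_le normr_ge0.
by rewrite andbT -f0 itv_norm_ge.
Qed.

HB.instance Definition _ :=
  Lmodule_isNormed.Build R C itv_normD itv_normZ itv_norm_eq0.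

Lemma itv_normP (f : C) M : `|f| <= M <-> forall x, `|f x| <= M.
Proof.
split=> [fM x|]; last exact: itv_norm_le.
exact: le_trans (itv_norm_ge _ _) fM.
Qed.

Lemma itv_normE (f : C) x : `|f x| <= `|f|.
Proof. exact: itv_norm_ge. Qed.

End normed_module.
End itv_algebra.

Section itv_complete.
Variables (R : realType) (Z : set (unit_itv R)) (V : completeNormedModType R).
Local Notation I := (unit_itv R).
Local Notation C := (itv_algebra Z V).

Lemma itv_complete (F : set_system C) : ProperFilter F -> cauchy F -> cvg F.
Proof.
move=> FF /cauchy_ballP Fc.
have Fc' (e : R) : 0 < e -> \forall f & g \near F, `|f - g| < e.
  by move=> /Fc; rewrite -ball_normE.
pose ev (x : I) (f : C) := f x.
have evc x : cvg (ev x @ F).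
  apply: cauchy_cvg; apply/cauchy_ballP => e e0.
  rewrite !near_simpl -ball_normE/=; move: (Fc' e e0).
  apply: filterS => -[f g] /=; apply: le_lt_trans.
  by rewrite -[ev x f - ev x g]/((f - g) x) itv_normE.
pose h x := lim (ev x @ F).
have Fh (e : R) : 0 < e -> \forall f \near F, forall x, `|ev x f - h x| <= e.
  move=> e0; near=> f => x.
  have /cvgrPdist_le fh : (fun g : C => f x - g x) @ F --> f x - h x.
    by apply: cvgB; [exact: cvg_cst|exact: evc].
  apply/ler_addgt0Pr => d d0; near F => g.
  rewrite -[f x - h x](subrK (f x - g x)) addrC (le_trans (ler_normD _ _))//.
  rewrite lerD//; last by near: g; exact: fh.
  rewrite (le_trans (itv_normE (f - g) x))// ltW//.
  by near: g; near: f; apply: nearP_dep; exact: Fc'.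
have hc : continuous h.
  move=> x; apply/(@cvgrPdist_le _ _ _ (nbhs x)) => e e0.
  have e3 : 0 < e / 3 by rewrite divr_gt0.
  near F => f.
  have fh : forall x, `|f x - h x| <= e / 3 by near: f; exact: Fh.
  have /(@cvgrPdist_le _ _ _ (nbhs x))/(_ _ e3) := @itv_continuous _ _ _ f x.
  apply: filterS => y fxy.
  have -> : h x - h y = (h x - f x) + (f x - f y) + (f y - h y).
    by rewrite !addrA !subrK.
  rewrite (_ : e = e / 3 + e / 3 + e / 3); last by lra.
  rewrite (le_trans (ler_normD _ _))// lerD//.
  by rewrite (le_trans (ler_normD _ _))// lerD// distrC.
have h0 x : Z x -> h x = 0.
  move=> Zx; rewrite /h (_ : ev x = cst 0); first exact: lim_cst.
  by apply/funext => f; rewrite /ev itv_vanish.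
apply/cvg_ex; exists (mk_itv hc h0); apply/cvgrPdist_le => e e0.
near=> f; rewrite distrC; apply/itv_normP => x.
by move: x; near: f; exact: Fh.
Unshelve. all: by end_near. Qed.

HB.instance Definition _ := Uniform_isComplete.Build C itv_complete.

End itv_complete.

Section itv_cstar.
Variables (R : realType) (Z : set (unit_itv R)) (B : realCstarType R).
Local Notation I := (unit_itv R).
Local Notation C := (itv_algebra Z B).

Lemma cvg_cmul (T : Type) (F : set_system T) {FF : Filter F} (f g : T -> B) a b :
  f @ F --> a -> g @ F --> b -> (fun t => f t ** g t) @ F --> a ** b.
Proof.
move=> /cvgrPdist_le fa /cvgrPdist_le gb; apply/cvgrPdist_le => e e0.
pose c := `|a| + `|b| + 1.
have c0 : 0 < c by rewrite ltr_wpDl// addr_ge0.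
have [d [d0 d1 dc]] : exists d, [/\ 0 < d, d <= 1 & d * c <= e].
  exists (Num.min 1 (e / c)); split.
  - by rewrite lt_min ltr01 divr_gt0.
  - by rewrite ge_min lexx.
  - by rewrite -ler_pdivlMr// ge_min lexx orbT.
apply: filterS2 (fa _ d0) (gb _ d0) => t fd gd.
have -> : a ** b - f t ** g t =
    (a - f t) ** b + a ** (b - g t) - (a - f t) ** (b - g t).
  rewrite !cmulBl !cmulBr !opprB !addrA.
  by rewrite [RHS](ACl (1*6*3*8*7*4*5*2))/= !addrK.
apply: le_trans (ler_normB _ _) _; apply: le_trans dc.
have h1 : `|(a - f t) ** b| <= d * `|b|.
  by rewrite (le_trans (cnormM _ _))// ler_wpM2r.
have h2 : `|a ** (b - g t)| <= d * `|a|.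
  by rewrite (le_trans (cnormM _ _))// mulrC ler_wpM2r.
have h3 : `|(a - f t) ** (b - g t)| <= d.
  by rewrite (le_trans (cnormM _ _))// -[leRHS]mulr1 ler_pM// (le_trans gd).
rewrite /c mulrDr mulr1 lerD// (le_trans (ler_normD _ _))// addrC mulrDr.
by rewrite lerD.
Qed.

Lemma cmul_continuous (f g : I -> B) : continuous f -> continuous g ->
  continuous (fun x => f x ** g x).
Proof. by move=> cf cg x; apply: (@cvg_cmul _ (nbhs x)); [exact: cf|exact: cg]. Qed.

Lemma cstar_continuous (f : I -> B) : continuous f ->
  continuous (fun x => cstar (f x)).
Proof.
move=> cf x; apply/(@cvgrPdist_le _ _ _ (nbhs x)) => e e0.
have /(@cvgrPdist_le _ _ _ (nbhs x))/(_ _ e0) := cf x.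
by apply: filterS => y; rewrite -cstarB cnorm_star.
Qed.

Lemma quasi_inverse_continuous (f g : I -> B) : continuous f ->
  (forall x, quasi_inverse (f x) (g x)) -> continuous g.
Proof.
move=> cf fg x; apply/(@cvgrPdist_le _ _ _ (nbhs x)) => e e0.
set c := 1 + `|g x|.
have c0 : 0 < c by rewrite ltr_pwDl.
have d0 : 0 < Num.min (c^-1 / 2) (e / (c ^+ 2 * 2)).
  by rewrite lt_min !divr_gt0 ?invr_gt0 ?mulr_gt0 ?exprn_gt0.
have /(@cvgrPdist_le _ _ _ (nbhs x))/(_ _ d0) := cf x.
apply: filterS => y; rewrite le_min => /andP[h1 h2].
have h3 : `|f x - f y| * c <= 2^-1.
  by rewrite -ler_pdivlMr// mulrC.
have h4 : `|f x - f y| * (c ^+ 2 * 2) <= e.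
  by rewrite -ler_pdivlMr// mulr_gt0// exprn_gt0.
rewrite distrC.
have : `|g y - g x| <= `|f x - f y| * ((1 + `|g y|) * c).
  rewrite (quasi_inverseB (fg x) (fg y)).
  set d := f x - f y.
  have -> : `|d| * ((1 + `|g y|) * c) =
    `|d| + `|g y| * `|d| + `|d| * `|g x| + `|g y| * `|d| * `|g x|.
    by rewrite /c; ring.
  rewrite (le_trans (ler_normD _ _))// lerD//.
    rewrite (le_trans (ler_normD _ _))// lerD ?cnormM//.
    by rewrite (le_trans (ler_normD _ _))// lerD ?cnormM.
  by rewrite (le_trans (cnormM _ _))// ler_wpM2r// cnormM.
have gy : `|g y| <= `|g x| + `|g y - g x|.
  by rewrite -{1}(subrKC (g x) (g y)) ler_normD.
have dge0 := normr_ge0 (f x - f y); have Dge0 := normr_ge0 (g y - g x).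
set d := `|f x - f y| in h3 h4 dge0 *; set D := `|g y - g x| in gy Dge0 *.
have : d * ((1 + `|g y|) * c) <= d * ((c + D) * c).
  by rewrite ler_wpM2l// ler_wpM2r// ?(ltW c0)// /c; lra.
have : D * (d * c) <= D * 2^-1 by rewrite ler_wpM2l.
have -> : d * ((c + D) * c) = d * (c ^+ 2 * 2) / 2 + D * (d * c) by field.
lra.
Qed.

Definition itv_mul (f g : C) : C.
Proof.
refine (@mk_itv _ Z _ (fun x => f x ** g x) _ _).
- exact: (cmul_continuous (@itv_continuous _ _ _ f) (@itv_continuous _ _ _ g)).
- by move=> x Zx; rewrite itv_vanish// cmul0r.
Defined.

Definition itv_star (f : C) : C.
Proof.
refine (@mk_itv _ Z _ (fun x => cstar (f x)) _ _).
- exact: (cstar_continuous (@itv_continuous _ _ _ f)).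
- by move=> x Zx; rewrite itv_vanish// cstar0.
Defined.

Lemma itv_mulA : associative itv_mul.
Proof. by move=> f g h; apply/itv_eqP => x; exact: cmulA. Qed.
Lemma itv_mulDl : left_distributive itv_mul +%R.
Proof. by move=> f g h; apply/itv_eqP => x; exact: cmulDl. Qed.
Lemma itv_mulDr : right_distributive itv_mul +%R.
Proof. by move=> f g h; apply/itv_eqP => x; exact: cmulDr. Qed.
Lemma itv_mulZl (k : R) f g : itv_mul (k *: f) g = k *: itv_mul f g.
Proof. by apply/itv_eqP => x; exact: cmulZl. Qed.
Lemma itv_mulZr (k : R) f g : itv_mul f (k *: g) = k *: itv_mul f g.
Proof. by apply/itv_eqP => x; exact: cmulZr. Qed.
Lemma itv_normM f g : `|itv_mul f g| <= `|f| * `|g|.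
Proof.
apply/itv_normP => x; rewrite (le_trans (cnormM _ _))//.
by rewrite ler_pM// itv_normE.
Qed.
Lemma itv_starK : involutive itv_star.
Proof. by move=> f; apply/itv_eqP => x; exact: cstarK. Qed.
Lemma itv_starD : {morph itv_star : f g / f + g}.
Proof. by move=> f g; apply/itv_eqP => x; exact: cstarD. Qed.
Lemma itv_starZ (k : R) f : itv_star (k *: f) = k *: itv_star f.
Proof. by apply/itv_eqP => x; exact: cstarZ. Qed.
Lemma itv_starM f g : itv_star (itv_mul f g) = itv_mul (itv_star g) (itv_star f).
Proof. by apply/itv_eqP => x; exact: cstarM. Qed.

Lemma itv_norm_star_mul f : `|itv_mul (itv_star f) f| = `|f| ^+ 2.
Proof.
have star_le : `|itv_star f| <= `|f|.
  by apply/itv_normP => x; rewrite cnorm_star itv_normE.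
apply/eqP; rewrite eq_le (le_trans (itv_normM _ _))/=; last first.
  by rewrite expr2 ler_wpM2r.
rewrite -[leRHS]sqr_sqrtr// ler_sqr ?nnegrE ?sqrtr_ge0//.
apply/itv_normP => x; rewrite -ler_sqr ?nnegrE ?sqrtr_ge0// sqr_sqrtr//.
by rewrite -cnorm_star_mul (itv_normE (itv_mul (itv_star f) f)).
Qed.

Lemma itv_unit_star_mul f :
  unitization_invertible itv_mul (itv_mul (itv_star f) f, 1).
Proof.
have /choice[g fg] : forall x, exists y, quasi_inverse (cstar (f x) ** f x) y.
  by move=> x; apply/unitization_invertibleP/cunit_star_mul.
have cg : continuous g.
  exact: (quasi_inverse_continuous
    (@itv_continuous _ _ _ (itv_mul (itv_star f) f)) fg).
have g0 x : Z x -> g x = 0.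
  move=> Zx; have [+ _] := fg x.
  by rewrite itv_vanish// cmulr0 cmul0r !addr0.
exists (mk_itv cg g0, 1); rewrite /unitization_mul/= !scale1r mulr1.
split; congr pair; apply/itv_eqP => x; have [xy yx] := fg x.
  by rewrite itv0E -[RHS]xy (addrC (g x)).
by rewrite itv0E -[RHS]yx (addrC (g x)) addrAC.
Qed.

HB.instance Definition _ := CompleteNormedModule_isRealCstar.Build R C
  itv_mulA itv_mulDl itv_mulDr itv_mulZl itv_mulZr itv_normM itv_starK
  itv_starD itv_starZ itv_starM itv_norm_star_mul itv_unit_star_mul.

Lemma itv_mulE (f g : C) x : (f ** g) x = f x ** g x. Proof. by []. Qed.
Lemma itv_starE (f : C) x : (cstar f) x = cstar (f x). Proof. by []. Qed.

End itv_cstar.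

(* The two-sided cylinder C([0, 1], B) and the suspension
   SB = C_0((0, 1), B). *)
Notation cylinder B := (itv_algebra set0 B).
Notation endpoints := ([set clamp 0; clamp 1]).
Notation suspension B := (itv_algebra endpoints B).

Section starhom.
Variable R : realType.
Implicit Types A B C : realCstarType R.

Definition is_starhom A B (f : A -> B) : Prop :=
  [/\ forall (k : R) x y, f (k *: x + y) = k *: f x + f y,
      forall x y, f (x ** y) = f x ** f y &
      forall x, f (cstar x) = cstar (f x)].

(* Contractivity is automatic, but it is convenient to have it at hand. *)
Record starhom A B := Starhom {
  starhom_fun :> A -> B;
  starhomP : is_starhom starhom_fun;
  starhom_contractive : forall x, `|starhom_fun x| <= `|x|
}.

Section starhom_theory.
Variables (A B : realCstarType R) (f : starhom A B).

Lemma starhomL (k : R) x y : f (k *: x + y) = k *: f x + f y.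
Proof. by case: (starhomP f). Qed.
Lemma starhomM x y : f (x ** y) = f x ** f y.
Proof. by case: (starhomP f). Qed.
Lemma starhom_star x : f (cstar x) = cstar (f x).
Proof. by case: (starhomP f). Qed.
Lemma starhomD x y : f (x + y) = f x + f y.
Proof. by have := starhomL 1 x y; rewrite !scale1r. Qed.
Lemma starhom0 : f 0 = 0.
Proof. by apply: (addrI (f 0)); rewrite -starhomD !addr0. Qed.
Lemma starhomZ (k : R) x : f (k *: x) = k *: f x.
Proof. by have := starhomL k x 0; rewrite starhom0 !addr0. Qed.
Lemma starhomN x : f (- x) = - f x.
Proof. by rewrite -scaleN1r starhomZ scaleN1r. Qed.
Lemma starhomB x y : f (x - y) = f x - f y.
Proof. by rewrite starhomD starhomN. Qed.

Lemma starhom_continuous : continuous f.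
Proof.
move=> x; apply/cvgrPdist_le => e e0.
have : \forall y \near x, `|x - y| <= e by exact: cvgr_dist_le.
by apply: filterS => y; rewrite -starhomB; apply/le_trans/starhom_contractive.
Qed.

End starhom_theory.

Section cyl_map.
Variables (A B : realCstarType R) (f : starhom A B).

Definition cyl_map_fun (h : cylinder A) : cylinder B.
Proof.
refine (@mk_itv _ set0 _ (fun x => f (h x)) _ _); last by [].
move=> x; apply: (@continuous_comp _ _ _ h f).
  exact: itv_continuous.
exact: starhom_continuous.
Defined.

Lemma cyl_map_starhom : is_starhom cyl_map_fun.
Proof.
split=> [k x y|x y|x]; apply/itv_eqP => z.
- exact: starhomL.
- exact: starhomM.
- exact: starhom_star.
Qed.

Lemma cyl_map_contractive h : `|cyl_map_fun h| <= `|h|.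
Proof.
apply/itv_normP => x; rewrite (le_trans (starhom_contractive _ _))//.
exact: itv_normE.
Qed.

Definition cyl_map := Starhom cyl_map_starhom cyl_map_contractive.

End cyl_map.

Section cyl_comp.
Variables (B : realCstarType R) (a : R -> R) (ca : continuous a).

Definition cyl_comp_fun (h : cylinder B) : cylinder B.
Proof.
refine (@mk_itv _ set0 _ (fun x => h (clamp (a (set_val x)))) _ _); last by [].
move=> x; apply: (@continuous_comp _ _ _ (fun x => clamp (a (set_val x))) h).
  apply: (@continuous_comp _ _ _ (fun x => a (set_val x)) (@clamp R)).
    apply: (@continuous_comp _ _ _ set_val a); last exact: ca.
    exact: initial_continuous.
  exact: clamp_continuous.
exact: itv_continuous.
Defined.

Lemma cyl_comp_starhom : is_starhom cyl_comp_fun.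
Proof. by split=> [k x y|x y|x]; apply/itv_eqP. Qed.

Lemma cyl_comp_contractive h : `|cyl_comp_fun h| <= `|h|.
Proof. by apply/itv_normP => x; exact: (itv_normE h). Qed.

Definition cyl_comp := Starhom cyl_comp_starhom cyl_comp_contractive.

End cyl_comp.

Section cyl_cst.
Variables B : realCstarType R.

Definition cyl_cst_fun (b : B) : cylinder B.
Proof.
by refine (@mk_itv _ set0 _ (fun=> b) _ _); [exact: cst_continuous|].
Defined.

Lemma cyl_cst_starhom : is_starhom cyl_cst_fun.
Proof. by split=> [k x y|x y|x]; apply/itv_eqP. Qed.

Lemma cyl_cst_contractive b : `|cyl_cst_fun b| <= `|b|.
Proof. by apply/itv_normP => x. Qed.

Definition cyl_cst := Starhom cyl_cst_starhom cyl_cst_contractive.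

End cyl_cst.

End starhom.

Section asymptotic_morphisms.
Variable R : realType.
Implicit Types A B C : realCstarType R.

(* Only the values at parameters t >= 1 are meaningful. *)
Record asymptotic_morphism A B (phi : R -> A -> B) : Prop := {
  asym_bounded : forall a, exists M, forall t, 1 <= t -> `|phi t a| <= M;
  asym_continuous : forall a, {within `[1, +oo[, continuous (phi ^~ a)};
  asym_linear : forall (k : R) a b,
    phi t (k *: a + b) - (k *: phi t a + phi t b) @[t --> +oo_R] --> (0 : B);
  asym_mul : forall a b,
    phi t (a ** b) - phi t a ** phi t b @[t --> +oo_R] --> (0 : B);
  asym_star : forall a,
    phi t (cstar a) - cstar (phi t a) @[t --> +oo_R] --> (0 : B)
}.

Record asym A B := Asym {
  asym_fun :> R -> A -> B;
  asymP : asymptotic_morphism asym_fun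
}.

HB.instance Definition _ A B := gen_eqMixin (asym A B).
HB.instance Definition _ A B := gen_choiceMixin (asym A B).

Lemma cvg0_le (V W : normedModType R) (u : R -> V) (v : R -> W) :
  (forall t, 1 <= t -> `|v t| <= `|u t|) ->
  u t @[t --> +oo_R] --> (0 : V) -> v t @[t --> +oo_R] --> (0 : W).
Proof.
move=> vu /cvgr0Pnorm_le u0; apply/cvgr0Pnorm_le => e /u0.
apply: filterS2 (nbhs_pinfty_ge (num_real 1)) => t t1.
by apply: le_trans; exact: vu.
Qed.

Lemma cvg0_eq (V : normedModType R) (u v : R -> V) :
  (forall t, 1 <= t -> v t = u t) ->
  u t @[t --> +oo_R] --> (0 : V) -> v t @[t --> +oo_R] --> (0 : V).
Proof. by move=> vu; apply: cvg0_le => t /vu ->. Qed.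

Lemma cvg0_hom A B (f : starhom A B) (u : R -> A) :
  u t @[t --> +oo_R] --> (0 : A) -> f (u t) @[t --> +oo_R] --> (0 : B).
Proof. by apply: cvg0_le => t _; exact: starhom_contractive. Qed.

Lemma cvg0D (V : normedModType R) (u v : R -> V) :
  u t @[t --> +oo_R] --> (0 : V) -> v t @[t --> +oo_R] --> (0 : V) ->
  u t + v t @[t --> +oo_R] --> (0 : V).
Proof. by move=> u0 v0; rewrite -[X in _ --> X]addr0; exact: cvgD. Qed.

Lemma cvg0N (V : normedModType R) (u : R -> V) :
  u t @[t --> +oo_R] --> (0 : V) -> - u t @[t --> +oo_R] --> (0 : V).
Proof. by move=> u0; rewrite -[X in _ --> X]oppr0; exact: cvgN. Qed.

Lemma hom_asym_subproof A B (f : starhom A B) :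
  asymptotic_morphism (fun _ : R => f).
Proof.
split=> [a|a|k a b|a b|a].
- by exists `|f a|.
- by apply: continuous_subspaceT; exact: cst_continuous.
- by rewrite starhomL subrr; exact: cvg_cst.
- by rewrite starhomM subrr; exact: cvg_cst.
- by rewrite starhom_star subrr; exact: cvg_cst.
Qed.

Definition hom_asym A B (f : starhom A B) : asym A B :=
  Asym (hom_asym_subproof f).

Lemma asym_zero_subproof A B : asymptotic_morphism (fun (_ : R) (_ : A) => 0 : B).
Proof.
split=> [a|a|k a b|a b|a].
- by exists 0 => t _; rewrite normr0.
- by apply: continuous_subspaceT; exact: cst_continuous.
- by rewrite scaler0 addr0 subrr; exact: cvg_cst.
- by rewrite cmulr0 subrr; exact: cvg_cst.
- by rewrite cstar0 subrr; exact: cvg_cst.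
Qed.

Definition asym_zero A B : asym A B := Asym (asym_zero_subproof A B).

Section post.
Variables (A B C : realCstarType R) (f : starhom B C) (phi : asym A B).

Lemma asym_post_subproof : asymptotic_morphism (fun t a => f (phi t a)).
Proof.
split=> [a|a|k a b|a b|a].
- have [M phiM] := asym_bounded (asymP phi) a; exists M => t /phiM.
  by apply: le_trans; exact: starhom_contractive.
- have cphi : {within `[1, +oo[, continuous (phi ^~ a)}.
    exact: (asym_continuous (asymP phi)).
  move=> t; exact: (continuous_comp (cphi t) (@starhom_continuous _ _ _ f _)).
- apply: cvg0_eq (cvg0_hom f (asym_linear (asymP phi) k a b)) => t _.
  by rewrite starhomB starhomL.
- apply: cvg0_eq (cvg0_hom f (asym_mul (asymP phi) a b)) => t _.
  by rewrite starhomB starhomM.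
- apply: cvg0_eq (cvg0_hom f (asym_star (asymP phi) a)) => t _.
  by rewrite starhomB starhom_star.
Qed.

Definition asym_post : asym A C := Asym asym_post_subproof.

End post.

Section sum.
Variables (A B C : realCstarType R) (f g : starhom B C) (phi psi : asym A B).
Hypothesis fg0 : forall x y, f x ** g y = 0.

Lemma orth_sym x y : g x ** f y = 0.
Proof.
apply: (can_inj (@cstarK _ _)).
by rewrite cstarM -!starhom_star fg0 cstar0.
Qed.

Lemma asym_sum_subproof :
  asymptotic_morphism (fun t a => f (phi t a) + g (psi t a)).
Proof.
pose P := asymP (asym_post f phi); pose Q := asymP (asym_post g psi).
split=> [a|a|k a b|a b|a].
- have [M phiM] := asym_bounded P a; have [N psiN] := asym_bounded Q a.
  exists (M + N) => t t1; rewrite (le_trans (ler_normD _ _))// lerD//.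
    exact: phiM.
  exact: psiN.
- have cP : {within `[1, +oo[, continuous (fun t => f (phi t a))}.
    exact: (asym_continuous P).
  have cQ : {within `[1, +oo[, continuous (fun t => g (psi t a))}.
    exact: (asym_continuous Q).
  by move=> t; exact: (continuousD (cP t) (cQ t)).
- apply: cvg0_eq (cvg0D (asym_linear P k a b) (asym_linear Q k a b)) => t _ /=.
  by rewrite scalerDr !opprD !addrA [RHS](ACl (1*4*2*5*3*6))/=.
- apply: cvg0_eq (cvg0D (asym_mul P a b) (asym_mul Q a b)) => t _ /=.
  rewrite cmulDl !cmulDr fg0 orth_sym addr0 add0r opprD !addrA.
  by rewrite [RHS](ACl (1*3*2*4))/=.
- apply: cvg0_eq (cvg0D (asym_star P a) (asym_star Q a)) => t _ /=.
  by rewrite cstarD opprD !addrA [RHS](ACl (1*3*2*4))/=.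
Qed.

Definition asym_sum : asym A C := Asym asym_sum_subproof.

End sum.

Definition homotopic A B (phi psi : asym A B) : Prop :=
  exists H : asym A (cylinder B), forall t a, 1 <= t ->
    H t a (clamp 0) = phi t a /\ H t a (clamp 1) = psi t a.

Lemma homotopic_refl A B (phi : asym A B) : homotopic phi phi.
Proof. by exists (asym_post (cyl_cst B) phi). Qed.

Lemma homotopic_sym A B (phi psi : asym A B) :
  homotopic phi psi -> homotopic psi phi.
Proof.
move=> [H HP].
have ca : continuous (fun x : R => 1 - x).
  by move=> x; apply: cvgB; [exact: cvg_cst|exact: cvg_id].
exists (asym_post (cyl_comp B ca) H) => t a /HP -/(_ a)[H0 H1].
split; rewrite -?H0 -?H1/=; congr (H t a (clamp _)); rewrite set_valE/=.
  by rewrite min_l// maxxx subr0.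
by rewrite minxx max_r// subrr.
Qed.

Section concatenation.
Variables (A B : realCstarType R) (H G : asym A (cylinder B)).
Hypothesis HG : forall t a, 1 <= t -> H t a (clamp 1) = G t a (clamp 0).

Let ca : continuous (fun x : R => 2 * x).
Proof. by move=> x; apply: cvgM; [exact: cvg_cst|exact: cvg_id]. Qed.

Let cb : continuous (fun x : R => 2 * x - 1).
Proof. by move=> x; apply: cvgB; [exact: ca|exact: cvg_cst]. Qed.

Let cc : continuous (fun _ : R => 1 : R).
Proof. exact: cst_continuous. Qed.

Let P := asym_post (cyl_comp B ca) H.
Let Q := asym_post (cyl_comp B cb) G.
Let S := asym_post (cyl_comp B cc) H.

Let concatE t a x : 1 <= t -> (P t a + Q t a - S t a) x =
  if set_val x <= 2^-1 then P t a x else Q t a x.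
Proof.
move=> t1; rewrite !itvDE itvNE.
case: leP => x2 /=.
  rewrite (_ : clamp (2 * _ - 1) = clamp 0); last first.
    apply: val_inj => /=; rewrite !max_l// ge_min; apply/orP; left; lra.
  by rewrite HG// addrK.
rewrite (_ : clamp (2 * _) = clamp 1); last first.
  apply: val_inj => /=; rewrite !min_r//; lra.
by rewrite addrAC subrr add0r.
Qed.

Lemma concat_subproof :
  asymptotic_morphism (fun t a => P t a + Q t a - S t a).
Proof.
have [bP cP lP mP sP] := asymP P; have [bQ cQ lQ mQ sQ] := asymP Q.
have [bS cS lS mS sS] := asymP S.
split=> [a|a|k a b|a b|a].
- have [M PM] := bP a; have [N QN] := bQ a; have [L SL] := bS a.
  exists (M + N + L) => t t1; rewrite (le_trans (ler_normB _ _))//.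
  by rewrite lerD// ?SL// (le_trans (ler_normD _ _))// lerD// ?PM ?QN.
- have cPa : {within `[1, +oo[, continuous (P ^~ a)} by exact: cP.
  have cQa : {within `[1, +oo[, continuous (Q ^~ a)} by exact: cQ.
  have cSa : {within `[1, +oo[, continuous (S ^~ a)} by exact: cS.
  by move=> t; exact: (continuousB (continuousD (cPa t) (cQa t)) (cSa t)).
- apply: cvg0_eq (cvg0D (cvg0D (lP k a b) (lQ k a b)) (cvg0N (lS k a b))).
  move=> t _; rewrite scalerBr scalerDr !opprD !opprK !addrA.
  by rewrite [RHS](ACl (1*4*7*2*5*8*3*6*9))/=.
- apply: cvg0_eq (cvg0D (cvg0D (mP a b) (mQ a b)) (cvg0N (mS a b))).
  move=> t t1; rewrite [RHS](_ : _ = (P t (a ** b) + Q t (a ** b)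
      - S t (a ** b)) - (P t a ** P t b + Q t a ** Q t b - S t a ** S t b)).
    congr (_ - _); apply/itv_eqP => x; rewrite itv_mulE !concatE//.
    rewrite !itvDE itvNE !itv_mulE /=.
    case: leP => x2.
      rewrite (_ : clamp (2 * _ - 1) = clamp 0); last first.
        apply: val_inj => /=; rewrite !max_l// ge_min; apply/orP; left; lra.
      by rewrite !HG// addrK.
    rewrite (_ : clamp (2 * _) = clamp 1); last first.
      apply: val_inj => /=; rewrite !min_r//; lra.
    by rewrite addrAC subrr add0r.
  by rewrite !opprD !opprK !addrA [RHS](ACl (1*4*2*5*3*6))/=.
- apply: cvg0_eq (cvg0D (cvg0D (sP a) (sQ a)) (cvg0N (sS a))) => t _.
  rewrite cstarB cstarD !opprD !opprK !addrA.
  by rewrite [RHS](ACl (1*3*5*2*4*6))/=.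
Qed.

Definition asym_concat : asym A (cylinder B) := Asym concat_subproof.

Lemma asym_concat0 t a : 1 <= t -> asym_concat t a (clamp 0) = H t a (clamp 0).
Proof.
move=> t1; rewrite [LHS]concatE// ifT /=.
  by congr (H t a (clamp _)); rewrite set_valE/= min_l// maxxx mulr0.
rewrite set_valE/= min_l// maxxx; lra.
Qed.

Lemma asym_concat1 t a : 1 <= t -> asym_concat t a (clamp 1) = G t a (clamp 1).
Proof.
move=> t1; rewrite [LHS]concatE// ifF /=.
  congr (G t a (clamp _)); rewrite set_valE/= minxx max_r//; lra.
rewrite set_valE/= minxx max_r//; lra.
Qed.

End concatenation.

Lemma homotopic_trans A B (phi psi chi : asym A B) :
  homotopic phi psi -> homotopic psi chi -> homotopic phi chi.
Proof.
move=> [H HP] [G GP].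
have HG t a : 1 <= t -> H t a (clamp 1) = G t a (clamp 0).
  by move=> t1; rewrite (HP t a t1).2 (GP t a t1).1.
exists (asym_concat HG) => t a t1.
by rewrite asym_concat0// asym_concat1// (HP t a t1).1 (GP t a t1).2.
Qed.

Definition homotopicb A B : rel (asym A B) := fun phi psi => `[< homotopic phi psi >].

Lemma homotopicb_refl A B : reflexive (@homotopicb A B).
Proof. by move=> phi; apply/asboolP; exact: homotopic_refl. Qed.
Lemma homotopicb_sym A B : symmetric (@homotopicb A B).
Proof. by move=> phi psi; apply/asboolP/asboolP; exact: homotopic_sym. Qed.
Lemma homotopicb_trans A B : transitive (@homotopicb A B).
Proof.
move=> psi phi chi /asboolP h1 /asboolP h2; apply/asboolP.
exact: homotopic_trans h1 h2.
Qed.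

Canonical homotopic_equiv A B := EquivRel (@homotopicb A B)
  (@homotopicb_refl A B) (@homotopicb_sym A B) (@homotopicb_trans A B).

Definition homotopy_classes A B := {eq_quot (@homotopicb A B)}%qT.

Definition hclass A B (phi : asym A B) : homotopy_classes A B :=
  (\pi_({eq_quot (@homotopicb A B)}) phi)%qT.

Definition hrepr A B (x : homotopy_classes A B) : asym A B := repr x.

Lemma hreprK A B (x : homotopy_classes A B) : hclass (hrepr x) = x.
Proof. exact: reprK. Qed.

Lemma hclassP A B (phi psi : asym A B) :
  hclass phi = hclass psi <-> homotopic phi psi.
Proof.
split=> [/eqmodP/asboolP//|h]; exact/eqmodP/asboolP.
Qed.

End asymptotic_morphisms.

(* Multipliers of B, as adjointable operators: M(B) = L(B). *)
Record multiplier (R : realType) (B : realCstarType R) := Multiplier {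
  mult_op :> B -> B;
  mult_adj : B -> B;
  mult_adjP : forall x y, cstar (mult_op x) ** y = cstar x ** mult_adj y
}.

(* Isometries s1, s2 of M(B) with s1 s1^* + s2 s2^* = 1. They exist when B is
   stable, and give the identification M_2(B) = B, (b_ij) |-> sum_ij s_i b_ij
   s_j^*, through which the direct sum takes its values in B. *)
Record cuntz_pair (R : realType) (B : realCstarType R) := CuntzPair {
  cuntz1 : multiplier B;
  cuntz2 : multiplier B;
  cuntz1_isometry : forall x, mult_adj cuntz1 (cuntz1 x) = x;
  cuntz2_isometry : forall x, mult_adj cuntz2 (cuntz2 x) = x;
  cuntz_sum : forall x,
    cuntz1 (mult_adj cuntz1 x) + cuntz2 (mult_adj cuntz2 x) = x
}.

Section direct_sum.
Variables (R : realType) (B : realCstarType R).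
Implicit Types s : multiplier B.

Lemma mult_opL s (k : R) x y : s (k *: x + y) = k *: s x + s y.
Proof.
apply: (can_inj (@cstarK _ _)); apply: cmul_injr => z.
by rewrite mult_adjP !cstarD !cstarZ !cmulDl !cmulZl !mult_adjP.
Qed.

Lemma mult_adjL s (k : R) x y :
  mult_adj s (k *: x + y) = k *: mult_adj s x + mult_adj s y.
Proof.
apply: cmul_inj => z; rewrite -mult_adjP !cmulDr !cmulZr -!mult_adjP.
by [].
Qed.

Lemma mult_op0 s : s 0 = 0.
Proof. by have := mult_opL s (-1) 0 0; rewrite scaler0 addr0 scaleN1r addNr. Qed.

Lemma mult_adj0 s : mult_adj s 0 = 0.
Proof.
by have := mult_adjL s (-1) 0 0; rewrite scaler0 addr0 scaleN1r addNr.
Qed.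

Lemma mult_opM s x y : s (x ** y) = s x ** y.
Proof.
apply: (can_inj (@cstarK _ _)); apply: cmul_injr => z.
by rewrite mult_adjP !cstarM -!cmulA mult_adjP.
Qed.

(* b |-> s b s^* *)
Definition mult_conj s (b : B) : B := s (cstar (s (cstar b))).

Section isometry.
Variable s : multiplier B.
Hypothesis s_iso : forall x, mult_adj s (s x) = x.

Lemma isometry_norm x : `|s x| = `|x|.
Proof.
by apply/eqP; rewrite -(@eqrXn2 _ 2)// -!cnorm_star_mul mult_adjP s_iso.
Qed.

Lemma mult_conj_starhom : is_starhom (mult_conj s).
Proof.
split=> [k x y|x y|x]; rewrite /mult_conj.
- by rewrite cstarD cstarZ mult_opL cstarD cstarZ mult_opL.
- rewrite -mult_opM mult_adjP s_iso cstarK; congr (s _).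
  by rewrite cstarM mult_opM cstarM cstarK.
- apply: cmul_injr => z; rewrite cstarK -mult_opM !mult_adjP cstarK.
  by rewrite mult_opM.
Qed.

Lemma mult_conj_contractive b : `|mult_conj s b| <= `|b|.
Proof. by rewrite isometry_norm cnorm_star isometry_norm cnorm_star. Qed.

Definition conj_hom := Starhom mult_conj_starhom mult_conj_contractive.

End isometry.

Section cuntz.
Variable s : cuntz_pair B.

Definition cuntz_hom1 := conj_hom (@cuntz1_isometry _ _ s).
Definition cuntz_hom2 := conj_hom (@cuntz2_isometry _ _ s).

Lemma cuntz_orth x y : cuntz_hom1 x ** cuntz_hom2 y = 0.
Proof.
pose s1 := cuntz1 s; pose s2 := cuntz2 s.
have orth z : mult_adj s1 (s2 z) = 0.
  have := cuntz_sum s (s2 z); rewrite cuntz2_isometry -[RHS]add0r.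
  move=> /addIr/(congr1 (mult_adj s1)); rewrite cuntz1_isometry => ->.
  by rewrite mult_adj0.
rewrite /= /mult_conj -mult_opM mult_adjP orth cmulr0.
by rewrite mult_op0.
Qed.

Variable A : realCstarType R.

(* phi (+) psi = s1 phi s1^* + s2 psi s2^* *)
Definition direct_sum (phi psi : asym A B) : asym A B :=
  asym_sum phi psi cuntz_orth.

End cuntz.
End direct_sum.

Section semigroup.
Variables (R : realType) (A B : realCstarType R).

Definition hzero : homotopy_classes A B := hclass (asym_zero A B).

Definition hadd (s : cuntz_pair B) (x y : homotopy_classes A B) :
  homotopy_classes A B := hclass (direct_sum s (hrepr x) (hrepr y)).

Lemma haddE s (phi psi : asym A B) :
  hadd s (hclass phi) (hclass psi) = hclass (direct_sum s phi psi).
Proof.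
have /hclassP[H HP] := hreprK (hclass phi).
have /hclassP[G GP] := hreprK (hclass psi).
have orth x y : cyl_map (cuntz_hom1 s) x ** cyl_map (cuntz_hom2 s) y = 0.
  by apply/itv_eqP => z; exact: cuntz_orth.
apply/hclassP; exists (asym_sum H G orth) => t a t1 /=.
have [H0 H1] := HP t a t1; have [G0 G1] := GP t a t1.
by split; [rewrite -H0 -G0|rewrite -H1 -G1].
Qed.

End semigroup.

Section functoriality.
Variables (R : realType) (A B C : realCstarType R) (f : starhom B C).

Definition hpost (x : homotopy_classes A B) : homotopy_classes A C :=
  hclass (asym_post f (hrepr x)).

Lemma hpostE (phi : asym A B) : hpost (hclass phi) = hclass (asym_post f phi).
Proof.
have /hclassP[H HP] := hreprK (hclass phi).
apply/hclassP; exists (asym_post (cyl_map f) H) => t a t1 /=.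
by have [-> ->] := HP t a t1.
Qed.

End functoriality.

Section suspension.
Variables (R : realType) (A B : realCstarType R).

Definition susp_tensor (D : realCstarType R) (f : itv_algebra endpoints R^o)
  (a : D) : suspension D.
Proof.
refine (@mk_itv _ endpoints D (fun x => (f x : R) *: a) _ _).
- move=> x; apply: (@continuousZ _ _ _ (f : _ -> R^o) (cst a)).
    exact: (@itv_continuous _ _ _ f).
  exact: cst_continuous.
- by move=> x x01; rewrite itv_vanish// scale0r.
Defined.

(* The maps phi_t need not be continuous, so that phi_t need not act pointwise
   on SA.  The suspension of phi is instead the asymptotic morphism, unique up
   to homotopy, given by f (x) a |-> f (x) phi_t(a) on elementary tensors,
   up to an error that vanishes as t tends to infinity. *)
Definition is_suspension (phi : asym A B)
    (Phi : asym (suspension A) (suspension B)) : Prop :=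
  forall f a,
    Phi t (susp_tensor f a) - susp_tensor f (phi t a) @[t --> +oo_R] -->
      (0 : suspension B).

Definition is_suspension_map
    (Sigma : homotopy_classes A B ->
             homotopy_classes (suspension A) (suspension B)) : Prop :=
  forall phi : asym A B, (exists Phi, is_suspension phi Phi) /\
   (forall Phi, is_suspension phi Phi -> Sigma (hclass phi) = hclass Phi).

End suspension.

Section linear_independence.
Variables (R : realType) (V : lmodType R).

Definition linearly_independent n (v : 'I_n -> V) : Prop :=
  forall c : 'I_n -> R, \sum_(i < n) c i *: v i = 0 -> forall i, c i = 0.

Definition infinite_dimensional : Prop :=
  forall n, exists v : 'I_n -> V, linearly_independent v.

End linear_independence.

Record realHilbert (R : realType) := RealHilbert {
  hilbert_space :> completeNormedModType R;
  inner : hilbert_space -> hilbert_space -> R;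
  innerC : forall x y, inner x y = inner y x;
  innerL : forall (k : R) x y z,
    inner (k *: x + y) z = k * inner x z + inner y z;
  inner_norm : forall x, inner x x = `|x| ^+ 2
}.

Section inner.
Variables (R : realType) (H : realHilbert R).
Implicit Types x y z : H.

Lemma inner0 z : inner 0 z = 0.
Proof.
by have := innerL (-1) z z z; rewrite scaleN1r addNr mulN1r addNr.
Qed.

Lemma innerZ (k : R) x z : inner (k *: x) z = k * inner x z.
Proof. by have := innerL k x 0 z; rewrite inner0 !addr0. Qed.

Lemma inner_inj x y : (forall z, inner x z = inner y z) -> x = y.
Proof.
move=> xy; apply/eqP; rewrite -subr_eq0 -normr_eq0 -sqrf_eq0 -inner_norm.
by rewrite addrC -scaleN1r innerL -xy mulN1r addNr.
Qed.

End inner.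

Definition is_compact_operator (R : realType) (H : realHilbert R)
    (T : H -> H) : Prop :=
  (forall (k : R) x y, T (k *: x + y) = k *: T x + T y) /\
 compact (closure (T @` [set x | `|x| <= 1])).

(* The real C*-algebra of compact operators on a separable
   infinite-dimensional real Hilbert space, with its action. *)
Record compact_operators (R : realType) := CompactOperators {
  co_space : realHilbert R;
  co_separable : separable co_space;
  co_infinite : infinite_dimensional co_space;
  co_alg :> realCstarType R;
  co_op : co_alg -> co_space -> co_space;
  co_op_inj : injective co_op;
  co_op_compact : forall T, is_compact_operator T <-> exists k, co_op k = T;
  co_opL : forall (c : R) k l x,
    co_op (c *: k + l) x = c *: co_op k x + co_op l x;
  co_opM : forall k l x, co_op (k ** l) x = co_op k (co_op l x);
  co_op_star : forall k x y, inner (co_op (cstar k) x) y = inner x (co_op k y);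
  co_op_norm : forall k, `|k| = sup [set `|co_op k x| | x in [set x | `|x| <= 1]]
}.

Record rank_one_projection (R : realType) (K : compact_operators R) :=
  RankOneProjection {
  rop_val :> K;
  rop_P : exists v : co_space K, `|v| = 1 /\
   forall x, co_op rop_val x = inner x v *: v
}.

Section rank_one_projection.
Variables (R : realType) (K : compact_operators R) (e : rank_one_projection K).

Lemma rop_mul : e ** e = e :> K.
Proof.
have [v [v1 ev]] := rop_P e; apply: co_op_inj; apply/funext => x.
by rewrite co_opM !ev innerZ inner_norm v1 expr1n mulr1.
Qed.

Lemma rop_star : cstar (e : K) = e.
Proof.
have [v [v1 ev]] := rop_P e; apply: co_op_inj; apply/funext => x.
apply: inner_inj => y; rewrite co_op_star !ev innerC !innerZ.
by rewrite mulrC (innerC x) (innerC y).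
Qed.

Lemma rop_norm : `|e : K| <= 1.
Proof.
have := cnorm_star_mul (e : K); rewrite rop_star rop_mul => e2.
have [->|e0] := eqVneq `|e : K| 0; first exact: ler01.
by rewrite -(ler_pM2r (_ : 0 < `|e : K|)) ?lt_def ?e0//= mul1r -expr2 -e2.
Qed.

End rank_one_projection.

(* [T], with [tens b k] for b (x) k, is a C*-completion of the algebraic tensor
   product of B and K. Since K is nuclear, there is only one C*-norm on the
   latter; it is automatically a cross norm. *)
Record is_tensor_product (R : realType) (B K T : realCstarType R)
    (tens : B -> K -> T) : Prop := {
  tensLl : forall (c : R) b b' k,
    tens (c *: b + b') k = c *: tens b k + tens b' k;
  tensLr : forall (c : R) b k k',
    tens b (c *: k + k') = c *: tens b k + tens b k';
  tensM : forall b b' k k', tens (b ** b') (k ** k') = tens b k ** tens b' k';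
  tens_star : forall b k, tens (cstar b) (cstar k) = cstar (tens b k);
  tens_inj : forall n (b : 'I_n -> B) (k : 'I_n -> K),
    linearly_independent k ->
    \sum_(i < n) tens (b i) (k i) = 0 -> forall i, b i = 0;
  tens_dense : dense [set x : T | exists n (b : 'I_n -> B) (k : 'I_n -> K),
    x = \sum_(i < n) tens (b i) (k i)];
  tens_norm : forall b k, `|tens b k| = `|b| * `|k|
}.

Record tensor_product (R : realType) (B K : realCstarType R) := TensorProduct {
  tp_alg :> realCstarType R;
  tp_tens : B -> K -> tp_alg;
  tp_P : is_tensor_product tp_tens
}.

Section stability.
Variables (R : realType) (K : compact_operators R).

Definition stable (B : realCstarType R) : Prop :=
  exists (T : tensor_product B K) (f : B -> T), is_starhom f /\ bijective f.

Variable e : rank_one_projection K.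

Section corner.
Variables (B : realCstarType R) (T : tensor_product B K).

Lemma corner_starhom : is_starhom (fun b => tp_tens T b e).
Proof.
have P := tp_P T; split=> [k x y|x y|x].
- by rewrite (tensLl P).
- by rewrite -(tensM P) rop_mul.
- by rewrite -(tens_star P) rop_star.
Qed.

Lemma corner_contractive b : `|tp_tens T b e| <= `|b|.
Proof. by rewrite (tens_norm (tp_P T)) ler_piMr// rop_norm. Qed.

Definition corner : starhom B T := Starhom corner_starhom corner_contractive.

End corner.

Definition homotopy_symmetric (A : realCstarType R) : Prop :=
  exists (T : tensor_product A K) (s : cuntz_pair T) (y : homotopy_classes A T),
    hadd s (hclass (hom_asym (corner T))) y = hzero A T.

End stability.

(* E(A, B) = [[SA, SB (x) K]], where T is a model of SB (x) K. *)
Definition E_theory (R : realType) (K : compact_operators R)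
  (A B : realCstarType R) (T : tensor_product (suspension B) K) :=
  homotopy_classes (suspension A) T.

(* When B is stable, the identification of [[SA, SB]] with E(A, B). *)
Definition stabilization (R : realType) (K : compact_operators R)
  (e : rank_one_projection K) (A B : realCstarType R)
  (T : tensor_product (suspension B) K) :
  homotopy_classes (suspension A) (suspension B) -> E_theory A T :=
  hpost (corner e T).

(* For stable algebras, direct sums of classes do not depend on the choice of
   the isometries, hence the quantification over s and s'. *)
Definition semigroup_isomorphism (R : realType) (A B A' B' : realCstarType R)
    (f : homotopy_classes A B -> homotopy_classes A' B') : Prop :=
  [/\ bijective f, f (hzero A B) = hzero A' B' &
      forall (s : cuntz_pair B) (s' : cuntz_pair B') x y,
        f (hadd s x y) = hadd s' (f x) (f y)].

(* Main.v *)
(* A two-sided inverse of the suspension map is given by a quantization.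
   Homotopy symmetry yields a 2x2 matrix (g_ij) of paths of maps of A,
   asymptotically multiplicative, that joins a corner embedding g_11(0),
   homotopic to the identity, to 0.  Folding these paths over (0,1), and
   conjugating the half (1/2,1) by diag(1,z), gives an asymptotic morphism
   a |-> b_-1(a) z^-1 + b_0(a) + b_1(a) z from A to SA (x) C(T).  An asymptotic
   morphism Psi : SA -> SB is then sent to
     D(Psi)(a) = sum_(d,n) r_(n+d) Psi(b_d(a))(x_n) r_n^*,
   where the r_n, for n in Z, are isometries of M(B) with orthogonal ranges and
   the step of the subdivision x_n = 1/2 + n/q(t) of (0,1) goes to 0: functions
   on (0,1) act by multiplication, and z by the bilateral shift.

   If Psi = S phi, one can slide the points x_n to the end of the path, where g
   vanishes; all that remains is phi(g_11(0)) at the index n = 1, so D(S phi) is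
   homotopic to phi, whence injectivity.  For surjectivity, S D(Psi) = D(Psi'),
   where Psi' is S Psi with the two suspension coordinates exchanged in SSA and
   SSB; as a quarter turn of the square is homotopic to the identity, Psi' is
   homotopic to S Psi, and D(S Psi) is homotopic to Psi by the first case.

   Asymptotic morphisms out of a separable algebra are first replaced by
   equivalent ones that are jointly continuous and asymptotically Lipschitz, so
   that they act pointwise on functions. *)

Require Import Defs.
From HB Require Import structures.
From mathcomp Require Import all_boot all_order all_algebra.
From mathcomp Require Import all_classical all_reals topology normedtype sequences.
From mathcomp Require Import derive realfun trigo interval_inference ring lra zify.

Set Implicit Arguments.
Unset Strict Implicit.
Unset Printing Implicit Defensive.

Import Order.TTheory GRing.Theory Num.Theory.
Import numFieldNormedType.Exports.

Local Open Scope classical_set_scope.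
Local Open Scope ring_scope.

(** Two obstacles shape the proof. Asymptotic morphisms compose only once the outer parameter runs
    fast enough with respect to the inner one: [fast] collects such requirements, and the mesh 1/q
    is chosen after the reparametrization p, as it must be fine for the composite. And no spectral
    theory is at hand: asymptotic contractivity, on which the estimates rest, comes from a
    comparison of C*-seminorms with the norm through averages of resolvents over roots of unity.

    Degree 1 suffices because conjugation by diag(1,z) multiplies the off-diagonal entries of a 2x2
    matrix by z or z^-1; C(T) itself is replaced by finitely many relations between three
    coefficients, [graded_rel]. The two halves match at 1/2 because the off-diagonal paths vanish
    there. The shift commutes with functions up to an error that tends to 0 with the mesh, which
    makes the evaluation at nodes asymptotically multiplicative.

    Stability enters through pure pairs of isometries: they make conjugation by any isometric
    multiplier homotopic to the identity, so that corners and choices of isometries do not affect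
    classes. *)

(** * Linear identities in modules, by reflection *)

Section lmod_reflection.
Variables (R : pzRingType) (V : lmodType R).

Inductive lexpr :=
  | LZero | LVar of nat | LAdd of lexpr & lexpr | LOpp of lexpr
  | LScale of R & lexpr.

Fixpoint leval (l : seq V) (e : lexpr) : V :=
  match e with
  | LZero => 0
  | LVar n => l`_n
  | LAdd a b => leval l a + leval l b
  | LOpp a => - leval l a
  | LScale k a => k *: leval l a
  end.

Fixpoint lcoef (e : lexpr) (i : nat) : R :=
  match e with
  | LZero => 0
  | LVar n => if eqn n i then 1 else 0
  | LAdd a b => lcoef a i + lcoef b i
  | LOpp a => - lcoef a i
  | LScale k a => k * lcoef a i
  end.

Lemma leval_sum (l : seq V) (e : lexpr) :
  leval l e = \sum_(i < size l) lcoef e i *: l`_i.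
Proof.
elim: e => [|n|a IHa b IHb|a IHa|k a IHa] /=; rewrite ?IHa ?IHb.
- by rewrite big1// => i _; rewrite scale0r.
- have [nl|ln] := ltnP n (size l).
    rewrite (bigD1 (Ordinal nl))//= big1 ?addr0; last first.
      by move=> i; rewrite -val_eqE/= eq_sym => /negbTE ni; rewrite eqnE ni scale0r.
    by rewrite eqnE eqxx scale1r.
  rewrite nth_default// big1// => i _; rewrite eqnE.
  by case: eqP => [ni|_]; rewrite ?scale0r//; move: (ltn_ord i); rewrite -ni ltnNge ln.
- by rewrite -big_split; apply: eq_bigr => i _; rewrite /= scalerDl.
- by rewrite -sumrN; apply: eq_bigr => i _; rewrite scaleNr.
- by rewrite scaler_sumr; apply: eq_bigr => i _; rewrite scalerA.
Qed.

Fixpoint lsame (n : nat) (a b : lexpr) : Prop :=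
  if n is m.+1 then lcoef a m = lcoef b m /\ lsame m a b else True.

Lemma lsameP (l : seq V) (a b : lexpr) :
  lsame (size l) a b -> leval l a = leval l b.
Proof.
move=> ab; rewrite !leval_sum; apply: eq_bigr => i _; congr (_ *: _).
move: ab; case: i => i /=; elim: (size l) => [|n IH] //= il [e1 e2].
by move: il; rewrite ltnS leq_eqVlt => /orP[/eqP->//|il]; exact: IH.
Qed.

End lmod_reflection.

Ltac lmod_index x l :=
  match l with
  | cons ?y ?l' =>
      match goal with
      | _ => let _ := match goal with _ => first [constr_eq x y | unify x y] end in constr:(O)
      | _ => let n := lmod_index x l' in constr:(S n)
      end
  end.

Ltac lmod_vars e l :=
  lazymatch e with
  | @GRing.add _ ?a ?b => let l := lmod_vars a l in lmod_vars b l
  | @GRing.opp _ ?a => lmod_vars a l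
  | @GRing.scale _ _ _ ?a => lmod_vars a l
  | @GRing.zero _ => l
  | ?x => match goal with
      | _ => let n := lmod_index x l in l
      | _ => constr:(cons x l)
      end
  end.

Ltac lmod_reify R e l :=
  lazymatch e with
  | @GRing.add _ ?a ?b =>
      let a' := lmod_reify R a l in let b' := lmod_reify R b l in
      constr:(@LAdd R a' b')
  | @GRing.opp _ ?a => let a' := lmod_reify R a l in constr:(@LOpp R a')
  | @GRing.scale _ _ ?k ?a =>
      let a' := lmod_reify R a l in constr:(@LScale R k a')
  | @GRing.zero _ => constr:(@LZero R)
  | ?x => let n := lmod_index x l in constr:(@LVar R n)
  end.

(* Decides the equalities between linear combinations. *)
Ltac lmod_gen R V :=
  lazymatch goal with
  | |- ?a = ?b =>
      let l := lmod_vars a (@nil V) in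
      let l := lmod_vars b l in
      let a' := lmod_reify R a l in
      let b' := lmod_reify R b l in
      apply: (@lsameP R _ l a' b'); rewrite /=; repeat split; first [ring | lra]
  end.

(** Products are expanded and reassociated first, so that noncommutative monomials are the atoms of
    a linear identity. *)
Ltac calg R V :=
  rewrite ?(cmulDl, cmulDr, cmulNr, cmulrN, cmulZl, cmulZr, cmulA); lmod_gen R V.

(** If x > y > 0, the powers of x / y are unbounded by Bernoulli's inequality. This removes a
    constant factor from estimates that are compatible with squaring, as C*-norms are on
    self-adjoint elements. *)
Lemma exprn_le_mul (R : realType) (x y c : R) : 0 <= x -> 0 <= y ->
  (forall n, x ^+ (2 ^ n) <= c * y ^+ (2 ^ n)) -> x <= y.
Proof.
move=> x0 y0 xy; rewrite leNgt; apply/negP => yx.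
have [y00|yn0] := eqVneq y 0.
  have := xy 0%N; rewrite y00 expn0 expr1 mulr0 => x00.
  by move: yx; rewrite y00 ltNge x00.
have yp : 0 < y by rewrite lt_def yn0.
have z1 : 1 < x / y by rewrite ltr_pdivlMr// mul1r.
have zc n : (x / y) ^+ (2 ^ n) <= c.
  by rewrite expr_div_n ler_pdivrMr ?exprn_gt0.
pose d := x / y - 1; have d0 : 0 < d by rewrite subr_gt0.
have bern n : 1 + d *+ n <= (x / y) ^+ n.
  have -> : x / y = 1 + d by rewrite /d addrC subrK.
  elim: n => [|n IH]; first by rewrite mulr0n addr0 expr0.
  rewrite exprS (le_trans (_ : _ <= (1 + d) * (1 + d *+ n)))//.
    have : 0 <= d * (d *+ n) by rewrite mulr_ge0// ?mulrn_wge0// ltW.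
    by rewrite mulrS; lra.
  by rewrite ler_wpM2l// addr_ge0// ltW.
have [n cn] : exists n : nat, c / d < n%:R.
  exists (Num.bound `|c / d|).
  exact: le_lt_trans (ler_norm _) (archi_boundP (normr_ge0 _)).
have := zc n; rewrite leNgt => /negP; apply.
rewrite (lt_le_trans _ (bern _))//.
have : n%:R * d <= d *+ 2 ^ n.
  by rewrite -[leRHS]mulr_natl ler_pM2r// ler_nat ltnW// ltn_expl.
by move: cn; rewrite ltr_pdivrMr//; lra.
Qed.

(** * C*-seminorms are dominated by the norm *)

Section complexification.
Context {R : realType} {A : realCstarType R}.
Implicit Types u v w : A * A.

(* [(a, b)] stands for [a + i b]. *)
Definition cxmul u v : A * A :=
  (u.1 ** v.1 - u.2 ** v.2, u.1 ** v.2 + u.2 ** v.1).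
Definition cxscale (x y : R) u : A * A :=
  (x *: u.1 - y *: u.2, x *: u.2 + y *: u.1).

Local Ltac cx := rewrite /cxscale /cxmul/=;
  congr pair; rewrite /=; calg R A.

Lemma cxmulA u v w : cxmul u (cxmul v w) = cxmul (cxmul u v) w.
Proof. by cx. Qed.
Lemma cxmulDl u v w : cxmul (u + v) w = cxmul u w + cxmul v w.
Proof. by cx. Qed.
Lemma cxmulDr u v w : cxmul w (u + v) = cxmul w u + cxmul w v.
Proof. by cx. Qed.
Lemma cxmulZl x y u v : cxmul (cxscale x y u) v = cxscale x y (cxmul u v).
Proof. by cx. Qed.
Lemma cxmulZr x y u v : cxmul u (cxscale x y v) = cxscale x y (cxmul u v).
Proof. by cx. Qed.


Lemma cxscaleDr x y u v : cxscale x y (u + v) = cxscale x y u + cxscale x y v.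
Proof. by cx. Qed.
Lemma cxscaleN x y u : cxscale (- x) (- y) u = - cxscale x y u.
Proof. by cx. Qed.
Lemma cxmulNl u v : cxmul (- u) v = - cxmul u v.
Proof. by cx. Qed.
Lemma cxmulNr u v : cxmul u (- v) = - cxmul u v.
Proof. by cx. Qed.

(** [e] is the sum of the Neumann series, (1 - d)^-1 - 1, obtained as the fixed point of a
    contraction. *)
Lemma neumann (d : A) : `|d| < 1 -> exists e, e = d + d ** e.
Proof.
move=> d1.
pose f := 'totalfun_[set: A] (fun x : A => d + d ** x).
have cf : is_contraction f.
  exists (NngNum (normr_ge0 d)); split=> //= -[x y] _ /=.
  rewrite /f/= opprD addrACA subrr add0r -cmulBr; exact: cnormM.
have [e _ eE] := banach_fixed_point cf closedT (ex_intro _ 0 I).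
by exists e.
Qed.

(** This characterizes F = h (1 - z h)^-1, with z = x + i y, without a unit; no norm is put on the
    complexification. *)
Definition resolvent (h : A) (x y : R) (F : A * A) :=
  F = (h, 0) + cxscale x y (cxmul (h, 0) F) /\
  F = (h, 0) + cxscale x y (cxmul F (h, 0)).

(** The resolvent identity. Being algebraic, it bounds the variation of [F] in any submultiplicative
    seminorm. *)
Lemma resolventB h x y x' y' F F' : resolvent h x y F -> resolvent h x' y' F' ->
  F - F' = cxscale (x - x') (y - y') (cxmul F' F).
Proof.
move=> [Fl _] [_ Fr'].
set H := (h, 0) in Fl Fr'.
set q := cxmul (cxmul F' H) F.
have E1 : cxmul F' H = cxmul F' F - cxscale x y q.
  by rewrite {1}Fl cxmulDr cxmulZr cxmulA addrK.
have E2 : cxmul H F = cxmul F' F - cxscale x' y' q.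
  by rewrite {1}Fr' cxmulDl cxmulZl addrK.
rewrite {1}Fl {1}Fr' E1 E2; clearbody q; move: (cxmul F' F) => c.
by cx.
Qed.

(** The product of 1 - z h and its conjugate is 1 - d with [d] real, and the three bounds give |d|
    <= 5/8. With 1 + e = (1 - d)^-1, one takes F = h (1 - z' h) (1 + e), where z' is the conjugate
    of z. *)
Lemma resolvent_exists h x y : `|h| <= 4^-1 -> `|x| <= 1 -> `|y| <= 1 ->
  exists F, resolvent h x y F.
Proof.
move=> h4 x1 y1.
pose n := x ^+ 2 + y ^+ 2.
pose d := (2 * x) *: h - n *: (h ** h).
have n0 : 0 <= n by rewrite addr_ge0 ?sqr_ge0.
have n2 : n <= 2.
  by rewrite /n -[x ^+ 2]real_normK ?num_real// -[y ^+ 2]real_normK ?num_real//;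
     have := exprn_ile1 2 (normr_ge0 x) x1; have := exprn_ile1 2 (normr_ge0 y) y1; lra.
have d1 : `|d| < 1.
  have hh : `|h ** h| <= 4^-1 * 4^-1.
    by rewrite (le_trans (cnormM _ _))// ler_pM.
  have h0 := normr_ge0 h; have hh0 := normr_ge0 (h ** h).
  have E1 : `|(2 * x) *: h| <= 2 * 4^-1.
    by rewrite normrZ ler_pM// (_ : 2 * x = x + x) ?(le_trans (ler_normD _ _))//; lra.
  have E2 : `|n *: (h ** h)| <= 2 * (4^-1 * 4^-1).
    by rewrite normrZ ler_pM// ger0_norm.
  have := ler_normB ((2 * x) *: h) (n *: (h ** h)); rewrite -/d; lra.
have [e eE] := neumann d1.
have dh : d ** h = h ** d by rewrite /d; calg R A.
have eh : e ** h = h ** e.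
  apply/eqP; rewrite -subr_eq0; apply: contraTT isT => ne.
  have cE : e ** h - h ** e = d ** (e ** h - h ** e).
    rewrite {1}eE {2}eE cmulDl cmulDr dh cmulBr !cmulA dh opprD addrACA subrr add0r.
    by rewrite -!cmulA.
  have np : 0 < `|e ** h - h ** e| by rewrite normr_gt0.
  have : `|e ** h - h ** e| < `|e ** h - h ** e|.
    rewrite {1}cE (le_lt_trans (cnormM _ _))//.
    by rewrite -[ltRHS]mul1r ltr_pM2r.
  by rewrite ltxx.
have he : h ** e = (2 * x) *: (h ** h) - n *: (h ** h ** h) +
   ((2 * x) *: (h ** h ** e) - n *: (h ** h ** h ** e)).
  by rewrite {1}eE /d; calg R A.
pose X := h - x *: (h ** h) + h ** e - x *: (h ** h ** e).
pose Y := y *: (h ** h + h ** h ** e).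
have hX : X ** h = h ** X.
  by rewrite /X !(cmulBl, cmulBr, cmulDl, cmulDr, cmulZl, cmulZr) -!cmulA eh !cmulA.
have hY : Y ** h = h ** Y.
  by rewrite /Y !(cmulBl, cmulBr, cmulDl, cmulDr, cmulZl, cmulZr) -!cmulA eh !cmulA.
have E : (X, Y) = (h, 0) + cxscale x y (cxmul (h, 0) (X, Y)).
  rewrite /cxscale /cxmul /= !cmul0r; congr pair; rewrite /=.
    rewrite /X /Y ?(cmulDl, cmulDr, cmulNr, cmulrN, cmulZl, cmulZr, cmulA).
    by rewrite he /n; lmod_gen R A.
  by rewrite /X /Y; calg R A.
exists (X, Y); split=> //; rewrite {1}E; congr (_ + cxscale _ _ _).
by rewrite /cxmul/= hX hY !cmul0r !cmulr0 addr0 add0r.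
Qed.

End complexification.

Section cstar_seminorm.
Variables (R : realType) (A : realCstarType R) (p : A -> R).
Hypothesis p_ge0 : forall a, 0 <= p a.
Hypothesis pD : forall a b, p (a + b) <= p a + p b.
Hypothesis pZ : forall k a, p (k *: a) <= `|k| * p a.
Hypothesis pM : forall a b, p (a ** b) <= p a * p b.
Hypothesis pC : forall a, p (cstar a ** a) = p a ^+ 2.
Implicit Types u v w : A * A.

Let pN a : p (- a) <= p a.
Proof. by rewrite -scaleN1r (le_trans (pZ _ _))// normrN1 mul1r. Qed.

Let P u := p u.1 + p u.2.

Let P_ge0 u : 0 <= P u. Proof. exact: addr_ge0. Qed.

Let PD u v : P (u + v) <= P u + P v.
Proof. by rewrite /P addrACA; apply: lerD; exact: pD. Qed.

Let PN u : P (- u) <= P u.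
Proof. by rewrite /P; apply: lerD; exact: pN. Qed.

Let PM u v : P (cxmul u v) <= P u * P v.
Proof.
rewrite /P /cxmul/= mulrDl !mulrDr.
have := pD (u.1 ** v.1) (- (u.2 ** v.2)); have := pN (u.2 ** v.2).
have := pD (u.1 ** v.2) (u.2 ** v.1).
have := pM u.1 v.1; have := pM u.2 v.2; have := pM u.1 v.2; have := pM u.2 v.1.
lra.
Qed.

Let PZ x y u : P (cxscale x y u) <= (`|x| + `|y|) * P u.
Proof.
rewrite /P /cxscale/=.
have := pD (x *: u.1) (- (y *: u.2)); have := pN (y *: u.2).
have := pD (x *: u.2) (y *: u.1).
have := pZ x u.1; have := pZ x u.2; have := pZ y u.1; have := pZ y u.2.
lra.
Qed.

Section resolvent_bound.
Variable h : A.
Hypothesis h4 : `|h| <= 4^-1.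

Let Q := [set z : R * R | `|z.1| <= 1 /\ `|z.2| <= 1].

Let compactQ : compact Q.
Proof.
have -> : Q = `[-1, 1]%classic `*` `[-1, 1]%classic.
  by apply/seteqP; split=> -[x y]; rewrite /Q/= !in_itv/= !ler_norml => -[].
by apply: compact_setX; exact: segment_compact.
Qed.

(** As [p] is not known to be continuous, a Neumann series gives no bound. But the resolvent
    identity yields P (F z') <= 2 P (F z) for z' near z, and the square [Q] is compact. *)
Lemma resolvent_bound : exists C (F : R * R -> A * A), 0 <= C /\
  forall z, Q z -> resolvent h z.1 z.2 (F z) /\ P (F z) <= C.
Proof.
have /choice[F FP] : forall z : R * R, exists F : A * A,
    Q z -> resolvent h z.1 z.2 F.
  move=> z; have [[z1 z2]|nQ] := pselect (Q z); last by exists 0.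
  by have [F] := resolvent_exists h4 z1 z2; exists F.
suff [C CP] : exists C, forall z, Q z -> P (F z) <= C.
  by exists `|C|, F; split=> // z Qz; split; [exact: FP|rewrite (le_trans (CP _ Qz))// ler_norm].
have : \forall C \near +oo_R, Q `<=` (fun z => P (F z) <= C).
  move: compactQ => /compact_near_coveringP/near_covering_withinP; apply => z Qz.
  pose K := P (F z); pose d := (2 * K + 2)^-1 / 2.
  have K0 : 0 <= K by exact: P_ge0.
  have d0 : 0 < d by rewrite divr_gt0// invr_gt0; lra.
  have KC : \forall C \near +oo_R, 2 * K <= C.
    by apply: nbhs_pinfty_ge; exact: num_real.
  near=> z' C => Qz'.
  have z1 : `|z.1 - z'.1| <= d.
    near: z'; apply: (@cvgr_dist_le _ _ _ (nbhs z) _ (fun z => z.1) z.1) => //.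
    exact: cvg_fst.
  have z2 : `|z.2 - z'.2| <= d.
    near: z'; apply: (@cvgr_dist_le _ _ _ (nbhs z) _ (fun z => z.2) z.2) => //.
    exact: cvg_snd.
  apply: (@le_trans _ _ (2 * K)); last first.
    exact: (near KC C).
  have FE := resolventB (FP _ Qz') (FP _ Qz).
  have : P (F z') <= P (F z) + P (F z' - F z).
    by rewrite -{1}(subrKC (F z) (F z')) PD.
  have : P (F z' - F z) <= (d + d) * (P (F z) * P (F z')).
    rewrite FE (le_trans (PZ _ _ _))// ler_pM ?addr_ge0//.
    by rewrite lerD// distrC.
  rewrite -/K.
  have dK : (d + d) * K <= 2^-1.
    rewrite /d; set i := (2 * K + 2)^-1.
    have : i * (2 * K + 2) = 1 by rewrite mulVf//; lra.
    have : 0 < i by rewrite invr_gt0; lra.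
    by nra.
  have := P_ge0 (F z').
  have -> : (d + d) * (K * P (F z')) = ((d + d) * K) * P (F z') by rewrite mulrA.
  move=> F0; have : (d + d) * K * P (F z') <= 2^-1 * P (F z') by rewrite ler_wpM2r.
  lra.
move=> [M [_ /(_ (M + 1))]]; rewrite ltrDl ltr01 => /(_ isT) QM.
by exists (M + 1).
Unshelve. all: by end_near. Qed.


Let pow2 m := iter m (fun x : A => x ** x) h.

Let wpow m (r th : R) : A * A :=
  cxscale (r ^+ (2 ^ m) * cos ((2 ^ m)%:R * th))
          (r ^+ (2 ^ m) * sin ((2 ^ m)%:R * th)) (pow2 m, 0).

(* [K] is the average of [z (1 - z h)^-1 h] over the points [z] with
   [z ^ (2 ^ m)] fixed, hence it is [w (1 - w)^-1] for [w = (z h) ^ (2 ^ m)]. *)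
Lemma root_averages : exists L, 0 <= L /\ forall m, exists K : R -> R -> A * A,
  (forall r th, 0 <= r <= 1 -> K r th = wpow m r th + cxmul (wpow m r th) (K r th)) /\
  (forall r r' th, 0 <= r <= 1 -> 0 <= r' <= 1 ->
     P (K r th - K r' th) <= L * `|r - r'|).
Proof.
have [C [F [C0 FP]]] := resolvent_bound.
have QP r th : 0 <= r <= 1 -> Q (r * cos th, r * sin th).
  move=> /andP[r0 r1]; rewrite /Q/= !normrM (ger0_norm r0); split.
    by rewrite -[leRHS]mulr1 ler_pM// ler_norml cos_geN1 cos_le1.
  by rewrite -[leRHS]mulr1 ler_pM// ler_norml sin_geN1 sin_le1.
(* From z F(z) - z' F(z') = (z - z') F(z) + z' (F(z) - F(z')), the resolvent identity, and |x - x'|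
   + |y - y'| <= 2 |r - r'|. *)
exists (2 * C + 4 * C ^+ 2); split.
  by rewrite addr_ge0// mulr_ge0// ?sqr_ge0.
elim=> [|m [K [KE KL]]].
  exists (fun r th => cxscale (r * cos th) (r * sin th) (F (r * cos th, r * sin th))).
  split=> [r th /QP-/(_ th)/FP[[Fl _] _]|r r' th r01 r01'].
    rewrite /wpow expn0 !expr1 !mul1r /=.
    set G := F _ in Fl *; rewrite /= in Fl; rewrite {1}Fl cxscaleDr; congr (_ + _).
    by rewrite cxmulZr cxmulZl.
  set x := r * cos th; set y := r * sin th.
  set x' := r' * cos th; set y' := r' * sin th.
  have [Fz PF] := FP _ (QP _ th r01); have [Fz' PF'] := FP _ (QP _ th r01').
  rewrite -/x -/y /= in Fz PF; rewrite -/x' -/y' /= in Fz' PF'.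
  have dx : `|x - x'| <= `|r - r'|.
    by rewrite /x /x' -mulrBl normrM -[leRHS]mulr1 ler_pM// ler_norml cos_geN1 cos_le1.
  have dy : `|y - y'| <= `|r - r'|.
    by rewrite /y /y' -mulrBl normrM -[leRHS]mulr1 ler_pM// ler_norml sin_geN1 sin_le1.
  have [z1 z2] := QP _ th r01'; rewrite /= -/x' -/y' in z1 z2.
  have -> : cxscale x y (F (x, y)) - cxscale x' y' (F (x', y')) =
    cxscale (x - x') (y - y') (F (x, y)) + cxscale x' y' (F (x, y) - F (x', y')).
    by rewrite /cxscale; congr pair; rewrite /=; lmod_gen R A.
  rewrite (le_trans (PD _ _))// [leRHS](_ : _ = (`|r - r'| + `|r - r'|) * C +
    (1 + 1) * ((`|r - r'| + `|r - r'|) * (C * C))); last by ring.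
  apply: lerD.
    by rewrite (le_trans (PZ _ _ _))// ler_pM ?addr_ge0// lerD.
  rewrite (le_trans (PZ _ _ _))// ler_pM ?addr_ge0// ?lerD//.
  rewrite (resolventB Fz Fz') (le_trans (PZ _ _ _))// ler_pM ?addr_ge0// ?lerD//.
  by rewrite (le_trans (PM _ _))// ler_pM.
have m0 : (2 ^ m)%:R != 0 :> R by rewrite pnatr_eq0 -lt0n expn_gt0.
(* The shift by pi / 2^m replaces w by -w, and w / (1 - w) - w / (1 + w) = 2 w^2 / (1 - w^2).
   Averaging preserves the Lipschitz constant. *)
pose sh (th : R) := th + pi / (2 ^ m)%:R.
exists (fun r th => cxscale 2^-1 0 (K r th + K r (sh th))).
split=> [r th r01|r r' th r01 r01'].
  have E1 := KE r th r01; have E2 := KE r (sh th) r01.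
  have wN : wpow m r (sh th) = - wpow m r th.
    rewrite /wpow /sh mulrDr (mulrC _ (pi / _)) divfK//.
    by rewrite cosDpi sinDpi !mulrN cxscaleN.
  have wS : wpow m.+1 r th = cxmul (wpow m r th) (wpow m r th).
    rewrite /wpow (_ : pow2 m.+1 = pow2 m ** pow2 m)//.
    rewrite (_ : (2 ^ m.+1)%:R * th = (2 ^ m)%:R * th + (2 ^ m)%:R * th); last first.
      by rewrite expnS natrM; ring.
    rewrite cosD sinD expnS mulnC exprM.
    by rewrite /cxscale /cxmul/=; congr pair; rewrite /= ?scaler0 ?subr0 ?add0r; calg R A.
  rewrite wN in E2; rewrite wS.
  move: (wpow m r th) (K r th) (K r (sh th)) E1 E2 => w k1 k2 E1 E2.
  have {E1}E1 : k1 = w + cxmul w w + cxmul (cxmul w w) k1.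
    by rewrite {1}E1 {1}E1 cxmulDr -cxmulA addrA.
  have {E2}E2 : k2 = - w + cxmul w w + cxmul (cxmul w w) k2.
    by rewrite {1}E2 {1}E2 cxmulDr !cxmulNl !cxmulNr !opprK addrA cxmulA.
  rewrite {1}E1 {1}E2 cxmulZr cxmulDr.
  move: (cxmul w w) => w2; move: (cxmul w2 k1) (cxmul w2 k2) => l1 l2.
  by rewrite /cxscale; congr pair; rewrite /=; lmod_gen R A.
rewrite [X in P X](_ : _ = cxscale 2^-1 0 ((K r th - K r' th) + (K r (sh th) - K r' (sh th)))); last first.
  by rewrite /cxscale; congr pair; rewrite /=; lmod_gen R A.
rewrite (le_trans (PZ _ _ _))// normr0 addr0 ger0_norm ?invr_ge0//.
rewrite ler_pdivrMl// [leRHS]mulr_natl [leRHS]mulr2n (le_trans (PD _ _))//.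
by rewrite lerD// KL.
Qed.

Hypothesis hs : cstar h = h.

(** A substitute for the comparison of spectral radii. If p h > 1, let mu = 1 / p h and mu' be
    slightly smaller. For large m, w = (mu h)^(2^m) has p w >= 1, while (mu' h)^(2^m) is small. Then
    w (1 - w)^-1 is of seminorm at least 1/2 at mu and small at mu', against the Lipschitz bound,
    which is uniform in m. *)
Lemma sa_seminorm_le1 : p h <= 1.
Proof.
have [L [L0 LP]] := root_averages.
have pow2s m : cstar (pow2 m) = pow2 m.
  by elim: m => //= m IH; rewrite cstarM IH.
have pp m : p (pow2 m) = p h ^+ (2 ^ m).
  elim: m => [|m IH]; first by rewrite expr1.
  by rewrite /= -{1}(pow2s m) pC IH expnS mulnC exprM.
rewrite leNgt; apply/negP => p1.
have p0 : 0 < p h by rewrite (lt_trans _ p1).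
pose mu := (p h)^-1.
have mu0 : 0 < mu by rewrite invr_gt0.
have mu1 : mu <= 1 by rewrite invf_le1// ltW.
(* This makes L |mu - mu'| <= 1/4 for every [m], which is chosen only afterwards. *)
pose mu' := Num.max 0 (mu - (4 * (L + 1))^-1).
have mu'0 : 0 <= mu' by rewrite /mu' le_max lexx.
have L1 : 0 < 4 * (L + 1) by rewrite mulr_gt0// ltr_wpDl.
have mu'mu : mu' < mu by rewrite /mu' gt_max mu0/= ltrBlDr ltrDl invr_gt0.
have mud : `|mu - mu'| <= (4 * (L + 1))^-1.
  rewrite ger0_norm ?subr_ge0 ?(ltW mu'mu)//.
  by rewrite lerBlDr addrC -lerBlDr /mu' le_max lexx orbT.
have r01 : 0 <= mu <= 1 by rewrite ltW.
have r01' : 0 <= mu' <= 1 by rewrite mu'0/= (le_trans (ltW mu'mu)).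
have w0 m r : wpow m r 0 = (r ^+ (2 ^ m) *: pow2 m, 0).
  by rewrite /wpow mulr0 cos0 sin0 mulr1 mulr0 /cxscale/= !scaler0 !scale0r addr0 subr0.
pose q := mu' * p h.
have q1 : q < 1 by rewrite /q -ltr_pdivlMr// mul1r.
have q0 : 0 <= q by rewrite mulr_ge0// ltW.
have [m qm] : exists m, q ^+ (2 ^ m) <= 8^-1.
  have [//|nq] := pselect (exists m, q ^+ (2 ^ m) <= 8^-1).
  have : 1 <= q.
    apply: (@exprn_le_mul _ _ _ 8) => // n; rewrite expr1n.
    rewrite -ler_pdivrMl// mulr1 leNgt; apply/negP => /ltW qn.
    by apply: nq; exists n.
  by rewrite leNgt q1.
have [K [KE KL]] := LP m.
have := KL mu mu' 0 r01 r01'; have := KE mu 0 r01; have := KE mu' 0 r01'.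
rewrite !w0; case: (K mu 0) (K mu' 0) => [k1 k2] [l1 l2].
rewrite /cxmul/= !cmul0r !subr0 !addr0 /P/= => -[El1 El2] [Ek1 _] kl.
set w := mu ^+ _ *: _ in Ek1; set w' := mu' ^+ _ *: _ in El1 El2.
have pw' : p w' <= 8^-1.
  rewrite (le_trans (pZ _ _))// pp ger0_norm ?exprn_ge0// -exprMn.
  exact: qm.
have pw : 1 <= p w.
  have : p (mu ^- (2 ^ m) *: w) <= mu ^- (2 ^ m) * p w.
    rewrite (le_trans (pZ _ _))// ger0_norm// invr_ge0 exprn_ge0// ltW//.
  rewrite scalerA mulVf ?gt_eqF ?exprn_gt0// scale1r pp -exprVn invrK.
  by rewrite ler_pMr// exprn_gt0.
have kl1 : p (k1 - l1) <= 4^-1.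
  have := p_ge0 (k2 - l2).
  have : L * `|mu - mu'| <= 4^-1.
    have : L * `|mu - mu'| <= (L + 1) * (4 * (L + 1))^-1 by rewrite ler_pM// lerDl.
    by rewrite invfM mulrCA mulfV ?mulr1// gt_eqF// ltr_wpDl.
  lra.
have pl : p l1 <= p w' + p w' * p l1.
  by rewrite {1}El1 (le_trans (pD _ _))// lerD.
have pk : p w <= p k1 + p w * p k1.
  have {1}-> : w = k1 - w ** k1 by rewrite {1}Ek1 addrK.
  by rewrite (le_trans (pD _ _))// lerD// (le_trans (pN _)).
have : p k1 <= p l1 + p (k1 - l1) by rewrite -{1}(subrKC l1 k1) pD.
have pl0 := p_ge0 l1.
have : p w' * p l1 <= 8^-1 * p l1 by rewrite ler_wpM2r.
move=> a1 a2.
have k12 : p k1 <= 7^-1 + 4^-1 by lra.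
have : p w * p k1 <= p w * (7^-1 + 4^-1) by rewrite ler_wpM2l.
lra.
Qed.

End resolvent_bound.

(** For self-adjoint elements, rescaling into the ball of radius 1/4 costs a factor 4, which
    disappears on passing to h^(2^n), where [p] and the norm are both exact powers. The two
    C*-identities reduce the general case to a^* a. *)
Lemma cstar_seminorm_le a : p a <= `|a|.
Proof.
have sa h : cstar h = h -> p h <= 4 * `|h|.
  move=> hs; have [->|h0] := eqVneq h 0.
    have := pZ 0 0; rewrite scale0r normr0 mul0r => /le_trans; apply.
    by rewrite mulr_ge0.
  have hp : 0 < `|h| by rewrite normr_gt0.
  pose k := (4 * `|h|)^-1.
  have k0 : 0 < k by rewrite invr_gt0 mulr_gt0.
  have kh : `|k *: h| <= 4^-1.
    by rewrite normrZ gtr0_norm// /k invfM -mulrA mulVf ?mulr1// gt_eqF.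
  have khs : cstar (k *: h) = k *: h by rewrite cstarZ hs.
  have := sa_seminorm_le1 kh khs.
  have : p (k^-1 *: (k *: h)) <= k^-1 * p (k *: h).
    by rewrite (le_trans (pZ _ _))// gtr0_norm// invr_gt0.
  rewrite scalerA mulVf ?gt_eqF// scale1r => /le_trans + ph1; apply.
  by rewrite /k invrK -[leRHS]mulr1 ler_wpM2l// mulr_ge0.
have sa1 h : cstar h = h -> p h <= `|h|.
  move=> hs; pose hn n := iter n (fun x : A => x ** x) h.
  have hnP n : [/\ cstar (hn n) = hn n, p (hn n) = p h ^+ (2 ^ n) &
      `|hn n| = `|h| ^+ (2 ^ n)].
    elim: n => [|n [IH1 IH2 IH3]]; first by rewrite !expr1.
    have E : hn n.+1 = cstar (hn n) ** hn n by rewrite IH1.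
    by rewrite {1 2}E cstarM cstarK E pC cnorm_star_mul IH2 IH3 expnS mulnC !exprM.
  apply: (@exprn_le_mul _ _ _ 4) => // n.
  by have [hns <- <-] := hnP n; exact: sa.
rewrite -(@ler_sqr _ (p a)) ?nnegrE//.
rewrite -pC -cnorm_star_mul sa1// cstarM cstarK//.
Qed.

End cstar_seminorm.

(** * Asymptotic contractivity of asymptotic morphisms *)

Lemma null_normP (R : realType) (V : normedModType R) (u : R -> V) :
  u t @[t --> +oo_R] --> (0 : V) <->
  forall e, 0 < e -> \forall t \near +oo_R, `|u t| <= e.
Proof. exact: cvgr0Pnorm_le. Qed.

Section asym_contractive.
Variables (R : realType) (A B : realCstarType R).

(** The limit superior of the norms, as the infimum of the eventual bounds. *)
Let ls (u : R -> B) : R := inf [set M | \forall t \near +oo_R, `|u t| <= M].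

Let ls_lb (u : R -> B) : lbound [set M | \forall t \near +oo_R, `|u t| <= M] 0.
Proof.
move=> M /= uM; have [t tM] := filter_ex uM.
exact: le_trans (normr_ge0 _) tM.
Qed.

Let ls_le u M : (\forall t \near +oo_R, `|u t| <= M) -> ls u <= M.
Proof. by move=> uM; apply: ge_inf => //; exists 0; exact: ls_lb. Qed.

Let ls_near u M : (exists M, \forall t \near +oo_R, `|u t| <= M) ->
  ls u < M -> \forall t \near +oo_R, `|u t| <= M.
Proof.
move=> [N uN] uM.
have hi : has_inf [set M | \forall t \near +oo_R, `|u t| <= M].
  by split; [exists N|exists 0; exact: ls_lb].
have [N' uN' N'M] := inf_lt hi.1 uM.
by apply: filterS uN' => t /le_trans; apply; exact: ltW.
Qed.

Let ls_ge0 u : (exists M, \forall t \near +oo_R, `|u t| <= M) -> 0 <= ls u.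
Proof. by move=> [N uN]; apply: lb_le_inf; [exists N|exact: ls_lb]. Qed.

Variable phi : asym A B.

Let bnd a : exists M, \forall t \near +oo_R, `|phi t a| <= M.
Proof.
have [M PM] := asym_bounded (asymP phi) a; exists M.
by apply: filterS (nbhs_pinfty_ge (num_real 1)) => t; exact: PM.
Qed.

Lemma asym_at0 : phi t 0 @[t --> +oo_R] --> (0 : B).
Proof.
apply: cvg0_eq (cvg0N (asym_linear (asymP phi) 1 0 0)) => t _.
by rewrite !scale1r addr0 opprB addrK.
Qed.

Lemma asymD a b : phi t (a + b) - (phi t a + phi t b) @[t --> +oo_R] --> (0 : B).
Proof.
by apply: cvg0_eq (asym_linear (asymP phi) 1 a b) => t _; rewrite !scale1r.
Qed.

Lemma asymZ k a : phi t (k *: a) - k *: phi t a @[t --> +oo_R] --> (0 : B).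
Proof.
apply: cvg0_eq (cvg0D (asym_linear (asymP phi) k a 0) asym_at0) => t _.
by rewrite addr0; lmod_gen R B.
Qed.

Lemma asymB a b : phi t (a - b) - (phi t a - phi t b) @[t --> +oo_R] --> (0 : B).
Proof.
apply: cvg0_eq (asym_linear (asymP phi) (-1) b a) => t _.
by rewrite !scaleN1r (addrC (- b)) (addrC (- phi t b)).
Qed.

(** The limit superior of the norm of [phi t a] is a C*-seminorm in [a], so that [cstar_seminorm_le]
    applies. *)
Lemma asym_near_le a e : 0 < e -> \forall t \near +oo_R, `|phi t a| <= `|a| + e.
Proof.
move=> e0; apply: ls_near => //.
suff : ls (phi ^~ a) <= `|a| by move=> /le_lt_trans; apply; rewrite ltrDl.
apply: (@cstar_seminorm_le R A (fun a => ls (phi ^~ a))) => {a e e0}.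
- by move=> a; exact: ls_ge0.
- move=> a b; apply/ler_addgt0Pr => e e0; apply: ls_le.
  have e3 : 0 < e / 3 by rewrite divr_gt0.
  have /null_normP/(_ _ e3) := asymD a b.
  have := @ls_near (phi ^~ a) (ls (phi ^~ a) + e / 3) (bnd a) _.
  rewrite ltrDl => /(_ e3).
  have := @ls_near (phi ^~ b) (ls (phi ^~ b) + e / 3) (bnd b) _.
  rewrite ltrDl => /(_ e3).
  apply: filterS3 => t h1 h2 h3.
  rewrite -(subrK (phi t a + phi t b) (phi t (a + b))).
  rewrite (le_trans (ler_normD _ _))//.
  have := ler_normD (phi t a) (phi t b); lra.
- move=> k a; apply/ler_addgt0Pr => e e0; apply: ls_le.
  have e3 : 0 < e / 2 by rewrite divr_gt0.
  have e4 : 0 < e / 2 / (`|k| + 1) by rewrite divr_gt0// ltr_wpDl.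
  have /null_normP/(_ _ e3) := asymZ k a.
  have := @ls_near (phi ^~ a) (ls (phi ^~ a) + e / 2 / (`|k| + 1)) (bnd a) _.
  rewrite ltrDl => /(_ e4).
  apply: filterS2 => t h1 h2.
  rewrite -(subrK (k *: phi t a) (phi t (k *: a))).
  rewrite (le_trans (ler_normD _ _))// normrZ.
  have : `|k| * `|phi t a| <= `|k| * (ls (phi ^~ a) + e / 2 / (`|k| + 1)).
    by rewrite ler_wpM2l.
  have : `|k| * (e / 2 / (`|k| + 1)) <= e / 2.
    rewrite mulrCA ler_piMr ?(ltW e3)// ler_pdivrMr ?ltr_wpDl// mul1r lerDl//.
  rewrite mulrDr; lra.
- move=> a b; apply/ler_addgt0Pr => e e0; apply: ls_le.
  have la := ls_ge0 (bnd a); have lb := ls_ge0 (bnd b).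
  set x := ls (phi ^~ a) in la *; set y := ls (phi ^~ b) in lb *.
  pose d := Num.min 1 (e / (x + y + 2)).
  have c0 : 0 < x + y + 2 by lra.
  have d0 : 0 < d by rewrite lt_min ltr01 divr_gt0.
  have d1 : d <= 1 by rewrite ge_min lexx.
  have dc : d * (x + y + 2) <= e by rewrite -ler_pdivlMr// ge_min lexx orbT.
  have /null_normP/(_ _ d0) := asym_mul (asymP phi) a b.
  have := @ls_near (phi ^~ a) (x + d) (bnd a) _; rewrite ltrDl => /(_ d0).
  have := @ls_near (phi ^~ b) (y + d) (bnd b) _; rewrite ltrDl => /(_ d0).
  apply: filterS3 => t h1 h2 h3.
  rewrite -(subrK (phi t a ** phi t b) (phi t (a ** b))).
  rewrite (le_trans (ler_normD _ _))//.
  have : `|phi t a ** phi t b| <= (x + d) * (y + d).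
    by rewrite (le_trans (cnormM _ _))// ler_pM.
  have : d * d <= d by rewrite ler_piMr// ltW.
  nra.
- move=> a; have la := ls_ge0 (bnd a); have lc := ls_ge0 (bnd (cstar a ** a)).
  have sq : (fun t => phi t (cstar a ** a) - cstar (phi t a) ** phi t a) t @[t --> +oo_R] --> (0 : B).
    have [M aM] := asym_bounded (asymP phi) a.
    have M0 : 0 <= M by rewrite (le_trans (normr_ge0 _) (aM 1 _)).
    have u0 : (phi t (cstar a) - cstar (phi t a)) ** phi t a @[t --> +oo_R] --> (0 : B).
      apply/null_normP => e e0.
      have e1 : 0 < e / (M + 1) by rewrite divr_gt0// ltr_wpDl.
      have /null_normP/(_ _ e1) := asym_star (asymP phi) a.
      apply: filterS2 (nbhs_pinfty_ge (num_real 1)) => t /aM tM h.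
      rewrite (le_trans (cnormM _ _))// (le_trans (ler_pM _ _ h tM))//.
      by rewrite mulrAC ler_pdivrMr ?ltr_wpDl// ler_wpM2l ?(ltW e0)// lerDl.
    apply: cvg0_eq (cvg0D (asym_mul (asymP phi) (cstar a) a) u0) => t _ /=.
    by calg R B.
  apply/eqP; rewrite eq_le; apply/andP; split.
    apply/ler_addgt0Pr => e e0; apply: ls_le.
    set x := ls (phi ^~ a) in la *.
    pose d := Num.min 1 (e / (2 * x + 2)).
    have c0 : 0 < 2 * x + 2 by lra.
    have d0 : 0 < d by rewrite lt_min ltr01 divr_gt0.
    have d1 : d <= 1 by rewrite ge_min lexx.
    have dc : d * (2 * x + 2) <= e by rewrite -ler_pdivlMr// ge_min lexx orbT.
    have /null_normP/(_ _ d0) := sq.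
    have := @ls_near (phi ^~ a) (x + d) (bnd a) _; rewrite ltrDl => /(_ d0).
    apply: filterS2 => t h1 h2.
    rewrite -(subrK (cstar (phi t a) ** phi t a) (phi t (cstar a ** a))).
    rewrite (le_trans (ler_normD _ _))// cnorm_star_mul.
    have : `|phi t a| ^+ 2 <= (x + d) ^+ 2 by rewrite ler_sqr ?nnegrE// addr_ge0// ltW.
    have : d * d <= d by rewrite ler_piMr// ltW.
    rewrite !expr2; nra.
  set y := ls (fun t => phi t (cstar a ** a)) in lc *.
  apply/ler_addgt0Pr => e e0.
  have ye0 : 0 <= y + e by rewrite addr_ge0// ltW.
  rewrite -(sqr_sqrtr ye0) ler_sqr ?nnegrE ?sqrtr_ge0//; apply: ls_le.
  have e2 : 0 < e / 2 by rewrite divr_gt0.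
  have /null_normP/(_ _ e2) := sq.
  have := @ls_near (fun t => phi t (cstar a ** a)) (y + e / 2) (bnd _) _; rewrite ltrDl => /(_ e2).
  apply: filterS2 => t h1 h2.
  rewrite -ler_sqr ?nnegrE ?sqrtr_ge0// sqr_sqrtr// -cnorm_star_mul.
  rewrite -(subKr (phi t (cstar a ** a)) (cstar (phi t a) ** phi t a)).
  have := ler_normB (phi t (cstar a ** a)) (phi t (cstar a ** a) - cstar (phi t a) ** phi t a).
  lra.
Qed.

Lemma asym_near_lip a b e : 0 < e ->
  \forall t \near +oo_R, `|phi t a - phi t b| <= `|a - b| + e.
Proof.
move=> e0; have e2 : 0 < e / 2 by rewrite divr_gt0.
have /null_normP/(_ _ e2) := asymB a b.
apply: filterS2 (asym_near_le (a - b) e2) => t h1 h2.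
rewrite -(subKr (phi t (a - b)) (phi t a - phi t b)).
have := ler_normB (phi t (a - b)) (phi t (a - b) - (phi t a - phi t b)).
lra.
Qed.

End asym_contractive.

Lemma starhom_norm_le (R : realType) (A B : realCstarType R) (f : A -> B) :
  is_starhom f -> forall a, `|f a| <= `|a|.
Proof.
move=> [fL fM fs] a.
have f0 : f 0 = 0 by have := fL (-1) 0 0; rewrite scaler0 addr0 scaleN1r addNr.
apply: (@cstar_seminorm_le R A (fun a => `|f a|)) => //.
- by move=> x y; have := fL 1 x y; rewrite !scale1r => ->; exact: ler_normD.
- by move=> k x; have := fL k x 0; rewrite f0 !addr0 => ->; rewrite normrZ.
- by move=> x y; rewrite fM cnormM.
- by move=> x; rewrite fM fs cnorm_star_mul.
Qed.

(** * Asymptotically equicontinuous families *)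

Section quasi_continuity.
Variables (R : realType) (P : topologicalType).
Implicit Types (V : normedModType R) (B : realCstarType R).

(* Asymptotic equicontinuity: for large [t], [u t] moves little around each
   point, in a neighborhood independent of [t]. *)
Definition qc V (u : R -> P -> V) : Prop :=
  (forall p : P, exists M, \forall t \near +oo_R, `|u t p| <= M) /\
  (forall (p : P) e, 0 < e -> exists U, nbhs p U /\
     \forall t \near +oo_R, forall p', U p' -> `|u t p' - u t p| <= e).

Lemma qc_near_bounded V (u : R -> P -> V) (p : P) : qc u ->
  exists M U, [/\ 0 <= M, nbhs p U &
    \forall t \near +oo_R, forall p', U p' -> `|u t p'| <= M].
Proof.
move=> [bu cu]; have [M uM] := bu p; have [U [pU uU]] := cu p 1 ltr01.
exists (`|M| + 1), U; split=> //.
apply: filterS2 uM uU => t h1 h2 p' /h2 h3.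
rewrite -(subrK (u t p) (u t p')) (le_trans (ler_normD _ _))// addrC lerD//.
by rewrite (le_trans h1) ?ler_norm.
Qed.

Lemma qcD V (u v : R -> P -> V) : qc u -> qc v -> qc (fun t p => u t p + v t p).
Proof.
move=> [bu cu] [bv cv]; split=> [p|p e e0].
  have [M uM] := bu p; have [N vN] := bv p; exists (M + N).
  by apply: filterS2 uM vN => t h1 h2; rewrite (le_trans (ler_normD _ _))// lerD.
have e2 : 0 < e / 2 by rewrite divr_gt0.
have [U [pU uU]] := cu p _ e2; have [W [pW vW]] := cv p _ e2.
exists (U `&` W); split; first exact: filterI.
apply: filterS2 uU vW => t h1 h2 p' [/h1 {}h1 /h2 {}h2].
by rewrite opprD addrACA (splitr e) (le_trans (ler_normD _ _))// lerD.
Qed.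

Lemma qcZ V (k : P -> R) (u : R -> P -> V) :
  continuous k -> qc u -> qc (fun t p => k p *: u t p).
Proof.
move=> ck qu; split=> [p|p e e0].
  have [M uM] := qu.1 p; exists (`|k p| * M).
  by apply: filterS uM => t h; rewrite normrZ ler_wpM2l.
have [M [U [M0 pU uM]]] := qc_near_bounded p qu.
have d1 : 0 < e / 2 / (M + 1) by rewrite !divr_gt0// ltr_wpDl.
have d2 : 0 < e / 2 / (`|k p| + 1) by rewrite !divr_gt0// ltr_wpDl.
have [W [pW uW]] := qu.2 p _ d2.
have ck' : \forall p' \near p, `|k p - k p'| <= e / 2 / (M + 1).
  by apply: (@cvgr_dist_le _ _ _ (nbhs p) _ k (k p)) => //; exact: ck.
exists ((U `&` W) `&` [set p' | `|k p - k p'| <= e / 2 / (M + 1)]); split.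
  by apply: filterI => //; exact: filterI.
apply: filterS2 uM uW => t h1 h2 p' [[/h1 {}h1 /h2 {}h2] h3].
have -> : k p' *: u t p' - k p *: u t p =
  (k p' - k p) *: u t p' + k p *: (u t p' - u t p).
  by rewrite scalerBl scalerBr addrA subrK.
rewrite (splitr e) (le_trans (ler_normD _ _))// !normrZ lerD//.
  rewrite distrC (le_trans (ler_pM _ _ h3 h1))// mulrAC ler_pdivrMr ?ltr_wpDl//.
  by rewrite ler_wpM2l ?divr_ge0 ?(ltW e0)// lerDl.
rewrite (le_trans (ler_wpM2l _ h2))// mulrCA ler_piMr ?divr_ge0 ?(ltW e0)//.
by rewrite ler_pdivrMr ?ltr_wpDl// mul1r lerDl.
Qed.

Lemma qcN V (u : R -> P -> V) : qc u -> qc (fun t p => - u t p).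
Proof.
move=> [bu cu]; split=> [p|p e e0].
  by have [M uM] := bu p; exists M; apply: filterS uM => t; rewrite normrN.
have [U [pU uU]] := cu p _ e0; exists U; split=> //.
by apply: filterS uU => t h p' /h; rewrite -opprD normrN.
Qed.

Lemma qcB V (u v : R -> P -> V) : qc u -> qc v -> qc (fun t p => u t p - v t p).
Proof. by move=> qu qv; apply: qcD => //; exact: qcN. Qed.

Lemma qcM B (u v : R -> P -> B) : qc u -> qc v -> qc (fun t p => u t p ** v t p).
Proof.
move=> qu qv; split=> [p|p e e0].
  have [M uM] := qu.1 p; have [N vN] := qv.1 p; exists (M * N).
  apply: filterS2 uM vN => t h1 h2.
  by rewrite (le_trans (cnormM _ _))// ler_pM.
have [M [U [M0 pU uM]]] := qc_near_bounded p qu.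
have [N [U' [N0 pU' vN]]] := qc_near_bounded p qv.
have d1 : 0 < e / 2 / (M + 1) by rewrite !divr_gt0// ltr_wpDl.
have d2 : 0 < e / 2 / (N + 1) by rewrite !divr_gt0// ltr_wpDl.
have [W [pW uW]] := qu.2 p _ d2; have [W' [pW' vW]] := qv.2 p _ d1.
exists ((U `&` W) `&` (U' `&` W')); split; first by do 2?apply: filterI.
have uMW : \forall t \near +oo_R, forall p', U p' -> W p' ->
    `|u t p'| <= M /\ `|u t p' - u t p| <= e / 2 / (N + 1).
  by apply: filterS2 uM uW => t h1 h2 p' Up Wp; split; [exact: h1|exact: h2].
apply: filterS3 uMW vN vW => t h h3 h4 p' [[pp1 pp2] [pp3 pp4]].
have [_ h2] := h _ pp1 pp2.
have [h1 _] := h _ (nbhs_singleton pU) (nbhs_singleton pW).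
have -> : u t p' ** v t p' - u t p ** v t p =
  (u t p' - u t p) ** v t p' + u t p ** (v t p' - v t p) by calg R B.
rewrite (splitr e) (le_trans (ler_normD _ _))// lerD//.
  rewrite (le_trans (cnormM _ _))// (le_trans (ler_pM _ _ h2 (h3 _ pp3)))//.
  rewrite mulrAC ler_pdivrMr ?ltr_wpDl//.
  by rewrite ler_wpM2l ?divr_ge0 ?(ltW e0)// lerDl.
rewrite (le_trans (cnormM _ _))//.
rewrite (le_trans (ler_pM _ _ h1 (h4 _ pp4)))//.
rewrite mulrCA ler_piMr ?divr_ge0 ?(ltW e0)//.
by rewrite ler_pdivrMr ?ltr_wpDl// mul1r lerDl.
Qed.

Lemma qc_star B (u : R -> P -> B) : qc u -> qc (fun t p => cstar (u t p)).
Proof.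
move=> [bu cu]; split=> [p|p e e0].
  have [M uM] := bu p; exists M; apply: filterS uM => t; by rewrite cnorm_star.
have [U [pU uU]] := cu p _ e0; exists U; split=> //.
by apply: filterS uU => t h p' /h; rewrite -cstarB cnorm_star.
Qed.

Lemma qc_cst V (f : P -> V) : continuous f -> qc (fun _ => f).
Proof.
move=> cf; split=> [p|p e e0]; first by exists `|f p|; apply: nearW.
exists [set p' | `|f p' - f p| <= e]; split; last by apply: nearW.
rewrite /=; have : \forall p' \near p, `|f p - f p'| <= e.
  by apply: (@cvgr_dist_le _ _ _ (nbhs p) _ f (f p)) => //; exact: cf.
by apply: filterS => p'; rewrite distrC.
Qed.

Lemma qc_sum (I : Type) (s : seq I) V (u : I -> R -> P -> V) :
  (forall i, qc (u i)) -> qc (fun t p => \sum_(i <- s) u i t p).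
Proof.
move=> qu; elim: s => [|i s IH].
  have := @qc_cst V (fun _ => 0) (@cst_continuous _ _ _).
  by congr qc; apply/funext => t; apply/funext => p; rewrite big_nil.
have := qcD (qu i) IH.
by congr qc; apply/funext => t; apply/funext => p; rewrite big_cons.
Qed.

(** This uniformity on compact sets is what lets asymptotic morphisms act on functions point by
    point. *)
Lemma qc_compact V (u : R -> P -> V) (K : set P) : qc u ->
  (forall p, K p -> u t p @[t --> +oo_R] --> (0 : V)) -> compact K ->
  forall e, 0 < e -> \forall t \near +oo_R, forall p, K p -> `|u t p| <= e.
Proof.
move=> [_ cu] u0 /compact_near_coveringP/near_covering_withinP cK e e0.
have e2 : 0 < e / 2 by rewrite divr_gt0.
have := cK _ (pinfty_nbhs R) (fun t p => `|u t p| <= e) _.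
apply=> p Kp; have [U [pU uU]] := cu p _ e2.
have /null_normP/(_ _ e2) u0p := u0 p Kp.
have TT : \forall t \near +oo_R, (forall p', U p' -> `|u t p' - u t p| <= e / 2) /\ `|u t p| <= e / 2.
  by apply: filterS2 uU u0p => t.
exists (U, [set t | (forall p', U p' -> `|u t p' - u t p| <= e / 2) /\ `|u t p| <= e / 2]).
  by split.
move=> [p' t] [/= Up' [/(_ _ Up') h1 h2]] _.
rewrite -(subrK (u t p) (u t p')) (splitr e) (le_trans (ler_normD _ _))//.
exact: lerD.
Qed.

(** Thus countably many conditions suffice, and a single reparametrization can meet them all. *)
Lemma qc_dense V (u : R -> P -> V) (D : set P) : qc u -> dense D ->
  (forall p, D p -> u t p @[t --> +oo_R] --> (0 : V)) ->
  forall p, u t p @[t --> +oo_R] --> (0 : V).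
Proof.
move=> [_ cu] dD u0 p; apply/null_normP => e e0.
have e2 : 0 < e / 2 by rewrite divr_gt0.
have [U [pU uU]] := cu p _ e2.
have [p' [Up' Dp']] : (U^° `&` D) !=set0.
  apply: dD; last exact: open_interior.
  by exists p.
have /null_normP/(_ _ e2) := u0 p' Dp'.
apply: filterS2 uU => t /(_ _ (interior_subset Up')) h1 h2.
rewrite -(subKr (u t p') (u t p)) (splitr e) addrC.
by rewrite (le_trans (ler_normD _ _))// normrN lerD.
Qed.

End quasi_continuity.

(** * Functions on the interval: currying and exchange of variables *)

Lemma compact_unit_itv (R : realType) : compact [set: unit_itv R].
Proof.
have -> : [set: unit_itv R] = (@clamp R) @` `[0, 1]%classic.
  apply/seteqP; split=> // x _; exists (set_val x); last exact: clampK.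
  by rewrite /= in_itv/= val_itv_ge0 val_itv_le1.
apply: continuous_compact; last exact: segment_compact.
by apply: continuous_subspaceT => x; exact: clamp_continuous.
Qed.

Section curry.
Variables (R : realType) (X : topologicalType) (Z : set (unit_itv R)).
Variable V : normedModType R.
Local Notation I := (unit_itv R).

Lemma itv_curry_continuous (f : X -> itv_algebra Z V) :
  continuous (fun p : X * I => f p.1 p.2) -> continuous f.
Proof.
move=> cf x; apply/(@cvgrPdist_le _ _ _ (nbhs x)) => e e0.
have e2 : 0 < e / 2 by rewrite divr_gt0.
have := compact_near_coveringP [set: I].
move=> [/(_ (@compact_unit_itv R)) cI _].
have := cI _ (nbhs x) (fun x' y => `|f x y - f x' y| <= e) _.
have H : forall y, [set: I] y -> \forall y' \near nbhs y & x' \near nbhs x,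
    `|f x y' - f x' y'| <= e.
  move=> y _.
  have /cvgr_dist_le/(_ _ e2) : (fun p : X * I => f p.1 p.2) p @[p --> (x, y)] --> f x y.
    exact: (cf (x, y)).
  move=> [[U W] /= [xU yW] UW].
  exists (W, U) => //= -[y' x'] [/= Wy' Ux'].
  have h1 := UW (x, y') (conj (nbhs_singleton xU) Wy').
  have h2 := UW (x', y') (conj Ux' Wy'); rewrite /= in h1 h2.
  rewrite -(subrKA (f x y)) (splitr e) (le_trans (ler_normD _ _))// lerD//.
  by rewrite distrC.
move=> /(_ _ H); apply: filterS => x' h; apply/itv_normP => y.
by have := h y Logic.I.
Qed.

Lemma itv_uncurry_continuous (f : X -> itv_algebra Z V) :
  continuous f -> continuous (fun p : X * I => f p.1 p.2).
Proof.
move=> cf [x y]; apply/(@cvgrPdist_le _ _ _ (nbhs (x, y))) => e e0.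
have e2 : 0 < e / 2 by rewrite divr_gt0.
have := @cvgr_dist_le _ _ _ (nbhs x) _ f (f x) (cf x) _ e2.
have := @cvgr_dist_le _ _ _ (nbhs y) _ (f x) (f x y) (@itv_continuous _ _ _ (f x) y) _ e2.
move=> h1 h2; exists ([set x' | `|f x - f x'| <= e / 2], [set y' | `|f x y - f x y'| <= e / 2]); first by split; [exact: h2|exact: h1].
move=> [x' y'] [/= xx yy].
rewrite -(subrKA (f x y')) (splitr e) (le_trans (ler_normD _ _))// lerD//.
by rewrite (le_trans _ xx)//; exact: (itv_normE (f x - f x')).
Qed.

End curry.

Section itv_maps.
Variables (R : realType) (Z : set (unit_itv R)).
Local Notation I := (unit_itv R).

Definition itv_map_fun (A B : normedModType R) (f : A -> B)
  (cf : continuous f) (f0 : f 0 = 0) (F : itv_algebra Z A) : itv_algebra Z B.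
Proof.
refine (@mk_itv _ Z _ (fun x => f (F x)) _ _).
- by move=> x; apply: continuous_comp; [exact: itv_continuous|exact: cf].
- by move=> x Zx; rewrite itv_vanish.
Defined.

Section starhom.
Variables (A B : realCstarType R) (f : starhom A B).

Lemma itv_map_starhom :
  is_starhom (itv_map_fun (@starhom_continuous _ _ _ f) (starhom0 f)).
Proof.
split=> [k x y|x y|x]; apply/itv_eqP => z.
- exact: starhomL.
- exact: starhomM.
- exact: starhom_star.
Qed.

Lemma itv_map_contractive F :
  `|itv_map_fun (@starhom_continuous _ _ _ f) (starhom0 f) F| <= `|F|.
Proof.
apply/itv_normP => x; rewrite (le_trans (starhom_contractive _ _))//.
exact: itv_normE.
Qed.

Definition itv_map : starhom (itv_algebra Z A) (itv_algebra Z B) :=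
  Starhom itv_map_starhom itv_map_contractive.

End starhom.
End itv_maps.

Section swap.
Variables (R : realType) (Z1 Z2 : set (unit_itv R)).
Local Notation I := (unit_itv R).

Lemma joint_continuous (V : normedModType R) (F : itv_algebra Z1 (itv_algebra Z2 V)) :
  continuous (fun p : I * I => F p.1 p.2).
Proof. by apply: itv_uncurry_continuous; exact: itv_continuous. Qed.

Definition swap_slice (V : normedModType R) (F : itv_algebra Z1 (itv_algebra Z2 V))
  (x : I) : itv_algebra Z1 V.
Proof.
refine (@mk_itv _ Z1 _ (fun y => F y x) _ _).
- move=> y; apply: (@continuous_comp _ _ _ (fun y => (y, x)) (fun p => F p.1 p.2)).
    by apply: (@cvg_pair _ _ _ (nbhs y) (nbhs y) (nbhs x)); [exact: cvg_id|exact: cvg_cst].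
  exact: (@joint_continuous V F).
- by move=> y Zy; rewrite (@itv_vanish _ _ _ F y Zy).
Defined.

Definition swap_map (V : normedModType R) (F : itv_algebra Z1 (itv_algebra Z2 V)) :
  itv_algebra Z2 (itv_algebra Z1 V).
Proof.
refine (@mk_itv _ Z2 _ (swap_slice F) _ _).
- apply: itv_curry_continuous => /= -[x y].
  apply: (@continuous_comp _ _ _ (fun p : I * I => (p.2, p.1)) (fun p => F p.1 p.2)).
    by apply: (@cvg_pair _ _ _ (nbhs (x, y)) (nbhs y) (nbhs x)); [exact: cvg_snd|exact: cvg_fst].
  exact: (@joint_continuous V F).
- move=> x Zx; apply/itv_eqP => y; exact: (itv_vanish (F y) Zx).
Defined.

Lemma swap_mapE (V : normedModType R) (F : itv_algebra Z1 (itv_algebra Z2 V)) x y :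
  swap_map F x y = F y x.
Proof. by []. Qed.

Variable A : realCstarType R.

Lemma swap_starhom : is_starhom (@swap_map A).
Proof.
split=> [k F G|F G|F]; apply/itv_eqP => x; apply/itv_eqP => y; rewrite swap_mapE.
- by rewrite !(itvDE, itvZE) !swap_mapE.
- by rewrite !itv_mulE !swap_mapE.
- by rewrite !itv_starE swap_mapE.
Qed.

Lemma swap_contractive F : `|@swap_map A F| <= `|F|.
Proof.
apply/itv_normP => x; apply/itv_normP => y.
rewrite [swap_map F x y]swap_mapE. by rewrite (le_trans (itv_normE _ _))// itv_normE.
Qed.

Definition swap := Starhom swap_starhom swap_contractive.

Lemma swapE F x y : swap F x y = F y x. Proof. exact: swap_mapE. Qed.

End swap.

Section continuity.
Variables (R : realType) (T : topologicalType).
Implicit Types (V : normedModType R).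

Lemma contD V (f g : T -> V) : continuous f -> continuous g ->
  continuous (fun x => f x + g x).
Proof. by move=> cf cg x; apply: cvgD; [exact: cf|exact: cg]. Qed.

Lemma contB V (f g : T -> V) : continuous f -> continuous g ->
  continuous (fun x => f x - g x).
Proof. by move=> cf cg x; apply: cvgB; [exact: cf|exact: cg]. Qed.

Lemma contZ V (k : T -> R) (f : T -> V) : continuous k -> continuous f ->
  continuous (fun x => k x *: f x).
Proof. by move=> ck cf x; apply: cvgZ; [exact: ck|exact: cf]. Qed.

Lemma contM (B : realCstarType R) (f g : T -> B) : continuous f -> continuous g ->
  continuous (fun x => f x ** g x).
Proof. by move=> cf cg x; apply: (@cvg_cmul _ _ _ (nbhs x)); [exact: cf|exact: cg]. Qed.

Lemma cont_star (B : realCstarType R) (f : T -> B) : continuous f ->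
  continuous (fun x => cstar (f x)).
Proof.
move=> cf x; apply/(@cvgrPdist_le _ _ _ (nbhs x)) => e e0.
have /(@cvgrPdist_le _ _ _ (nbhs x))/(_ _ e0) := cf x.
by apply: filterS => y; rewrite -cstarB cnorm_star.
Qed.

Lemma cont_norm V (f : T -> V) : continuous f -> continuous (fun x => `|f x| : R).
Proof. by move=> cf x; apply: cvg_norm; exact: cf. Qed.

Lemma cont_sum V (I : Type) (s : seq I) (F : I -> T -> V) :
  (forall i, continuous (F i)) -> continuous (fun x => \sum_(i <- s) F i x).
Proof.
by move=> cF; apply: continuous_big => [|i _]; [exact: add_continuous|exact: cF].
Qed.

Lemma cont_max (f g : T -> R) : continuous f -> continuous g ->
  continuous (fun x => Num.max (f x) (g x)).
Proof. by move=> cf cg x; apply: continuous_max; [exact: cf|exact: cg]. Qed.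

Lemma cont_min (f g : T -> R) : continuous f -> continuous g ->
  continuous (fun x => Num.min (f x) (g x)).
Proof. by move=> cf cg x; apply: continuous_min; [exact: cf|exact: cg]. Qed.

Lemma cont_mulr (f g : T -> R) : continuous f -> continuous g ->
  continuous (fun x => f x * g x).
Proof. by move=> cf cg x; apply: cvgM; [exact: cf|exact: cg]. Qed.

Lemma cont_inv (f : T -> R) : (forall x, f x != 0) -> continuous f ->
  continuous (fun x => (f x)^-1).
Proof. by move=> f0 cf x; apply: cvgV; [exact: f0|exact: cf]. Qed.

Lemma cont_comp (S U : topologicalType) (f : T -> S) (g : S -> U) :
  continuous f -> continuous g -> continuous (fun x => g (f x)).
Proof.
by move=> cf cg x; apply: continuous_comp; [exact: cf|exact: cg].
Qed.

Lemma cont_pair (S U : topologicalType) (f : T -> S) (g : T -> U) :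
  continuous f -> continuous g -> continuous (fun x => (f x, g x)).
Proof.
move=> cf cg x; apply: (@cvg_pair _ _ _ (nbhs x) (nbhs (f x)) (nbhs (g x))).
  exact: cf.
exact: cg.
Qed.

Lemma cont_local (S : topologicalType) (f : T -> S) :
  (forall x : T, exists g : T -> S, continuous g /\ \forall y \near x, f y = g y) ->
  continuous f.
Proof.
move=> fg x; have [g [cg fgx]] := fg x.
rewrite /continuous_at (nbhs_singleton fgx) => U /(cg x) gU.
by apply: filterS2 fgx gU => y; rewrite /= => ->.
Qed.

End continuity.

Lemma cont_fst (X Y : topologicalType) : continuous (@fst X Y).
Proof. by move=> x; exact: cvg_fst. Qed.

Lemma cont_snd (X Y : topologicalType) : continuous (@snd X Y).
Proof. by move=> x; exact: cvg_snd. Qed.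

Lemma cont_id (X : topologicalType) : continuous (@id X).
Proof. by move=> x; exact: cvg_id. Qed.

(** * Asymptotic morphisms acting pointwise *)

Section nice.
Variable R : realType.
Implicit Types A B : normedModType R.

(** The time from which the estimate holds depends on [a] but not on [b]. For each pair of points,
    such an estimate follows from asymptotic contractivity; its uniformity in [b] is what gives
    asymptotic equicontinuity. *)
Definition qlip A B (phi : R -> A -> B) := exists2 C, 0 <= C &
  forall (a : A) e, 0 < e ->
    \forall t \near +oo_R, forall b, `|phi t b - phi t a| <= C * `|b - a| + e.

(** Joint continuity keeps the images of continuous functions continuous, [nice_at0] makes them
    vanish where the functions do, and [nice_qlip] turns relations that hold at each point into
    uniform ones. *)
Record nice A B (phi : R -> A -> B) : Prop := Nice {
  nice_continuous : continuous (fun p : R * A => phi p.1 p.2);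
  nice_at0 : forall t, phi t 0 = 0;
  nice_qlip : qlip phi
}.

Section theory.
Variables (A B : normedModType R) (phi : R -> A -> B).
Hypothesis nphi : nice phi.

Lemma nice_continuous_at t : continuous (phi t).
Proof.
apply: (@cont_comp _ _ _ (fun a : A => (t, a)) (fun p => phi p.1 p.2)).
  by apply: cont_pair; [exact: cst_continuous|exact: cont_id].
exact: (nice_continuous nphi).
Qed.

Lemma nice_continuous_t a : continuous (phi ^~ a).
Proof.
apply: (@cont_comp _ _ _ (fun t : R => (t, a)) (fun p => phi p.1 p.2)).
  by apply: cont_pair; [exact: cont_id|exact: cst_continuous].
exact: (nice_continuous nphi).
Qed.

Lemma qc_nice (P : topologicalType) (x : P -> A) : continuous x ->
  qc (fun t p => phi t (x p)).
Proof.
move=> cx; have [C C0 phiC] := nice_qlip nphi; split=> [p|p e e0].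
  exists (C * `|x p| + 1); apply: filterS (phiC 0 1 ltr01) => t /(_ (x p)).
  by rewrite (nice_at0 nphi) !subr0.
have e2 : 0 < e / 2 by rewrite divr_gt0.
have d0 : 0 < e / 2 / (C + 1) by rewrite divr_gt0// ltr_wpDl.
exists [set p' | `|x p - x p'| <= e / 2 / (C + 1)]; split.
  by apply: (@cvgr_dist_le _ _ _ (nbhs p) _ x (x p)) => //; exact: cx.
apply: filterS (phiC (x p) _ e2) => t h p' /= px; rewrite (le_trans (h _))//.
rewrite {2}(splitr e) lerD// distrC (le_trans (ler_wpM2l C0 px))//.
by rewrite mulrCA ler_piMr ?(ltW e2)// ler_pdivrMr ?ltr_wpDl// mul1r lerDl.
Qed.

Lemma nice_qlip_compact : exists2 C, 0 <= C &
  forall (K : set A) e, compact K -> 0 < e ->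
    \forall t \near +oo_R, forall a, K a -> forall b,
      `|phi t b - phi t a| <= C * `|b - a| + e.
Proof.
have [C C0 phiC] := nice_qlip nphi; exists C => // K e.
move=> /compact_near_coveringP/near_covering_withinP cK e0.
have e4 : 0 < e / 4 by rewrite divr_gt0.
have d0 : 0 < e / 4 / (C + 1) by rewrite divr_gt0// ltr_wpDl.
have := cK _ (pinfty_nbhs R) (fun t a => forall b, `|phi t b - phi t a| <= C * `|b - a| + e) _.
apply=> a Ka.
exists ([set a' : A | `|a - a'| <= e / 4 / (C + 1)],
    [set t | forall b, `|phi t b - phi t a| <= C * `|b - a| + e / 4]).
  split; last exact: phiC.
  apply: (@cvgr_dist_le _ _ _ (nbhs a) _ id a) => //; exact: cvg_id.
move=> [a' t] [/= aa' h] _ b.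
have Ca : C * `|a - a'| <= e / 4.
  rewrite (le_trans (ler_wpM2l C0 aa'))// mulrCA ler_piMr ?(ltW e4)//.
  by rewrite ler_pdivrMr ?ltr_wpDl// mul1r lerDl.
have h1 := h b; have h2 := h a'; rewrite distrC (distrC a') in h2.
rewrite -(subrKA (phi t a)) (le_trans (ler_normD _ _))//.
have : C * `|b - a| <= C * `|b - a'| + C * `|a - a'|.
  by rewrite -mulrDr ler_wpM2l// (distrC a) -{1}(subrKA a') ler_normD.
lra.
Qed.

End theory.

Lemma continuous_ge1_bounded B (f : R -> B) : {within `[1, +oo[, continuous f} ->
  (exists M, \forall t \near +oo_R, `|f t| <= M) ->
  exists M, forall t, 1 <= t -> `|f t| <= M.
Proof.
move=> cf [M [T [_ fM]]].
have /compact_bounded[N [_ /(_ (N + 1))]] : compact (f @` `[1, T + 1]%classic).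
  apply: continuous_compact; last exact: segment_compact.
  apply: continuous_subspaceW cf => x /=; rewrite !in_itv/= => /andP[->]//.
rewrite ltrDl ltr01 => /(_ isT) fN.
exists (Num.max M (N + 1)) => t t1; rewrite le_max.
have [tT|Tt] := leP t (T + 1); last first.
  by rewrite fM// (lt_trans _ Tt)// ltrDl.
by apply/orP; right; apply: fN; exists t => //=; rewrite in_itv/= t1.
Qed.

Lemma nice_asym (A B : realCstarType R) (phi : R -> A -> B) : nice phi ->
  (forall (k : R) a b,
    phi t (k *: a + b) - (k *: phi t a + phi t b) @[t --> +oo_R] --> (0 : B)) ->
  (forall a b, phi t (a ** b) - phi t a ** phi t b @[t --> +oo_R] --> (0 : B)) ->
  (forall a, phi t (cstar a) - cstar (phi t a) @[t --> +oo_R] --> (0 : B)) ->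
  asymptotic_morphism phi.
Proof.
move=> nphi l m s; have cphi a : {within `[1, +oo[, continuous (phi ^~ a)}.
  by apply: continuous_subspaceT; exact: nice_continuous_t.
split=> // a; apply: continuous_ge1_bounded => //.
have [bphi _] := qc_nice nphi (@cont_id A); exact: bphi.
Qed.

Definition aeq A B (phi psi : R -> A -> B) :=
  forall a, phi t a - psi t a @[t --> +oo_R] --> (0 : B).

Lemma aeq_sym A B (phi psi : R -> A -> B) : aeq phi psi -> aeq psi phi.
Proof.
by move=> h a; apply: cvg0_eq (cvg0N (h a)) => t _; rewrite opprB.
Qed.

End nice.

(** * Null families and perturbations of asymptotic morphisms *)

Section null.
Variables (R : realType).

Lemma cvg0Z (V : normedModType R) (k : R) (u : R -> V) :
  u t @[t --> +oo_R] --> (0 : V) -> k *: u t @[t --> +oo_R] --> (0 : V).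
Proof.
move=> u0; rewrite -[X in _ --> X](scaler0 _ k).
by apply: cvgZ => //; exact: cvg_cst.
Qed.

Lemma cvg0_star (B : realCstarType R) (u : R -> B) :
  u t @[t --> +oo_R] --> (0 : B) -> cstar (u t) @[t --> +oo_R] --> (0 : B).
Proof. by apply: cvg0_le => t _; rewrite cnorm_star. Qed.

Lemma cvg0Ml (B : realCstarType R) (M : R) (u v : R -> B) :
  (forall t, 1 <= t -> `|v t| <= M) ->
  u t @[t --> +oo_R] --> (0 : B) -> v t ** u t @[t --> +oo_R] --> (0 : B).
Proof.
move=> vM u0; have := cvg0Z M u0; apply: cvg0_le => t t1; rewrite normrZ.
rewrite (le_trans (cnormM _ _))// ler_wpM2r// (le_trans (vM _ t1))// ler_norm//.
Qed.

Lemma cvg0Mr (B : realCstarType R) (M : R) (u v : R -> B) :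
  (forall t, 1 <= t -> `|v t| <= M) ->
  u t @[t --> +oo_R] --> (0 : B) -> u t ** v t @[t --> +oo_R] --> (0 : B).
Proof.
move=> vM u0; have := cvg0Z M u0; apply: cvg0_le => t t1; rewrite normrZ mulrC.
rewrite (le_trans (cnormM _ _))// ler_wpM2l// (le_trans (vM _ t1))// ler_norm//.
Qed.

End null.

Section perturbation.
Variables (R : realType) (A B : realCstarType R) (phi : asym A B) (u : R -> A -> B).
Hypothesis cu : forall a, {within `[1, +oo[, continuous (u ^~ a)}.
Hypothesis u0 : forall a, u t a @[t --> +oo_R] --> (0 : B).

Let bu a : exists M, forall t, 1 <= t -> `|u t a| <= M.
Proof.
apply: continuous_ge1_bounded => //; exists 1.
by have /null_normP/(_ 1 ltr01) := u0 a.
Qed.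

Lemma perturbation_asym : asymptotic_morphism (fun t a => phi t a + u t a).
Proof.
have [bphi cphi lphi mphi sphi] := asymP phi; split=> [a|a|k a b|a b|a].
- have [M pM] := bphi a; have [N uN] := bu a; exists (M + N) => t t1.
  by rewrite (le_trans (ler_normD _ _))// lerD// ?pM// uN.
- have ca := cphi a; have ua := cu (a := a).
  by move=> t; exact: (continuousD (ca t) (ua t)).
- apply: cvg0_eq (cvg0D (lphi k a b) (cvg0D (u0 (k *: a + b))
    (cvg0N (cvg0D (cvg0Z k (u0 a)) (u0 b))))) => t _.
  by lmod_gen R B.
- have [M pM] := bphi a; have [N uN] := bu b; have [L pL] := bphi b.
  apply: cvg0_eq (cvg0D (mphi a b) (cvg0D (u0 (a ** b)) (cvg0N
    (cvg0D (cvg0Ml pM (u0 b)) (cvg0D (cvg0Mr pL (u0 a)) (cvg0Mr uN (u0 a))))))) => t _.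
  by calg R B.
- apply: cvg0_eq (cvg0D (sphi a) (cvg0D (u0 (cstar a)) (cvg0N (cvg0_star (u0 a))))) => t _.
  by rewrite cstarD; lmod_gen R B.
Qed.

Definition asym_perturb : asym A B := Asym perturbation_asym.

End perturbation.

Section line.
Variables (R : realType) (B : realCstarType R).

Definition itv_line (b : B) : cylinder B.
Proof.
refine (@mk_itv _ set0 B (fun x => (set_val x : R) *: b) _ _); last by [].
by apply: contZ; [exact: initial_continuous|exact: cst_continuous].
Defined.

Lemma itv_line_norm b : `|itv_line b| <= `|b|.
Proof.
apply/itv_normP => x /=; rewrite normrZ ger0_norm ?val_itv_ge0//.
by rewrite ler_piMl// val_itv_le1.
Qed.

Lemma itv_lineB a b : itv_line a - itv_line b = itv_line (a - b).
Proof. by apply/itv_eqP => x; rewrite /= scalerBr. Qed.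

Lemma itv_line_continuous : continuous itv_line.
Proof.
move=> x; apply/(@cvgrPdist_le _ _ _ (nbhs x)) => e e0.
have : \forall y \near x, `|x - y| <= e by exact: cvgr_dist_le.
by apply: filterS => y; rewrite itv_lineB; exact/le_trans/itv_line_norm.
Qed.

End line.

Lemma set_val_clamp0 (R : realType) : set_val (clamp 0 : unit_itv R) = 0.
Proof. by rewrite set_valE/= min_l// maxxx. Qed.

Lemma set_val_clamp1 (R : realType) : set_val (clamp 1 : unit_itv R) = 1.
Proof. by rewrite set_valE/= minxx max_r. Qed.

(** The straight line from [phi] to [psi] is the constant homotopy plus a null family, and null
    perturbations of asymptotic morphisms are asymptotic morphisms. *)
Lemma aeq_homotopic (R : realType) (A B : realCstarType R) (phi psi : asym A B) :
  aeq phi psi -> homotopic phi psi.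
Proof.
move=> pp.
have cu a : {within `[1, +oo[, continuous (fun t => itv_line (psi t a - phi t a))}.
  have cp : {within `[1, +oo[, continuous (phi ^~ a)} by exact: (asym_continuous (asymP phi)).
  have cq : {within `[1, +oo[, continuous (psi ^~ a)} by exact: (asym_continuous (asymP psi)).
  move=> t.
  exact: (continuous_comp (continuousB (cq t) (cp t)) (@itv_line_continuous R B _)).
have u0 a : itv_line (psi t a - phi t a) @[t --> +oo_R] --> (0 : cylinder B).
  apply: cvg0_le (pp a) => t _; rewrite (le_trans (itv_line_norm _))//.
  by rewrite distrC.
exists (@asym_perturb _ _ _ (asym_post (cyl_cst B) phi) _ cu u0) => t a _.
have E x : (@asym_perturb _ _ _ (asym_post (cyl_cst B) phi) _ cu u0) t a x =
  phi t a + set_val x *: (psi t a - phi t a) by [].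
by rewrite !E set_val_clamp0 set_val_clamp1 scale0r addr0 scale1r subrKC.
Qed.

Lemma aeq_asymp (R : realType) (A B : realCstarType R) (phi : asym A B) (psi : R -> A -> B) :
  aeq psi phi -> (forall a, {within `[1, +oo[, continuous (psi ^~ a)}) ->
  asymptotic_morphism psi.
Proof.
move=> pp cpsi.
have cu a : {within `[1, +oo[, continuous (fun t => psi t a - phi t a)}.
  have cp : {within `[1, +oo[, continuous (phi ^~ a)} by exact: (asym_continuous (asymP phi)).
  by move=> t; exact: (continuousB (cpsi a t) (cp t)).
have := @perturbation_asym _ _ _ phi _ cu pp.
congr asymptotic_morphism; apply/funext => t; apply/funext => a.
by rewrite subrKC.
Qed.

(** * Pointwise action on function algebras *)

Section nice_maps.
Variable R : realType.
Local Notation I := (unit_itv R).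

Lemma lipB_continuous (A B : normedModType R) (f : A -> B) c :
  (forall x y, `|f x - f y| <= c * `|x - y|) -> continuous f.
Proof.
move=> fc x; apply/(@cvgrPdist_le _ _ _ (nbhs x)) => e e0.
have d0 : 0 < e / (`|c| + 1) by rewrite divr_gt0// ltr_wpDl.
have : \forall y \near x, `|x - y| <= e / (`|c| + 1) by exact: cvgr_dist_le.
apply: filterS => y xy; rewrite (le_trans (fc _ _))//.
apply: (@le_trans _ _ (`|c| * (e / (`|c| + 1)))).
  by rewrite (le_trans (ler_wpM2r _ (ler_norm c)))// ler_wpM2l.
by rewrite mulrCA ler_piMr ?(ltW e0)// ler_pdivrMr ?ltr_wpDl// mul1r lerDl.
Qed.

Lemma nice_post (A B C : normedModType R) (phi : R -> A -> B) (f : B -> C) c :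
  0 <= c -> f 0 = 0 -> (forall x y, `|f x - f y| <= c * `|x - y|) -> nice phi ->
  nice (fun t a => f (phi t a)).
Proof.
move=> c0 f0 fc nphi; split.
- apply: (cont_comp (nice_continuous nphi)); exact: lipB_continuous fc.
- by move=> t; rewrite (nice_at0 nphi).
have [D D0 phiD] := nice_qlip nphi; exists (c * D); first exact: mulr_ge0.
move=> a e e0; have d0 : 0 < e / (c + 1) by rewrite divr_gt0// ltr_wpDl.
apply: filterS (phiD a _ d0) => t h b; rewrite (le_trans (fc _ _))//.
rewrite (le_trans (ler_wpM2l c0 (h b)))// mulrDr mulrA lerD2l.
by rewrite mulrCA ler_piMr ?(ltW e0)// ler_pdivrMr ?ltr_wpDl// mul1r lerDl.
Qed.

Lemma starhom_lip (A B : realCstarType R) (f : starhom A B) x y :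
  `|f x - f y| <= 1 * `|x - y|.
Proof. by rewrite -starhomB mul1r starhom_contractive. Qed.

Lemma nice_post_hom (A : normedModType R) (B C : realCstarType R)
  (phi : R -> A -> B) (f : starhom B C) : nice phi -> nice (fun t a => f (phi t a)).
Proof. by apply: (@nice_post _ _ _ _ _ 1) => //; [exact: starhom0|exact: starhom_lip]. Qed.

Lemma nice_pre (A A' : realCstarType R) (B : normedModType R)
  (phi : R -> A -> B) (f : starhom A' A) : nice phi -> nice (fun t a => phi t (f a)).
Proof.
move=> nphi; split.
- apply: (@cont_comp _ _ _ (fun p : R * A' => (p.1, f p.2)) (fun p => phi p.1 p.2)).
    apply: cont_pair; first exact: cont_fst.
    by apply: cont_comp; [exact: cont_snd|exact: starhom_continuous].
  exact: (nice_continuous nphi).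
- by move=> t; rewrite starhom0 (nice_at0 nphi).
have [C C0 phiC] := nice_qlip nphi; exists C => // a e e0.
apply: filterS (phiC (f a) _ e0) => t h b; rewrite (le_trans (h _))// lerD2r.
by rewrite ler_wpM2l// -starhomB starhom_contractive.
Qed.

Lemma nice_comb (A B : normedModType R) (phi psi : R -> A -> B) (k : R) :
  nice phi -> nice psi -> nice (fun t a => k *: phi t a + psi t a).
Proof.
move=> nphi npsi; split.
- apply: contD; last exact: (nice_continuous npsi).
  by apply: contZ; [exact: cst_continuous|exact: (nice_continuous nphi)].
- by move=> t; rewrite (nice_at0 nphi) (nice_at0 npsi) scaler0 addr0.
have [C C0 hC] := nice_qlip nphi; have [D D0 hD] := nice_qlip npsi.
exists (`|k| * C + D); first by rewrite addr_ge0// mulr_ge0.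
move=> a e e0; have e2 : 0 < e / 2 by rewrite divr_gt0.
have d0 : 0 < e / 2 / (`|k| + 1) by rewrite divr_gt0// ltr_wpDl.
apply: filterS2 (hC a _ d0) (hD a _ e2) => t h1 h2 b.
rewrite opprD addrACA -scalerBr (le_trans (ler_normD _ _))// normrZ.
have := ler_wpM2l (normr_ge0 k) (h1 b); have := h2 b.
have : `|k| * (e / 2 / (`|k| + 1)) <= e / 2.
  by rewrite mulrCA ler_piMr ?(ltW e2)// ler_pdivrMr ?ltr_wpDl// mul1r lerDl.
rewrite mulrDl mulrDr -mulrA; lra.
Qed.

Section functor.
Variables (Z : set I) (A B : normedModType R) (phi : R -> A -> B).
Hypothesis nphi : nice phi.

Definition itv_fam (t : R) : itv_algebra Z A -> itv_algebra Z B :=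
  itv_map_fun (@nice_continuous_at _ _ _ _ nphi t) (nice_at0 nphi t).

Lemma itv_fam_nice : nice itv_fam.
Proof.
split.
- apply: (@itv_curry_continuous R _ Z B (fun p : R * itv_algebra Z A => itv_fam p.1 p.2)) => /=.
  apply: (@cont_comp _ _ _ (fun p : (R * itv_algebra Z A) * I => (p.1.1, p.1.2 p.2))
    (fun p => phi p.1 p.2)); last exact: (nice_continuous nphi).
  apply: cont_pair; first by apply: cont_comp; exact: cont_fst.
  apply: (@cont_comp _ _ _ (fun p : (R * itv_algebra Z A) * I => (p.1.2, p.2))
    (fun p : itv_algebra Z A * I => p.1 p.2)); last first.
    by apply: (@itv_uncurry_continuous _ _ _ _ id); exact: cont_id.
  apply: cont_pair; last exact: cont_snd.
  by apply: cont_comp; [exact: cont_fst|exact: cont_snd].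
- by move=> t; apply/itv_eqP => x; exact: nice_at0.
have [C C0 phiC] := nice_qlip_compact nphi; exists C => // F e e0.
(* The estimate is needed at all the values of [F] at once, and these form a compact set. *)
have cK : compact (F @` [set: I]).
  apply: continuous_compact; last exact: compact_unit_itv.
  by apply: continuous_subspaceT; exact: itv_continuous.
apply: filterS (phiC _ _ cK e0) => t h G; apply/itv_normP => x.
have Fx : (F @` [set: I]) (F x) by exists x.
rewrite (le_trans (h _ Fx (G x)))//.
rewrite lerD2r ler_wpM2l//; exact: (itv_normE (G - F)).
Qed.

End functor.

Lemma itv_null (Z : set I) (B : normedModType R) (u : R -> itv_algebra Z B) :
  qc (fun t x => u t x) -> (forall x, u t x @[t --> +oo_R] --> (0 : B)) ->
  u t @[t --> +oo_R] --> (0 : itv_algebra Z B).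
Proof.
move=> qu u0; apply/null_normP => e e0.
have := qc_compact qu (fun p _ => u0 p) (@compact_unit_itv R) e0.
by apply: filterS => t h; apply/itv_normP => x; exact: h.
Qed.

Lemma itv_fam_asym (Z : set I) (A B : realCstarType R) (phi : R -> A -> B)
  (nphi : nice phi) : asymptotic_morphism phi ->
  asymptotic_morphism (@itv_fam Z A B phi nphi).
Proof.
move=> [_ _ l m s]; apply: nice_asym => [|k F G|F G|F].
- exact: itv_fam_nice.
- apply: itv_null => [|x]; last exact: l.
  apply: qcB.
    apply: (qc_nice nphi (x := fun x => k *: F x + G x)).
    by apply: contD; [apply: contZ; [exact: cst_continuous|]|]; exact: itv_continuous.
  apply: qcD; last by apply: (qc_nice nphi); exact: itv_continuous.
  apply: (@qcZ _ _ _ (fun=> k)); first exact: cst_continuous.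
  by apply: (qc_nice nphi); exact: itv_continuous.
- apply: itv_null => [|x]; last exact: m.
  apply: qcB.
    apply: (qc_nice nphi (x := fun x => F x ** G x)).
    by apply: contM; exact: itv_continuous.
  by apply: qcM; apply: (qc_nice nphi); exact: itv_continuous.
- apply: itv_null => [|x]; last exact: s.
  apply: qcB.
    apply: (qc_nice nphi (x := fun x => cstar (F x))).
    by apply: cont_star; exact: itv_continuous.
  by apply: qc_star; apply: (qc_nice nphi); exact: itv_continuous.
Qed.

Definition itv_asym (Z : set I) (A B : realCstarType R) (phi : asym A B)
  (nphi : nice phi) : asym (itv_algebra Z A) (itv_algebra Z B) :=
  Asym (@itv_fam_asym Z A B phi nphi (asymP phi)).

End nice_maps.

Section pre.
Variables (R : realType) (A B C : realCstarType R) (f : starhom A B) (phi : asym B C).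

Lemma asym_pre_subproof : asymptotic_morphism (fun t a => phi t (f a)).
Proof.
have [b c l m s] := asymP phi; split=> [a|a|k x y|x y|x].
- exact: b.
- exact: c.
- by rewrite starhomL; exact: l.
- by rewrite starhomM; exact: m.
- by rewrite starhom_star; exact: s.
Qed.

Definition asym_pre : asym A C := Asym asym_pre_subproof.

End pre.

Lemma separable_seq (R : realType) (A : normedModType R) : separable A ->
  exists a : nat -> A, forall x e, 0 < e -> exists n, `|x - a n| < e.
Proof.
move=> [D [/countable_injP[f fI] dD]].
have approx x e : 0 < e -> exists y, D y /\ `|x - y| < e.
  move=> e0; have [y [xy Dy]] : ((ball x e) `&` D) !=set0.
    by apply: dD; [exists x; exact: ballxx|exact: ball_open].
  by exists y; split=> //; move: xy; rewrite -ball_normE.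
have [d0 [Dd0 _]] := approx 0 1 ltr01.
have /choice[a aP] : forall n, exists y, D y /\ ((exists z, D z /\ f z = n) -> f y = n).
  move=> n; have [[z [Dz zn]]|nz] := pselect (exists z, D z /\ f z = n).
    by exists z.
  by exists d0.
exists a => x e e0; have [y [Dy xy]] := approx x e e0.
exists (f y); have [Da /(_ (ex_intro _ y (conj Dy erefl))) /fI] := aP (f y).
by rewrite !inE => /(_ Da Dy) ->.
Qed.

(** * Regularization of asymptotic morphisms *)

Section regularization.
Variables (R : realType) (A B : realCstarType R) (phi : asym A B) (a_ : nat -> A).
Hypothesis a_dense : forall x e, 0 < e -> exists n, `|x - a_ n| < e.

(** Freezing the family before t = 1 makes it continuous on the whole line. *)
Let ph t a := phi (Num.max 1 t) a.

Let ph_continuous a : continuous (ph ^~ a).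
Proof.
have cphi : {within `[1, +oo[, continuous (phi ^~ a)}.
  by exact: (asym_continuous (asymP phi)).
have /subspace_continuousP := cphi.
move=> h t U; rewrite /ph; have t1 : `[1, +oo[%classic (Num.max 1 t).
  by rewrite /= in_itv/= andbT le_max lexx.
move=> /(h _ t1) /= hU.
have : \forall s \near t, `[1, +oo[%classic (Num.max 1 s) ->
    U (phi (Num.max 1 s) a).
  have cm : continuous (fun s : R => Num.max 1 s).
    by apply: cont_max; [exact: cst_continuous|exact: cont_id].
  exact: cm t _ hU.
by apply: filterS => s; apply; rewrite /= in_itv/= andbT le_max lexx.
Qed.

Fixpoint mindist (n : nat) (a : A) : R :=
  if n is m.+1 then Num.min (mindist m a) `|a - a_ n| else `|a - a_ 0|.

Lemma mindist_le n i a : (i <= n)%N -> mindist n a <= `|a - a_ i|.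
Proof.
elim: n i => [|n IH] i; first by rewrite leqn0 => /eqP->.
rewrite leq_eqVlt => /orP[/eqP->|]; first by rewrite /= ge_min lexx orbT.
by rewrite ltnS /= ge_min => /IH ->.
Qed.

Lemma mindist_ex n a : exists2 i, (i <= n)%N & mindist n a = `|a - a_ i|.
Proof.
elim: n => [|n [i ni IH]]; first by exists 0%N.
rewrite /=; have [h|h] := leP (mindist n a) `|a - a_ n.+1|.
  by exists i => //; exact: leqW.
by exists n.+1.
Qed.

Lemma mindist_continuous n : continuous (mindist n).
Proof.
elim: n => [|n IH]; last apply: cont_min => //.
  by apply: cont_norm; apply: contB; [exact: cont_id|exact: cst_continuous].
by apply: cont_norm; apply: contB; [exact: cont_id|exact: cst_continuous].
Qed.

(** The average at [a] uses those of the points a_0, ..., a_n that are nearest to [a] up to 1 / (n +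
    1). This margin keeps the sum of the weights positive. *)
Let rad n a := mindist n a + n.+1%:R^-1.
Let wt n i a : R := Num.max 0 (rad n a - `|a - a_ i|).
Let wsum n a : R := \sum_(i < n.+1) wt n i a.

Let wt_ge0 n i a : 0 <= wt n i a.
Proof. by rewrite /wt le_max lexx. Qed.

Let wt_continuous n i : continuous (wt n i).
Proof.
apply: cont_max; first exact: cst_continuous.
apply: contB; last first.
  by apply: cont_norm; apply: contB; [exact: cont_id|exact: cst_continuous].
by apply: contD; [exact: mindist_continuous|exact: cst_continuous].
Qed.

Let wsum_gt0 n a : 0 < wsum n a.
Proof.
have [i ni E] := mindist_ex n a.
rewrite /wsum (bigD1 (Ordinal (ni : (i < n.+1)%N)))//= ltr_pwDl ?sumr_ge0//.
by rewrite /wt /rad E lt_max addrAC subrr add0r invr_gt0 ltr0n orbT.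
Qed.

Let st n t a : B := (wsum n a)^-1 *: \sum_(i < n.+1) wt n i a *: ph t (a_ i).

Let st_ball n t a b M :
  (forall i, (i <= n)%N -> `|a - a_ i| <= rad n a -> `|ph t (a_ i) - b| <= M) ->
  `|st n t a - b| <= M.
Proof.
move=> h; have w0 := wsum_gt0 n a.
have -> : st n t a - b = (wsum n a)^-1 *: \sum_(i < n.+1) wt n i a *: (ph t (a_ i) - b).
  rewrite (eq_bigr (fun i : 'I_n.+1 => wt n i a *: ph t (a_ i) - wt n i a *: b)); last first.
    by move=> i _; rewrite scalerBr.
  rewrite sumrB scalerBr -scaler_suml -/(wsum n a) scalerA mulVf ?scale1r//.
  by rewrite gt_eqF.
rewrite normrZ gtr0_norm ?invr_gt0// ler_pdivrMl// mulr_suml.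
rewrite (le_trans (ler_norm_sum _ _ _))//; apply: ler_sum => i _.
rewrite normrZ ger0_norm//.
have [w00|wn] := eqVneq (wt n i a) 0; first by rewrite w00 !mul0r.
rewrite ler_wpM2l//; apply: h; first by rewrite -ltnS.
move: wn; apply: contraNT; rewrite -ltNge => h.
by rewrite /wt max_l// subr_le0 ltW.
Qed.

Let st_continuous n : continuous (fun p : R * A => st n p.1 p.2).
Proof.
apply: contZ.
  apply: (@cont_comp _ _ _ (@snd R A) (fun a => (wsum n a)^-1)); first exact: cont_snd.
  apply: cont_inv; first by move=> a; rewrite gt_eqF.
  by apply: cont_sum => i; exact: wt_continuous.
apply: cont_sum => i; apply: contZ.
  by apply: (@cont_comp _ _ _ (@snd R A) (wt n i)); [exact: cont_snd|exact: wt_continuous].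
by apply: (@cont_comp _ _ _ (@fst R A) (ph ^~ (a_ i))); [exact: cont_fst|exact: ph_continuous].
Qed.

(** Only finitely many pairs occur for each n, so that asymptotic contractivity holds for all of
    them from a common time on. *)
Let controlled : exists T : nat -> R, forall n t, T n <= t ->
  forall i j, (i <= n)%N -> (j <= n)%N ->
    `|ph t (a_ i) - ph t (a_ j)| <= `|a_ i - a_ j| + n.+1%:R^-1.
Proof.
suff /choice[T TP] : forall n, exists T, forall t, T <= t ->
  forall i j, (i <= n)%N -> (j <= n)%N ->
    `|ph t (a_ i) - ph t (a_ j)| <= `|a_ i - a_ j| + n.+1%:R^-1.
  by exists T => n; exact: TP.
move=> n; have n0 : 0 < n.+1%:R^-1 :> R by rewrite invr_gt0.
have : \forall t \near +oo_R, forall ij : 'I_n.+1 * 'I_n.+1,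
    `|phi t (a_ ij.1) - phi t (a_ ij.2)| <= `|a_ ij.1 - a_ ij.2| + n.+1%:R^-1.
  by apply: filter_forall => -[i j]; exact: asym_near_lip.
move=> [T [_ TP]]; exists (Num.max 1 T + 1) => t Tt i j ni nj.
have t1 : Num.max 1 t = t.
  by rewrite max_r// (le_trans _ Tt)// ler_wpDr// le_max lexx.
have Tt' : T < t by rewrite (lt_le_trans _ Tt)// ltr_pwDr// le_max lexx orbT.
by have /(_ (inord i, inord j)) := TP t Tt'; rewrite /= !inordK// /ph t1.
Qed.

(** At stage n, phi_t is averaged over the points chosen near [a] by a partition of unity; the stage
    grows so slowly with t that phi_t is already almost contractive on a_0, ..., a_n. The points
    chosen at [a] lie at most about twice as far from a fixed a_i as [a] does, whence the Lipschitz
    constant 2. *)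
Lemma regularize : exists psi : R -> A -> B, nice psi /\ aeq psi phi.
Proof.
have [T0 T0P] := controlled.
(* These partial sums ensure at once T0 (n + 1) <= T n, T n + 1 <= T (n + 1) and n + 1 <= T n. *)
pose T n : R := \sum_(i < n.+1) (`|T0 i.+1| + 1).
have TS n : T n + 1 <= T n.+1.
  by rewrite /T [leRHS]big_ord_recr /= lerD2l lerDr.
have TT0 n : T0 n.+1 <= T n.
  rewrite /T big_ord_recr/= (le_trans (ler_norm _))//.
  apply: ler_wpDl; last by rewrite lerDl.
  by apply: sumr_ge0 => i _; rewrite addr_ge0.
have Tn n : n.+1%:R <= T n.
  elim: n => [|n IH]; first by rewrite /T big_ord_recr big_ord0/= add0r lerDr.
  by rewrite (le_trans _ (TS n))// -natr1 lerD2r.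
have Tmono m n : (m <= n)%N -> T m <= T n.
  elim: n => [|n IH]; first by rewrite leqn0 => /eqP->.
  rewrite leq_eqVlt => /orP[/eqP->//|]; rewrite ltnS => /IH /le_trans; apply.
  by rewrite (le_trans _ (TS n))// lerDl.
(* [th n] rises from 0 to 1 on the unit interval that starts at T n, which ends before T (n + 1); so
   only two consecutive stages are mixed at any time. *)
pose th n (t : R) : R := Num.max 0 (Num.min 1 (t - T n)).
have th_cont n : continuous (th n).
  apply: cont_max; first exact: cst_continuous.
  apply: cont_min; first exact: cst_continuous.
  by apply: contB; [exact: cont_id|exact: cst_continuous].
have th0 n t : t <= T n -> th n t = 0.
  by move=> tT; rewrite /th max_l// ge_min subr_le0 tT orbT.
have th1 n t : T n.+1 <= t -> th n t = 1.
  move=> tT; rewrite /th min_l ?max_r//.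
  by rewrite lerBrDl (le_trans (TS n)).
have th01 n t : 0 <= th n t <= 1.
  by rewrite /th le_max lexx/= ge_max ler01 ge_min lexx.
(* Between T m and T (m + 1) the sum telescopes to (1 - th m) st m + th m st (m + 1). *)
pose psiN N t a := st 0 t a + \sum_(n < N) th n t *: (st n.+1 t a - st n t a).
have psiN_eq N M t a : t <= T N -> (N <= M)%N -> psiN M t a = psiN N t a.
  move=> tN; elim: M => [|M IH]; first by rewrite leqn0 => /eqP->.
  rewrite leq_eqVlt => /orP[/eqP->//|]; rewrite ltnS => NM.
  rewrite -(IH NM) /psiN big_ord_recr/= th0 ?scale0r ?addr0//.
  by rewrite (le_trans tN)// Tmono.
have psiN_cont N : continuous (fun p : R * A => psiN N p.1 p.2).
  apply: contD => //; apply: cont_sum => n; apply: contZ; last exact: contB.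
  by apply: (@cont_comp _ _ _ (@fst R A) (th n)); [exact: cont_fst|exact: th_cont].
have Nt_ex (t : R) : exists N, t <= T N.
  exists (Num.bound `|t|); rewrite (le_trans (ler_norm _))//.
  rewrite (le_trans _ (Tn _))// ltW// (lt_trans (archi_boundP _))//.
  by rewrite ltr_nat.
have /choice[Nt NtP] := Nt_ex.
pose psi t a := psiN (Nt t) t a.
have psiE N t a : t <= T N -> psi t a = psiN N t a.
  move=> tN; rewrite /psi; have [h|/ltnW h] := leqP (Nt t) N.
    by rewrite (psiN_eq (Nt t))//.
  by rewrite (psiN_eq N (Nt t)).
have psi_cont : continuous (fun p : R * A => psi p.1 p.2).
  apply: cont_local => -[t a]; exists (fun p => psiN (Nt (t + 1)) p.1 p.2); split=> //.
  have : \forall p \near (t, a), p.1 <= t + 1.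
    have h : \forall s \near t, s <= t + 1.
      have /cvgr_dist_le/(_ 1 ltr01) : s @[s --> t] --> t by exact: cvg_id.
      by apply: filterS => s; rewrite ler_norml => /andP[]; lra.
    exact: (@cvg_fst _ _ (nbhs t) (nbhs a) _ _ h).
  by apply: filterS => -[s b] /= st1; apply: psiE; rewrite (le_trans st1).
have psi_ball n0 t a b M : T n0 <= t ->
  (forall m, (n0 <= m)%N -> T m <= t -> forall i, (i <= m.+1)%N ->
    `|a - a_ i| <= rad m a -> `|ph t (a_ i) - b| <= M) ->
  `|psi t a - b| <= M.
  move=> n0t h.
  have [m [mn0 mt tm]] : exists m, [/\ (n0 <= m)%N, T m <= t & t <= T m.+1].
    have [N tN] := Nt_ex t.
    elim: N tN => [|N IH] tN.
      by exists n0; split=> //; rewrite (le_trans tN)// Tmono.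
    have [/IH//|Nt'] := leP t (T N).
    have [n0N|Nn0] := leqP n0 N; first by exists N; split=> //; exact: ltW.
    by exists n0; split=> //; rewrite (le_trans tN)// Tmono// leqW.
  have -> : psi t a = (1 - th m t) *: st m t a + th m t *: st m.+1 t a.
    rewrite (psiE m.+1)// /psiN big_ord_recr/=.
    rewrite (eq_bigr (fun n : 'I_m => st n.+1 t a - st n t a)); last first.
      by move=> i _; rewrite th1 ?scale1r// (le_trans _ mt)// Tmono.
    have -> : \sum_(i < m) (st i.+1 t a - st i t a) = st m t a - st 0%N t a.
      rewrite -(big_mkord xpredT (fun i => st i.+1 t a - st i t a)).
      by rewrite telescope_sumr.
    by lmod_gen R B.
  have /andP[tm0 tm1] := th01 m t.
  have b1 : `|st m t a - b| <= M.
    by apply: st_ball => i im; apply: h => //; exact: leqW.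
  have b2 : `|st m.+1 t a - b| <= M.
    apply: st_ball => i im ai; apply: (h m) => //.
    rewrite (le_trans ai)// /rad lerD//=; first by rewrite ge_min lexx.
    by rewrite lef_pV2 ?posrE// ler_nat.
  have -> : (1 - th m t) *: st m t a + th m t *: st m.+1 t a - b =
    (1 - th m t) *: (st m t a - b) + th m t *: (st m.+1 t a - b).
    by lmod_gen R B.
  rewrite (le_trans (ler_normD _ _))// !normrZ (ger0_norm tm0) ger0_norm ?subr_ge0//.
  have : (1 - th m t) * `|st m t a - b| <= (1 - th m t) * M.
    by rewrite ler_wpM2l// subr_ge0.
  have : th m t * `|st m.+1 t a - b| <= th m t * M by rewrite ler_wpM2l.
  lra.
have ctl m t i j : T m <= t -> (i <= m.+1)%N -> (j <= m.+1)%N ->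
    `|ph t (a_ i) - ph t (a_ j)| <= `|a_ i - a_ j| + m.+1%:R^-1.
  move=> mt im jm; rewrite (le_trans (T0P m.+1 _ _ _ _ _ _))//.
    by rewrite (le_trans _ mt).
  by rewrite lerD2l lef_pV2 ?posrE// ler_nat.
have small (e : R) : 0 < e -> exists n : nat, n.+1%:R^-1 <= e.
  move=> e0; exists (Num.bound e^-1); rewrite -[leRHS]invrK lef_pV2 ?posrE ?invr_gt0//.
  rewrite (le_trans (ltW (archi_boundP _)))// ?invr_ge0 ?ltW//.
  by rewrite ltr_nat.
have inv_le m n : (m <= n)%N -> n.+1%:R^-1 <= m.+1%:R^-1 :> R.
  by move=> mn; rewrite lef_pV2 ?posrE// ler_nat ltnS.
have psi_phi : aeq psi phi.
  move=> a; apply/null_normP => e e0.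
  have e8 : 0 < e / 8 by rewrite divr_gt0.
  have [i0 ai0] := a_dense a e8.
  have [n1 n1e] := small _ e8.
  pose n0 := maxn i0 n1.
  have := asym_near_lip phi (a_ i0) a e8.
  apply: filterS2 (nbhs_pinfty_ge (num_real (T n0))) => t tT hi0.
  have t1 : 1 <= t by rewrite (le_trans _ tT)// (le_trans _ (Tn _))// ler1n.
  apply: (psi_ball n0) => // m n0m mt i im ai.
  have i0m : (i0 <= m)%N by rewrite (leq_trans _ n0m)// leq_maxl.
  have me : m.+1%:R^-1 <= e / 8.
    by rewrite (le_trans (inv_le _ _ n0m))// (le_trans _ n1e)// inv_le// leq_maxr.
  rewrite -(subrKA (ph t (a_ i0))) (le_trans (ler_normD _ _))//.
  have h1 := ctl m t i i0 mt im (leqW i0m).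
  have h2 : `|ph t (a_ i0) - phi t a| <= `|a_ i0 - a| + e / 8.
    by rewrite /ph max_r.
  have h3 : `|a_ i - a_ i0| <= `|a - a_ i| + `|a - a_ i0|.
    by rewrite -(subrKA a) (le_trans (ler_normD _ _))// distrC.
  have h4 : rad m a <= e / 8 + e / 8.
    rewrite /rad lerD// (le_trans (mindist_le _ i0m))//; exact: ltW.
  rewrite (distrC _ a) in h2.
  move: h1 h2 h3 h4 ai me ai0 e0; clear; rewrite /rad.
  move: `|ph t (a_ i) - ph t (a_ i0)| `|ph t (a_ i0) - phi t a| `|a - a_ i0|
    `|a_ i - a_ i0| `|a - a_ i| (mindist m a) (m.+1%:R^-1).
  by move=> *; lra.
have psi_lip : qlip psi.
  exists 2 => // a e e0.
  have e8 : 0 < e / 8 by rewrite divr_gt0.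
  have [i0 ai0] := a_dense a e8.
  have [n1 n1e] := small _ e8.
  pose n0 := maxn i0 n1.
  apply: filterS (nbhs_pinfty_ge (num_real (T n0))) => t tT b.
  have core c : `|psi t c - ph t (a_ i0)| <= 2 * `|c - a_ i0| + e / 4.
    apply: (psi_ball n0) => // m n0m mt i im ai.
    have i0m : (i0 <= m)%N by rewrite (leq_trans _ n0m)// leq_maxl.
    have me : m.+1%:R^-1 <= e / 8.
      by rewrite (le_trans (inv_le _ _ n0m))// (le_trans _ n1e)// inv_le// leq_maxr.
    have h1 := ctl m t i i0 mt im (leqW i0m).
    have h3 : `|a_ i - a_ i0| <= `|c - a_ i| + `|c - a_ i0|.
      by rewrite -(subrKA c) (le_trans (ler_normD _ _))// distrC.
    have h4 : rad m c <= `|c - a_ i0| + e / 8.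
      by rewrite /rad lerD// mindist_le.
    move: h1 h3 h4 ai me e0; clear; rewrite /rad.
    move: `|ph t (a_ i) - ph t (a_ i0)| `|c - a_ i0| `|a_ i - a_ i0| `|c - a_ i|
      (mindist m c) (m.+1%:R^-1).
    by move=> *; lra.
  rewrite -(subrKA (ph t (a_ i0))) (le_trans (ler_normD _ _))//.
  have := core a; have := core b; rewrite (distrC (psi t a)).
  have : `|b - a_ i0| <= `|b - a| + `|a - a_ i0|.
    by rewrite -(subrKA a) (le_trans (ler_normD _ _)).
  lra.
(* The correction gives exact vanishing at 0; it is null because phi_t(0) tends to 0. *)
exists (fun t a => psi t a - psi t 0); split.
  split.
  - apply: contB => //.
    apply: (@cont_comp _ _ _ (fun p : R * A => (p.1, 0 : A)) (fun p => psi p.1 p.2)) => //.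
    by apply: cont_pair; [exact: cont_fst|exact: cst_continuous].
  - by move=> t; rewrite subrr.
  - have [C C0 psiC] := psi_lip; exists C => // a e e0.
    apply: filterS (psiC a e e0) => t h b.
    by rewrite opprB addrA subrK.
move=> a.
have := cvg0D (psi_phi a) (cvg0N (cvg0D (psi_phi 0) (asym_at0 phi))).
by apply: cvg0_eq => t _; lmod_gen R B.
Qed.

End regularization.

Lemma asym_nice (R : realType) (A B : realCstarType R) (phi : asym A B) :
  separable A -> exists psi : asym A B, nice psi /\ aeq psi phi.
Proof.
move=> /separable_seq[a_ ad]; have [psi [npsi pp]] := regularize phi ad.
unshelve eexists (Asym (aeq_asymp pp _)); last by split.
by move=> a; apply: continuous_subspaceT; exact: nice_continuous_t.
Qed.

(** * Homotopies of homomorphisms and conjugation by isometries *)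

Section hom_homotopy.
Variable R : realType.
Implicit Types A B C : realCstarType R.

Section comp.
Variables (A B C : realCstarType R) (g : starhom B C) (f : starhom A B).

Lemma starhom_comp_subproof : is_starhom (fun a => g (f a)).
Proof.
by split=> *; rewrite ?starhomL ?starhomM ?starhom_star.
Qed.

Lemma starhom_comp_contractive a : `|g (f a)| <= `|a|.
Proof. by rewrite (le_trans (starhom_contractive _ _))// starhom_contractive. Qed.

Definition starhom_comp := Starhom starhom_comp_subproof starhom_comp_contractive.
End comp.

Section id.
Variable A : realCstarType R.
Lemma starhom_id_subproof : is_starhom (fun a : A => a). Proof. by split. Qed.
Lemma starhom_id_contractive (a : A) : `|a| <= `|a|. Proof. by []. Qed.
Definition starhom_id := Starhom starhom_id_subproof starhom_id_contractive.
End id.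

Section ev.
Variables (Z : set (unit_itv R)) (A : realCstarType R) (x : unit_itv R).
Lemma itv_ev_subproof : is_starhom (fun F : itv_algebra Z A => F x).
Proof. by split. Qed.
Lemma itv_ev_contractive (F : itv_algebra Z A) : `|F x| <= `|F|.
Proof. exact: itv_normE. Qed.
Definition itv_ev := Starhom itv_ev_subproof itv_ev_contractive.
End ev.

(* The equivalence relation generated by the homotopies of *-homomorphisms. *)
Inductive hh A B : starhom A B -> starhom A B -> Prop :=
| hh_path (f g : starhom A B) (H : starhom A (cylinder B)) :
    (forall a, H a (clamp 0) = f a) -> (forall a, H a (clamp 1) = g a) -> hh f g
| hh_sym (f g : starhom A B) : hh f g -> hh g f
| hh_trans (f g h : starhom A B) : hh f g -> hh g h -> hh f h.

Lemma hh_ext A B (f g : starhom A B) : f =1 g -> hh f g.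
Proof. by move=> fg; apply: (hh_path (H := starhom_comp (cyl_cst B) f)). Qed.

Lemma hh_post A B C (h : starhom B C) (f g : starhom A B) : hh f g ->
  hh (starhom_comp h f) (starhom_comp h g).
Proof.
elim=> [{}f {}g H H0 H1|{}f {}g _|{}f {}g k _ h1 _ h2].
- by apply: (hh_path (H := starhom_comp (cyl_map h) H)) => a /=; rewrite ?H0 ?H1.
- exact: hh_sym.
- exact: hh_trans h1 h2.
Qed.

Lemma hh_pre A B C (h : starhom C A) (f g : starhom A B) : hh f g ->
  hh (starhom_comp f h) (starhom_comp g h).
Proof.
elim=> [{}f {}g H H0 H1|{}f {}g _|{}f {}g k _ h1 _ h2].
- by apply: (hh_path (H := starhom_comp H h)) => a /=; rewrite ?H0 ?H1.
- exact: hh_sym.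
- exact: hh_trans h1 h2.
Qed.

Lemma hh_itv_map Z A B (f g : starhom A B) : hh f g ->
  hh (itv_map Z f) (itv_map Z g).
Proof.
elim=> [{}f {}g H H0 H1|{}f {}g _|{}f {}g k _ h1 _ h2].
- apply: (hh_path (H := starhom_comp (swap Z set0 B) (itv_map Z H))) => a;
    by apply/itv_eqP => x; rewrite /= ?H0 ?H1.
- exact: hh_sym.
- exact: hh_trans h1 h2.
Qed.

Lemma hh_asym_post A B C (f g : starhom B C) (x : asym A B) : hh f g ->
  homotopic (asym_post f x) (asym_post g x).
Proof.
elim=> [{}f {}g H H0 H1|{}f {}g _|{}f {}g k _ h1 _ h2].
- by exists (asym_post H x) => t a _ /=; rewrite H0 H1.
- exact: homotopic_sym.
- exact: homotopic_trans h1 h2.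
Qed.

(** The homotopy takes its values in a cylinder, on which [x] has to act pointwise; hence
    [nice x]. *)
Lemma hh_asym_pre A B C (f g : starhom A B) (x : asym B C) : nice x -> hh f g ->
  homotopic (asym_pre f x) (asym_pre g x).
Proof.
move=> nx; elim=> [{}f {}g H H0 H1|{}f {}g _|{}f {}g k _ h1 _ h2].
- by exists (asym_pre H (itv_asym set0 nx)) => t a _ /=; rewrite H0 H1.
- exact: homotopic_sym.
- exact: homotopic_trans h1 h2.
Qed.

Lemma homotopic_ext A B (x y : asym A B) :
  (forall t a, 1 <= t -> x t a = y t a) -> homotopic x y.
Proof.
move=> xy; exists (asym_post (cyl_cst B) x) => t a t1; split=> //=; exact: xy.
Qed.

End hom_homotopy.

(** * Isometric multipliers and conjugation *)

Section multipliers.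
Variables (R : realType) (B : realCstarType R).
Implicit Types s r v w : multiplier B.
Local Notation I := (unit_itv R).

Definition is_isometry s := forall x, mult_adj s (s x) = x.

Lemma mult_opD s x y : s (x + y) = s x + s y.
Proof. by have := mult_opL s 1 x y; rewrite !scale1r. Qed.
Lemma mult_opZ s (k : R) x : s (k *: x) = k *: s x.
Proof. by have := mult_opL s k x 0; rewrite mult_op0 !addr0. Qed.
Lemma mult_opB s x y : s (x - y) = s x - s y.
Proof. by rewrite mult_opD -scaleN1r mult_opZ scaleN1r. Qed.
Lemma mult_adjD s x y : mult_adj s (x + y) = mult_adj s x + mult_adj s y.
Proof. by have := mult_adjL s 1 x y; rewrite !scale1r. Qed.
Lemma mult_adjZ s (k : R) x : mult_adj s (k *: x) = k *: mult_adj s x.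
Proof. by have := mult_adjL s k x 0; rewrite mult_adj0 !addr0. Qed.
Lemma mult_adjB s x y : mult_adj s (x - y) = mult_adj s x - mult_adj s y.
Proof. by rewrite mult_adjD -scaleN1r mult_adjZ scaleN1r. Qed.

Lemma mult_adjP' s x y : cstar (mult_adj s x) ** y = cstar x ** s y.
Proof. by apply: (can_inj (@cstarK _ _)); rewrite !cstarM !cstarK mult_adjP. Qed.

Lemma mult_adjM s x y : mult_adj s (x ** y) = mult_adj s x ** y.
Proof.
apply: (can_inj (@cstarK _ _)); apply: cmul_injr => z.
by rewrite mult_adjP' !cstarM -!cmulA mult_adjP'.
Qed.

(** As x r^* is encoded by [cstar (r (cstar x))], this is the associativity of s x r^*. *)
Lemma mult_comm s r x : cstar (r (cstar (s x))) = s (cstar (r (cstar x))).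
Proof.
apply: cmul_inj => z; rewrite -[RHS]mult_adjP' -!cstarM; congr cstar.
by rewrite -!mult_opM mult_adjP.
Qed.

Lemma adj_norm_le s x : is_isometry s -> `|mult_adj s x| <= `|x|.
Proof.
move=> si; have [->|a0] := eqVneq (mult_adj s x) 0; first by rewrite normr0.
have ap : 0 < `|mult_adj s x| by rewrite normr_gt0.
rewrite -(ler_pM2l ap) -expr2 -cnorm_star_mul -mult_adjP.
by rewrite (le_trans (cnormM _ _))// cnorm_star (isometry_norm si).
Qed.

Definition mult_id : multiplier B :=
  @Multiplier _ B id id (fun x y => erefl).

Lemma mult_comp_subproof s r x y :
  cstar (s (r x)) ** y = cstar x ** mult_adj r (mult_adj s y).
Proof. by rewrite !mult_adjP. Qed.
Definition mult_comp s r := Multiplier (mult_comp_subproof s r).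

Lemma mult_lin_subproof (c d : R) s r x y :
  cstar (c *: s x + d *: r x) ** y =
  cstar x ** (c *: mult_adj s y + d *: mult_adj r y).
Proof. by rewrite cstarD !cstarZ cmulDl cmulDr !cmulZl !cmulZr !mult_adjP. Qed.
Definition mult_lin c d s r := Multiplier (mult_lin_subproof c d s r).

Lemma adj_orth_sym s r : (forall x, mult_adj s (r x) = 0) ->
  forall x, mult_adj r (s x) = 0.
Proof.
move=> sr x; apply: cmul_inj => z; rewrite -mult_adjP cmulr0.
by apply: (can_inj (@cstarK _ _)); rewrite cstarM cstarK mult_adjP sr cmulr0 cstar0.
Qed.

Lemma isometry_comp s r : is_isometry s -> is_isometry r -> is_isometry (mult_comp s r).
Proof. by move=> si ri x /=; rewrite si ri. Qed.

(** Orthogonality of the ranges is weighted by [c * d], hence asked only where both terms occur: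
    along [shift_path] the two isometries are orthogonal at those parameters. *)
Lemma isometry_lin (c d : R) s r : is_isometry s -> is_isometry r ->
  c ^+ 2 + d ^+ 2 = 1 -> (forall x, (c * d) *: mult_adj s (r x) = 0) ->
  is_isometry (mult_lin c d s r).
Proof.
move=> si ri cd sr x /=.
rewrite !mult_adjD !mult_adjZ si ri.
have rs : (c * d) *: mult_adj r (s x) = 0.
  apply: cmul_inj => z; rewrite cmulZr -mult_adjP cmulr0.
  apply: (can_inj (@cstarK _ _)); rewrite cstarZ cstarM cstarK mult_adjP.
  by rewrite -cmulZr sr cmulr0 cstar0.
have := sr x; move: (mult_adj s _) (mult_adj r _) rs => u v rs sr'.
have -> : c *: (c *: x + d *: u) + d *: (c *: v + d *: x) =
  (c ^+ 2 + d ^+ 2) *: x + (c * d) *: u + (c * d) *: v by lmod_gen R B.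
by rewrite cd sr' rs scale1r !addr0.
Qed.

Section path.
Variable X : I -> multiplier B.
Hypothesis Xi : forall x, is_isometry (X x).
Hypothesis Xc : forall b, continuous (fun x => X x b).

Let Xcc (b : I -> B) : continuous b -> continuous (fun x => X x (b x)).
Proof.
move=> cb x; apply/(@cvgrPdist_le _ _ _ (nbhs x)) => e e0.
have e2 : 0 < e / 2 by rewrite divr_gt0.
have /(@cvgrPdist_le _ _ _ (nbhs x))/(_ _ e2) hX := @Xc (b x) x.
have /(@cvgrPdist_le _ _ _ (nbhs x))/(_ _ e2) hb := cb x.
apply: filterS2 hX hb => y h1 h2.
rewrite -(subrKA (X y (b x))) (splitr e) (le_trans (ler_normD _ _))// lerD//.
by rewrite -mult_opB (isometry_norm (Xi y)).
Qed.

Definition conj_path_fun (b : B) : cylinder B.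
Proof.
refine (@mk_itv _ set0 _ (fun x => mult_conj (X x) b) _ _); last by [].
by apply: Xcc; apply: cont_star; exact: Xc.
Defined.

Lemma conj_path_starhom : is_starhom conj_path_fun.
Proof.
split=> [k x y|x y|x]; apply/itv_eqP => z; have [l m s] := mult_conj_starhom (Xi z).
- exact: l.
- exact: m.
- exact: s.
Qed.

Lemma conj_path_contractive b : `|conj_path_fun b| <= `|b|.
Proof. by apply/itv_normP => x; exact: (mult_conj_contractive (Xi x)). Qed.

Definition conj_path := Starhom conj_path_starhom conj_path_contractive.

Lemma hh_conj_path v w (vi : is_isometry v) (wi : is_isometry w) :
  X (clamp 0) =1 v -> X (clamp 1) =1 w -> hh (conj_hom vi) (conj_hom wi).
Proof.
move=> Xv Xw; apply: (hh_path (H := conj_path)) => a.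
  by rewrite /= /mult_conj !Xv.
by rewrite /= /mult_conj !Xw.
Qed.

End path.

Lemma sqrt_val_continuous (f : I -> R) : continuous f ->
  continuous (fun x => Num.sqrt (f x)).
Proof.
by move=> cf; apply: (@cont_comp _ _ _ f (@Num.sqrt R)) => //; exact: sqrt_continuous.
Qed.

(** The path sqrt(1 - x) v + sqrt(x) w consists of isometries. *)
Lemma hh_orthogonal v w (vi : is_isometry v) (wi : is_isometry w) :
  (forall x, mult_adj v (w x) = 0) -> hh (conj_hom vi) (conj_hom wi).
Proof.
move=> vw.
pose X (x : I) := mult_lin (Num.sqrt (1 - set_val x)) (Num.sqrt (set_val x)) v w.
have cv : continuous (fun x : I => set_val x : R) by exact: initial_continuous.
apply: (@hh_conj_path X) => [x|b|b|b].
- apply: isometry_lin => // [|y]; last by rewrite vw scaler0.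
  by rewrite !sqr_sqrtr ?val_itv_ge0 ?subr_ge0 ?val_itv_le1// subrK.
- rewrite /=; apply: contD; apply: contZ; try exact: cst_continuous.
    by apply: sqrt_val_continuous; apply: contB => //; exact: cst_continuous.
  exact: sqrt_val_continuous.
- by rewrite /X/= -/(set_val (clamp 0)) set_val_clamp0 subr0 sqrtr1 sqrtr0 scale1r scale0r addr0.
- by rewrite /X/= -/(set_val (clamp 1)) set_val_clamp1 subrr sqrtr1 sqrtr0 scale1r scale0r add0r.
Qed.

End multipliers.

(** * Conjugation by an isometry is homotopic to the identity *)

Section shift.
Variables (R : realType) (B : realCstarType R) (s : cuntz_pair B).
Local Notation I := (unit_itv R).
Local Notation s1 := (cuntz1 s).
Local Notation s2 := (cuntz2 s).

Lemma cuntz_adj12 x : mult_adj s1 (s2 x) = 0.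
Proof.
have := cuntz_sum s (s2 x); rewrite cuntz2_isometry -[RHS]add0r.
move=> /addIr/(congr1 (mult_adj s1)); rewrite cuntz1_isometry => ->.
by rewrite mult_adj0.
Qed.

Lemma cuntz_adj21 x : mult_adj s2 (s1 x) = 0.
Proof. exact: (adj_orth_sym cuntz_adj12). Qed.

(* [s2 ^* n] tends to 0, so that the ranges of the [s2 ^ n s1] add up to 1. *)
Definition pure := forall b e, 0 < e -> exists n, `|iter n (mult_adj s2) b| <= e.

Lemma mult_block_subproof (v : multiplier B) x y :
  cstar (s1 (mult_adj s1 x) + s2 (v (mult_adj s2 x))) ** y =
  cstar x ** (s1 (mult_adj s1 y) + s2 (mult_adj v (mult_adj s2 y))).
Proof.
by rewrite cstarD cmulDl cmulDr !mult_adjP mult_adjP' mult_adjP'.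
Qed.

(* s1 s1^* + s2 v s2^* *)
Definition mult_block v := Multiplier (mult_block_subproof v).

Lemma mult_block_isometry v : is_isometry v -> is_isometry (mult_block v).
Proof.
move=> vi x /=.
rewrite !(mult_adjD, cuntz1_isometry, cuntz_adj12, cuntz_adj21, cuntz2_isometry).
by rewrite !(mult_adj0, addr0, add0r) vi cuntz_sum.
Qed.

Definition shift_w := mult_comp s2 s1.

Lemma shift_w_isometry : is_isometry shift_w.
Proof. by apply: isometry_comp; [exact: cuntz2_isometry|exact: cuntz1_isometry]. Qed.

(** [tau n] rises from 0 to 1 while x goes from n / (n + 1) to (n + 1) / (n + 2). These intervals
    are consecutive, so that stage n + 1 starts when stage n is complete. *)
Let tau (n : nat) (x : I) : R :=
  Num.max 0 (Num.min 1 (n.+1%:R * n.+2%:R * set_val x - n%:R * n.+2%:R)).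

Let tau01 n x : 0 <= tau n x <= 1.
Proof. by rewrite /tau le_max lexx/= ge_max ler01 ge_min lexx. Qed.

Let tau_continuous n : continuous (tau n).
Proof.
have cv : continuous (fun x : I => set_val x : R) by exact: initial_continuous.
apply: cont_max; first exact: cst_continuous.
apply: cont_min; first exact: cst_continuous.
apply: contB; last exact: cst_continuous.
by apply: cont_mulr => //; exact: cst_continuous.
Qed.

Let tau_at0 : tau 0 (clamp 0) = 0.
Proof.
by rewrite /tau set_val_clamp0 mulr0 mul0r subr0 min_r// maxxx.
Qed.

Let tau_at1 n : tau n (clamp 1) = 1.
Proof.
rewrite /tau set_val_clamp1 mulr1 min_l ?max_r// -mulrBl -natrB// subSnn mul1r.
by rewrite ler1n.
Qed.

Let tau_disjoint n x : (1 - tau n x) * tau n.+1 x = 0.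
Proof.
have n0 : 0 <= n%:R :> R by rewrite ler0n.
rewrite /tau; set v := set_val x.
have [h|h] := leP (n.+2%:R * n.+3%:R * v - n.+1%:R * n.+3%:R) 0.
  by rewrite [X in _ * X]max_l ?mulr0// ge_min h orbT.
have h1 : n.+1%:R <= n.+2%:R * v.
  have : 0 < n.+3%:R * (n.+2%:R * v - n.+1%:R) by move: h; congr (_ < _); ring.
  by rewrite pmulr_rgt0 ?ltr0n// subr_gt0 => /ltW.
rewrite [X in (_ - X) * _](_ : _ = 1) ?subrr ?mul0r// min_l ?max_r//.
have : n.+1%:R * n.+1%:R <= n.+1%:R * (n.+2%:R * v) by rewrite ler_wpM2l.
by rewrite -!natr1 in n0 *; rewrite mulrA; nra.
Qed.

Let cc n x : R := Num.sqrt (1 - tau n x).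
Let ss n x : R := Num.sqrt (tau n x).

Let cc_ss n x : cc n x ^+ 2 + ss n x ^+ 2 = 1.
Proof.
have /andP[t0 t1] := tau01 n x.
by rewrite !sqr_sqrtr ?subr_ge0// subrK.
Qed.

Let cc_ss0 n x : cc n x * ss n.+1 x = 0.
Proof.
have /andP[t0 t1] := tau01 n x.
by rewrite /cc /ss -sqrtrM ?subr_ge0// tau_disjoint sqrtr0.
Qed.

(** Once the stages 0, ..., n of the path that starts at index 0 are complete, the isometry is 1 on
    the ranges of s2^i s1 for i <= n and a copy of [shift_w] on the range of s2^(n+1). Each stage
    rotates the current copy of [shift_w] into the next isometry. By purity the limit at x = 1 is
    the identity, strongly; [k] bounds the number of stages. *)
Fixpoint shift_path (k n : nat) (x : I) : multiplier B :=
  if k is k'.+1 then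
    mult_lin (cc n x) (ss n x) shift_w (mult_block (shift_path k' n.+1 x))
  else shift_w.

Let shift_path_adj1 k n x z : exists t : R,
  (if n is m.+1 then cc m x * t = 0 else True) /\
  mult_adj s1 (shift_path k n x z) = t *: mult_adj s1 z.
Proof.
case: k => [|k].
  exists 0; split; first by case: n => // n; rewrite mulr0.
  by rewrite /= cuntz_adj12 scale0r.
exists (ss n x); split; first by case: n => // n; exact: cc_ss0.
rewrite /= mult_adjD !mult_adjZ cuntz_adj12 mult_adjD cuntz1_isometry cuntz_adj12.
by rewrite scaler0 addr0 add0r.
Qed.

Lemma shift_path_isometry k n x : is_isometry (shift_path k n x).
Proof.
elim: k n => [|k IH] n; first exact: shift_w_isometry.
apply: isometry_lin => //; first exact: shift_w_isometry.
  exact: mult_block_isometry.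
move=> y /=; rewrite mult_adjD cuntz_adj21 cuntz2_isometry add0r.
have [t [ct ->]] := shift_path_adj1 k n.+1 x (mult_adj s2 y).
by rewrite scalerA mulrAC ct mul0r scale0r.
Qed.

Lemma mult_continuous (v : multiplier B) : is_isometry v -> continuous v.
Proof.
move=> vi; apply: (@lipB_continuous _ _ _ _ 1) => x y.
by rewrite -mult_opB (isometry_norm vi) mul1r.
Qed.

Lemma shift_path_continuous k n b : continuous (fun x => shift_path k n x b).
Proof.
elim: k n b => [|k IH] n b; first exact: cst_continuous.
apply: contD; apply: contZ.
- apply: sqrt_val_continuous; apply: contB; first exact: cst_continuous.
  exact: tau_continuous.
- exact: cst_continuous.
- apply: sqrt_val_continuous; exact: tau_continuous.
- apply: contD; first exact: cst_continuous.
  apply: (@cont_comp _ _ _ (fun x => shift_path k n.+1 x (mult_adj s2 b)) s2) => //.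
  by apply: mult_continuous; exact: cuntz2_isometry.
Qed.

Let ss_le1 n x : `|ss n x| <= 1.
Proof.
have /andP[t0 t1] := tau01 n x.
by rewrite ger0_norm ?sqrtr_ge0// -sqrtr1 ler_wsqrtr.
Qed.

(** Both paths go through the same first [k] stages, and what follows only concerns the range of
    s2^k, where both act isometrically. *)
Lemma shift_pathD k j n x b :
  `|shift_path k n x b - shift_path (k + j) n x b| <= 2 * `|iter k (mult_adj s2) b|.
Proof.
elim: k n b => [|k IH] n b.
  rewrite (le_trans (ler_normB _ _))// (isometry_norm (@shift_path_isometry _ _ _)).
  by rewrite (isometry_norm (@shift_path_isometry _ _ _)) mulr_natl mulr2n.
rewrite addSn /= opprD addrACA subrr add0r -scalerBr opprD addrACA subrr add0r.
rewrite -mult_opB normrZ (isometry_norm (@cuntz2_isometry _ _ s)).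
rewrite (le_trans (ler_piMl _ (ss_le1 n x)))// -iterS iterSr.
exact: IH.
Qed.

Lemma shift_path_at1 k n b :
  `|shift_path k n (clamp 1) b - b| <= 2 * `|iter k (mult_adj s2) b|.
Proof.
elim: k n b => [|k IH] n b.
  rewrite (le_trans (ler_normB _ _))// (isometry_norm (@shift_path_isometry _ _ _)).
  by rewrite mulr_natl mulr2n.
rewrite /= /cc /ss tau_at1 subrr sqrtr0 sqrtr1 scale0r add0r scale1r.
rewrite -[X in _ - X](cuntz_sum s b) opprD addrACA subrr add0r.
rewrite -mult_opB (isometry_norm (@cuntz2_isometry _ _ s)) -iterS iterSr.
exact: IH.
Qed.

Let shift_path_stop m j n x : tau (n + m) x = 0 ->
  shift_path (m + j) n x =1 shift_path m n x.
Proof.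
elim: m n => [|m IH] n t0 b.
  case: j => // j; rewrite /= /cc /ss; rewrite addn0 in t0.
  by rewrite t0 subr0 sqrtr0 sqrtr1 scale1r scale0r addr0.
by rewrite addSn /= IH// addSnnS.
Qed.

Let stop_ex x : x != clamp 1 -> exists N, forall k, (N <= k)%N -> tau k x = 0.
Proof.
move=> x1; set v := set_val x.
have v1 : v < 1.
  rewrite lt_neqAle val_itv_le1 andbT; apply: contra x1 => /eqP v1.
  by rewrite -(clampK x) -/v v1.
have d0 : 0 < 1 - v by rewrite subr_gt0.
exists (Num.bound (1 - v)^-1) => k Nk.
have k0 : 0 <= k%:R :> R by rewrite ler0n.
have kv : 1 <= k.+1%:R * (1 - v).
  rewrite -ler_pdivrMr// mul1r; apply: (le_trans (ltW (archi_boundP _))).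
    by rewrite invr_ge0 ltW.
  by rewrite ler_nat leqW.
rewrite /tau -/v max_l// ge_min; apply/orP; right.
rewrite subr_le0 mulrAC ler_wpM2r// -natr1.
by move: kv; rewrite -natr1; lra.
Qed.

Let NN x : nat := if pselect (x = clamp 1) is right h then
  projT1 (cid (stop_ex (introN eqP h))) else 0%N.

(** Only finitely many stages have begun at x < 1, so that the limit over [k] is attained there; the
    value at 1 is the strong limit. *)
Let strong_path x : multiplier B :=
  if x == clamp 1 then mult_id B else shift_path (NN x) 0 x.

Let strong_pathE k x b : `|strong_path x b - shift_path k 0 x b| <= 2 * `|iter k (mult_adj s2) b|.
Proof.
rewrite /strong_path; case: eqVneq => [->|x1].
  by rewrite distrC; exact: shift_path_at1.
have NNP j : (NN x <= j)%N -> tau j x = 0.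
  rewrite /NN; case: pselect => [h|h]; first by rewrite h eqxx in x1.
  by case: cid => /= N; apply.
have [kN|Nk] := leqP k (NN x).
  by rewrite -(subnKC kN) distrC; exact: shift_pathD.
rewrite -(subnKC (ltnW Nk)) shift_path_stop ?add0n ?NNP//.
by rewrite subrr normr0 mulr_ge0.
Qed.

Hypothesis s_pure : pure.

(** For fixed [b], purity makes the paths with finitely many stages converge to [strong_path]
    uniformly in x, whence strong continuity up to x = 1. *)
Lemma hh_id_shift : hh (conj_hom shift_w_isometry) (starhom_id B).
Proof.
have idi : is_isometry (mult_id B) by [].
have h : hh (conj_hom shift_w_isometry) (conj_hom idi).
  apply: (@hh_conj_path _ _ strong_path) => [x|b|b|b].
  - rewrite /strong_path; case: eqP => // _; exact: shift_path_isometry.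
  - move=> x; apply/(@cvgrPdist_le _ _ _ (nbhs x)) => e e0.
    have e8 : 0 < e / 8 by rewrite divr_gt0.
    have [k ke] := s_pure b e8.
    have e2 : 0 < e / 2 by rewrite divr_gt0.
    have /(@cvgrPdist_le _ _ _ (nbhs x))/(_ _ e2) := @shift_path_continuous k 0 b x.
    apply: filterS => y hy.
    have h1 := strong_pathE k x b; have h2 := strong_pathE k y b.
    rewrite -(subrKA (shift_path k 0 x b)) (le_trans (ler_normD _ _))//.
    rewrite -(subrKA (shift_path k 0 y b) (shift_path k 0 x b)).
    have := ler_normD (shift_path k 0 x b - shift_path k 0 y b) (shift_path k 0 y b - strong_path y b).
    rewrite (distrC _ (strong_path y b)) in h2 *.
    move: h1 h2 ke hy; clear; move: `|_ : B| `|_ : B| `|_ : B| `|_ : B| => *; lra.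
  - rewrite /strong_path ifF; last first.
      apply/negbTE/eqP => /(congr1 set_val); rewrite set_val_clamp0 set_val_clamp1.
      by move=> /eqP; rewrite eq_sym oner_eq0.
    case: (NN _) => // n; rewrite /= /cc /ss tau_at0 subr0 sqrtr0 sqrtr1.
    by rewrite scale1r scale0r addr0.
  - by rewrite /strong_path eqxx.
apply: hh_trans h _; apply: hh_ext => b; by rewrite /= /mult_conj/= cstarK.
Qed.

(** Write w for [shift_w]. As w is homotopic to 1, v is homotopic to w v; its range is orthogonal to
    that of s1, so w v is homotopic to s1; and s1 is homotopic to w, since these are orthogonal
    too. *)
Lemma hh_conj_id (v : multiplier B) (vi : is_isometry v) : hh (conj_hom vi) (starhom_id B).
Proof.
have h1 := hh_id_shift.
have c1 : hh (conj_hom vi) (starhom_comp (conj_hom shift_w_isometry) (conj_hom vi)).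
  apply: hh_sym; apply: hh_trans (hh_pre (conj_hom vi) h1) _.
  by apply: hh_ext.
have wvi : is_isometry (mult_comp shift_w v).
  by apply: isometry_comp => //; exact: shift_w_isometry.
apply: hh_trans c1 _.
apply: (@hh_trans _ _ _ _ (conj_hom wvi)).
  apply: hh_ext => b; rewrite /= /mult_conj /=.
  by have /= -> := mult_comm v shift_w (cstar (v (cstar b))); rewrite cstarK.
apply: (@hh_trans _ _ _ _ (conj_hom (@cuntz1_isometry _ _ s))).
  by apply: hh_orthogonal => x; rewrite /= cuntz_adj21 !mult_adj0.
apply: hh_trans h1.
by apply: hh_orthogonal => x; rewrite /= cuntz_adj12.
Qed.

End shift.

(** * Matrix units of the compact operators *)

Section hilbert.
Variables (R : realType) (H : realHilbert R).
Implicit Types x y z : H.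

Lemma innerD x y z : inner (x + y) z = inner x z + inner y z.
Proof. by have := innerL 1 x y z; rewrite scale1r mul1r. Qed.

Lemma innerN x z : inner (- x) z = - inner x z.
Proof. by rewrite -scaleN1r innerZ mulN1r. Qed.

Lemma innerB x y z : inner (x - y) z = inner x z - inner y z.
Proof. by rewrite innerD innerN. Qed.

Lemma inner_sum (I : Type) (s : seq I) (F : I -> H) z :
  inner (\sum_(i <- s) F i) z = \sum_(i <- s) inner (F i) z.
Proof.
elim: s => [|i s IH]; first by rewrite !big_nil inner0.
by rewrite !big_cons innerD IH.
Qed.

Lemma pythagoras x y : inner x y = 0 -> `|x + y| ^+ 2 = `|x| ^+ 2 + `|y| ^+ 2.
Proof.
move=> xy; rewrite -!inner_norm innerD (innerC x) (innerC y) !innerD.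
by rewrite (innerC y x) xy addr0 add0r.
Qed.

Definition orthonormal (xi : nat -> H) := forall i j, inner (xi i) (xi j) = (i == j)%:R.

Definition hproj (xi : nat -> H) n x := \sum_(i < n) inner x (xi i) *: xi i.

Section projection.
Variable xi : nat -> H.
Hypothesis oxi : orthonormal xi.

Lemma inner_hproj n x i : (i < n)%N -> inner (hproj xi n x) (xi i) = inner x (xi i).
Proof.
move=> ni; rewrite /hproj inner_sum (bigD1 (Ordinal ni))//= innerZ oxi eqxx mulr1.
rewrite big1 ?addr0// => j ji; rewrite innerZ oxi.
by rewrite (_ : _ == _ = false) ?mulr0//; apply/negbTE.
Qed.

Lemma hproj_best n x (c : 'I_n -> R) :
  `|x - hproj xi n x| <= `|x - \sum_(i < n) c i *: xi i|.
Proof.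
rewrite -(@ler_sqr _ `|x - hproj xi n x|) ?nnegrE//.
rewrite -[X in _ <= `|X| ^+ 2](subrKA (hproj xi n x)) [X in _ <= X]pythagoras.
  by rewrite lerDl sqr_ge0.
have -> : hproj xi n x - \sum_(i < n) c i *: xi i =
    \sum_(i < n) (inner x (xi i) - c i) *: xi i.
  by rewrite /hproj -sumrB; apply: eq_bigr => i _; rewrite scalerBl.
rewrite innerC inner_sum big1// => i _.
by rewrite innerZ (innerC (xi i)) innerB inner_hproj// subrr mulr0.
Qed.

Lemma hproj_le n x : `|x - hproj xi n x| <= `|x|.
Proof.
have := hproj_best x (fun _ : 'I_n => 0).
by rewrite big1 ?subr0// => i _; rewrite scale0r.
Qed.

Lemma hprojB n x y : hproj xi n (x - y) = hproj xi n x - hproj xi n y.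
Proof. by rewrite /hproj -sumrB; apply: eq_bigr => i _; rewrite innerB scalerBl. Qed.

Lemma inner_le i x : `|inner x (xi i)| <= `|x|.
Proof.
rewrite -(@ler_sqr _ `|inner _ _|) ?nnegrE//.
set c := inner x (xi i).
have n1 : `|xi i| ^+ 2 = 1 by rewrite -inner_norm oxi eqxx.
rewrite -(subrK (c *: xi i) x) pythagoras; last first.
  by rewrite innerC innerZ innerC innerB innerZ oxi eqxx mulr1 subrr mulr0.
by rewrite normrZ exprMn n1 mulr1 lerDr sqr_ge0.
Qed.

End projection.

Definition hspan (l : seq H) x := \sum_(y <- l) inner x y *: y.

(* Gram-Schmidt; since [H] is infinite-dimensional, a new direction is
   available even if [d] is already in the span. *)
Lemma gram_schmidt_step (l : seq H) (d : H) : infinite_dimensional H ->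
  (forall i j, (i < size l)%N -> (j < size l)%N ->
     inner l`_i l`_j = (i == j)%:R) ->
  exists w, [/\ inner w w = 1, forall i, (i < size l)%N -> inner w l`_i = 0 &
    d = hspan (rcons l w) d].
Proof.
move=> infH ol.
have unit_of r : r != 0 -> (forall i, (i < size l)%N -> inner r l`_i = 0) ->
    exists w, [/\ inner w w = 1, forall i, (i < size l)%N -> inner w l`_i = 0 &
      r = `|r| *: w].
  move=> r0 rl; exists (`|r|^-1 *: r); split.
  - rewrite inner_norm normrZ ger0_norm ?invr_ge0// mulVf ?expr1n// normr_eq0//.
  - by move=> i /rl ri; rewrite innerZ ri mulr0.
  - by rewrite scalerA mulfV ?scale1r// normr_eq0.
pose r := d - hspan l d.
have rl i : (i < size l)%N -> inner r l`_i = 0.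
  move=> il; rewrite /r innerB /hspan inner_sum (big_nth 0) big_mkord.
  rewrite (bigD1 (Ordinal il))//= innerZ ol// eqxx mulr1 big1 ?addr0 ?subrr// => j ji.
  by rewrite innerZ ol// (_ : _ == _ = false) ?mulr0//; apply/negbTE.
have [r0|r0] := eqVneq r 0.
  (* By counting dimensions, [(size l).+1] independent vectors have a nontrivial combination that is
     orthogonal to [l]. *)
  have [v vi] := infH (size l).+1.
  pose M := (\matrix_(i < (size l).+1, j < size l) inner (v i) l`_j).
  have : kermx M != 0.
    rewrite kermx_eq0 /row_free; apply/negP => /eqP rM.
    by have := rank_leq_col M; rewrite rM ltnn.
  move=> /rowV0Pn[u /sub_kermxP uM u0].
  pose z := \sum_(i < (size l).+1) u 0 i *: v i.
  have z0 : z != 0.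
    apply: contra u0 => /eqP z0; apply/eqP/matrixP => a b.
    by rewrite (ord1 a) mxE; exact: (vi (u 0) z0).
  have zl i : (i < size l)%N -> inner z l`_i = 0.
    move=> il; have /matrixP/(_ 0 (Ordinal il)) := uM; rewrite !mxE => <-.
    by rewrite /z inner_sum; apply: eq_bigr => k _; rewrite innerZ mxE.
  have [w [w1 wl zw]] := unit_of z z0 zl; exists w; split=> //.
  have dE : d = hspan l d by apply/eqP; rewrite -subr_eq0 -/r r0.
  rewrite /hspan -cats1 big_cat big_seq1/= -/(hspan l d) -dE.
  suff -> : inner d w = 0 by rewrite scale0r addr0.
  rewrite dE /hspan inner_sum (big_nth 0) big_mkord big1// => i _.
  by rewrite innerZ (innerC _ w) wl// mulr0.
have [w [w1 wl rw]] := unit_of r r0 rl; exists w; split=> //.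
rewrite /hspan -cats1 big_cat big_seq1/= -/(hspan l d).
have dE : d = hspan l d + r by rewrite /r subrKC.
rewrite [LHS]dE; congr (_ + _); rewrite {1}rw; congr (_ *: _).
have <- : inner r w = `|r| by rewrite {1}rw innerZ w1 mulr1.
have -> : inner d w = inner (hspan l d) w + inner r w by rewrite -innerD -dE.
rewrite /hspan inner_sum (big_nth 0) big_mkord big1 ?add0r// => i _.
by rewrite innerZ (innerC _ w) wl// mulr0.
Qed.

(** The basis starts at [v] so that the given rank one projection becomes the matrix unit
    [E 0 0]. *)
Lemma orthonormal_basis (v : H) : separable H -> infinite_dimensional H ->
  `|v| = 1 -> exists xi, [/\ orthonormal xi, xi 0%N = v &
    forall x e, 0 < e -> exists N, forall n, (N <= n)%N -> `|x - hproj xi n x| <= e].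
Proof.
move=> sepH infH v1; have [d dd] := separable_seq sepH.
pose ok (l : seq H) := forall i j, (i < size l)%N -> (j < size l)%N ->
     inner l`_i l`_j = (i == j)%:R.
have /choice[nxt nxtP] : forall ld : seq H * H, exists w, ok ld.1 ->
  [/\ inner w w = 1, forall i, (i < size ld.1)%N -> inner w ld.1`_i = 0 &
    ld.2 = hspan (rcons ld.1 w) ld.2].
  move=> [l x]; have [okl|nok] := pselect (ok l); last by exists 0.
  by have [w] := gram_schmidt_step x infH okl; exists w.
pose L := fix L n := if n is m.+1 then rcons (L m) (nxt (L m, d m)) else [:: v].
have sL n : size (L n) = n.+1 by elim: n => //= n IH; rewrite size_rcons IH.
have okL n : ok (L n).
  elim: n => [|n IH].
    by move=> [|i] [|j]//= _ _; rewrite inner_norm v1 expr1n.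
  have [w1 wl _] := nxtP (L n, d n) IH; rewrite /= in w1 wl.
  move=> i j; rewrite /= !size_rcons !nth_rcons !ltnS => il jl.
  have [il'|il'] := ltnP i (size (L n)); have [jl'|jl'] := ltnP j (size (L n)).
  - exact: IH.
  - have -> : j = size (L n) by apply/eqP; rewrite eqn_leq jl jl'.
    by rewrite eqxx innerC wl// ltn_eqF.
  - have -> : i = size (L n) by apply/eqP; rewrite eqn_leq il il'.
    by rewrite eqxx wl// gtn_eqF.
  - have -> : i = size (L n) by apply/eqP; rewrite eqn_leq il il'.
    have -> : j = size (L n) by apply/eqP; rewrite eqn_leq jl jl'.
    by rewrite !eqxx w1.
pose xi n := (L n)`_n.
have Lxi n i : (i <= n)%N -> (L n)`_i = xi i.
  elim: n => [|n IH]; first by rewrite leqn0 => /eqP->.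
  rewrite leq_eqVlt => /orP[/eqP->//|]; rewrite ltnS => ni.
  by rewrite /= nth_rcons sL ltnS ni IH.
have oxi : orthonormal xi.
  move=> i j; rewrite -(Lxi (maxn i j)) ?leq_maxl// -(Lxi (maxn i j) j) ?leq_maxr//.
  by rewrite okL// sL ltnS ?leq_maxl ?leq_maxr.
exists xi; split=> // x e e0.
(* [d m] lies in the span of [L m.+1], which has m + 2 vectors; projections on longer initial
   segments approximate at least as well. *)
have [m xd] := dd x e e0; exists m.+2 => n mn.
have dE : d m = \sum_(i < n) (if (i < m.+2)%N then inner (d m) (xi i) else 0) *: xi i.
  have [_ _] := nxtP (L m, d m) (okL m); rewrite /= => dE.
  rewrite [LHS]dE /hspan -/(L m.+1) (big_nth 0) big_mkord sL.
  rewrite (eq_bigr (fun i : 'I_m.+2 => inner (d m) (xi i) *: xi i)); last first.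
    by move=> i _; rewrite Lxi// -ltnS.
  rewrite (big_ord_widen n (fun i => inner (d m) (xi i) *: xi i))//.
  rewrite big_mkcond; apply: eq_bigr => i _; case: ifP => //.
  by rewrite scale0r.
rewrite (le_trans _ (ltW xd))// dE.
exact: (hproj_best oxi x (fun i => if (i < m.+2)%N then inner (d m) (xi i) else 0)).
Qed.

End hilbert.

Section matrix_units.
Variables (R : realType) (K : compact_operators R) (e : rank_one_projection K).
Local Notation H := (co_space K).

Let opD k l (x : H) : co_op (k + l) x = co_op k x + co_op l x.
Proof. by have := co_opL 1 k l x; rewrite !scale1r. Qed.

Let op0 (x : H) : co_op (0 : K) x = 0.
Proof.
by have := co_opL (-1) (0 : K) 0 x; rewrite scaler0 addr0 scaleN1r addNr.
Qed.

Let opZ (c : R) k (x : H) : co_op (c *: k) x = c *: co_op k x.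
Proof. by have := co_opL c k 0 x; rewrite op0 !addr0. Qed.

Let opB k l (x : H) : co_op (k - l) x = co_op k x - co_op l x.
Proof. by rewrite opD -scaleN1r opZ scaleN1r. Qed.

Let op_sum (I : Type) (s : seq I) (F : I -> K) (x : H) :
  co_op (\sum_(i <- s) F i) x = \sum_(i <- s) co_op (F i) x.
Proof.
elim: s => [|i s IH]; first by rewrite !big_nil op0.
by rewrite !big_cons opD IH.
Qed.

Let op_lin (k : K) (c : R) x y : co_op k (c *: x + y) = c *: co_op k x + co_op k y.
Proof. by have [+ _] := (co_op_compact (co_op k)).2 (ex_intro _ k erefl); apply. Qed.

Let op_at0 (k : K) : co_op k 0 = 0.
Proof.
by have := op_lin k (-1) 0 0; rewrite scaler0 addr0 scaleN1r addNr.
Qed.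

Let op_linZ (k : K) (c : R) x : co_op k (c *: x) = c *: co_op k x.
Proof.
by have := op_lin k c x 0; rewrite op_at0 !addr0.
Qed.

Let op_linsum (k : K) (I : Type) (s : seq I) (c : I -> R) (F : I -> H) :
  co_op k (\sum_(i <- s) c i *: F i) = \sum_(i <- s) co_op k (c i *: F i).
Proof.
elim: s => [|i s IH]; first by rewrite !big_nil op_at0.
by rewrite !big_cons op_lin IH op_linZ.
Qed.

Let rank_one_compact (x y : H) : (forall z, `|inner z y| <= `|z|) ->
  is_compact_operator (fun z : H => inner z y *: x).
Proof.
move=> yz; split=> [k z z'|].
  by rewrite innerL scalerDl scalerA.
pose C := (fun c : R => c *: x) @` `[-1, 1]%classic.
have cC : compact C.
  apply: continuous_compact; last exact: segment_compact.
  apply: continuous_subspaceT => c.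
  by apply: (@contZ R R^o H id (cst x)); [exact: cont_id|exact: cst_continuous].
apply: (subclosed_compact _ cC); first exact: closed_closure.
have /closure_id CE : closed C by apply: compact_closed => //; exact: norm_hausdorff.
rewrite [X in _ `<=` X]CE.
apply: closure_subset => _ [z z1 <-]; exists (inner z y) => //=.
by rewrite in_itv/= -ler_norml (le_trans (yz z)).
Qed.

Lemma matrix_units : exists E : nat -> nat -> K, [/\ E 0%N 0%N = e,
  forall i j k l, E i j ** E k l = if j == k then E i l else 0,
  forall i j, cstar (E i j) = E j i &
  forall (k : K) eps, 0 < eps -> exists N (c : nat -> nat -> R),
    `|k - \sum_(i < N) \sum_(j < N) c i j *: E i j| <= eps].
Proof.
have [v [v1 ev]] := rop_P e.
have [xi [oxi xi0 xiP]] := orthonormal_basis (co_separable K) (co_infinite K) v1.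
have /choice[E' EP'] : forall ij : nat * nat, exists k : K,
    co_op k = fun z => inner z (xi ij.2) *: xi ij.1.
  move=> [i j] /=; apply/co_op_compact; apply: rank_one_compact.
  exact: inner_le.
pose E i j := E' (i, j).
have EE i j z : co_op (E i j) z = inner z (xi j) *: xi i by rewrite EP'.
have EM i j k l : E i j ** E k l = if j == k then E i l else 0.
  apply: co_op_inj; apply/funext => z; rewrite co_opM !EE innerZ oxi eq_sym.
  case: eqP => [_|_]; first by rewrite mulr1 EE.
  by rewrite mulr0 scale0r op0.
have Es i j : cstar (E i j) = E j i.
  apply: co_op_inj; apply/funext => z; apply: inner_inj => y.
  by rewrite co_op_star !EE (innerC z (_ *: _)) !innerZ mulrC (innerC (xi i)) (innerC y).
exists E; split=> //.
  by apply: co_op_inj; apply/funext => z; rewrite EE ev xi0.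
pose P n := \sum_(i < n) E i i.
have Pop n z : co_op (P n) z = hproj xi n z.
  by rewrite op_sum; apply: eq_bigr => i _; rewrite EE.
have PP n : P n ** P n = P n.
  rewrite /P; apply: co_op_inj; apply/funext => z; rewrite co_opM !Pop.
  transitivity (\sum_(i < n) inner (hproj xi n z) (xi i) *: xi i) => //.
  by apply: eq_bigr => i _; rewrite inner_hproj.
have Ps n : cstar (P n) = P n.
  rewrite /P; elim: n => [|n IH]; first by rewrite big_ord0 cstar0.
  by rewrite big_ord_recr/= cstarD IH Es.
have P1 n : `|P n| <= 1.
  have := cnorm_star_mul (P n); rewrite Ps PP => p2.
  have [->|p0] := eqVneq `|P n| 0; first exact: ler01.
  by rewrite -(ler_pM2r (_ : 0 < `|P n|)) ?lt_def ?p0//= mul1r -expr2 -p2.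
(* The projections tend to 1 pointwise and are equicontinuous, hence converge uniformly on the
   compact closure of the image of the unit ball. *)
have approx (k : K) eps : 0 < eps -> exists N, forall n, (N <= n)%N -> `|k - P n ** k| <= eps.
  move=> eps0; have [_ cK] := (co_op_compact (co_op k)).2 (ex_intro _ k erefl).
  have : \forall n \near \oo, closure (co_op k @` [set x | `|x| <= 1]) `<=`
      (fun y => `|y - hproj xi n y| <= eps).
    move: cK => /compact_near_coveringP; apply => y _.
    have e2 : 0 < eps / 2 by rewrite divr_gt0.
    have [N yN] := xiP y _ e2.
    exists ([set y' | `|y - y'| <= eps / 2], [set n | (N <= n)%N]).
      split; last by exists N.
      apply: (@cvgr_dist_le _ _ _ (nbhs y) _ id y) => //; exact: cvg_id.
    move=> [y' n] [/= yy Nn].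
    have -> : y' - hproj xi n y' = ((y' - y) - hproj xi n (y' - y)) + (y - hproj xi n y).
      by rewrite hprojB; lmod_gen R (hilbert_space (co_space K)).
    rewrite (splitr eps) (le_trans (ler_normD _ _))// lerD ?yN//.
    by rewrite (le_trans (hproj_le oxi _ _))// distrC.
  move=> [N _ NP]; exists N => n Nn; rewrite co_op_norm.
  apply: ge_sup; first by exists `|co_op (k - P n ** k) 0|, 0; rewrite //= normr0.
  move=> _ [x x1 <-]; rewrite opB co_opM Pop; apply: (NP n Nn).
  by apply: subset_closure; exists x.
move=> k eps eps0; have e2 : 0 < eps / 2 by rewrite divr_gt0.
(* Left approximation of both [k] and its adjoint gives the two-sided compression P k P. *)
have [N1 h1] := approx k _ e2; have [N2 h2] := approx (cstar k) _ e2.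
pose n := maxn N1 N2; have {}h1 := h1 n (leq_maxl _ _); have {}h2 := h2 n (leq_maxr _ _).
exists n, (fun i j => inner (co_op k (xi j)) (xi i)).
have -> : \sum_(i < n) \sum_(j < n) inner (co_op k (xi j)) (xi i) *: E i j = P n ** k ** P n.
  apply: co_op_inj; apply/funext => z; rewrite !co_opM !Pop op_sum.
  rewrite {1}/hproj; apply: eq_bigr => i _; rewrite op_sum.
  rewrite (eq_bigr (fun j : 'I_n => (inner z (xi j) * inner (co_op k (xi j)) (xi i)) *: xi i)); last first.
    by move=> j _; rewrite opZ EE scalerA mulrC.
  rewrite -scaler_suml; congr (_ *: _).
  rewrite /hproj op_linsum inner_sum; apply: eq_bigr => j _.
  by rewrite op_linZ innerZ.
rewrite (_ : k - _ = (k - P n ** k) + P n ** (k - k ** P n)); last first.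
  by rewrite cmulBr cmulA; lmod_gen R K.
rewrite (splitr eps) (le_trans (ler_normD _ _))// lerD// (le_trans (cnormM _ _))//.
rewrite (le_trans (ler_piMl _ (P1 n)))// -cnorm_star cstarB cstarM Ps//.
Qed.
End matrix_units.

(** * Tensor products with the compact operators *)

Section extension.
Variable R : realType.

Lemma cauchy_limit (V : completeNormedModType R) (S : nat -> V) :
  (forall e, 0 < e -> exists N, forall n, (N <= n)%N -> `|S n - S N| <= e) ->
  exists x, forall e, 0 < e -> exists N, forall n, (N <= n)%N -> `|x - S n| <= e.
Proof.
move=> cS.
have : cvg (S @ \oo).
  apply/cauchy_cvgP; apply/cauchy_ballP => e e0.
  have e3 : 0 < e / 3 by rewrite divr_gt0.
  have [N NS] := cS _ e3.
  exists (S @` [set n | (N <= n)%N], S @` [set n | (N <= n)%N]).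
    by split; exists N => // n Nn; exists n.
  move=> [_ _] [/= [n Nn <-] [m Nm <-]]; rewrite -ball_normE /=.
  rewrite -(subrKA (S N)) (le_lt_trans (ler_normD _ _))//.
  have := NS n Nn; have := NS m Nm; rewrite (distrC (S m)); lra.
move=> cvS; exists (lim (S @ \oo)) => e e0.
have /cvgrPdist_le/(_ e e0)[N _ NP] := cvS.
by exists N => n; exact: NP.
Qed.

Lemma small_nat (e : R) : 0 < e -> exists N : nat, forall n, (N <= n)%N -> n.+1%:R^-1 <= e.
Proof.
move=> e0; exists (Num.bound e^-1) => n Nn.
rewrite -[leRHS]invrK lef_pV2 ?posrE ?invr_gt0//.
apply: (le_trans (ltW (archi_boundP _))); first by rewrite invr_ge0 ltW.
by rewrite ler_nat leqW.
Qed.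

Variables (V : normedModType R) (W : completeNormedModType R) (I : Type).
Variables (u : I -> V) (v : I -> W).

Lemma lip_agree (F G : V -> W) c :
  (forall x e, 0 < e -> exists i, `|x - u i| <= e) ->
  (forall x y, `|F x - F y| <= c * `|x - y|) ->
  (forall x y, `|G x - G y| <= c * `|x - y|) ->
  (forall i, F (u i) = G (u i)) -> F =1 G.
Proof.
move=> du Fc Gc FG x; apply/eqP; rewrite -subr_eq0 -normr_eq0 eq_le normr_ge0 andbT.
apply/ler_addgt0Pr => e e0; rewrite add0r.
have d0 : 0 < e / 2 / (`|c| + 1) by rewrite !divr_gt0// ltr_wpDl.
have [i xi] := du x _ d0.
have small : c * `|x - u i| <= e / 2.
  rewrite (le_trans (ler_wpM2r _ (ler_norm c)))// (le_trans (ler_wpM2l _ xi))//.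
  by rewrite mulrCA ler_piMr ?divr_ge0 ?(ltW e0)// ler_pdivrMr ?ltr_wpDl// mul1r lerDl.
rewrite -(subrKA (F (u i))) {2}FG (splitr e) (le_trans (ler_normD _ _))// lerD//.
  exact: le_trans (Fc _ _) small.
by rewrite distrC; exact: le_trans (Gc _ _) small.
Qed.

(** [u] may take a value at several indices; the second hypothesis then makes the values of [v]
    agree. *)
Lemma extend_lip :
  (forall x e, 0 < e -> exists i, `|x - u i| <= e) ->
  (forall i j, `|v i - v j| <= `|u i - u j|) ->
  exists f : V -> W, (forall i, f (u i) = v i) /\ forall x y, `|f x - f y| <= `|x - y|.
Proof.
move=> du uv.
have /choice[f fP] : forall x, exists y, forall j, `|y - v j| <= `|x - u j|.
  move=> x.
  have /choice[i iP] : forall n : nat, exists i, `|x - u i| <= n.+1%:R^-1.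
    by move=> n; apply: du; rewrite invr_gt0.
  have [e e0|y yP] := @cauchy_limit W (fun n => v (i n)).
    have e2 : 0 < e / 2 by rewrite divr_gt0.
    have [N NP] := small_nat e2; exists N => n Nn.
    rewrite (le_trans (uv _ _))// -(subrKA x) (splitr e) (le_trans (ler_normD _ _))// lerD//.
      by rewrite distrC (le_trans (iP _))// NP.
    by rewrite (le_trans (iP _))// NP.
  exists y => j; apply/ler_addgt0Pr => e e0.
  have e2 : 0 < e / 2 by rewrite divr_gt0.
  have [N NP] := small_nat e2; have [M MP] := yP _ e2.
  have [n [Nn Mn]] : exists n, (N <= n)%N /\ (M <= n)%N.
    by exists (maxn N M); rewrite leq_maxl leq_maxr.
  have h1 := MP n Mn; have h2 := NP n Nn.
  rewrite -(subrKA (v (i n))) (le_trans (ler_normD _ _))//.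
  have h3 := uv (i n) j; have h4 := iP n.
  have h5 : `|u (i n) - u j| <= `|x - u (i n)| + `|x - u j|.
    by rewrite -(subrKA x) (le_trans (ler_normD _ _))// distrC.
  move: (n.+1%:R^-1) h1 h2 h3 h4 h5; clear => *; lra.
exists f; split=> [i|x y].
  apply/eqP; rewrite -subr_eq0 -normr_eq0 eq_le normr_ge0 andbT.
  by have := fP (u i) i; rewrite subrr normr0.
apply/ler_addgt0Pr => e e0; have e2 : 0 < e / 2 by rewrite divr_gt0.
have [i yi] := du y _ e2.
have h1 := fP x i; have h2 := fP y i.
rewrite -(subrKA (v i)) (le_trans (ler_normD _ _))// (distrC (v i)).
have h3 : `|x - u i| <= `|x - y| + `|y - u i|.
  by rewrite -(subrKA y) (le_trans (ler_normD _ _)).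
move: h1 h2 h3 yi; clear => *; lra.
Qed.

End extension.

(** The consequence of stability on which the proof relies. It passes to function algebras on the
    interval, and tensor products with the compact operators have it. *)
Definition good (R : realType) (B : realCstarType R) := exists s : cuntz_pair B, pure s.

Lemma cmul_suml (R : realType) (B : realCstarType R) (I : Type) (l : seq I) (F : I -> B) y :
  (\sum_(i <- l) F i) ** y = \sum_(i <- l) F i ** y.
Proof. exact: (big_morph (fun x => x ** y) (fun x z => cmulDl x z y) (cmul0r y)). Qed.

Lemma cmul_sumr (R : realType) (B : realCstarType R) (I : Type) (l : seq I) (F : I -> B) y :
  y ** (\sum_(i <- l) F i) = \sum_(i <- l) y ** F i.
Proof. exact: (big_morph (fun x => y ** x) (fun x z => cmulDr y x z) (cmulr0 y)). Qed.

Section cuntz_sequence.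
Variables (R : realType) (B : realCstarType R) (s : cuntz_pair B).

Definition cuntz_seq (n : nat) : multiplier B := iter n (mult_comp (cuntz2 s)) (cuntz1 s).

Lemma cuntz_seq_isometry n : is_isometry (cuntz_seq n).
Proof.
elim: n => [|n IH]; first exact: cuntz1_isometry.
exact: isometry_comp (@cuntz2_isometry _ _ s) IH.
Qed.

Lemma cuntz_seq_adj i j x : mult_adj (cuntz_seq i) (cuntz_seq j x) = if i == j then x else 0.
Proof.
elim: i j => [|i IH] [|j] /=.
- exact: cuntz1_isometry.
- exact: cuntz_adj12.
- by rewrite cuntz_adj21 mult_adj0.
- by rewrite cuntz2_isometry IH.
Qed.

Lemma cuntz_seq_sum N x : \sum_(n < N) cuntz_seq n (mult_adj (cuntz_seq n) x) =
  x - iter N (cuntz2 s) (iter N (mult_adj (cuntz2 s)) x).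
Proof.
elim: N x => [|N IH] x; first by rewrite big_ord0 /= subrr.
rewrite big_ord_recl /=.
under eq_bigr => i _ do rewrite /=.
rewrite -(big_morph (cuntz2 s) (mult_opD _) (mult_op0 _)).
rewrite (IH (mult_adj (cuntz2 s) x)) mult_opB addrA cuntz_sum -iterS -iterSr; congr (_ - _).
Qed.

Lemma pure_cauchy x e : pure s -> 0 < e -> exists N, forall n, (N <= n)%N ->
  `|iter n (mult_adj (cuntz2 s)) x| <= e.
Proof.
move=> sp e0; have [N xN] := sp x e e0; exists N => n Nn.
rewrite -(subnK Nn) iterD; elim: (n - N)%N => //= k.
by apply: le_trans; apply: adj_norm_le; exact: cuntz2_isometry.
Qed.

End cuntz_sequence.

Section tensor.
Variables (R : realType) (K : compact_operators R) (E : nat -> nat -> K).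
Hypothesis EM : forall i j k l, E i j ** E k l = if j == k then E i l else 0.
Hypothesis Es : forall i j, cstar (E i j) = E j i.
Hypothesis Etotal : forall (k : K) eps, 0 < eps -> exists N (c : nat -> nat -> R),
    `|k - \sum_(i < N) \sum_(j < N) c i j *: E i j| <= eps.
Variables (B : realCstarType R) (T : tensor_product B K).
Local Notation tens := (tp_tens T).
Local Notation gen := (B * nat * nat)%type.
Let P := tp_P T.

Let tg (g : gen) : T := tens g.1.1 (E g.1.2 g.2).
Let u (l : seq gen) : T := \sum_(g <- l) tg g.

Let tensDl b b' k : tens (b + b') k = tens b k + tens b' k.
Proof. by have := tensLl P 1 b b' k; rewrite !scale1r. Qed.
Let tens0l k : tens 0 k = 0.
Proof. by apply: (addrI (tens 0 k)); rewrite -tensDl !addr0. Qed.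
Let tensZl c b k : tens (c *: b) k = c *: tens b k.
Proof. by have := tensLl P c b 0 k; rewrite tens0l !addr0. Qed.
Let tensDr b k k' : tens b (k + k') = tens b k + tens b k'.
Proof. by have := tensLr P 1 b k k'; rewrite !scale1r. Qed.
Let tens0r b : tens b 0 = 0.
Proof. by apply: (addrI (tens b 0)); rewrite -tensDr !addr0. Qed.
Let tensZr c b k : tens b (c *: k) = c *: tens b k.
Proof. by have := tensLr P c b k 0; rewrite tens0r !addr0. Qed.
Let tensBl b b' k : tens (b - b') k = tens b k - tens b' k.
Proof. by rewrite tensDl -scaleN1r tensZl scaleN1r. Qed.
Let tensBr b k k' : tens b (k - k') = tens b k - tens b k'.
Proof. by rewrite tensDr -scaleN1r tensZr scaleN1r. Qed.

Let u_dense x e : 0 < e -> exists l, `|x - u l| <= e.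
Proof.
pose app x := forall e, 0 < e -> exists l, `|x - u l| <= e.
have app0 : app 0 by move=> d d0; exists [::]; rewrite /u big_nil subrr normr0 ltW.
have appD y z : app y -> app z -> app (y + z).
  move=> ay az d d0; have d2 : 0 < d / 2 by rewrite divr_gt0.
  have [l yl] := ay _ d2; have [m zm] := az _ d2; exists (l ++ m).
  rewrite /u big_cat/= opprD addrACA (splitr d) (le_trans (ler_normD _ _))//.
  exact: lerD.
have app_sum (I : Type) (s : seq I) (F : I -> T) : (forall i, app (F i)) ->
    app (\sum_(i <- s) F i).
  by move=> aF; elim: s => [|i s IH]; rewrite ?big_nil ?big_cons//; exact: appD.
have appcl y : (forall d, 0 < d -> exists z, app z /\ `|y - z| <= d) -> app y.
  move=> ay d d0; have d2 : 0 < d / 2 by rewrite divr_gt0.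
  have [z [az yz]] := ay _ d2; have [l zl] := az _ d2; exists l.
  by rewrite -(subrKA z) (splitr d) (le_trans (ler_normD _ _))// lerD.
have appg b i j : app (tens b (E i j)).
  by move=> d d0; exists [:: (b, i, j)]; rewrite /u big_seq1 subrr normr0 ltW.
have appt b k : app (tens b k).
  apply: appcl => d d0; have d1 : 0 < d / (`|b| + 1) by rewrite divr_gt0// ltr_wpDl.
  have [N [c kc]] := Etotal k d1.
  exists (tens b (\sum_(i < N) \sum_(j < N) c i j *: E i j)); split; last first.
    rewrite -tensBr (tens_norm P) (le_trans (ler_wpM2l _ kc))//.
    by rewrite mulrCA ler_piMr ?(ltW d0)// ler_pdivrMr ?ltr_wpDl// mul1r lerDl.
  rewrite (big_morph (tens b) (tensDr b) (tens0r b)); apply: (app_sum) => i.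
  rewrite (big_morph (tens b) (tensDr b) (tens0r b)); apply: (app_sum) => j.
  by rewrite tensZr -tensZl; exact: appg.
suff : app x by apply.
apply: appcl => d d0.
have [y [xy [n [b [k yE]]]]] : ((ball x d) `&` [set x : T | exists n (b : 'I_n -> B) (k : 'I_n -> K),
    x = \sum_(i < n) tens (b i) (k i)]) !=set0.
  by apply: (tens_dense P); [exists x; exact: ballxx|exact: ball_open].
exists y; split; first by rewrite yE; apply: (app_sum) => i; exact: appt.
by move: xy; rewrite -ball_normE => /ltW.
Qed.

Section multiplier_of_generators.
Variables V V' : gen -> T.
Hypothesis VV' : forall g h, cstar (V g) ** tg h = cstar (tg g) ** V' h.
Hypothesis VV : forall g h, cstar (V g) ** V h = cstar (tg g) ** tg h.

Let v l := \sum_(g <- l) V g.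
Let v' l := \sum_(g <- l) V' g.

Let sum_mul (F G F' G' : gen -> T) :
  (forall g h, cstar (F g) ** G h = cstar (F' g) ** G' h) ->
  forall l m, cstar (\sum_(g <- l) F g) ** (\sum_(h <- m) G h) =
              cstar (\sum_(g <- l) F' g) ** (\sum_(h <- m) G' h).
Proof.
move=> FG l m; elim: l => [|g l IH]; first by rewrite !big_nil !cstar0 !cmul0r.
rewrite !big_cons !cstarD !cmulDl IH; congr (_ + _).
elim: m {IH} => [|h m IH]; first by rewrite !big_nil !cmulr0.
by rewrite !big_cons !cmulDr FG IH.
Qed.

(** [VV] says that V preserves the inner products of generators, so that it extends to an isometry.
    [VV'] makes V' a formal adjoint, which is then contractive and extends as well. *)
Lemma multiplier_of_generators : exists w : multiplier T,
  [/\ is_isometry w, forall g, w (tg g) = V g & forall g, mult_adj w (tg g) = V' g].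
Proof.
have vu l m : cstar (v l) ** u m = cstar (u l) ** v' m by exact: sum_mul.
have vv l m : cstar (v l) ** v m = cstar (u l) ** u m by exact: sum_mul.
have v_lip l m : `|v l - v m| <= `|u l - u m|.
  rewrite -(@ler_sqr _ `|v l - v m|) ?nnegrE// -!cnorm_star_mul.
  by rewrite !cstarB !cmulBl !cmulBr !vv.
have [f [fu fl]] := extend_lip u_dense v_lip.
have f0 : f 0 = 0 by have := fu [::]; rewrite /u /v !big_nil.
have f_le x : `|f x| <= `|x| by have := fl x 0; rewrite f0 !subr0.
have mul_lip (x y y' : T) : `|x ** y - x ** y'| <= `|x| * `|y - y'|.
  by rewrite -cmulBr cnormM.
have mul_lipl (x y y' : T) : `|cstar y ** x - cstar y' ** x| <= `|x| * `|y - y'|.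
  by rewrite -cmulBl -cstarB (le_trans (cnormM _ _))// cnorm_star mulrC.
have fu' x m : cstar (f x) ** u m = cstar x ** v' m.
  pose c := `|u m| + `|v' m|.
  apply: (@lip_agree R T T _ u (fun x => cstar (f x) ** u m) (fun x => cstar x ** v' m) c) => [||y z|l].
  - exact: u_dense.
  - move=> y z; rewrite (le_trans (mul_lipl _ _ _))//.
    by rewrite ler_pM// lerDl.
  - rewrite (le_trans (mul_lipl _ _ _))// ler_wpM2r// lerDr//.
  - by rewrite fu vu.
(* The square of the norm of d equals that of [cstar (f d) ** (u l - u m)], hence is at most |d| |u
   l - u m|. *)
have v'_lip l m : `|v' l - v' m| <= `|u l - u m|.
  set d := v' l - v' m.
  have dd : cstar d ** d = cstar (f d) ** (u l - u m).
    by rewrite {2}/d cmulBr cmulBr !fu'.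
  have [->|d0] := eqVneq d 0; first by rewrite normr0.
  have dp : 0 < `|d| by rewrite normr_gt0.
  rewrite -(ler_pM2l dp) -expr2 -cnorm_star_mul dd (le_trans (cnormM _ _))//.
  by rewrite cnorm_star ler_wpM2r.
have [g [gu gl]] := extend_lip u_dense v'_lip.
have fg x y : cstar (f x) ** y = cstar x ** g y.
  pose c := `|f x| + `|x|.
  apply: (@lip_agree R T T _ u (fun y => cstar (f x) ** y) (fun y => cstar x ** g y) c) => [||y' z|l].
  - exact: u_dense.
  - move=> y' z; rewrite (le_trans (mul_lip _ _ _))// cnorm_star.
    by rewrite ler_wpM2r// lerDl.
  - rewrite (le_trans (mul_lip _ _ _))// cnorm_star ler_pM// ?lerDr//.
  - by rewrite gu fu'.
exists (Multiplier fg); split=> [x|h|h] /=.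
- have ffu l m : cstar (v l) ** f (u m) = cstar (u l) ** u m by rewrite fu vv.
  have ff1 l y : cstar (v l) ** f y = cstar (u l) ** y.
    pose c := `|v l| + `|u l|.
    apply: (@lip_agree R T T _ u (fun y => cstar (v l) ** f y) (fun y => cstar (u l) ** y) c) => [||y' z|m].
    - exact: u_dense.
    - move=> y' z; rewrite (le_trans (mul_lip _ _ _))// cnorm_star.
      by rewrite ler_pM// lerDl.
    - by rewrite (le_trans (mul_lip _ _ _))// cnorm_star ler_wpM2r// lerDr.
    - exact: ffu.
  have ff z y : cstar (f z) ** f y = cstar z ** y.
    pose c := `|f y| + `|y|.
    apply: (@lip_agree R T T _ u (fun z => cstar (f z) ** f y) (fun z => cstar z ** y) c) => [||y' z'|m].
    - exact: u_dense.
    - move=> y' z'; rewrite (le_trans (mul_lipl _ _ _))//.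
      by rewrite ler_pM// lerDl.
    - by rewrite (le_trans (mul_lipl _ _ _))// ler_wpM2r// lerDr.
    - by rewrite fu ff1.
  by apply: cmul_inj => z; rewrite -fg ff.
- by have := fu [:: h]; rewrite /u /v !big_seq1.
- by have := gu [:: h]; rewrite /u /v' !big_seq1.
Qed.

End multiplier_of_generators.

Lemma gen_agree (F G : T -> T) c :
  (forall x y, `|F x - F y| <= c * `|x - y|) ->
  (forall x y, `|G x - G y| <= c * `|x - y|) ->
  (forall x y, F (x + y) = F x + F y) -> (forall x y, G (x + y) = G x + G y) ->
  (forall g, F (tg g) = G (tg g)) -> F =1 G.
Proof.
move=> Fc Gc FD GD FG; apply: (lip_agree (u := u) u_dense Fc Gc) => l.
have F0 : F 0 = 0 by apply: (addrI (F 0)); rewrite -FD !addr0.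
have G0 : G 0 = 0 by apply: (addrI (G 0)); rewrite -GD !addr0.
rewrite /u; elim: l => [|g l IH]; first by rewrite !big_nil F0 G0.
by rewrite !big_cons FD GD FG IH.
Qed.

Let tgM b i j b' k l :
  tg (b, i, j) ** tg (b', k, l) = if j == k then tg (b ** b', i, l) else 0.
Proof. by rewrite /tg/= -(tensM P) EM; case: eqP => // _; rewrite tens0r. Qed.

Let tg_star b i j : cstar (tg (b, i, j)) = tg (cstar b, j, i).
Proof. by rewrite /tg/= -(tens_star P) Es. Qed.

(* [h] is the partial inverse of the injection [f]. *)
Section index_isometry.
Variables (f : nat -> nat) (h : nat -> option nat).
Hypothesis fh : forall i k, (f i == k) = (h k == Some i).

(** This is 1 (x) W, where W is the isometry of the Hilbert space that sends the i-th basis vector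
    to the (f i)-th. *)
Lemma index_isometry : exists w : multiplier T,
  [/\ is_isometry w, forall b i j, w (tg (b, i, j)) = tg (b, f i, j) &
    forall b i j, mult_adj w (tg (b, i, j)) = if h i is Some k then tg (b, k, j) else 0].
Proof.
have [|| w [wi wV wV']] := @multiplier_of_generators
   (fun g => tg (g.1.1, f g.1.2, g.2))
   (fun g => if h g.1.2 is Some k then tg (g.1.1, k, g.2) else 0).
- move=> [[b i] j] [[b' k] l] /=; rewrite !tg_star tgM fh.
  case: (h k) => [k'|]; last by rewrite cmulr0.
  by rewrite tgM (eq_sym i).
- move=> [[b i] j] [[b' k] l] /=; rewrite !tg_star !tgM.
  have -> : (f i == f k) = (i == k).
    rewrite eq_sym fh; have := fh i (f i); rewrite eqxx => /esym/eqP -> //.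
  by [].
by exists w; split=> // b i j; rewrite ?wV ?wV'.
Qed.

End index_isometry.

(** The Hilbert space is split along even and odd indices. The adjoint of the second isometry sends
    the index 2 i + 1 to i and kills even indices; as it lowers the index, its iterates kill every
    generator. *)
Lemma tensor_good : good T.
Proof.
pose h0 (k : nat) := if odd k then None else Some k./2.
pose h1 (k : nat) := if odd k then Some k./2 else None.
have [|w1 [w1i w1V w1V']] := @index_isometry double h0.
  move=> i k; rewrite /h0; case: ifP => ok; first by apply/negbTE/eqP => kE; rewrite -kE odd_double in ok.
  apply/eqP/eqP => [<-|[<-]]; first by rewrite doubleK.
  by rewrite even_halfK// ok.
have [|w2 [w2i w2V w2V']] := @index_isometry (fun i => i.*2.+1) h1.
  move=> i k; rewrite /h1; case: ifP => ok.
    apply/eqP/eqP => [<-|[<-]]; first by rewrite /= uphalf_double.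
    by rewrite odd_halfK// prednK// odd_gt0.
  by apply/negbTE/eqP => kE; rewrite -kE /= odd_double in ok.
have sum12 x : w1 (mult_adj w1 x) + w2 (mult_adj w2 x) = x.
  apply: (@gen_agree (fun x => w1 (mult_adj w1 x) + w2 (mult_adj w2 x)) id 2) => [y z|y z|y z|//|[[b i] j]].
  - rewrite opprD addrACA -!mult_opB -!mult_adjB (le_trans (ler_normD _ _))//.
    rewrite (isometry_norm w1i) (isometry_norm w2i) mulr_natl mulr2n.
    by rewrite lerD// adj_norm_le.
  - by rewrite mulr_natl mulr2n lerDl.
  - by rewrite !mult_adjD !mult_opD addrACA.
  - rewrite w1V' w2V' /h0 /h1; case: ifP => oi.
      by rewrite mult_op0 add0r w2V odd_halfK// prednK// odd_gt0.
    by rewrite mult_op0 addr0 w1V even_halfK// oi.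
exists (CuntzPair w1i w2i sum12) => x e e0 /=.
have iterB n y z : iter n (mult_adj w2) (y - z) = iter n (mult_adj w2) y - iter n (mult_adj w2) z.
  by elim: n => //= n ->; rewrite mult_adjB.
have iter_le n y : `|iter n (mult_adj w2) y| <= `|y|.
  by elim: n => //= n IH; rewrite (le_trans (adj_norm_le _ w2i)).
have iter0 n : iter n (mult_adj w2) 0 = 0 by elim: n => //= n ->; rewrite mult_adj0.
have iterD n y z : iter n (mult_adj w2) (y + z) = iter n (mult_adj w2) y + iter n (mult_adj w2) z.
  by elim: n => //= n ->; rewrite mult_adjD.
have gen0 n b i j : (i < n)%N -> iter n (mult_adj w2) (tg (b, i, j)) = 0.
  elim: n i => // n IH i; rewrite ltnS => ni; rewrite iterSr w2V' /h1.
  case: ifP => oi; last exact: iter0.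
  by apply: IH; rewrite (leq_trans _ ni)// ltn_half_double -addnn -[ltnLHS]addn0 ltn_add2l odd_gt0.
have [l xl] := u_dense x e0.
exists (\max_(g <- l) g.1.2.+1).
have ul0 : iter (\max_(g <- l) g.1.2.+1) (mult_adj w2) (u l) = 0.
  have : forall n, (\max_(g <- l) g.1.2.+1 <= n)%N -> iter n (mult_adj w2) (u l) = 0.
    rewrite /u; elim: l {xl} => [|[[b i] j] l IH] n; first by rewrite !big_nil.
    rewrite !big_cons geq_max iterD => /andP[/= ni /IH ->].
    by rewrite addr0 gen0.
  by apply.
by rewrite -[x in `|_ x|](subrK (u l)) iterD ul0 addr0 (le_trans (iter_le _ _)).
Qed.


(** [w] is v (x) 1. *)
Lemma amplify (v : multiplier B) : is_isometry v -> exists w : multiplier T,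
  [/\ is_isometry w, forall b i j, w (tens b (E i j)) = tens (v b) (E i j) &
      forall b i j, mult_adj w (tens b (E i j)) = tens (mult_adj v b) (E i j)].
Proof.
move=> vi; have [|| w [wi wV wV']] := @multiplier_of_generators
   (fun g => tg (v g.1.1, g.1.2, g.2)) (fun g => tg (mult_adj v g.1.1, g.1.2, g.2)).
- move=> [[b i] j] [[b' k] l] /=; rewrite !tg_star !tgM.
  by case: eqP => // _; rewrite mult_adjP.
- move=> [[b i] j] [[b' k] l] /=; rewrite !tg_star !tgM.
  by case: eqP => // _; rewrite mult_adjP vi.
by exists w; split=> // b i j; [rewrite (wV (b, i, j))|rewrite (wV' (b, i, j))].
Qed.

Lemma amplify_orth (w1 w2 : multiplier T) : is_isometry w1 -> is_isometry w2 ->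
  (forall b i j, mult_adj w1 (w2 (tens b (E i j))) = 0) -> forall x, mult_adj w1 (w2 x) = 0.
Proof.
move=> w1i w2i w0; apply: (@gen_agree _ (fun=> 0) 1) => [x y|x y|x y|x y|[[b i] j]].
- rewrite -mult_adjB -mult_opB mul1r (le_trans (adj_norm_le _ w1i))//.
  by rewrite (isometry_norm w2i).
- by rewrite subrr normr0 mul1r.
- by rewrite mult_opD mult_adjD.
- by rewrite addr0.
- exact: w0.
Qed.

Section compression.
Variables (s : cuntz_pair B) (s_pure : pure s).
Local Notation r := (cuntz_seq s).

(** The tail is a column, so its square is (b^* Q) (x) E_ii, where Q is the corresponding tail of
    the sum of r_n r_n^* b, a difference of two vectors of norm at most that of the M-th iterate. *)
Let tail b i (M N : nat) : `|\sum_(n < M + N) tg (mult_adj (r n) b, n : nat, i)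
   - \sum_(n < M) tg (mult_adj (r n) b, n : nat, i)| ^+ 2 <=
   `|b| * (2 * `|iter M (mult_adj (cuntz2 s)) b|).
Proof.
set y := (X in `|X|).
have yE : y = \sum_(n < N) tg (mult_adj (r (M + n)%N) b, (M + n)%N, i).
  by rewrite /y big_split_ord /= addrAC subrr add0r.
have -> : `|y| ^+ 2 = `|cstar y ** y| by rewrite cnorm_star_mul.
pose Q := \sum_(n < N) r (M + n)%N (mult_adj (r (M + n)%N) b).
have QE : Q = iter M (cuntz2 s) (iter M (mult_adj (cuntz2 s)) b) -
    iter (M + N) (cuntz2 s) (iter (M + N) (mult_adj (cuntz2 s)) b).
  have := cuntz_seq_sum s (M + N) b; rewrite big_split_ord /= cuntz_seq_sum -/Q.
  move=> QE; apply: (addrI (b - iter M (cuntz2 s) (iter M (mult_adj (cuntz2 s)) b))).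
  by rewrite QE addrA subrK.
have -> : cstar y ** y = tg (cstar b ** Q, i, i).
  rewrite yE (big_morph (@cstar R T) (@cstarD _ _) (@cstar0 _ _)).
  rewrite cmul_suml.
  rewrite /Q cmul_sumr.
  rewrite /tg /= (big_morph (tens ^~ (E i i)) (fun x z => tensDl x z _) (tens0l _)).
  apply: eq_bigr => n _.
  rewrite cmul_sumr.
  rewrite (bigD1 n) //= big1 ?addr0 => [|m mn].
    rewrite (tg_star _ (M + n)%N i) (tgM _ i (M + n)%N) eqxx /tg/=.
    by rewrite mult_adjP'.
  rewrite (tg_star _ (M + n)%N i) (tgM _ i (M + n)%N) ifF //.
  by apply/negbTE; rewrite eqn_add2l eq_sym.
have iter_op n x : `|iter n (cuntz2 s) x| = `|x|.
  by elim: n => //= n; rewrite (isometry_norm (@cuntz2_isometry _ _ s)).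
have iter_adj n x : `|iter n (mult_adj (cuntz2 s)) x| <= `|x|.
  elim: n => //= n; apply: le_trans; apply: adj_norm_le; exact: cuntz2_isometry.
rewrite /tg /= (tens_norm P).
have E1 : `|E i i| <= 1.
  have := cnorm_star_mul (E i i); rewrite Es EM eqxx => e2.
  have [->|e0] := eqVneq `|E i i| 0; first exact: ler01.
  by rewrite -(ler_pM2r (_ : 0 < `|E i i|)) ?lt_def ?e0//= mul1r -expr2 -e2.
rewrite (le_trans (ler_wpM2l _ E1))// mulr1 (le_trans (cnormM _ _))// cnorm_star.
rewrite ler_wpM2l// QE (le_trans (ler_normB _ _))// !iter_op addnC iterD.
by rewrite mulr_natl mulr2n lerD// iter_adj.
Qed.

(** The adjoint of the isometry sum_n r_n (x) E_0n sends b (x) E_0i to this infinite column, which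
    converges by purity. *)
Let column b i : exists y, forall e, 0 < e -> exists M, forall N, (M <= N)%N ->
  `|y - \sum_(n < N) tg (mult_adj (r n) b, n : nat, i)| <= e.
Proof.
apply: (@cauchy_limit R T) => e e0.
have c0 : 0 < 2 * (`|b| + 1) by rewrite mulr_gt0// ltr_wpDl.
have d0 : 0 < e ^+ 2 / (2 * (`|b| + 1)) by rewrite divr_gt0// exprn_gt0.
have [M MP] := pure_cauchy b s_pure d0; exists M => N MN.
rewrite -(@ler_sqr _ `|_|) ?nnegrE ?(ltW e0)//.
rewrite -(subnKC MN) (le_trans (tail _ _ _ _))//.
have h := MP M (leqnn M).
have b1 : `|b| <= `|b| + 1 by rewrite lerDl.
rewrite (le_trans (ler_pM _ _ b1 (ler_wpM2l _ h)))//.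
by rewrite mulrCA mulrA [leRHS](_ : _ = 2 * (`|b| + 1) * (e ^+ 2 / (2 * (`|b| + 1)))) // mulrC divfK// gt_eqF.
Qed.

(* [sum_i r_i (x) E_0i], an isometry that maps [T] onto the corner. *)
Lemma compression_isometry : exists w : multiplier T,
  is_isometry w /\ forall b i j, w (tens b (E i j)) = tens (r i b) (E 0 j).
Proof.
have /choice[y yP] : forall bi : B * nat, exists y, forall e, 0 < e -> exists M, forall N,
    (M <= N)%N -> `|y - \sum_(n < N) tg (mult_adj (r n) bi.1, n : nat, bi.2)| <= e.
  by move=> [b i]; exact: column.
have [|| w [wi wV _]] := @multiplier_of_generators
   (fun g => tg (r g.1.2 g.1.1, 0%N, g.2))
   (fun g => if g.1.2 is 0%N then y (g.1.1, g.2) else 0).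
- move=> [[b i] j] [[b' k] l] /=; rewrite !tg_star tgM.
  case: k => [|k] /=; last by rewrite cmulr0.
  rewrite mult_adjP; apply/eqP; rewrite -subr_eq0 -normr_eq0 eq_le normr_ge0 andbT.
  apply/ler_addgt0Pr => e e0; rewrite add0r.
  pose x := tg (cstar b, j, i).
  have d0 : 0 < e / (`|x| + 1) by rewrite divr_gt0// ltr_wpDl.
  have [M MP] := yP (b', l) _ d0.
  have := MP (maxn M i.+1) (leq_maxl _ _) => /= h.
  have xS : x ** (\sum_(n < maxn M i.+1) tg (mult_adj (r n) b', n : nat, l)) =
      tg (cstar b ** mult_adj (r i) b', j, l).
    rewrite cmul_sumr (bigD1 (Ordinal (leq_maxr M i.+1))) //= tgM eqxx big1 ?addr0// => n ni.
    rewrite tgM ifF //; apply/negbTE; apply: contra ni => /eqP ni.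
    by apply/eqP/val_inj.
  rewrite -xS -/x -cmulBr (le_trans (cnormM _ _))//.
  rewrite distrC (le_trans (ler_wpM2l _ h))// mulrCA ler_piMr ?(ltW e0)//.
  by rewrite ler_pdivrMr ?ltr_wpDl// mul1r lerDl.
- move=> [[b i] j] [[b' k] l] /=; rewrite !tg_star !tgM eqxx mult_adjP cuntz_seq_adj.
  by case: eqP => // _; rewrite cmulr0 /tg/= tens0l.
by exists w; split=> // b i j; rewrite (wV (b, i, j)).
Qed.

Variable e : rank_one_projection K.
Hypothesis e00 : E 0 0 = e.

(** Conjugations by isometries being homotopic to the identity for good algebras, [f] is a homotopy
    inverse of the corner embedding. *)
Lemma compression : exists (f : starhom T B) (w : multiplier T) (wi : is_isometry w),
  (forall x, corner e T (f x) = conj_hom wi x) /\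
  (forall b, f (corner e T b) = conj_hom (cuntz_seq_isometry s 0) b).
Proof.
have [w [wi wE]] := compression_isometry.
(* The map b (x) E_ij |-> r_i b r_j^*. *)
pose f0 (g : gen) : B := r g.1.2 (cstar (r g.2 (cstar g.1.1))).
have f0E g : tens (f0 g) e = mult_conj w (tg g).
  case: g => [[b i] j]; rewrite /f0 /mult_conj /tg/=.
  by rewrite -!(tens_star P) Es wE -(tens_star P) Es wE e00.
pose v (l : seq gen) := \sum_(g <- l) f0 g.
have conjD x z : mult_conj w (x + z) = mult_conj w x + mult_conj w z.
  by rewrite /mult_conj cstarD mult_opD cstarD mult_opD.
have conj0 : mult_conj w 0 = 0 by apply: (addrI (mult_conj w 0)); rewrite -conjD !addr0.
have vE l : tens (v l) e = mult_conj w (u l).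
  rewrite /v /u (big_morph (mult_conj w) conjD conj0).
  rewrite (big_morph (tens ^~ (e : K)) (fun x z => tensDl x z _) (tens0l _)).
  by apply: eq_bigr => g _.
have conjB x z : mult_conj w (x - z) = mult_conj w x - mult_conj w z.
  by rewrite /mult_conj cstarB mult_opB cstarB mult_opB.
have conj_norm x : `|mult_conj w x| = `|x|.
  by rewrite /mult_conj (isometry_norm wi) cnorm_star (isometry_norm wi) cnorm_star.
(* The corner embedding is thus isometric, and estimates and identities may be checked after
   applying it. *)
have e1 : `|e : K| = 1.
  have [x [x1 ex]] := rop_P e.
  have /eqP := cnorm_star_mul (e : K); rewrite rop_star rop_mul -subr_eq0.
  rewrite expr2 -{1}[`|_|]mulr1 -mulrBr mulf_eq0 => /orP[/eqP|]; last first.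
    by rewrite subr_eq0 => /eqP <-.
  move=> /eqP; rewrite normr_eq0 => /eqP ee0.
  have := ex x; rewrite inner_norm x1 expr1n scale1r ee0 => xx.
  have : co_op (0 : K) x = 0 by have := co_opL 0 (0 : K) 0 x; rewrite !scale0r addr0 add0r => {1}->; have := co_opL (-1) (0 : K) 0 x; rewrite scaler0 addr0 scaleN1r addNr.
  by rewrite xx => x0; move: x1; rewrite x0 normr0 => /esym/eqP; rewrite oner_eq0.
have tens_e b : `|tens b e| = `|b| by rewrite (tens_norm P) e1 mulr1.
have v_lip l m : `|v l - v m| <= `|u l - u m|.
  by rewrite -tens_e tensBl !vE -conjB conj_norm.
have [f [fu fl]] := extend_lip u_dense v_lip.
have fE x : tens (f x) e = mult_conj w x.
  apply: (@lip_agree R T T _ u (fun x => tens (f x) e) (mult_conj w) 1 u_dense) => [y z|y z|l].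
  - by rewrite mul1r -tensBl tens_e.
  - by rewrite mul1r -conjB conj_norm.
  - by rewrite fu vE.
have tens_inj b b' : tens b e = tens b' e -> b = b'.
  by move=> bb; apply/eqP; rewrite -subr_eq0 -normr_eq0 -tens_e tensBl bb subrr normr0.
have [wL wM wS] := mult_conj_starhom wi.
have fh : is_starhom f.
  split=> [k x y|x y|x]; apply: tens_inj; rewrite fE.
  - by rewrite wL tensDl tensZl !fE.
  - by rewrite wM -!fE -(tensM P) rop_mul.
  - by rewrite wS -fE -(tens_star P) rop_star.
have fc x : `|f x| <= `|x| by rewrite -tens_e fE conj_norm.
exists (Starhom fh fc), w, wi; split=> [x|b]; first exact: fE.
apply: tens_inj; rewrite /= fE /mult_conj -e00.
by rewrite -!(tens_star P) !Es wE -(tens_star P) Es wE.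
Qed.

End compression.
End tensor.

Section transport.
Variables (R : realType) (B T : realCstarType R) (f : B -> T) (g : T -> B).
Hypotheses (fh : is_starhom f) (fg : cancel f g) (gf : cancel g f).

Lemma inverse_starhom : is_starhom g.
Proof.
have [fL fM fs] := fh.
by split=> *; apply: (can_inj fg); rewrite ?(fL, fM, fs) !gf.
Qed.

Lemma transport_mult_subproof (w : multiplier T) x y :
  cstar (g (w (f x))) ** y = cstar x ** g (mult_adj w (f y)).
Proof.
have [fL fM fs] := fh; apply: (can_inj fg).
by rewrite !fM !fs !gf mult_adjP.
Qed.
Definition transport_mult w := Multiplier (transport_mult_subproof w).

Lemma good_transport : good T -> good B.
Proof.
have [gL gM gs] := inverse_starhom.
have gD x y : g (x + y) = g x + g y by have := gL 1 x y; rewrite !scale1r.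
move=> [s s_pure].
have iso w : is_isometry w -> is_isometry (transport_mult w) by move=> wi x; rewrite /= gf wi fg.
have sum12 x : transport_mult (cuntz1 s) (mult_adj (transport_mult (cuntz1 s)) x) +
  transport_mult (cuntz2 s) (mult_adj (transport_mult (cuntz2 s)) x) = x.
  by rewrite /= !gf -gD cuntz_sum fg.
exists (CuntzPair (iso _ (@cuntz1_isometry _ _ s)) (iso _ (@cuntz2_isometry _ _ s)) sum12).
move=> x e e0 /=; have [n xn] := s_pure (f x) e e0; exists n.
rewrite (_ : iter n _ x = g (iter n (mult_adj (cuntz2 s)) (f x))); last first.
  by elim: n {xn} => [|n IH]; rewrite /= ?fg// IH gf.
by rewrite (le_trans (starhom_norm_le inverse_starhom _)).
Qed.

End transport.

Lemma stable_good (R : realType) (K : compact_operators R) (e : rank_one_projection K)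
  (B : realCstarType R) : stable K B -> good B.
Proof.
move=> [T [f [fh [g fg gf]]]].
have [E [_ EM Es Et]] := matrix_units e.
exact: good_transport fh fg gf (tensor_good EM Es Et T).
Qed.

Section itv_multiplier.
Variables (R : realType) (Z : set (unit_itv R)) (B : realCstarType R).
Variables (v : multiplier B) (vi : is_isometry v).

Lemma adj_continuous : continuous (mult_adj v).
Proof.
apply: (@lipB_continuous _ _ _ _ 1) => x y.
by rewrite -mult_adjB mul1r adj_norm_le.
Qed.

Lemma itv_mult_subproof (F G : itv_algebra Z B) :
  cstar (itv_map_fun (mult_continuous vi) (mult_op0 v) F) ** G =
  cstar F ** itv_map_fun adj_continuous (mult_adj0 v) G.
Proof. by apply/itv_eqP => x; exact: mult_adjP. Qed.
Definition itv_mult := Multiplier itv_mult_subproof.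

Lemma itv_mult_isometry : is_isometry itv_mult.
Proof. by move=> F; apply/itv_eqP => x; exact: vi. Qed.

End itv_multiplier.

Section itv_cuntz.
Variables (R : realType) (Z : set (unit_itv R)) (B : realCstarType R) (s : cuntz_pair B).

Let m1 := itv_mult Z (@cuntz1_isometry _ _ s).
Let m2 := itv_mult Z (@cuntz2_isometry _ _ s).

Lemma itv_cuntz_sum x : m1 (mult_adj m1 x) + m2 (mult_adj m2 x) = x.
Proof. by apply/itv_eqP => z; exact: cuntz_sum. Qed.

Definition itv_cuntz := CuntzPair (itv_mult_isometry (Z := Z) (@cuntz1_isometry _ _ s))
  (itv_mult_isometry (Z := Z) (@cuntz2_isometry _ _ s)) itv_cuntz_sum.

(** The iterates of the adjoint are contractive, so that their pointwise convergence to 0 is uniform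
    on the compact interval. *)
Lemma itv_cuntz_pure : pure s -> pure itv_cuntz.
Proof.
move=> sp F e e0.
have e2 : 0 < e / 2 by rewrite divr_gt0.
pose w n b := iter n (mult_adj (cuntz2 s)) b.
have w_lip n b c : `|w n b - w n c| <= `|b - c|.
  elim: n => //= n; apply: le_trans; rewrite -mult_adjB adj_norm_le//.
  exact: cuntz2_isometry.
have /compact_near_coveringP cI := @compact_unit_itv R.
have := cI _ \oo (fun n x => `|w n (F x)| <= e) _.
case=> [x _|N _ NP].
  have [N NP] := pure_cauchy (F x) sp e2.
  exists ([set x' | `|F x - F x'| <= e / 2], [set n | (N <= n)%N]).
    split; last by exists N.
    by apply: (@cvgr_dist_le _ _ _ (nbhs x) _ F (F x)) => //; exact: itv_continuous.
  move=> [x' n] [/= xx Nn].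
  rewrite -(subrK (w n (F x)) (w n (F x'))) (splitr e) (le_trans (ler_normD _ _))// lerD//.
    by rewrite (le_trans (w_lip _ _ _))// distrC.
  exact: NP.
exists N; apply/itv_normP => x.
have -> : iter N (mult_adj (cuntz2 itv_cuntz)) F x = w N (F x).
  elim: N {NP} => //= N IH; exact: (congr1 (mult_adj (cuntz2 s)) IH).
by apply: (NP N) => //=.
Qed.

End itv_cuntz.

Lemma good_itv (R : realType) (Z : set (unit_itv R)) (B : realCstarType R) :
  good B -> good (itv_algebra Z B).
Proof. by move=> [s sp]; exists (itv_cuntz Z s); exact: itv_cuntz_pure. Qed.

Ltac minmax := repeat match goal with
  | |- context [Order.max ?a ?b] => case: (lerP a b)
  | |- context [Order.min ?a ?b] => case: (lerP a b)
  | |- context [Num.norm ?a] => case: (lerP 0 a)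
  end; intros; try lra.

(** * The suspension map *)

Section uniform.
Variable R : realType.
Local Notation I := (unit_itv R).

Lemma set_val_continuous : continuous (@set_val _ _ : I -> R).
Proof. exact: initial_continuous. Qed.

Lemma joint_unif (P : topologicalType) (K : set P) (V : normedModType R) (F : P -> I -> V) :
  compact K -> continuous (fun q : P * I => F q.1 q.2) ->
  forall e, 0 < e -> exists2 d : R, 0 < d & forall p, K p -> forall x y : I,
    `|set_val x - set_val y| <= d -> `|F p x - F p y| <= e.
Proof.
move=> cK cF e e0.
have /compact_near_coveringP/near_covering_withinP cKI := compact_setX cK (@compact_unit_itv R).
pose G (q : R * (P * I)) := F q.2.1 (clamp (set_val q.2.2 + q.1)) - F q.2.1 q.2.2.
have cG : continuous G.
  apply: contB.
    apply: (@cont_comp _ _ _ (fun q : R * (P * I) => (q.2.1, clamp (set_val q.2.2 + q.1)))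
      (fun q : P * I => F q.1 q.2)) => //.
    apply: cont_pair; first by apply: cont_comp; [exact: cont_snd|exact: cont_fst].
    apply: cont_comp; last exact: clamp_continuous.
    apply: contD; last exact: cont_fst.
    apply: (@cont_comp _ _ _ (fun q : R * (P * I) => q.2.2)); last exact: set_val_continuous.
    by apply: cont_comp; exact: cont_snd.
  by apply: (@cont_comp _ _ _ (fun q : R * (P * I) => q.2) (fun q : P * I => F q.1 q.2));
    [exact: cont_snd|].
have := cKI _ (nbhs (0 : R)) (fun h q => `|G (h, q)| <= e) _.
case=> [[p x] _|d /= d0 dP].
  have := @cvgrPdist_le _ _ _ (nbhs ((0 : R), (p, x))) _ G (G (0, (p, x))).
  case=> /(_ (cG _))/(_ _ e0) + _.
  have -> : G (0, (p, x)) = 0 by rewrite /G /= addr0 clampK subrr.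
  move=> [[U W] /= [U0 Wp] UW]; exists (W, U) => // -[q h] [/= Wq Uh] _.
  by have := UW (h, q) (conj Uh Wq); rewrite sub0r normrN.
exists (d / 2); first by rewrite divr_gt0.
move=> p Kp x y xy.
have := dP (set_val x - set_val y).
rewrite /= sub0r normrN => /(_ _ (p, y)) H.
have {}H := H _ (conj Kp Logic.I).
move: H; rewrite /G /= subrKC clampK; apply.
by rewrite (le_lt_trans xy)// ltr_pdivrMr// ltr_pMr// ltrDl.
Qed.

Lemma itv_unif (Z : set I) (V : normedModType R) (F : itv_algebra Z V) e : 0 < e ->
  exists2 d : R, 0 < d & forall x y : I, `|set_val x - set_val y| <= d -> `|F x - F y| <= e.
Proof.
move=> e0.
have cF : continuous (fun q : R * I => F q.2).
  by apply: (@cont_comp _ _ _ snd F); [exact: cont_snd|exact: itv_continuous].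
have [d d0 dP] := joint_unif (F := fun=> F) (@compact_set1 _ (0 : R)) cF e0.
by exists d => // x y; exact: (dP 0).
Qed.

Definition tent (y : R) : R := Num.max 0 (1 - `|y|).

Lemma tent_continuous : continuous tent.
Proof.
apply: cont_max; first exact: cst_continuous.
by apply: contB; [exact: cst_continuous|apply: cont_norm; exact: cont_id].
Qed.

Lemma tent_sum n (y : R) : 0 <= y -> \sum_(i < n.+1) tent (y - i%:R) =
  Num.min 1 (Num.max 0 (n.+1%:R - y)).
Proof.
move=> y0; elim: n => [|n IH].
  by rewrite big_ord_recl big_ord0 addr0 subr0 /tent ger0_norm//; minmax.
rewrite big_ord_recr /= IH /tent [n.+2%:R]mulrSr.
set z := n.+1%:R; clearbody z.
case: (lerP 0 (y - z)) => h; rewrite ?(ger0_norm h) ?(ltr0_norm h); minmax.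
Qed.

Lemma tent_ge0 y : 0 <= tent y.
Proof. by rewrite /tent le_max lexx. Qed.

(** The piecewise linear partition of unity with nodes i / n. *)
Definition hat n (i : nat) (x : I) : R := tent (n%:R * set_val x - i%:R).

Lemma hat_sum n x : \sum_(i < n.+1) hat n i x = 1.
Proof.
rewrite tent_sum ?mulr_ge0 ?val_itv_ge0//.
have := val_itv_le1 x; set z := set_val x => z1.
have : n%:R * z <= n%:R by rewrite ler_piMr.
rewrite [n.+1%:R]mulrSr; set w := n%:R * z; set v := n%:R.
by move=> h; minmax.
Qed.

Lemma hat_continuous n i : continuous (hat n i).
Proof.
apply: (@cont_comp _ _ _ (fun x : I => n%:R * set_val x - i%:R : R) tent); last exact: tent_continuous.
apply: contB; last exact: cst_continuous.
by apply: contZ; [exact: cst_continuous|exact: set_val_continuous].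
Qed.

Lemma hat_endpoints n i x : endpoints x -> (0 < i < n)%N -> hat n i x = 0.
Proof.
move=> xe /andP[i0 iN]; rewrite /hat /tent; apply/max_idPl; rewrite subr_le0.
have i1 : 1 <= i%:R :> R by rewrite ler1n.
have iN1 : i%:R + 1 <= n%:R :> R by rewrite -mulrSr ler_nat.
case: xe => ->; rewrite ?set_val_clamp0 ?set_val_clamp1 ?mulr0 ?mulr1.
  by rewrite sub0r normrN ger0_norm.
by rewrite ger0_norm; lra.
Qed.

Definition itv_hat n (i : 'I_n) : itv_algebra endpoints R^o.
Proof.
refine (@mk_itv _ endpoints R^o (hat n.+1 i.+1) _ _); first exact: hat_continuous.
by move=> x xe; apply: hat_endpoints; rewrite //= ltnS ltn_ord.
Defined.

Lemma hat_approx (V : normedModType R) (F : suspension V) e : 0 < e ->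
  exists n, forall x, `|F x - \sum_(i < n) hat n.+1 i.+1 x *: F (clamp (i.+1%:R / n.+1%:R))| <= e.
Proof.
move=> e0; have [d d0 dP] := itv_unif F e0.
have [n nP] := small_nat d0; exists n => x.
pose p i := clamp (i%:R / n.+1%:R) : I.
have n0 : (0 : R) < n.+1%:R by rewrite ltr0n.
(* [F] vanishes at both ends, so that the two extreme hats may be added to complete the partition of
   unity. *)
have -> : \sum_(i < n) hat n.+1 i.+1 x *: F (clamp (i.+1%:R / n.+1%:R)) =
    \sum_(i < n.+2) hat n.+1 i x *: F (p i).
  rewrite big_ord_recl big_ord_recr /= /p mul0r divff ?gt_eqF//.
  rewrite !(itv_vanish F) ?scaler0 ?add0r ?addr0; [|by right|by left].
  by apply: eq_bigr.
have -> : F x = \sum_(i < n.+2) hat n.+1 i x *: F x by rewrite -scaler_suml hat_sum scale1r.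
rewrite -sumrB.
rewrite (le_trans (ler_norm_sum _ _ _))//.
have -> : e = \sum_(i < n.+2) hat n.+1 i x * e by rewrite -mulr_suml hat_sum mul1r.
apply: ler_sum => i _.
rewrite -scalerBr normrZ ger0_norm ?tent_ge0//.
have [h|h] := leP 1 `|n.+1%:R * set_val x - i%:R|.
  by rewrite /hat /tent (max_idPl _) ?subr_le0// !mul0r.
rewrite ler_wpM2l ?tent_ge0//; apply: dP.
have i01 : 0 <= i%:R / n.+1%:R :> R by rewrite divr_ge0.
have i1 : i%:R / n.+1%:R <= 1 :> R by rewrite ler_pdivrMr// mul1r ler_nat -ltnS ltn_ord.
rewrite set_valE /= min_l// max_r//.
rewrite (le_trans _ (nP n _))// -(ler_pM2l n0) divff ?gt_eqF//.
rewrite -{1}(ger0_norm (ltW n0)) -normrM mulrBr [X in _ - X]mulrC divfK ?gt_eqF//.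
exact: ltW.
Qed.

Lemma susp_tensor_dense (A : realCstarType R) (F : suspension A) e : 0 < e ->
  exists n (f : 'I_n -> itv_algebra endpoints R^o) (a : 'I_n -> A),
    `|F - \sum_(i < n) susp_tensor (f i) (a i)| <= e.
Proof.
move=> e0; have [n nP] := hat_approx F e0.
exists n, (@itv_hat n), (fun i => F (clamp (i.+1%:R / n.+1%:R))).
apply/itv_normP => x; rewrite itvDE itvNE.
rewrite (big_morph (fun G : suspension A => G x) (fun G H => itvDE G H x) (itv0E _ _ x)).
exact: nP.
Qed.

Lemma separable_susp (A : realCstarType R) : separable A -> separable (suspension A).
Proof.
move=> /separable_seq[d dP].
pose D (l : seq nat) : suspension A :=
  \sum_(i < size l) susp_tensor (itv_hat i) (d (nth 0 l i)%N).
exists (range D); split; first by apply: sub_countable (card_image_le _ _) _; exact: countableP.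
move=> O [F OF] oO.
have /nbhs_ballP[e e0 eO] : nbhs F O by exact: open_nbhs_nbhs.
have e4 : 0 < e / 4 by rewrite divr_gt0.
have [n nP] := hat_approx F e4.
have /choice[l lP] : forall i : nat, exists j, `|F (clamp (i.+1%:R / n.+1%:R)) - d j| < e / 4.
  by move=> i; exact: dP.
exists (D (mkseq l n)); split; last by exists (mkseq l n).
apply: eO; rewrite -ball_normE /=; apply: (@le_lt_trans _ _ (e / 2)); last first.
  by rewrite ltr_pdivrMr// ltr_pMr// ltrDl.
apply/itv_normP => x; rewrite itvDE itvNE.
rewrite (big_morph (fun G : suspension A => G x) (fun G H => itvDE G H x) (itv0E _ _ x)).
have -> : \sum_(i < size (mkseq l n)) (susp_tensor (itv_hat i) (d (nth 0 (mkseq l n) i)%N)) x =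
   \sum_(i < n) hat n.+1 i.+1 x *: d (l i).
  by rewrite size_mkseq; apply: eq_bigr => i _ /=; rewrite nth_mkseq.
rewrite -(subrKA (\sum_(i < n) hat n.+1 i.+1 x *: F (clamp (i.+1%:R / n.+1%:R)))).
rewrite (le_trans (ler_normD _ _))//.
have := nP x; suff : `|\sum_(i < n) hat n.+1 i.+1 x *: F (clamp (i.+1%:R / n.+1%:R)) -
  \sum_(i < n) hat n.+1 i.+1 x *: d (l i)| <= e / 4 by lra.
rewrite -sumrB (le_trans (ler_norm_sum _ _ _))//.
apply: (@le_trans _ _ (\sum_(i < n) hat n.+1 i.+1 x * (e / 4))).
  apply: ler_sum => i _; rewrite -scalerBr normrZ ger0_norm ?tent_ge0//.
  by rewrite ler_wpM2l ?tent_ge0// ltW.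
rewrite -mulr_suml ler_piMl ?(ltW e4)// -(hat_sum n.+1 x) big_ord_recl big_ord_recr /=.
by rewrite addrCA lerDl addr_ge0// tent_ge0.
Qed.

End uniform.

Section agreement.
Variables (R : realType) (A B : realCstarType R) (phi psi : asym A B).

Let P a := phi t a - psi t a @[t --> +oo_R] --> (0 : B).

Lemma agreeD a b : P a -> P b -> P (a + b).
Proof.
move=> Pa Pb.
apply: cvg0_eq (cvg0D (cvg0D (asymD phi a b) (cvg0N (asymD psi a b))) (cvg0D Pa Pb)) => t _.
by lmod_gen R B.
Qed.

Lemma agree_sum n (a : 'I_n -> A) : (forall i, P (a i)) -> P (\sum_(i < n) a i).
Proof.
move=> Pa; elim/big_ind: _ => //; last exact: agreeD.
exact: cvg0D (asym_at0 phi) (cvg0N (asym_at0 psi)).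
Qed.

(** Asymptotic contractivity makes asymptotic agreement a closed condition. *)
Lemma agree_closed a : (forall e, 0 < e -> exists b, P b /\ `|a - b| <= e) -> P a.
Proof.
move=> Pa; apply/null_normP => e e0; have e8 : 0 < e / 8 by rewrite divr_gt0.
have [b [/null_normP/(_ _ e8) Pb ab]] := Pa _ e8.
have h1 := asym_near_lip phi a b e8; have h2 := asym_near_lip psi a b e8.
apply: filterS3 Pb h1 h2 => t h1 h2 h3.
rewrite (_ : _ - _ = phi t a - phi t b + (phi t b - psi t b) - (psi t a - psi t b)); last by lmod_gen R B.
rewrite (le_trans (ler_normB _ _))// (le_trans (lerD (ler_normD _ _) (lexx _)))//.
move: ab h1 h2 h3 e0; clear; lra.
Qed.

End agreement.

Section suspension_map.
Variables (R : realType).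

Lemma itv_fam_aeq (Z : set (unit_itv R)) (A B : normedModType R) (phi psi : R -> A -> B)
  (np : nice phi) (nq : nice psi) : aeq phi psi -> aeq (itv_fam (Z := Z) np) (itv_fam (Z := Z) nq).
Proof.
move=> pp F; apply: itv_null => [|x]; last exact: pp.
by apply: qcB; apply: qc_nice => //; exact: itv_continuous.
Qed.

Lemma is_suspension_itv (A B : realCstarType R) (phi psi : asym A B) (np : nice psi) :
  aeq psi phi -> is_suspension phi (itv_asym endpoints np).
Proof.
move=> pp f a; apply: itv_null => [|x].
  apply: (@qcB _ _ _ (fun t x => psi t (f x *: a)) (fun t x => f x *: phi t a)).
    apply: (qc_nice np (x := fun x => (f x : R) *: a)).
    by apply: contZ; [exact: (@itv_continuous _ _ R^o f)|exact: cst_continuous].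
  apply: (@qcZ _ _ _ (f : _ -> R) (fun t x => phi t a)).
    exact: (@itv_continuous _ _ R^o f).
  split=> [x|x e e0].
    have [M phiM] := asym_bounded (asymP phi) a; exists M.
    by apply: filterS (nbhs_pinfty_ge (num_real 1)) => t /phiM.
  exists setT; split; first exact: filterT.
  by apply: nearW => t x' _; rewrite subrr normr0 ltW.
have h1 := asymZ psi (f x : R) a; have h2 := cvg0Z (f x : R) (pp a).
apply: cvg0_eq (cvg0D h1 h2) => t _.
by rewrite itvDE itvNE /=; lmod_gen R B.
Qed.

Lemma is_suspension_unique (A B : realCstarType R) (phi : asym A B)
  (Phi Psi : asym (suspension A) (suspension B)) :
  is_suspension phi Phi -> is_suspension phi Psi -> aeq Phi Psi.
Proof.
move=> h1 h2 F; apply: agree_closed => e e0.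
have [n [f [a Fe]]] := susp_tensor_dense F e0.
exists (\sum_(i < n) susp_tensor (f i) (a i)); split=> //.
have := @agree_sum R _ _ Phi Psi n (fun i => susp_tensor (f i) (a i)); apply => i.
by apply: cvg0_eq (cvg0D (h1 (f i) (a i)) (cvg0N (h2 (f i) (a i)))) => t _; lmod_gen R (suspension B).
Qed.

Variables (A B : realCstarType R) (sepA : separable A).

(** The homotopy is regularized before it is suspended. Its ends then agree with [phi] and [psi]
    only asymptotically, and straight lines join them. *)
Lemma susp_homotopic (Z : set (unit_itv R)) (phi psi : asym A B) (np : nice phi) (nq : nice psi) :
  homotopic phi psi -> homotopic (itv_asym Z np) (itv_asym Z nq).
Proof.
move=> [H HP]; have [G [nG GH]] := asym_nice H sepA.
pose ev x := asym_post (itv_ev set0 B x) G.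
have nev x : nice (ev x) by exact: nice_post_hom.
have aev x (chi : asym A B) : (forall t a, 1 <= t -> H t a x = chi t a) -> aeq (ev x) chi.
  move=> Hx a; apply: cvg0_eq (cvg0_hom (itv_ev set0 B x) (GH a)) => t t1.
  by rewrite starhomB /= Hx.
have h0 := itv_fam_aeq (Z := Z) (nev _) np (aev (clamp 0) phi (fun t a t1 => (HP t a t1).1)).
have h1 := itv_fam_aeq (Z := Z) (nev _) nq (aev (clamp 1) psi (fun t a t1 => (HP t a t1).2)).
apply: homotopic_trans (aeq_homotopic (phi := itv_asym Z np) (psi := itv_asym Z (nev (clamp 0))) (aeq_sym h0)) _.
apply: homotopic_trans _ (aeq_homotopic (phi := itv_asym Z (nev (clamp 1))) (psi := itv_asym Z nq) h1).
exists (asym_post (swap Z set0 B) (itv_asym Z nG)) => t F t1.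
by split; apply/itv_eqP => x.
Qed.

(** The second clause computes [Sigma] on representatives that act pointwise, the form in which it
    is used for bijectivity. *)
Lemma suspension_map : exists Sigma : homotopy_classes A B ->
    homotopy_classes (suspension A) (suspension B),
  is_suspension_map Sigma /\
  forall (psi : asym A B) (np : nice psi), Sigma (hclass psi) = hclass (itv_asym endpoints np).
Proof.
have rep (x : homotopy_classes A B) : exists y, exists (psi : asym A B) (np : nice psi),
    hclass psi = x /\ y = hclass (itv_asym endpoints np).
  have [psi [np pp]] := asym_nice (hrepr x) sepA.
  exists (hclass (itv_asym endpoints np)), psi, np; split=> //.
  by rewrite -(hreprK x); apply/hclassP/aeq_homotopic.
have [Sigma SP] := choice rep.
have SE (psi : asym A B) (np : nice psi) : Sigma (hclass psi) = hclass (itv_asym endpoints np).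
  have [chi [nc [/hclassP cp ->]]] := SP (hclass psi).
  exact/hclassP/susp_homotopic.
exists Sigma; split=> // phi.
have [psi [np pp]] := asym_nice phi sepA; have sp := is_suspension_itv np pp.
split; first by exists (itv_asym endpoints np).
move=> Phi sPhi.
rewrite -(_ : hclass psi = hclass phi); last by apply/hclassP/aeq_homotopic.
rewrite (SE _ np); apply/hclassP/aeq_homotopic.
exact: is_suspension_unique sp sPhi.
Qed.

End suspension_map.

(** * Reparametrizations and compositions *)

Section fast.
Variable R : realType.

(* [P] holds for all continuous reparametrizations that grow fast enough. *)
Definition fast (P : (R -> R) -> Prop) := exists2 p0 : R -> R, continuous p0 &
  forall p : R -> R, continuous p -> (forall t, p0 t <= p t) -> P p.

Lemma fast_and P Q : fast P -> fast Q -> fast (fun p => P p /\ Q p).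
Proof.
move=> [p cp pP] [q cq qQ]; exists (fun t => Num.max (p t) (q t)); first exact: cont_max.
move=> r cr rP; split; [apply: pP => // t|apply: qQ => // t].
  by rewrite (le_trans _ (rP t))// le_max lexx.
by rewrite (le_trans _ (rP t))// le_max lexx orbT.
Qed.

Lemma fast_mono (P Q : (R -> R) -> Prop) :
  (forall p, continuous p -> P p -> Q p) -> fast P -> fast Q.
Proof. by move=> PQ [p cp pP]; exists p => // q cq pq; apply: PQ => //; exact: pP. Qed.

Lemma fast_ex P : fast P -> exists2 p : R -> R, continuous p & P p.
Proof. by move=> [p cp pP]; exists p => //; exact: pP. Qed.

Lemma fast_ge : fast (fun p => forall t, t <= p t).
Proof. by exists id => //; exact: cont_id. Qed.

Lemma majorant (M : nat -> R) : exists2 p : R -> R, continuous p &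
  forall n s, n%:R <= s -> s <= n.+1%:R -> M n <= p s.
Proof.
pose w (y : R) := Num.max 0 (Num.min 1 y).
have cw : continuous w.
  apply: cont_max; first exact: cst_continuous.
  by apply: cont_min; [exact: cst_continuous|exact: cont_id].
(* The k-th term is 0 up to s = k - 1 and complete from s = k on; so [Q N s] does not depend on N as
   soon as N >= s + 1. *)
pose Q N s := \sum_(k < N) `|M k| * w (s - k%:R + 1).
have Q0 N s k : s + 1 <= N%:R -> (N <= k)%N -> w (s - k%:R + 1) = 0.
  move=> sN; rewrite -(ler_nat R) => Nk; rewrite /w; minmax.
have QS N s m : s + 1 <= N%:R -> Q (N + m)%N s = Q N s.
  move=> sN; rewrite /Q big_split_ord /= [X in _ + X]big1 ?addr0// => i _.
  by rewrite (Q0 _ _ _ sN) ?mulr0// leq_addr.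
have QE N N' s : s + 1 <= N%:R -> s + 1 <= N'%:R -> Q N s = Q N' s.
  by move=> h h'; rewrite -(QS N s N' h) addnC QS.
pose b (s : R) := (Num.bound `|s|).+1.
have bP s : s + 1 <= (b s)%:R.
  rewrite /b mulrSr lerD2r (le_trans (ler_norm _))// ltW// archi_boundP//.
exists (fun s => Q (b s) s).
  apply: cont_local => s.
  exists (Q (b s).+1); split.
    apply: cont_sum => k; apply: cont_mulr; first exact: cst_continuous.
    apply: (@cont_comp _ _ _ (fun s : R => s - k%:R + 1) w) => //.
    apply: contD; last exact: cst_continuous.
    by apply: contB; [exact: cont_id|exact: cst_continuous].
  have : \forall s' \near s, s' < s + 1 by apply: lt_nbhsl; rewrite ltrDl.
  apply: filterS => s' s's; apply: QE; first exact: bP.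
  by rewrite [leRHS]mulrSr lerD2r ltW// (lt_le_trans s's).
move=> n s ns sn.
have -> : Q (b s) s = Q (b s + n.+1)%N s by rewrite QS.
have nb : (n < b s + n.+1)%N by rewrite ltn_addl.
rewrite /Q (bigD1 (Ordinal nb)) //= (_ : w _ = 1) ?mulr1; last first.
  by rewrite /w min_l ?max_r//; lra.
rewrite (le_trans (ler_norm _))// lerDl sumr_ge0// => i _.
by rewrite mulr_ge0// /w le_max lexx.
Qed.

(** A diagonal argument: for s between n and n + 1, p(s) exceeds the thresholds of the conditions 0,
    ..., n. *)
Lemma fast_seq (P : nat -> R -> R -> Prop) :
  (forall i S, \forall T \near +oo_R, forall s, 1 <= s <= S -> P i s T) ->
  fast (fun p => forall i, \forall s \near +oo_R, P i s (p s)).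
Proof.
move=> PS.
have /choice[T TP] : forall iS : nat * nat, exists T0, forall T, T0 < T -> forall s,
    1 <= s <= iS.2%:R -> P iS.1 s T.
  move=> [i S]; have [T0 [_ T0P]] := PS i S%:R; exists T0 => T; exact: T0P.
pose M n := 1 + \sum_(i < n.+1) `|T (i : nat, n.+1)|.
have [p0 cp0 pM] := majorant M; exists p0 => // p cp pp i.
near=> s.
have s0 : 0 <= s by near: s; apply: nbhs_pinfty_ge; rewrite num_real.
have s1 : 1 <= s by near: s; apply: nbhs_pinfty_ge; rewrite num_real.
have si : i.+1%:R <= s by near: s; apply: nbhs_pinfty_ge; rewrite num_real.
have /andP[ns sn] := truncn_itv s0; set n := Num.truncn s in ns sn.
have i_n : (i < n.+1)%N.
  by rewrite -(ltr_nat R) (le_lt_trans _ sn)// (le_trans _ si)// ler_nat.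
apply: (TP (i, n.+1)) => /=; last by rewrite s1 ltW.
apply: lt_le_trans (pp s); apply: lt_le_trans (pM n s ns (ltW sn)).
rewrite /M (bigD1 (Ordinal i_n)) //= addrCA.
rewrite (le_lt_trans (ler_norm _))// ltrDl ltr_wpDr//.
by apply: sumr_ge0.
Unshelve. all: by end_near.
Qed.

Lemma fast_countable (X : Type) (D : set X) (P : X -> R -> R -> Prop) : countable D ->
  (forall x S, \forall T \near +oo_R, forall s, 1 <= s <= S -> P x s T) ->
  fast (fun p => forall x, D x -> \forall s \near +oo_R, P x s (p s)).
Proof.
move=> /countable_injP[f fI] PS.
have := @fast_seq (fun n s T => forall x, D x -> f x = n -> P x s T) _.
have H : forall i S, \forall T \near +oo_R, forall s, 1 <= s <= S ->
    forall x, D x -> f x = i -> P x s T.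
  move=> i S; have [[x [Dx fx]]|nx] := pselect (exists x, D x /\ f x = i).
    apply: filterS (PS x S) => T h s /h {}h y Dy fy.
    by rewrite (fI y x) ?inE// fx fy.
  by apply: nearW => T s _ x Dx fx; case: nx; exists x.
move=> /(_ H); apply: fast_mono => p cp h x Dx.
by apply: filterS (h (f x)) => s; exact.
Qed.

Lemma inv1_null e : 0 < e -> \forall s \near +oo_R, (1 + s : R)^-1 <= e.
Proof.
move=> e0; near=> s.
have h : e^-1 <= s by near: s; apply: nbhs_pinfty_ge; rewrite num_real.
have e1 : 0 < e^-1 by rewrite invr_gt0.
have s0 : 0 < 1 + s by rewrite addr_gt0// (lt_le_trans e1 h).
by rewrite -[leRHS]invrK lef_pV2 ?posrE// (le_trans h)// lerDr.
Unshelve. all: by end_near.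
Qed.

(** [U T s] is the defect of a composite, with inner time s and outer time T. The error [o s] is due
    to the inner family and does not improve with T, while the outer error becomes small, for
    bounded s, as T grows. Equicontinuity extends the conclusion from the dense set. *)
Lemma fast_null (X : topologicalType) (V : normedModType R) (D : set X)
    (U : R -> R -> X -> V) : countable D -> dense D ->
  fast (fun p => qc (fun t x => U (p t) t x)) ->
  (forall x, exists2 o : R -> R, (forall e, 0 < e -> \forall s \near +oo_R, o s <= e) &
     forall S e, 0 < e -> \forall T \near +oo_R, forall s, 1 <= s <= S -> `|U T s x| <= o s + e) ->
  fast (fun p => forall x, U (p t) t x @[t --> +oo_R] --> (0 : V)).
Proof.
move=> cD dD fqc Uo.
have /choice[o oP] : forall x, exists o : R -> R,
    (forall e, 0 < e -> \forall s \near +oo_R, o s <= e) /\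
    forall S e, 0 < e -> \forall T \near +oo_R, forall s, 1 <= s <= S -> `|U T s x| <= o s + e.
  by move=> x; have [o o1 o2] := Uo x; exists o.
have H x S : \forall T \near +oo_R, forall s, 1 <= s <= S -> `|U T s x| <= o x s + (1 + s)^-1.
  pose S1 := Num.max 1 S.
  have S0 : 0 < (1 + S1)^-1 by rewrite invr_gt0 addr_gt0// lt_max ltr01.
  apply: filterS ((oP x).2 S _ S0) => T h s /[dup] /h {}h /andP[s1 sS].
  rewrite (le_trans h)// lerD2l lef_pV2 ?posrE ?addr_gt0 ?(lt_le_trans ltr01 s1)//.
    by rewrite lerD2l le_max sS orbT.
  by rewrite lt_max ltr01.
have fP := fast_countable cD H.
apply: fast_mono (fast_and fqc fP) => p cp [qU pP].
apply: qc_dense qU dD _ => x Dx; apply/null_normP => e e0.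
have e2 : 0 < e / 2 by rewrite divr_gt0.
apply: filterS3 (pP x Dx) ((oP x).1 _ e2) (inv1_null e2) => s h1 h2 h3.
by rewrite (le_trans h1)// (splitr e) lerD.
Qed.

Lemma separable_prod (X Y : topologicalType) : separable X -> separable Y -> separable (X * Y)%type.
Proof.
move=> [D [cD dD]] [D' [cD' dD']]; exists (D `*` D'); split; first exact: countableX.
move=> O [[x y] Oxy] oO.
have [[U W] /= [xU yW] UW] : nbhs (x, y) O by exact: open_nbhs_nbhs.
have [x' [Ux' Dx']] : (U^° `&` D) !=set0.
  by apply: dD; [exists x|exact: open_interior].
have [y' [Wy' Dy']] : (W^° `&` D') !=set0.
  by apply: dD'; [exists y|exact: open_interior].
exists (x', y'); split=> //; apply: UW.
by split; exact: interior_subset.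
Qed.

Lemma separable_real : separable R.
Proof.
exists (range (@ratr R)); split; last exact: dense_rat.
by apply: sub_countable (card_image_le _ _) _; exact: countableP.
Qed.

Section composition.
Variables (A B : realCstarType R) (Psi : asym A B) (nPsi : nice Psi).

Let compact_itv S : compact (`[1, S]%classic : set R).
Proof. exact: segment_compact. Qed.

Lemma comp_near (X Y : R -> A) : continuous X -> continuous Y ->
  exists2 C, 0 <= C & forall S e, 0 < e -> \forall T \near +oo_R, forall s, 1 <= s <= S ->
    `|Psi T (Y s) - Psi T (X s)| <= C * `|Y s - X s| + e.
Proof.
move=> cX cY; have [C C0 PC] := nice_qlip_compact nPsi; exists C => // S e e0.
have cK : compact (X @` `[1, S]%classic).
  by apply: continuous_compact; [exact: continuous_subspaceT|exact: compact_itv].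
apply: filterS (PC _ _ cK e0) => T h s s1S; apply: h; exists s => //.
Qed.

Lemma comp_null (W : normedModType R) (u : R -> R -> W) : qc u ->
  (forall s, u T s @[T --> +oo_R] --> (0 : W)) ->
  forall S e, 0 < e -> \forall T \near +oo_R, forall s, 1 <= s <= S -> `|u T s| <= e.
Proof.
move=> qu u0 S e e0.
apply: filterS (qc_compact qu (fun s _ => u0 s) (@compact_itv S) e0) => T h s s1S.
by apply: h; rewrite /= in_itv.
Qed.

Variables (D : realCstarType R) (sepD : separable D).

(** The estimate of Psi at the points c s (d i), for s bounded, holds from some T on; a fast p
    reaches this time for each of the countably many points d i. The point d i nearest to a given
    [a] then serves as an intermediate. *)
Lemma fast_nice (c : R -> D -> A) : nice c -> fast (fun p => nice (fun t a => Psi (p t) (c t a))).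
Proof.
move=> nc; have [C C0 PC] := nice_qlip_compact nPsi.
have [d dP] := separable_seq sepD.
have := @fast_seq (fun i s T => forall b, `|Psi T b - Psi T (c s (d i))| <= C * `|b - c s (d i)| + (1 + s)^-1) _.
have H : forall i S, \forall T \near +oo_R, forall s, 1 <= s <= S ->
    forall b, `|Psi T b - Psi T (c s (d i))| <= C * `|b - c s (d i)| + (1 + s)^-1.
  move=> i S; pose S1 := Num.max 1 S.
  have S0 : 0 < (1 + S1)^-1 by rewrite invr_gt0 addr_gt0// lt_max ltr01.
  have cK : compact ((c ^~ (d i)) @` `[1, S]%classic).
    apply: continuous_compact; last exact: compact_itv.
    by apply: continuous_subspaceT; exact: nice_continuous_t.
  apply: filterS (PC _ _ cK S0) => T h s /andP[s1 sS] b.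
  rewrite (le_trans (h _ _ _))//; first by exists s => //; rewrite /= in_itv/= s1.
  rewrite lerD2l lef_pV2 ?posrE ?addr_gt0 ?(lt_le_trans ltr01 s1)//.
    by rewrite lerD2l le_max sS orbT.
  by rewrite lt_max ltr01.
move=> /(_ H) fP; apply: fast_mono (fast_and fast_ge fP) => p cp [pt pP]; split.
- apply: (@cont_comp _ _ _ (fun q : R * D => (p q.1, c q.1 q.2)) (fun q => Psi q.1 q.2)).
    apply: cont_pair; last exact: (nice_continuous nc).
    by apply: cont_comp; [exact: cont_fst|].
  exact: (nice_continuous nPsi).
- by move=> t; rewrite (nice_at0 nc) (nice_at0 nPsi).
have [C' C'0 cC'] := nice_qlip nc; exists (C * C'); first exact: mulr_ge0.
(* [k] adds up the constants in front of the small quantity f in the estimates below. *)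
move=> a e e0; pose k := 4 * (C * C') + 2 * C + 4.
have k0 : 0 < k by rewrite ltr_wpDl// addr_ge0// ?mulr_ge0// mulr_ge0.
pose f := e / k; have f0 : 0 < f by rewrite divr_gt0.
have ek : e = k * f by rewrite mulrC divfK// gt_eqF.
clearbody f; have [i ai] := dP a _ f0.
apply: filterS3 (pP i) (cC' (d i) _ f0) (inv1_null f0) => t h1 h2 h3 b.
have h4 := h1 (c t b); have h5 := h1 (c t a).
have h6 := ler_wpM2l C0 (h2 b); have h7 := ler_wpM2l C0 (h2 a).
have h8 : C * (C' * `|b - d i|) <= C * (C' * `|b - a|) + C * (C' * `|a - d i|).
  by rewrite -!mulrDr !ler_wpM2l// -{1}(subrKA a) ler_normD.
have h9 : C * (C' * `|a - d i|) <= C * (C' * f) by rewrite !ler_wpM2l// ltW.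
rewrite -(subrKA (Psi (p t) (c t (d i)))) (le_trans (ler_normD _ _))//.
rewrite (distrC (Psi (p t) (c t (d i)))) ek /k !mulrDl -!mulrA.
have g1 : 0 <= C * (C' * f) by rewrite !mulr_ge0// ltW.
have g2 : 0 <= C * f by rewrite mulr_ge0// ltW.
move: f0 g1 g2 h3 h4 h5 h6 h7 h8 h9; rewrite !mulrDr; move: ((1 + t)^-1) => r.
move: (`|Psi _ _ - _|) => y1; move: (`|Psi _ _ - _|) => y2.
clear; lra.
Qed.

End composition.
End fast.

(** * Finite systems of asymptotic relations and their composition *)

Section systems.
Variable R : realType.

Lemma fast_fin (J : finType) (P : J -> (R -> R) -> Prop) : (forall j, fast (P j)) ->
  fast (fun p => forall j, P j p).
Proof.
move=> fP; have /choice[q qP] : forall j, exists q : R -> R, continuous q /\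
    forall p : R -> R, continuous p -> (forall t, q t <= p t) -> P j p.
  by move=> j; have [q cq qP] := fP j; exists q.
exists (fun t => \sum_j `|q j t|).
  by apply: cont_sum => j; apply: cont_norm; exact: (qP j).1.
move=> p cp qp j; apply: (qP j).2 => // t; apply: le_trans (qp t).
rewrite (bigD1 j)//= (le_trans (ler_norm _))// lerDl.
by apply: sumr_ge0.
Qed.

(* Families of maps [c j] with the involution [st] on the indices, and with the
   relations [sum_(k, l) c k a * c l b = c j (a * b)], or [= 0], asymptotically. *)
Record is_system (J I : finType) (st : J -> J) (rel : I -> seq (J * J) * option J)
    (D A : realCstarType R) (c : J -> R -> D -> A) : Prop := System {
  sys_nice : forall j, nice (c j);
  sys_linear : forall j (k : R) a b,
    c j t (k *: a + b) - (k *: c j t a + c j t b) @[t --> +oo_R] --> (0 : A);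
  sys_star : forall j a, c j t (cstar a) - cstar (c (st j) t a) @[t --> +oo_R] --> (0 : A);
  sys_mul : forall i a b, \sum_(q <- (rel i).1) c q.1 t a ** c q.2 t b -
    (if (rel i).2 is Some j then c j t (a ** b) else 0) @[t --> +oo_R] --> (0 : A)
}.

Lemma nice_zero (A B : normedModType R) : nice (fun (_ : R) (_ : A) => 0 : B).
Proof.
split=> //; first exact: cst_continuous.
by exists 0 => // a e e0; apply: nearW => t b; rewrite subrr normr0 mul0r add0r ltW.
Qed.

Lemma asym_sum_mul (A B : realCstarType R) (Psi : asym A B) (X : Type) (s : seq X) (x y : X -> A) :
  \sum_(i <- s) Psi t (x i) ** Psi t (y i) - Psi t (\sum_(i <- s) x i ** y i) @[t --> +oo_R] --> (0 : B).
Proof.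
elim: s => [|i s IH].
  by apply: cvg0_eq (cvg0N (asym_at0 Psi)) => t _; rewrite !big_nil sub0r.
have h1 := asym_mul (asymP Psi) (x i) (y i).
have h2 := asymD Psi (x i ** y i) (\sum_(i <- s) x i ** y i).
apply: cvg0_eq (cvg0D IH (cvg0N (cvg0D h1 h2))) => t _.
by rewrite !big_cons; lmod_gen R B.
Qed.

Section composition.
Variables (A B D : realCstarType R) (Psi : asym A B) (nPsi : nice Psi) (sepD : separable D).
Variables (J I : finType) (st : J -> J) (rel : I -> seq (J * J) * option J).
Variables (c : J -> R -> D -> A) (sc : is_system st rel c).

Let nc := sys_nice sc.
Let comp (p : R -> R) j t a := Psi (p t) (c j t a).

Let fast_comp_nice : fast (fun p => forall j, nice (comp p j)).
Proof. by apply: fast_fin => j; apply: fast_nice. Qed.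

Let null_le (W : normedModType R) (u : R -> W) C : 0 <= C -> u t @[t --> +oo_R] --> (0 : W) ->
  forall e, 0 < e -> \forall s \near +oo_R, C * `|u s| <= e.
Proof.
move=> C0 u0 e e0; have /null_normP/(_ _ e0) := cvg0Z C u0.
by apply: filterS => s; rewrite normrZ ger0_norm.
Qed.

(** [Y] and [Z] are the two sides of a relation of the inner family, which hold asymptotically in s;
    [U] is the same relation for the composite, and differs from Psi Y - Psi Z by a defect of Psi
    alone. *)
Let fast_rel (X : topologicalType) (sX : separable X) (U : R -> R -> X -> B)
    (Y Z : X -> R -> A) : 
  (forall x, continuous (Y x)) -> (forall x, continuous (Z x)) ->
  (forall p, continuous p -> (forall j, nice (comp p j)) -> qc (fun t x => U (p t) t x)) ->
  (forall x, Y x t - Z x t @[t --> +oo_R] --> (0 : A)) ->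
  (forall x s, U T s x - (Psi T (Y x s) - Psi T (Z x s)) @[T --> +oo_R] --> (0 : B)) ->
  (forall x, qc (fun T s => U T s x)) ->
  fast (fun p => forall x, U (p t) t x @[t --> +oo_R] --> (0 : B)).
Proof.
move=> cY cZ qU YZ UYZ qUs; have [E [cE dE]] := sX.
apply: (fast_null cE dE); first by apply: fast_mono fast_comp_nice => p cp; exact: qU.
move=> x; have [C C0 PC] := comp_near nPsi (cZ x) (cY x).
exists (fun s => C * `|Y x s - Z x s|); first exact: null_le.
move=> S e e0; have e2 : 0 < e / 2 by rewrite divr_gt0.
have qW : qc (fun T s => U T s x - (Psi T (Y x s) - Psi T (Z x s))).
  by apply: qcB => //; apply: qcB; exact: qc_nice.
apply: filterS2 (PC S _ e2) (comp_null qW (UYZ x) S e2) => T h1 h2 s s1.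
have := h1 s s1; have := h2 s s1.
rewrite -{2}(subrK (Psi T (Y x s) - Psi T (Z x s)) (U T s x)) => h3 h4.
rewrite (le_trans (ler_normD _ _))//; move: h3 h4; lra.
Qed.

Lemma fast_system : fast (fun p => is_system st rel (fun j t a => Psi (p t) (c j t a))).
Proof.
have cc j x : continuous (fun t : R => c j t x) by exact: nice_continuous_t.
have ccx (X : topologicalType) (f : X -> D) j s : continuous f -> continuous (fun x => c j s (f x)).
  by move=> cf; apply: (cont_comp cf); exact: nice_continuous_at.
have fst1 (X Y : topologicalType) : continuous (@fst X Y) by exact: cont_fst.
have snd1 (X Y : topologicalType) : continuous (@snd X Y) by exact: cont_snd.
have sepDD : separable (D * D)%type by exact: separable_prod.
have cfst2 : continuous (fun x : R * (D * D) => x.2.1) by exact: (cont_comp (snd1 _ _) (fst1 _ _)).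
have csnd2 : continuous (fun x : R * (D * D) => x.2.2) by exact: (cont_comp (snd1 _ _) (snd1 _ _)).
(* The scalar is made part of the point x: linearity becomes one condition on a separable space,
   instead of uncountably many. *)
have fl : fast (fun p => forall j (x : R * (D * D)),
    comp p j t (x.1 *: x.2.1 + x.2.2) - (x.1 *: comp p j t x.2.1 + comp p j t x.2.2)
    @[t --> +oo_R] --> (0 : B)).
  apply: fast_fin => j.
  apply: (@fast_rel (R * (D * D))%type _ (fun T s x => Psi T (c j s (x.1 *: x.2.1 + x.2.2)) -
      (x.1 *: Psi T (c j s x.2.1) + Psi T (c j s x.2.2)))
    (fun x s => c j s (x.1 *: x.2.1 + x.2.2))
    (fun x s => x.1 *: c j s x.2.1 + c j s x.2.2)).
  - by apply: separable_prod => //; exact: separable_real.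
  - by [].
  - by move=> x; apply: contD; [apply: contZ; [exact: cst_continuous|exact: cc]|exact: cc].
  - move=> p cp np; apply: qcB.
      by apply: (qc_nice (np j)); apply: contD; [apply: contZ; [exact: fst1|exact: cfst2]|exact: csnd2].
    by apply: qcD; [apply: qcZ; [exact: fst1|exact: (qc_nice (np j) cfst2)]|exact: (qc_nice (np j) csnd2)].
  - by move=> x; exact: (sys_linear sc).
  - move=> x s; apply: cvg0_eq (asym_linear (asymP Psi) x.1 (c j s x.2.1) (c j s x.2.2)) => T _.
    by lmod_gen R B.
  - move=> x; apply: qcB; first by apply: qc_nice => //; exact: cc.
    by apply: qcD; [apply: qcZ; [exact: cst_continuous|]|]; apply: qc_nice => //; exact: cc.
have fs : fast (fun p => forall j x, comp p j t (cstar x) - cstar (comp p (st j) t x)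
    @[t --> +oo_R] --> (0 : B)).
  apply: fast_fin => j.
  apply: (@fast_rel D sepD (fun T s x => Psi T (c j s (cstar x)) - cstar (Psi T (c (st j) s x)))
    (fun x s => c j s (cstar x)) (fun x s => cstar (c (st j) s x))).
  - by [].
  - by move=> x; apply: cont_star; exact: cc.
  - move=> p cp np; apply: qcB; last by apply: qc_star; apply: (qc_nice (np _)); exact: cont_id.
    by apply: (qc_nice (np j)); apply: cont_star; exact: cont_id.
  - by move=> x; exact: (sys_star sc).
  - move=> x s; apply: cvg0_eq (asym_star (asymP Psi) (c (st j) s x)) => T _.
    by lmod_gen R B.
  - by move=> x; apply: qcB; [|apply: qc_star]; apply: qc_nice => //; exact: cc.
have fm : fast (fun p => forall i (x : D * D), \sum_(q <- (rel i).1) comp p q.1 t x.1 ** comp p q.2 t x.2 -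
    (if (rel i).2 is Some j then comp p j t (x.1 ** x.2) else 0) @[t --> +oo_R] --> (0 : B)).
  apply: fast_fin => i.
  apply: (@fast_rel (D * D)%type sepDD (fun T s x =>
      \sum_(q <- (rel i).1) Psi T (c q.1 s x.1) ** Psi T (c q.2 s x.2) -
      (if (rel i).2 is Some j then Psi T (c j s (x.1 ** x.2)) else 0))
    (fun x s => \sum_(q <- (rel i).1) c q.1 s x.1 ** c q.2 s x.2)
    (fun x s => if (rel i).2 is Some j then c j s (x.1 ** x.2) else 0)).
  - by move=> x; apply: cont_sum => q; apply: contM; exact: cc.
  - by move=> x; case: ((rel i).2) => [j|]; [exact: cc|exact: cst_continuous].
  - move=> p cp np; apply: qcB.
      by apply: qc_sum => q; apply: qcM; [exact: (qc_nice (np q.1) (fst1 _ _))|exact: (qc_nice (np q.2) (snd1 _ _))].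
    case: ((rel i).2) => [j|]; last by apply: qc_cst; exact: cst_continuous.
    by apply: (qc_nice (np j)); apply: contM; [exact: fst1|exact: snd1].
  - by move=> x; exact: (sys_mul sc).
  - move=> x s.
    apply: cvg0_eq (asym_sum_mul Psi (rel i).1 (fun q => c q.1 s x.1) (fun q => c q.2 s x.2)) => T _.
    by case: ((rel i).2) => [j|]; rewrite ?(nice_at0 nPsi); lmod_gen R B.
  - move=> x; apply: qcB.
      by apply: qc_sum => q; apply: qcM; apply: qc_nice => //; exact: cc.
    case: ((rel i).2) => [j|]; last by apply: qc_cst; exact: cst_continuous.
    by apply: qc_nice => //; exact: cc.
apply: fast_mono (fast_and fast_comp_nice (fast_and fl (fast_and fs fm))) => p _ [h1 [h2 [h3 h4]]].
split=> // [j k a b|i a b]; first exact: (h2 j (k, (a, b))).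
exact: (h4 i (a, b)).
Qed.

End composition.
End systems.

Definition window (N : nat) : seq int := [seq k%:Z - N%:Z | k <- iota 0 (2 * N).+1].

Lemma mem_window N (n : int) : (n \in window N) = (absz n <= N)%N.
Proof.
apply/mapP/idP => [[k]|nN]; first by rewrite mem_iota => kN ->; lia.
by exists (absz (n + N%:Z)); [rewrite mem_iota|]; lia.
Qed.

Lemma window_uniq N : uniq (window N).
Proof. by rewrite map_inj_uniq ?iota_uniq// => i j; lia. Qed.

Lemma window_sum (V : nmodType) N N' (F : int -> V) : (N <= N')%N ->
  (forall n, (N < absz n)%N -> F n = 0) -> \sum_(n <- window N') F n = \sum_(n <- window N) F n.
Proof.
move=> NN F0; rewrite (bigID [pred n | (absz n <= N)%N]) /= [X in _ + X]big1 ?addr0; last first.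
  by move=> n; rewrite -ltnNge; exact: F0.
rewrite -big_filter; apply: perm_big; apply: uniq_perm; rewrite ?filter_uniq ?window_uniq//.
by move=> n; rewrite mem_filter !mem_window /=; lia.
Qed.

(** * Shifts and graded families *)

Section matrices.
Variables (R : realType) (B : realCstarType R) (r : int -> multiplier B).
Hypothesis ri : forall n, is_isometry (r n).
Hypothesis ro : forall i j x, i != j -> mult_adj (r i) (r j x) = 0.

Let rbr (m n : int) (b : B) : B := r m (cstar (r n (cstar b))).

Let rbrM m n k l b c : rbr m n b ** rbr k l c = if n == k then rbr m l (b ** c) else 0.
Proof.
rewrite /rbr -mult_opM mult_adjP cstarK; case: eqP => [->|/eqP nk].
  by rewrite ri; congr (r m _); rewrite cstarM mult_opM cstarM cstarK.
by rewrite ro// cmulr0 mult_op0.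
Qed.

Let rbr_star m n b : cstar (rbr m n b) = rbr n m (cstar b).
Proof. by rewrite /rbr mult_comm cstarK. Qed.

Let rbrD m n b c : rbr m n (b + c) = rbr m n b + rbr m n c.
Proof. by rewrite /rbr cstarD mult_opD cstarD mult_opD. Qed.
Let rbrZ m n (k : R) b : rbr m n (k *: b) = k *: rbr m n b.
Proof. by rewrite /rbr cstarZ mult_opZ cstarZ mult_opZ. Qed.
Let rbr0 m n : rbr m n 0 = 0.
Proof. by rewrite /rbr cstar0 mult_op0 cstar0 mult_op0. Qed.
Let rbr_norm m n b : `|rbr m n b| = `|b|.
Proof. by rewrite /rbr (isometry_norm (ri m)) cnorm_star (isometry_norm (ri n)) cnorm_star. Qed.

(* [sum_mn r_m x_mn r_n^*] *)
Definition mat N (x : int -> int -> B) : B :=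
  \sum_(m <- window N) \sum_(n <- window N) r m (cstar (r n (cstar (x m n)))).

Lemma mat_eq N x y : (forall m n, m \in window N -> n \in window N -> x m n = y m n) ->
  mat N x = mat N y.
Proof.
move=> xy; apply: eq_big_seq => m mN; apply: eq_big_seq => n nN.
by rewrite xy.
Qed.

Lemma mat_lin N (k : R) x y : mat N (fun m n => k *: x m n + y m n) = k *: mat N x + mat N y.
Proof.
rewrite /mat scaler_sumr -big_split; apply: eq_bigr => m _ /=.
rewrite scaler_sumr -big_split; apply: eq_bigr => n _ /=.
by have := rbrD m n (k *: x m n) (y m n); rewrite rbrZ.
Qed.

Lemma matB N x y : mat N (fun m n => x m n - y m n) = mat N x - mat N y.
Proof.
have := mat_lin N (-1) y x; rewrite scaleN1r addrC => <-.
by apply: mat_eq => m n _ _; rewrite scaleN1r addrC.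
Qed.

Lemma mat_star N x : cstar (mat N x) = mat N (fun m n => cstar (x n m)).
Proof.
rewrite /mat (big_morph _ (@cstarD _ B) (@cstar0 _ B)).
under eq_bigr => m _.
  rewrite (big_morph _ (@cstarD _ B) (@cstar0 _ B)).
  under eq_bigr => n _ do rewrite rbr_star.
  over.
by rewrite exchange_big.
Qed.

Lemma mat_mul N x y : mat N x ** mat N y =
  mat N (fun m n => \sum_(k <- window N) x m k ** y k n).
Proof.
rewrite /mat cmul_suml; apply: eq_bigr => m _.
rewrite cmul_suml.
under eq_big_seq => k kN.
  rewrite cmul_sumr (bigD1_seq k) ?window_uniq//= [X in _ + X]big1 ?addr0; last first.
    move=> l lk; rewrite cmul_sumr big1// => n _.
    by rewrite rbrM eq_sym (negbTE lk).
  rewrite cmul_sumr; under eq_bigr => n _ do rewrite rbrM eqxx.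
  over.
rewrite exchange_big; apply: eq_bigr => n _ /=.
by rewrite -(big_morph (rbr m n) (rbrD m n) (rbr0 m n)).
Qed.

Let diag (f : int -> B) m n : B := if m == n then f n else 0.

Let mat_diag_sqr N f : mat N (diag f) ** mat N (diag f) = mat N (diag (fun n => f n ** f n)).
Proof.
rewrite mat_mul; apply: mat_eq => m n mN nN.
rewrite (bigD1_seq n) ?window_uniq//= /diag eqxx big1 ?addr0.
  by case: eqP => // _; rewrite cmul0r.
by move=> k kn; rewrite (negbTE kn) cmulr0.
Qed.

Let mat_diag_crude N f M : (forall n, n \in window N -> `|f n| <= M) ->
  `|mat N (diag f)| <= (2 * N).+1%:R * M.
Proof.
move=> fM; rewrite /mat (le_trans (ler_norm_sum _ _ _))//.
have -> : (2 * N).+1%:R * M = \sum_(m <- window N) M.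
  by rewrite big_const_seq count_predT iter_addr_0 size_map size_iota mulr_natl.
rewrite big_seq [leRHS]big_seq; apply: ler_sum => m mN.
rewrite (bigD1_seq m) ?window_uniq//= big1 ?addr0.
  by have := rbr_norm m m (diag f m m); rewrite /rbr => ->; rewrite /diag eqxx fM.
by move=> n nm; rewrite /diag eq_sym (negbTE nm) [LHS]rbr0.
Qed.

(** Squaring a diagonal matrix squares its entries, so that the crude factor 2 N + 1 disappears
    under 2^n-th roots. The bound must not depend on N, which grows with t. *)
Let mat_diag_norm N f M : 0 <= M -> (forall n, cstar (f n) = f n) ->
  (forall n, n \in window N -> `|f n| <= M) -> `|mat N (diag f)| <= M.
Proof.
move=> M0 fs fM; apply: (@exprn_le_mul R _ _ (2 * N).+1%:R) => // n.
pose sq (f : int -> B) n := f n ** f n.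
have itM k : mat N (diag (iter k sq f)) = iter k (fun x => x ** x) (mat N (diag f)).
  by elim: k => //= k <-; rewrite mat_diag_sqr.
have its k m : cstar (iter k sq f m) = iter k sq f m.
  by elim: k => //= k IH; rewrite /sq cstarM IH.
have norm_it k : `|mat N (diag (iter k sq f))| = `|mat N (diag f)| ^+ (2 ^ k).
  elim: k => [|k IH]; first by rewrite expr1.
  have Xs : cstar (mat N (diag (iter k sq f))) = mat N (diag (iter k sq f)).
    rewrite mat_star; apply: mat_eq => m m' _ _; rewrite /diag eq_sym.
    by case: eqP => [->|_]; rewrite ?its ?cstar0.
  rewrite itM iterS -itM /= -{1}Xs cnorm_star_mul IH.
  by rewrite -exprM expnS mulnC.
rewrite -norm_it; apply: mat_diag_crude => m mN.
elim: n => [|n IH]; first by rewrite expr1; exact: fM.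
rewrite iterS /sq (le_trans (cnormM _ _))// expnS mulnC exprM expr2.
by rewrite ler_pM.
Qed.

(** The product of the adjoint of the matrix with the matrix itself is diagonal. *)
Let mat_shift_norm N (d : int) x M : 0 <= M ->
  (forall m n, m \in window N -> n \in window N -> `|x m n| <= M) ->
  `|mat N (fun m n => if m == n + d then x m n else 0)| <= M.
Proof.
move=> M0 xM; rewrite -(@ler_sqr _ `|_|) ?nnegrE// -cnorm_star_mul mat_star mat_mul.
pose f n := if n + d \in window N then cstar (x (n + d) n) ** x (n + d) n else 0.
rewrite (@mat_eq N _ (diag f)).
  apply: mat_diag_norm => [|n|n nN]; first by rewrite exprn_ge0.
    by rewrite /f; case: ifP => _; rewrite ?cstar0// cstarM cstarK.
  rewrite /f; case: ifP => dN; last by rewrite normr0 exprn_ge0.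
  by rewrite cnorm_star_mul ler_sqr ?nnegrE// xM.
move=> m n mN nN; rewrite /diag /f; case: eqP => [->|/eqP mn].
  case: ifP => dN.
    rewrite (bigD1_seq (n + d)) ?window_uniq//= eqxx big1 ?addr0// => k /negbTE ->.
    by rewrite cmulr0.
  rewrite big1_seq// => k /andP[_ kN]; case: eqP => [kE|]; last by rewrite cmulr0.
  by rewrite -kE kN in dN.
rewrite big1// => k _; case: eqP => [->|_]; last by rewrite cstar0 cmul0r.
case: eqP => [/addIr mnE|_]; last by rewrite cmulr0.
by rewrite mnE eqxx in mn.
Qed.

(** A product of two tridiagonal matrices has bandwidth 2, and 5 is the number of its diagonals. *)
Lemma mat_band_norm N x M : 0 <= M ->
  (forall m n, (2 < absz (m - n))%N -> x m n = 0) ->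
  (forall m n, m \in window N -> n \in window N -> `|x m n| <= M) ->
  `|mat N x| <= 5 * M.
Proof.
move=> M0 x0 xM.
pose y (d : int) m n := if m == n + d then x m n else 0.
have -> : mat N x = mat N (y 0) + mat N (y 1) + mat N (y (-1)) + mat N (y 2) + mat N (y (-2)).
  have mD u v : mat N u + mat N v = mat N (fun m n => u m n + v m n).
    rewrite -[mat N u]scale1r -mat_lin.
    by apply: mat_eq => m n _ _; rewrite scale1r.
  rewrite !mD; apply: mat_eq => m n _ _; rewrite /y.
  case: (ltnP 2 (absz (m - n))) => h; first by rewrite x0// !if_same !addr0.
  have : [\/ m = n + 0, m = n + 1, m = n + -1 | (m = n + 2 \/ m = n + -2)].
    have : m = n \/ m = n + 1 \/ m = n - 1 \/ m = n + 2 \/ m = n - 2 by lia.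
    by move=> [->|[->|[->|[->|->]]]]; [constructor 1; rewrite addr0|constructor 2
     |constructor 3|constructor 4; left|constructor 4; right].
  by case=> [->|->|->|[->|->]]; rewrite !(inj_eq (addrI n)) /= ?addr0 ?add0r.
rewrite [5 * M](_ : _ = M + M + M + M + M); last by ring.
have yM d : `|mat N (y d)| <= M by exact: mat_shift_norm.
by do ![rewrite (le_trans (ler_normD _ _))// lerD//].
Qed.

End matrices.

Definition deg := option bool.
Definition dz (d : deg) : int := match d with None => 0 | Some true => 1 | Some false => -1 end.
Definition neg (d : deg) : deg := omap negb d.
Definition degs : seq deg := [:: None; Some true; Some false].

(* The relations between the components of a morphism into Laurent polynomials
   of degree at most 1; the last ones say that the products of degree 2 vanish. *)
Definition graded_rel (i : option (bool * bool)) : seq (deg * deg) * option deg :=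
  match i with
  | None => ([:: (None, None); (Some true, Some false); (Some false, Some true)], Some None)
  | Some (true, b) => ([:: (Some b, None); (None, Some b)], Some (Some b))
  | Some (false, b) => ([:: (Some b, Some b)], None)
  end.

Definition unif (R : realType) (V : normedModType R) (u : R -> int -> V) :=
  forall eps, 0 < eps -> \forall t \near +oo_R, forall n, `|u t n| <= eps.

Lemma near_fin (R : realType) (J : finType) (X : Type) (V : normedModType R) (u : J -> R -> X -> V) eps :
  (forall j, \forall t \near +oo_R, forall x, `|u j t x| <= eps) ->
  \forall t \near +oo_R, forall j x, `|u j t x| <= eps.
Proof.
exact: (@filter_forall _ _ (fun j => [set t | forall x, `|u j t x| <= eps]) _ _).
Qed.

Section assembly.
Variables (R : realType) (A B : realCstarType R) (r : int -> multiplier B).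
Hypothesis ri : forall n, is_isometry (r n).
Hypothesis ro : forall i j x, i != j -> mult_adj (r i) (r j x) = 0.
Variables (e : deg -> R -> int -> A -> B) (N : R -> nat).
Hypothesis N_local : forall t0 : R, exists N', \forall t \near t0, (N t <= N')%N.
Hypothesis e_supp : forall d t n a, (N t <= absz n)%N -> e d t n a = 0.
Hypothesis e_cont : forall d n, continuous (fun q : R * A => e d q.1 n q.2).
Hypothesis e_at0 : forall d t n, e d t n 0 = 0.
Hypothesis e_qlip : exists2 C, 0 <= C & forall (a : A) eps, 0 < eps ->
  \forall t \near +oo_R, forall d n b, `|e d t n b - e d t n a| <= C * `|b - a| + eps.
Hypothesis e_lin : forall d (k : R) a b,
  unif (fun t n => e d t n (k *: a + b) - (k *: e d t n a + e d t n b)).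
Hypothesis e_star : forall d a,
  unif (fun t n => e d t n (cstar a) - cstar (e (neg d) t (n + dz d) a)).
Hypothesis e_mul : forall i a b,
  unif (fun t n => \sum_(q <- (graded_rel i).1) e q.1 t (n + dz q.2) a ** e q.2 t n b
    - (if (graded_rel i).2 is Some d then e d t n (a ** b) else 0)).

Let tri t a (m n : int) : B := \sum_(d <- degs) if m == n + dz d then e d t n a else 0.

Definition assemble (t : R) (a : A) : B := mat r (N t) (tri t a).

Let tri_at d t a n : tri t a (n + dz d) n = e d t n a.
Proof.
rewrite /tri !big_cons big_nil !(inj_eq (addrI n)).
by case: d => [[]|] /=; rewrite ?addr0 ?add0r.
Qed.

Let tri_far t a m n : (1 < absz (m - n))%N -> tri t a m n = 0.
Proof.
by move=> mn; rewrite /tri !big_cons big_nil /= !ifF ?addr0//; apply/negbTE/eqP; lia.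
Qed.

Let tri_cases m n : (1 < absz (m - n))%N \/ exists d, m = n + dz d.
Proof.
have : (1 < absz (m - n))%N \/ m = n + 0 \/ m = n + 1 \/ m = n + -1 by lia.
by move=> [|[->|[->|->]]]; [left|right; exists None|right; exists (Some true)|right; exists (Some false)].
Qed.

Let tri_supp t a m n : (N t < absz m)%N \/ (N t < absz n)%N -> tri t a m n = 0.
Proof.
move=> h; case: (tri_cases m n) => [|[d mn]]; first exact: tri_far.
rewrite mn tri_at e_supp//; rewrite mn in h.
by move: h; case: d mn => [[]|] /= _; lia.
Qed.

(** The number [N t] jumps, but a larger window gives the same sum; continuity in t thus reduces to
    that of a fixed window, locally. *)
Let assembleE t a N' : (N t <= N')%N -> assemble t a = mat r N' (tri t a).
Proof.
move=> NN; have z m n : (N t < absz m)%N \/ (N t < absz n)%N ->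
    r m (cstar (r n (cstar (tri t a m n)))) = 0.
  by move=> /tri_supp ->; rewrite !(cstar0, mult_op0).
rewrite /assemble /mat [RHS](window_sum NN); last first.
  by move=> m mN; apply: big1 => n _; apply: z; left.
by apply: eq_bigr => m _; rewrite (window_sum NN)// => n nN; apply: z; right.
Qed.

Let tri_mul t a b m n : \sum_(k <- window (N t)) tri t a m k ** tri t b k n =
  \sum_(d <- degs) tri t a m (n + dz d) ** e d t n b.
Proof.
under eq_bigr => k _ do rewrite {2}/tri cmul_sumr.
rewrite exchange_big; apply: eq_bigr => d _ /=.
have [dN|dN] := boolP (n + dz d \in window (N t)).
  rewrite (bigD1_seq _ dN) ?window_uniq//= eqxx big1 ?addr0// => k /negbTE ->.
  by rewrite cmulr0.
have -> : e d t n b = 0.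
  by apply: e_supp; move: dN; rewrite mem_window; case: d => [[]|] /=; lia.
by rewrite cmulr0 big1// => k _; rewrite if_same cmulr0.
Qed.

Let pair_sum (l : seq (deg * deg)) t a b n :=
  \sum_(q <- l) e q.1 t (n + dz q.2) a ** e q.2 t n b.

Let mul_entry t a b eps : 0 <= eps ->
  (forall i n, `|\sum_(q <- (graded_rel i).1) e q.1 t (n + dz q.2) a ** e q.2 t n b
    - (if (graded_rel i).2 is Some d then e d t n (a ** b) else 0)| <= eps) ->
  forall m n,
    let z := \sum_(d <- degs) tri t a m (n + dz d) ** e d t n b - tri t (a ** b) m n in
    `|z| <= eps /\ ((2 < absz (m - n))%N -> z = 0).
Proof.
move=> e0 he m n /=.
have E d d' : m = n + dz d + dz d' -> tri t a m (n + dz d) = e d' t (n + dz d) a.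
  by move=> ->; exact: tri_at.
have F d : (1 < absz (m - (n + dz d))%R)%N -> tri t a m (n + dz d) ** e d t n b = 0.
  by move=> /tri_far ->; rewrite cmul0r.
have G d : m = n + dz d -> tri t (a ** b) m n = e d t n (a ** b).
  by move=> ->; exact: tri_at.
have B0 (x : B) : x + 0 = x by exact: addr0.
have S (x y w : B) : x + (y + (w + 0)) = x + y + w by rewrite addr0 addrA.
rewrite /degs !big_cons !big_nil S.
have : (2 < absz (m - n))%N \/ m = n \/ m = n + 1 \/ m = n - 1 \/ m = n + 2 \/ m = n - 2 by lia.
move=> [mn|mn].
  suff z : forall x : B, x = 0 -> `|x| <= eps /\ ((2 < absz (m - n))%N -> x = 0).
    apply: z; rewrite !F /=; try lia.
    by rewrite tri_far ?subr0 ?addr0//; lia.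
  by move=> x ->; rewrite normr0.
have -> : (2 < absz (m - n))%N = false by lia.
split=> //.
move: mn => [mn|[mn|[mn|[mn|mn]]]].
- have := (he None n : `|pair_sum [:: (None, None); (Some true, Some false); (Some false, Some true)] t a b n
    - e None t n (a ** b)| <= eps).
  rewrite /pair_sum !big_cons !big_nil S.
  rewrite (G None) ?(E None None) ?(E (Some true) (Some false)) ?(E (Some false) (Some true)) /=; try lia.
  by move=> h; rewrite [X in `|X - _|]addrAC.
- have := (he (Some (true, true)) n : `|pair_sum [:: (Some true, None); (None, Some true)] t a b n
    - e (Some true) t n (a ** b)| <= eps).
  rewrite /pair_sum !big_cons !big_nil B0.
  rewrite (G (Some true)) ?(E None (Some true)) ?(E (Some true) None) ?(F (Some false)) /=; try lia.
  by rewrite !addr0.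
- have := (he (Some (true, false)) n : `|pair_sum [:: (Some false, None); (None, Some false)] t a b n
    - e (Some false) t n (a ** b)| <= eps).
  rewrite /pair_sum !big_cons !big_nil B0.
  rewrite (G (Some false)) ?(E None (Some false)) ?(E (Some false) None) ?(F (Some true)) /=; try lia.
  by rewrite !addr0.
- have := (he (Some (false, true)) n : `|pair_sum [:: (Some true, Some true)] t a b n - 0| <= eps).
  rewrite /pair_sum !big_cons !big_nil B0.
  rewrite (tri_far t (a ** b)) ?(E (Some true) (Some true)) ?(F (Some false)) ?(F None) /=; try lia.
  by rewrite !(addr0, add0r).
- have := (he (Some (false, false)) n : `|pair_sum [:: (Some false, Some false)] t a b n - 0| <= eps).
  rewrite /pair_sum !big_cons !big_nil B0.
  rewrite (tri_far t (a ** b)) ?(E (Some false) (Some false)) ?(F (Some true)) ?(F None) /=; try lia.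
  by rewrite !(addr0, add0r).
Qed.

Let tri_le t (f : int -> int -> B) (g : deg -> int -> B) eps : 0 <= eps ->
  (forall m n, (1 < absz (m - n))%N -> f m n = 0) ->
  (forall d n, f (n + dz d) n = g d n) -> (forall d n, `|g d n| <= eps) ->
  `|mat r (N t) f| <= 5 * eps.
Proof.
move=> e0 f0 fg ge; apply: mat_band_norm => // m n.
  by move=> mn; apply: f0; lia.
by move=> _ _; case: (tri_cases m n) => [/f0 ->|[d ->]]; rewrite ?normr0// fg.
Qed.

Lemma assemble_at t a (F : B) : (0 < N t)%N ->
  (forall d n, e d t n a = if (d == None) && (n == 1) then F else 0) ->
  assemble t a = r 1 (cstar (r 1 (cstar F))).
Proof.
move=> N0 eF; have w1 : (1 : int) \in window (N t) by rewrite mem_window.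
have E m n : tri t a m n = if (m == 1) && (n == 1) then F else 0.
  case: (tri_cases m n) => [mn|[d ->]].
    by rewrite tri_far// ifF//; apply/negbTE/negP => /andP[/eqP m1 /eqP n1]; lia.
  rewrite tri_at eF; case: (n =P 1) => [->|]; last by rewrite !andbF.
  by case: d => [[]|].
rewrite /assemble /mat (bigD1_seq 1) ?window_uniq//= (bigD1_seq 1) ?window_uniq//= E eqxx /=.
have z0 : r 1 (cstar (r 1 (cstar (0 : B)))) = 0 by rewrite !(cstar0, mult_op0).
rewrite !big1 ?addr0// => [m m1|n n1].
  by apply: big1 => n _; rewrite E (negbTE m1) !(cstar0, mult_op0).
by rewrite E (negbTE n1) !(cstar0, mult_op0).
Qed.

Lemma nice_assemble : nice assemble.
Proof.
split.
- apply: cont_local => -[t0 a0]; have [N' NN] := N_local t0.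
  exists (fun q : R * A => mat r N' (tri q.1 q.2)); split.
    apply: cont_sum => m; apply: cont_sum => n.
    apply: (@cont_comp _ _ _ (fun q : R * A => cstar (r n (cstar (tri q.1 q.2 m n)))) (r m));
      last exact: mult_continuous.
    apply: cont_star.
    apply: (@cont_comp _ _ _ (fun q : R * A => cstar (tri q.1 q.2 m n)) (r n));
      last exact: mult_continuous.
    apply: cont_star; apply: cont_sum => d.
    by case: (m == n + dz d); [exact: e_cont|exact: cst_continuous].
  exists ([set t | (N t <= N')%N], setT); first by split=> //; exact: filterT.
  by move=> [t a] [/= tN _]; exact: assembleE.
- move=> t; rewrite /assemble (@mat_eq _ _ r _ _ (fun _ _ => 0)).
    by rewrite /mat big1// => m _; rewrite big1// => n _; rewrite !(cstar0, mult_op0).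
  by move=> m n _ _; rewrite /tri big1// => d _; rewrite e_at0 if_same.
have [C C0 eC] := e_qlip; exists (5 * C); first by rewrite mulr_ge0.
move=> a eps eps0; have e5 : 0 < eps / 5 by rewrite divr_gt0.
apply: filterS (eC a _ e5) => t h b; rewrite /assemble -matB.
rewrite [leRHS](_ : _ = 5 * (C * `|b - a| + eps / 5)); last by field.
apply: (@tri_le t _ (fun d n => e d t n b - e d t n a)) => [|m n mn|d n|d n].
- by rewrite addr_ge0 ?mulr_ge0// ltW.
- by rewrite !(tri_far _ _ mn) subrr.
- by rewrite !tri_at.
- exact: h.
Qed.

Lemma asym_assemble : asymptotic_morphism assemble.
Proof.
apply: nice_asym => [|k a b|a b|a]; first exact: nice_assemble.
- apply/null_normP => eps eps0; have e5 : 0 < eps / 5 by rewrite divr_gt0.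
  have hd d := @e_lin d k a b _ e5.
  have := near_fin hd; apply: filterS => t h.
  rewrite /assemble -mat_lin -matB [leRHS](_ : _ = 5 * (eps / 5)); last by field.
  apply: (@tri_le t _ (fun d n => e d t n (k *: a + b) - (k *: e d t n a + e d t n b))) => [|m n mn|d n|d n].
  + exact: ltW.
  + by rewrite !(tri_far _ _ mn) scaler0 addr0 subr0.
  + by rewrite !tri_at.
  + exact: h.
- apply/null_normP => eps eps0; have e5 : 0 < eps / 5 by rewrite divr_gt0.
  have hi i := @e_mul i a b _ e5.
  have := near_fin hi; apply: filterS => t h.
  have z := mul_entry (ltW e5) h.
  rewrite distrC /assemble mat_mul// -matB [leRHS](_ : _ = 5 * (eps / 5)); last by field.
  apply: mat_band_norm => [//|//||m n mn|m n _ _]; first exact: ltW.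
    by rewrite tri_mul (z m n).2.
  by rewrite tri_mul (z m n).1.
- apply/null_normP => eps eps0; have e5 : 0 < eps / 5 by rewrite divr_gt0.
  have hd d := @e_star d a _ e5.
  have := near_fin hd; apply: filterS => t h.
  rewrite /assemble mat_star -matB [leRHS](_ : _ = 5 * (eps / 5)); last by field.
  apply: (@tri_le t _ (fun d n => e d t n (cstar a) - cstar (e (neg d) t (n + dz d) a))) => [|m n mn|d n|d n].
  + exact: ltW.
  + have nm : (1 < absz (n - m))%N by lia.
    by rewrite (tri_far _ _ mn) (tri_far _ _ nm) cstar0 subr0.
  + rewrite tri_at; congr (_ - cstar _).
    rewrite -[RHS]tri_at; congr tri.
    by case: d => [[]|] /=; rewrite ?addrK ?subrK ?addr0.
  + exact: h.
Qed.

End assembly.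

Lemma assemble_dist (R : realType) (A B : realCstarType R) (r : int -> multiplier B)
  (ri : forall n, is_isometry (r n)) (ro : forall i j x, i != j -> mult_adj (r i) (r j x) = 0)
  (e e' : deg -> R -> int -> A -> B) (N : R -> nat) t a eps : 0 <= eps ->
  (forall d n, `|e d t n a - e' d t n a| <= eps) ->
  `|assemble r e N t a - assemble r e' N t a| <= 5 * eps.
Proof.
move=> e0 ee; rewrite /assemble -matB; apply: mat_band_norm => // [m n mn|m n _ _].
  by rewrite !big1 ?subrr// => d _; rewrite ifF//; apply/negbTE/eqP; case: d => [[]|] /=; lia.
have z0 : `|0 - 0 : B| <= eps by rewrite subrr normr0.
rewrite !big_cons !big_nil.
have : (1 < absz (m - n))%N \/ exists d, m = n + dz d.
  have : (1 < absz (m - n))%N \/ m = n + 0 \/ m = n + 1 \/ m = n + -1 by lia.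
  by move=> [|[->|[->|->]]]; [left|right; exists None|right; exists (Some true)|right; exists (Some false)].
case=> [mn|[d ->]].
  by rewrite !ifF ?addr0//; apply/negbTE/eqP => /=; lia.
by rewrite !(inj_eq (addrI n)); case: d => [[]|] /=; rewrite ?addr0 ?add0r; exact: ee.
Qed.

Lemma assemble_ev (R : realType) (A B : realCstarType R) (Z : set (unit_itv R)) (r : int -> multiplier B)
  (ri : forall n, is_isometry (r n)) (e : deg -> R -> int -> A -> itv_algebra Z B) (N : R -> nat) t a x :
  assemble (fun n => itv_mult Z (ri n)) e N t a x = assemble r (fun d t n a => e d t n a x) N t a.
Proof.
have sumE (S : Type) (s : seq S) (F : S -> itv_algebra Z B) :
    (\sum_(i <- s) F i) x = \sum_(i <- s) F i x.
  exact: (big_morph (fun G : itv_algebra Z B => G x) (fun G H => itvDE G H x) (itv0E _ _ x)).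
rewrite /assemble /mat sumE; apply: eq_bigr => m _; rewrite sumE; apply: eq_bigr => n _ /=.
by congr (r m (cstar (r n (cstar _)))); rewrite sumE; apply: eq_bigr => d _; case: ifP.
Qed.

(** * Loops from a nullhomotopy *)

Section configuration.
Variables (R : realType) (B : realCstarType R).
Local Notation I := (unit_itv R).
Implicit Types G H P : bool * bool -> I -> B.
Variables (h : int -> bool) (y z : int -> I).

(* A 2x2 matrix [G] of paths is evaluated along the sequence [y]: where [h]
   holds, the component [true] is moved one step to the right. *)
Definition conf G (d : deg) (n : int) : B :=
  if h n then match d with
    | None => G (false, false) (y n) + G (true, true) (z (n - 1))
    | Some true => G (true, false) (y n)
    | Some false => G (false, true) (z (n - 1))
    end
  else if d is None then
    G (false, false) (y n) + G (false, true) (y n) + (G (true, false) (y n) + G (true, true) (y n))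
  else 0.

Let norm4 (a b c d : B) rho : `|a| <= rho -> `|b| <= rho -> `|c| <= rho -> `|d| <= rho ->
  `|a + b + (c + d)| <= 4 * rho.
Proof.
move=> h1 h2 h3 h4; rewrite (_ : 4 * rho = rho + rho + (rho + rho)); last by ring.
by do ![rewrite (le_trans (ler_normD _ _))// lerD//].
Qed.

Lemma conf_lin G H P (k : R) rho d n :
  (forall q x, `|P q x - (k *: G q x + H q x)| <= rho) ->
  `|conf P d n - (k *: conf G d n + conf H d n)| <= 4 * rho.
Proof.
move=> PGH; have r0 : 0 <= rho by apply: le_trans (normr_ge0 _) (PGH (true, true) (y 0)).
rewrite /conf; case: (h n); case: d => [[]|].
- by rewrite (le_trans (PGH _ _))// ler_peMl// ler1n.
- by rewrite (le_trans (PGH _ _))// ler_peMl// ler1n.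
- set a := P _ _; set b := P _ _.
  have h1 := PGH (false, false) (y n); have h2 := PGH (true, true) (z (n - 1)).
  rewrite (_ : _ - _ = (a - (k *: G (false, false) (y n) + H (false, false) (y n))) +
     (b - (k *: G (true, true) (z (n - 1)) + H (true, true) (z (n - 1)))) + (0 + 0)); last by lmod_gen R B.
  by apply: norm4; rewrite ?normr0.
- by rewrite scaler0 addr0 subr0 normr0 mulr_ge0.
- by rewrite scaler0 addr0 subr0 normr0 mulr_ge0.
- have hq q := PGH q (y n).
  rewrite (_ : _ - _ = (P (false, false) (y n) - (k *: G (false, false) (y n) + H (false, false) (y n))) +
   (P (false, true) (y n) - (k *: G (false, true) (y n) + H (false, true) (y n))) +
   ((P (true, false) (y n) - (k *: G (true, false) (y n) + H (true, false) (y n))) +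
   (P (true, true) (y n) - (k *: G (true, true) (y n) + H (true, true) (y n))))); last by lmod_gen R B.
  exact: norm4.
Qed.

Lemma conf_dist G H rho d n : (forall q x, `|G q x - H q x| <= rho) ->
  `|conf G d n - conf H d n| <= 4 * rho.
Proof.
move=> GH; have := @conf_lin H (fun _ _ => 0) G 1 rho d n.
have -> : conf (fun _ _ => 0) d n = 0.
  by rewrite /conf; case: (h n); case: d => [[]|]; rewrite ?addr0.
by rewrite scale1r addr0; apply=> q x; rewrite scale1r addr0.
Qed.

Hypothesis h_mono : forall n, h n -> h (n + 1).
Hypothesis z_y : forall n, h n -> z n = y n.
Hypothesis z_0 : forall n, ~~ h n -> h (n + 1) -> z n = clamp 0.

(** At the base point of the paths the off-diagonal entries vanish, so that the shifted and
    unshifted regimes fit together: [z] follows [y] where [h] holds and sits at the base point just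
    before. *)
Definition off G := forall i, G (i, ~~ i) (clamp 0) = 0.

Lemma conf_star G P rho d n : off G -> off P ->
  (forall i j x, `|P (i, j) x - cstar (G (j, i) x)| <= rho) ->
  `|conf P d n - cstar (conf G (neg d) (n + dz d))| <= 4 * rho.
Proof.
move=> G0 P0 PG; have r0 : 0 <= rho by apply: le_trans (normr_ge0 _) (PG true true (y 0)).
case: d => [[]|] /=; rewrite ?addr0.
- rewrite /conf addrK; have [hn|hn] := boolP (h n).
    by rewrite h_mono// z_y// (le_trans (PG _ _ _))// ler_peMl// ler1n.
  have [hn1|hn1] := boolP (h (n + 1)); last by rewrite cstar0 subrr normr0 mulr_ge0.
  by rewrite z_0// (G0 false) cstar0 subrr normr0 mulr_ge0.
- rewrite /conf; have [hn|hn] := boolP (h n).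
    have [hn1|hn1] := boolP (h (n - 1)).
      by rewrite z_y// (le_trans (PG _ _ _))// ler_peMl// ler1n.
    by rewrite z_0 ?subrK// (P0 false) cstar0 subrr normr0 mulr_ge0.
  rewrite ifF ?cstar0 ?subrr ?normr0 ?mulr_ge0//.
  by apply/negbTE; apply: contra hn => /h_mono; rewrite subrK.
rewrite /conf; case: (h n).
  rewrite cstarD (_ : _ - _ = (P (false, false) (y n) - cstar (G (false, false) (y n))) +
    (P (true, true) (z (n - 1)) - cstar (G (true, true) (z (n - 1)))) + (0 + 0)); last by lmod_gen R B.
  by apply: norm4; rewrite ?normr0.
rewrite !cstarD (_ : _ - _ = (P (false, false) (y n) - cstar (G (false, false) (y n))) +
   (P (false, true) (y n) - cstar (G (true, false) (y n))) +
   ((P (true, false) (y n) - cstar (G (false, true) (y n))) +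
   (P (true, true) (y n) - cstar (G (true, true) (y n))))); last by lmod_gen R B.
exact: norm4.
Qed.

(** In the shifted regime the two components are evaluated at different points of the path, so that
    the mismatched products have to be small for independent x and x'. In the unshifted one, the
    sixteen products form four instances of the matrix relation and eight mismatched terms, whence
    the constant 12. *)
Lemma conf_mul G H P rho i n : off G -> off H -> off P ->
  (forall i j x, `|G (i, false) x ** H (false, j) x + G (i, true) x ** H (true, j) x - P (i, j) x| <= rho) ->
  (forall i l j x x', `|G (i, l) x ** H (~~ l, j) x'| <= rho) ->
  `|\sum_(q <- (graded_rel i).1) conf G q.1 (n + dz q.2) ** conf H q.2 n
    - (if (graded_rel i).2 is Some d then conf P d n else 0)| <= 12 * rho.
Proof.
move=> G0 H0 P0 GHP GH; have r0 : 0 <= rho by apply: le_trans (normr_ge0 _) (GH true true true (y 0) (y 0)).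
have le4 (x : B) : `|x| <= 4 * rho -> `|x| <= 12 * rho.
  by move=> hx; rewrite (le_trans hx)// ler_wpM2r// ler_nat.
have z0 : `|0 : B| <= rho by rewrite normr0.
have n0 (b : bool) : ~~ h n -> conf H (Some b) n = 0 by rewrite /conf => /negbTE ->; case: b.
have p0 (b : bool) : ~~ h n -> conf P (Some b) n = 0 by rewrite /conf => /negbTE ->; case: b.
have g0 (b : bool) : ~~ h n -> conf G (Some b) n = 0 by rewrite /conf => /negbTE ->; case: b.
case: i => [[[] b]|]; rewrite /= !big_cons !big_nil /= !addr0; last first.
- have [hn|hn] := boolP (h n); last first.
    rewrite !n0// !cmulr0 !addr0 /conf (negbTE hn).
    pose S i j := G (i, false) (y n) ** H (false, j) (y n) + G (i, true) (y n) ** H (true, j) (y n) - P (i, j) (y n).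
    pose C i l j := G (i, l) (y n) ** H (~~ l, j) (y n).
    rewrite (_ : _ - _ = (S false false + S false true + (S true false + S true true))
      + (C false false false + C false false true + (C false true false + C false true true))
      + (C true false false + C true false true + (C true true false + C true true true))); last first.
      by rewrite /S /C; calg R B.
    rewrite (_ : 12 * rho = 4 * rho + 4 * rho + 4 * rho); last by ring.
    by do ![rewrite (le_trans (ler_normD _ _))// lerD//]; apply: norm4;
      first [exact: GHP|exact: GH].
  apply: le4.
  rewrite [conf G (Some false) (n + 1)]/conf h_mono// addrK z_y//.
  rewrite [conf _ None n]/conf [conf _ None n]/conf [conf _ None n]/conf hn.
  rewrite [conf _ (Some true) n]/conf [conf _ (Some false) n]/conf hn.
  have -> : conf G (Some true) (n - 1) ** H (false, true) (z (n - 1)) =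
     G (true, false) (z (n - 1)) ** H (false, true) (z (n - 1)).
    rewrite /conf /=; have [hn1|hn1] := boolP (h (n - 1)); first by rewrite z_y.
    by rewrite z_0 ?subrK// (H0 false) !cmulr0.
  rewrite (_ : _ - _ = (G (false, false) (y n) ** H (false, false) (y n) +
       G (false, true) (y n) ** H (true, false) (y n) - P (false, false) (y n)) +
     (G (true, false) (z (n - 1)) ** H (false, true) (z (n - 1)) +
       G (true, true) (z (n - 1)) ** H (true, true) (z (n - 1)) - P (true, true) (z (n - 1))) +
     (G (false, false) (y n) ** H (true, true) (z (n - 1)) +
      G (true, true) (z (n - 1)) ** H (false, false) (y n))); last by calg R B.
  by apply: norm4; [exact: GHP|exact: GHP|exact: (GH _ false)|exact: (GH _ true)].
- apply: le4; rewrite subr0; have [hn|hn] := boolP (h n); last first.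
    by rewrite n0// cmulr0 normr0 mulr_ge0.
  have r4 (x : B) : `|x| <= rho -> `|x| <= 4 * rho.
    by move=> hx; rewrite (le_trans hx)// ler_peMl// ler1n.
  apply: r4; case: b; rewrite /conf /= hn.
    by rewrite h_mono//; exact: (GH _ false).
  by case: (h (n - 1)); [exact: (GH _ true)|rewrite cmul0r].
- apply: le4; have [hn|hn] := boolP (h n); last first.
    by rewrite !n0// g0// p0// cmul0r cmulr0 addr0 subr0 normr0 mulr_ge0.
  case: b.
    rewrite /conf /= hn h_mono// addrK (z_y hn).
    rewrite (_ : _ - _ = (G (true, false) (y n) ** H (false, false) (y n) +
         G (true, true) (y n) ** H (true, false) (y n) - P (true, false) (y n)) +
       G (true, false) (y n) ** H (true, true) (z (n - 1)) +
       (G (false, false) (y (n + 1)) ** H (true, false) (y n) + 0)); last by calg R B.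
    by apply: norm4 => //; first [exact: GHP|exact: (GH _ false)].
  rewrite /conf /= hn; have [hn1|hn1] := boolP (h (n - 1)); last first.
    by rewrite z_0 ?subrK// (G0 false) (H0 false) (P0 false) cmul0r cmulr0 addr0 subr0 normr0 mulr_ge0.
  rewrite -(z_y hn1).
  rewrite (_ : _ - _ = (G (false, false) (z (n - 1)) ** H (false, true) (z (n - 1)) +
       G (false, true) (z (n - 1)) ** H (true, true) (z (n - 1)) - P (false, true) (z (n - 1))) +
     G (false, true) (z (n - 1)) ** H (false, false) (y n) +
     (G (true, true) (z (n - 1 - 1)) ** H (false, true) (z (n - 1)) + 0)); last by calg R B.
  by apply: norm4 => //; first [exact: GHP|exact: (GH _ true)].
Qed.

End configuration.

Section system_maps.
Variables (R : realType) (J X : finType) (st : J -> J) (rel : X -> seq (J * J) * option J).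
Variables (D A A' : realCstarType R).

Lemma sys_ext (c c' : J -> R -> D -> A) : (forall j t a, c j t a = c' j t a) ->
  is_system st rel c -> is_system st rel c'.
Proof.
move=> cc; suff -> : c = c' by [].
by apply/funext => j; apply/funext => t; apply/funext => a.
Qed.

Lemma sys_post (f : starhom A A') (c : J -> R -> D -> A) : is_system st rel c ->
  is_system st rel (fun j t a => f (c j t a)).
Proof.
move=> sc; split=> [j|j k a b|j a|i a b].
- by apply: nice_post_hom; exact: sys_nice sc j.
- by apply: cvg0_eq (cvg0_hom f (sys_linear sc j k a b)) => t _; rewrite starhomB starhomL.
- by apply: cvg0_eq (cvg0_hom f (sys_star sc j a)) => t _; rewrite starhomB starhom_star.
- apply: cvg0_eq (cvg0_hom f (sys_mul sc i a b)) => t _.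
  rewrite starhomB (big_morph f (starhomD f) (starhom0 f)).
  under [in RHS]eq_bigr => q _ do rewrite starhomM.
  by case: (rel i).2 => [j|]; rewrite ?starhom0.
Qed.

Lemma sys_itv (Z : set (unit_itv R)) (c : J -> R -> D -> A) (sc : is_system st rel c) :
  is_system st rel (fun j => itv_fam (Z := Z) (sys_nice sc j)).
Proof.
have ev (F : itv_algebra Z D) : continuous F by exact: itv_continuous.
have sumE (V : realCstarType R) (S : Type) (s : seq S) (F : S -> itv_algebra Z V) x :
    (\sum_(i <- s) F i) x = \sum_(i <- s) F i x.
  exact: (big_morph (fun G : itv_algebra Z V => G x) (fun G H => itvDE G H x) (itv0E _ _ x)).
have itv_null' (u v : R -> itv_algebra Z A) : (forall t x, u t x = v t x) ->
    u t @[t --> +oo_R] --> (0 : itv_algebra Z A) -> v t @[t --> +oo_R] --> (0 : itv_algebra Z A).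
  by move=> uv; apply: cvg0_eq => t _; apply/itv_eqP => x; rewrite uv.
split=> [j|j k F G|j F|i F G].
- exact: itv_fam_nice.
- apply: itv_null => [|x]; last exact: (sys_linear sc j k (F x) (G x)).
  apply: (@qcB _ _ _ (fun t x => c j t (k *: F x + G x))).
    apply: (qc_nice (sys_nice sc j) (x := fun x => k *: F x + G x)).
    by apply: contD => //; apply: contZ => //; exact: cst_continuous.
  apply: (@qcD _ _ _ (fun t x => k *: c j t (F x)) (fun t x => c j t (G x))); last exact: (qc_nice (sys_nice sc j) (ev G)).
  by apply: (@qcZ _ _ _ (fun=> k)); [exact: cst_continuous|exact: (qc_nice (sys_nice sc j) (ev F))].
- apply: itv_null => [|x]; last exact: (sys_star sc j (F x)).
  apply: (@qcB _ _ _ (fun t x => c j t (cstar (F x))) (fun t x => cstar (c (st j) t (F x)))).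
    by apply: (qc_nice (sys_nice sc j) (x := fun x => cstar (F x))); exact: cont_star.
  by apply: (@qc_star _ _ _ (fun t x => c (st j) t (F x))); exact: (qc_nice (sys_nice sc _) (ev F)).
- pose u t x := \sum_(q <- (rel i).1) c q.1 t (F x) ** c q.2 t (G x) -
    (if (rel i).2 is Some j then c j t (F x ** G x) else 0).
  have E t x : (\sum_(q <- (rel i).1) itv_fam (Z := Z) (sys_nice sc q.1) t F **
      itv_fam (Z := Z) (sys_nice sc q.2) t G -
    (if (rel i).2 is Some j then itv_fam (Z := Z) (sys_nice sc j) t (F ** G) else 0)) x = u t x.
    by rewrite /u itvDE itvNE sumE; case: (rel i).2.
  apply: itv_null => [|x]; last first.
    by apply: cvg0_eq (sys_mul sc i (F x) (G x)) => t _; rewrite E.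
  have -> : (fun t x => (\sum_(q <- (rel i).1) itv_fam (Z := Z) (sys_nice sc q.1) t F **
      itv_fam (Z := Z) (sys_nice sc q.2) t G -
    (if (rel i).2 is Some j then itv_fam (Z := Z) (sys_nice sc j) t (F ** G) else 0)) x) = u.
    by apply/funext => t; apply/funext => x; exact: E.
  apply: qcB.
    by apply: qc_sum => q; apply: qcM; [exact: (qc_nice (sys_nice sc q.1) (ev F))|exact: (qc_nice (sys_nice sc q.2) (ev G))].
  case: (rel i).2 => [j|]; last by apply: qc_cst; exact: cst_continuous.
  by apply: (qc_nice (sys_nice sc j) (x := fun x => F x ** G x)); exact: contM.
Qed.

End system_maps.

Section symmetry.
Variable R : realType.
Local Notation I := (unit_itv R).
Local Notation idx := (bool * (bool * bool))%type.

Definition hs_st (q : idx) : idx := (q.1, (q.2.2, q.2.1)).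

(** [inl] is matrix multiplication at one point. [inr] is the vanishing of products with mismatched
    inner indices, stated at two independent points; the first component of an index tells which
    variable is used. *)
Definition hs_rel (r : (bool * bool) + (bool * (bool * bool))) : seq (idx * idx) * option idx :=
  match r with
  | inl (i, j) => ([:: ((false, (i, false)), (false, (false, j)));
                      ((false, (i, true)), (false, (true, j)))], Some (false, (i, j)))
  | inr (i, (l, j)) => ([:: ((true, (i, l)), (false, (~~ l, j)))], None)
  end.

(* [G (x)] and [G (y)], as functions of two variables *)
Definition pr (A : realCstarType R) (w : bool) : starhom (cylinder A) (cylinder (cylinder A)) :=
  if w then itv_map set0 (cyl_cst A) else cyl_cst (cylinder A).

Definition hs_fam (D A : realCstarType R) (g : bool * bool -> R -> D -> cylinder A) (q : idx) t a :=
  pr A q.1 (g q.2 t a).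

(* A matrix [g] of paths, approximately multiplicative, from a corner
   embedding to 0: the nullhomotopy given by homotopy symmetry, cut by the
   projections of the direct sum. *)
Record hs_data (A : realCstarType R) (g : bool * bool -> R -> A -> cylinder A)
    (k : starhom A A) : Prop := HsData {
  hs_k : hh k (starhom_id A);
  hs_system : is_system hs_st hs_rel (hs_fam g);
  hs_nice : forall q, nice (g q);
  hs_at1 : forall q t a, g q t a (clamp 1) = 0;
  hs_off : forall t a, off (fun q => g q t a);
  hs_corner : forall a, g (true, true) t a (clamp 0) - k a @[t --> +oo_R] --> (0 : A)
}.

Section estimates.
Variables (D A : realCstarType R) (g : bool * bool -> R -> D -> cylinder A).
Hypothesis sg : is_system hs_st hs_rel (hs_fam g).

Let ev2 (F : cylinder (cylinder A)) x x' : `|F x x'| <= `|F|.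
Proof. by rewrite (le_trans (itv_normE (F x) x'))// itv_normE. Qed.

Let near_all (V : normedModType R) (S : finType) (u : S -> R -> V) : 
  (forall i, u i t @[t --> +oo_R] --> (0 : V)) -> forall e, 0 < e ->
  \forall t \near +oo_R, forall i, `|u i t| <= e.
Proof.
move=> u0 e e0; have H i : \forall t \near +oo_R, forall x : unit, `|u i t| <= e.
  by have /null_normP/(_ _ e0) := u0 i; apply: filterS.
have := @near_fin R S unit V (fun i t _ => u i t) e H.
by apply: filterS => t h i; exact: h tt.
Qed.

Lemma hs_near_mul a b e : 0 < e -> \forall t \near +oo_R,
  (forall i j x, `|g (i, false) t a x ** g (false, j) t b x +
     g (i, true) t a x ** g (true, j) t b x - g (i, j) t (a ** b) x| <= e) /\
  (forall i l j x x', `|g (i, l) t a x ** g (~~ l, j) t b x'| <= e).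
Proof.
move=> e0; have := near_all (fun i => sys_mul sg i a b) e0.
apply: filterS => t h; split=> [i j x|i l j x x'].
  have := h (inl (i, j)) : `|\sum_(q <- [:: ((false, (i, false)), (false, (false, j)));
      ((false, (i, true)), (false, (true, j)))]) hs_fam g q.1 t a ** hs_fam g q.2 t b -
    hs_fam g (false, (i, j)) t (a ** b)| <= e.
  rewrite !big_cons big_nil addr0 => /(le_trans (ev2 _ x x)).
  by rewrite !(itvDE, itvNE, itv_mulE).
have := h (inr (i, (l, j))) : `|\sum_(q <- [:: ((true, (i, l)), (false, (~~ l, j)))])
    hs_fam g q.1 t a ** hs_fam g q.2 t b - 0| <= e.
rewrite !big_cons big_nil addr0 subr0 => /(le_trans (ev2 _ x x')).
by rewrite !itv_mulE.
Qed.

Lemma hs_near_star a e : 0 < e -> \forall t \near +oo_R, forall i j x,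
  `|g (i, j) t (cstar a) x - cstar (g (j, i) t a x)| <= e.
Proof.
move=> e0; have := near_all (fun q => sys_star sg q a) e0.
apply: filterS => t h i j x.
exact: le_trans (ev2 _ x x) (h (false, (i, j))).
Qed.

Lemma hs_near_lin (k : R) a b e : 0 < e -> \forall t \near +oo_R, forall q x,
  `|g q t (k *: a + b) x - (k *: g q t a x + g q t b x)| <= e.
Proof.
move=> e0; have := near_all (fun q => sys_linear sg q k a b) e0.
apply: filterS => t h q x.
exact: le_trans (ev2 _ x x) (h (false, q)).
Qed.

End estimates.

Section loops.
Variables (A : realCstarType R) (g : bool * bool -> R -> A -> cylinder A) (k : starhom A A).
Hypothesis gP : hs_data g k.

Let cV : continuous (fun x : R => `|2 * x - 1|).
Proof.
apply: cont_norm; apply: contB; last exact: cst_continuous.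
by apply: contZ; [exact: cst_continuous|exact: cont_id].
Qed.
Let cM : continuous (fun x : R => 2 * x - 1).
Proof.
apply: contB; last exact: cst_continuous.
by apply: contZ; [exact: cst_continuous|exact: cont_id].
Qed.
Let V := cyl_comp A cV.
Let M := cyl_comp A cM.

(** [M] sits at the base point on the left half, where the off-diagonal entries vanish, and agrees
    with [V] on the right half. The formula in degree 0 is thus the sum of all entries on the left
    and the trace on the right, without a case distinction that would obscure continuity. *)
Let bcyl (d : deg) t a : cylinder A :=
  match d with
  | None => -1 *: M (g (true, false) t a) + (-1 *: M (g (false, true) t a) +
      (1 *: (1 *: V (g (false, false) t a) + V (g (false, true) t a)) +
       (1 *: V (g (true, false) t a) + V (g (true, true) t a))))
  | Some b => M (g (b, ~~ b) t a)
  end.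

Definition fold (x : I) : I := clamp `|2 * set_val x - 1|.

Lemma fold_half (x : I) : 1 / 2 < set_val x -> clamp (2 * set_val x - 1) = fold x.
Proof. by move=> x2; rewrite /fold ger0_norm//; lra. Qed.

Let bcyl_conf d t a x n : bcyl d t a x =
  conf (fun=> 1 / 2 < set_val x) (fun=> fold x) (fun=> fold x) (fun q => g q t a) d n.
Proof.
pose m : I := clamp (2 * set_val x - 1).
have BS b : bcyl (Some b) t a x = g (b, ~~ b) t a m by [].
have BN : bcyl None t a x = -1 *: g (true, false) t a m + (-1 *: g (false, true) t a m +
  (1 *: (1 *: g (false, false) t a (fold x) + g (false, true) t a (fold x)) +
  (1 *: g (true, false) t a (fold x) + g (true, true) t a (fold x)))) by [].
rewrite /conf; case: ltP => x2.
  have mE : m = fold x by exact: fold_half.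
  by case: d => [[]|]; rewrite ?BS ?BN mE //; lmod_gen R A.
have m0 : m = clamp 0.
  by apply: val_inj => /=; move: x2; set v := set_val x; minmax.
have g0 i : g (i, ~~ i) t a m = 0 by rewrite m0 (hs_off gP).
case: d => [b|]; first by rewrite BS g0.
by rewrite BN (g0 true) (g0 false); lmod_gen R A.
Qed.

Let bcyl0 d t a x : endpoints x -> bcyl d t a x = 0.
Proof.
move=> xe; have f1 : fold x = clamp 1.
  case: xe => ->; rewrite /fold ?set_val_clamp0 ?set_val_clamp1; congr clamp.
    by rewrite mulr0 sub0r normrN normr1.
  by rewrite (_ : 2 * 1 - 1 = 1 :> R) ?normr1//; lra.
rewrite (bcyl_conf _ _ _ _ 0) /conf !f1 !(hs_at1 gP) !addr0.
by case: ifP; case: d => [[]|].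
Qed.

Definition loop (d : deg) t a : suspension A :=
  mk_itv (@itv_continuous _ _ _ (bcyl d t a)) (@bcyl0 d t a).

(** A loop is a configuration that is constant in [n], so that the estimates for [conf] serve both
    for loops and for sequences of nodes. *)
Lemma loopE d t a x n : loop d t a x =
  conf (fun=> 1 / 2 < set_val x) (fun=> fold x) (fun=> fold x) (fun q => g q t a) d n.
Proof. exact: bcyl_conf. Qed.

Let loop_nice d : nice (loop d).
Proof.
have nb : nice (bcyl d).
  have n q (f : starhom (cylinder A) (cylinder A)) : nice (fun t a => f (g q t a)).
    by apply: nice_post_hom; exact: hs_nice gP q.
  case: d => [b|]; first exact: n.
  by do ![apply: nice_comb; try exact: n].
have dist t a t' a' : `|loop d t a - loop d t' a'| <= `|bcyl d t a - bcyl d t' a'|.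
  by apply/itv_normP => x; exact: (itv_normE (bcyl d t a - bcyl d t' a')).
split.
- move=> [t a]; apply/(@cvgrPdist_le _ _ _ (nbhs (t, a))) => e e0.
  have := @cvgrPdist_le _ _ _ (nbhs (t, a)) _ (fun p : R * A => bcyl d p.1 p.2) (bcyl d t a).
  case=> /(_ (@nice_continuous _ _ _ _ nb (t, a)))/(_ _ e0) + _.
  by apply: filterS => -[t' a'] /=; apply: le_trans; exact: dist.
- by move=> t; apply/itv_eqP => x; rewrite [LHS]/= (nice_at0 nb).
exact: nice_qlip nb.
Qed.

Lemma loop_system : is_system neg graded_rel loop.
Proof.
have e4 (e : R) : 0 < e -> 0 < e / 4 by move=> e0; rewrite divr_gt0.
have sumE (S : Type) (s : seq S) (F : S -> suspension A) x :
    (\sum_(i <- s) F i) x = \sum_(i <- s) F i x.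
  exact: (big_morph (fun G : suspension A => G x) (fun G H => itvDE G H x) (itv0E _ _ x)).
have sg := hs_system gP.
split=> [d|d c a b|d a|i a b].
- exact: loop_nice.
- apply/null_normP => e e0; have := hs_near_lin sg c a b (e4 _ e0).
  apply: filterS => t h; apply/itv_normP => x.
  rewrite itvDE itvNE itvDE itvZE !(loopE _ _ _ _ 0) [leRHS](_ : _ = 4 * (e / 4)); last by field.
  exact: conf_lin.
- apply/null_normP => e e0; have := hs_near_star sg a (e4 _ e0).
  apply: filterS => t h; apply/itv_normP => x.
  have -> : (loop d t (cstar a) - cstar (loop (neg d) t a)) x = loop d t (cstar a) x - cstar (loop (neg d) t a x) by [].
  rewrite (loopE d _ _ _ 0) (loopE (neg d) _ _ _ (0 + dz d)) [leRHS](_ : _ = 4 * (e / 4)); last by field.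
  apply: conf_star => //; [by move=> n /negbTE ->|exact: hs_off gP t a|exact: hs_off gP t (cstar a)].
- apply/null_normP => e e0; have e12 : 0 < e / 12 by rewrite divr_gt0.
  have := hs_near_mul sg a b e12; apply: filterS => t [h1 h2]; apply/itv_normP => x.
  have -> : (\sum_(q <- (graded_rel i).1) loop q.1 t a ** loop q.2 t b -
      (if (graded_rel i).2 is Some j then loop j t (a ** b) else 0)) x =
    \sum_(q <- (graded_rel i).1) loop q.1 t a x ** loop q.2 t b x -
      (if (graded_rel i).2 is Some j then loop j t (a ** b) x else 0).
    by rewrite itvDE itvNE sumE; case: (graded_rel i).2.
  under eq_bigr => q _ do rewrite (loopE q.1 t a x (0 + dz q.2)) (loopE q.2 t b x 0).
  rewrite (_ : (if _ is Some j then _ else _) = if (graded_rel i).2 is Some j then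
     conf (fun=> 1 / 2 < set_val x) (fun=> fold x) (fun=> fold x) (fun q => g q t (a ** b)) j 0 else 0); last first.
    by case: (graded_rel i).2 => // j; rewrite -loopE.
  rewrite [leRHS](_ : _ = 12 * (e / 12)); last by field.
  apply: conf_mul => //; [by move=> n /negbTE ->|exact: hs_off gP t a|exact: hs_off gP t b|exact: hs_off gP t _].
Qed.

End loops.
End symmetry.

(** * Quantization *)

Section discretization.
Variable R : realType.
Local Notation I := (unit_itv R).

Lemma clamp_lip (x y : R) : `|set_val (clamp x) - set_val (clamp y)| <= `|x - y|.
Proof.
rewrite !set_valE /=.
case: (lerP 0 (x - y)) => h; rewrite ?(ger0_norm h) ?(ltr0_norm h); rewrite ler_norml; apply/andP; split; minmax.
Qed.

Definition node (T : R) (n : int) : I := clamp (1 / 2 + n%:~R / Num.max 1 T).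

Let max_gt0 (T : R) : 0 < Num.max 1 T. Proof. by rewrite lt_max ltr01. Qed.

Lemma node_step T n (d : deg) :
  `|set_val (node T (n + dz d)) - set_val (node T n)| <= (Num.max 1 T)^-1.
Proof.
rewrite (le_trans (clamp_lip _ _))// opprD addrACA subrr add0r -mulrBl intrD [_ + _ - _]addrAC subrr add0r.
rewrite normrM (ger0_norm (_ : 0 <= (Num.max 1 T)^-1)) ?invr_ge0 ?(ltW (max_gt0 _))//.
by rewrite ler_piMl ?invr_ge0 ?(ltW (max_gt0 _))//; case: d => [[]|]; rewrite /= ?normr1 ?normrN1 ?normr0.
Qed.

(** Nodes with |n| >= [nodes T] - 1 are clamped to an end of the interval. The extra unit is a
    margin for the neighbours of an index. *)
Definition nodes (T : R) : nat := (Num.truncn (Num.max 1 T)).+2.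

Lemma node_end T n : (nodes T <= (absz n).+1)%N -> endpoints (node T n).
Proof.
rewrite ltnS => Tn; have := max_gt0 T; set M := Num.max 1 T => M0.
have Mn : M < (absz n)%:R by rewrite (lt_le_trans (truncnS_gt M))// ler_nat.
case: n Tn Mn => n Tn Mn; rewrite /node -/M.
  right; apply: val_inj => /=.
  have : 1 <= (Posz n)%:~R / M by rewrite ler_pdivlMr// mul1r ltW.
  by move: (_ / M) => {Tn Mn M0} u; minmax.
left; apply: val_inj => /=.
have : (Negz n)%:~R / M <= -1 by rewrite ler_pdivrMr// mulN1r NegzE mulrNz lerN2 ltW.
by move: (_ / M) => {Tn Mn M0} u; minmax.
Qed.

Lemma node_continuous (q : R -> R) n : continuous q -> continuous (fun t : R => node (q t) n).
Proof.
move=> cq; apply: cont_comp; last exact: clamp_continuous.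
apply: contD; first exact: cst_continuous.
apply: cont_mulr; first exact: cst_continuous.
apply: cont_inv; first by move=> x; rewrite gt_eqF.
by apply: cont_max; [exact: cst_continuous|].
Qed.

Lemma nodes_local (q : R -> R) (t0 : R) : continuous q -> exists N, \forall t \near t0, (nodes (q t) <= N)%N.
Proof.
move=> cq; exists (nodes (q t0 + 1)).
have : \forall t \near t0, q t < q t0 + 1.
  have /(@cvgrPdist_lt _ _ _ (nbhs t0))/(_ _ ltr01) := cq t0.
  by apply: filterS => t; rewrite ltr_distlC => /andP[].
apply: filterS => t qt; rewrite /nodes !ltnS; apply: le_truncn.
by rewrite ge_max le_max lexx /= le_max (ltW qt) orbT.
Qed.

Section mesh.
Variables (Z : set I) (A B : realCstarType R) (J : finType) (c : J -> R -> A -> itv_algebra Z B).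
Hypothesis nc : forall j, nice (c j).

(** The factor 2 absorbs the Lipschitz constant of [fold]. *)
Definition mesh (q : R -> R) := forall a e, 0 < e -> \forall t \near +oo_R,
  forall j (x y : I), `|set_val x - set_val y| <= 2 * (Num.max 1 (q t))^-1 -> `|c j t a x - c j t a y| <= e.

Lemma fin_qlip : exists2 C, 0 <= C & forall (a : A) eps, 0 < eps ->
  \forall t \near +oo_R, forall j b, `|c j t b - c j t a| <= C * `|b - a| + eps.
Proof.
have /choice[C CP] : forall j, exists C, 0 <= C /\ forall (a : A) e, 0 < e ->
    \forall t \near +oo_R, forall b, `|c j t b - c j t a| <= C * `|b - a| + e.
  by move=> j; have [C C0 h] := nice_qlip (nc j); exists C.
exists (\sum_j C j) => [|a e e0]; first by apply: sumr_ge0 => j _; exact: (CP j).1.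
have H j := (CP j).2 a e e0.
have HH : \forall t \near +oo_R, forall j b, `|c j t b - c j t a| <= C j * `|b - a| + e.
  exact: (@filter_forall _ _ (fun j => [set t | forall b, `|c j t b - c j t a| <= C j * `|b - a| + e]) _ _).
apply: filterS HH => t h j b; rewrite (le_trans (h j b))// lerD2r ler_wpM2r//.
by rewrite (bigD1 j)//= lerDl sumr_ge0// => i _; exact: (CP i).1.
Qed.

(** On bounded times the functions [c j t a] are uniformly continuous in x, jointly in t; a
    countable dense set of elements suffices because of the Lipschitz estimate of [nice]. *)
Lemma fast_mesh : separable A -> fast mesh.
Proof.
move=> [D [cD dD]].
pose P (x : J * A) s T := forall x1 x2 : I, `|set_val x1 - set_val x2| <= 2 * (Num.max 1 T)^-1 ->
   `|c x.1 s x.2 x1 - c x.1 s x.2 x2| <= (1 + s)^-1.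
have cD' : countable ([set: J] `*` D) by apply: countableX => //; exact: countableP.
have H (x : J * A) S : \forall T \near +oo_R, forall s, 1 <= s <= S -> P x s T.
  pose S1 := Num.max 1 S.
  have S0 : 0 < (1 + S1)^-1 by rewrite invr_gt0 addr_gt0// lt_max ltr01.
  have cu : continuous (fun w : R * I => c x.1 w.1 x.2 w.2).
    apply: (@itv_uncurry_continuous _ _ _ _ (fun s => c x.1 s x.2)).
    exact: nice_continuous_t (nc _) _.
  have [d d0 dP] := @joint_unif R R _ _ (fun s z => c x.1 s x.2 z) (@segment_compact R 1 S1) cu _ S0.
  apply: filterS (nbhs_pinfty_ge (num_real (2 / d))) => T Td s /andP[s1 sS] x1 x2 xx.
  rewrite (le_trans (dP s _ x1 x2 _))//.
  - by rewrite /= in_itv/= s1 le_max sS orbT.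
  - rewrite (le_trans xx)// ler_pdivrMr// mulrC -ler_pdivrMr//.
    by rewrite le_max Td orbT.
  - rewrite lef_pV2 ?posrE ?addr_gt0 ?(lt_le_trans ltr01 s1)//.
      by rewrite lerD2l le_max sS orbT.
    by rewrite lt_max ltr01.
apply: fast_mono (fast_countable cD' H) => q cq qP a e e0.
have [C C0 hC] := fin_qlip.
have e4 : 0 < e / 4 by rewrite divr_gt0.
have d0 : 0 < e / 4 / (C + 1) by rewrite divr_gt0// ltr_wpDl.
have [a' [aa' Da']] : ((ball a (e / 4 / (C + 1))) `&` D) !=set0.
  by apply: dD; [exists a; exact: ballxx|exact: ball_open].
move: aa'; rewrite -ball_normE /= => aa'.
have e8 : 0 < e / 8 by rewrite divr_gt0.
have h1 j := qP (j, a') (conj Logic.I Da').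
have {}h1 : \forall t \near +oo_R, forall j, P (j, a') t (q t).
  exact: (@filter_forall _ _ (fun j => [set t | P (j, a') t (q t)]) _ _).
have h2 := hC a' _ e8; have h3 := inv1_null e4.
apply: filterS3 h1 h2 h3 => t k1' k2 k3 d x y xy.
have k1 := k1' d x y xy.
have Ca : C * `|a - a'| <= e / 4.
  rewrite (le_trans (ler_wpM2l C0 (ltW aa')))// mulrCA ler_piMr ?(ltW e4)//.
  by rewrite ler_pdivrMr ?ltr_wpDl// mul1r lerDl.
have m z : `|c d t a z - c d t a' z| <= C * `|a - a'| + e / 8.
  by apply: le_trans (k2 d a); exact: (itv_normE (c d t a - c d t a')).
have m1 := m x; have m2 := m y.
rewrite (_ : _ - _ = (c d t a x - c d t a' x) + (c d t a' x - c d t a' y) - (c d t a y - c d t a' y));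
  last by lmod_gen R B.
rewrite (le_trans (ler_normB _ _))// (le_trans (lerD (ler_normD _ _) (lexx _)))//.
move: k1 k3 m1 m2 Ca; move: ((1 + t)^-1) => w.
move: (`|_ - _|) => y1; move: (`|_ - _|) => y2; move: (`|_ - _|) => y3; move: (C * _) => y4.
by lra.
Qed.


End mesh.

Section family.
Variables (A B : realCstarType R) (r : int -> multiplier B).
Hypothesis ri : forall n, is_isometry (r n).
Hypothesis ro : forall i j x, i != j -> mult_adj (r i) (r j x) = 0.
Variables (c : deg -> R -> A -> suspension B).
Hypothesis sc : is_system neg graded_rel c.

Definition disc (q : R -> R) : R -> A -> B :=
  assemble r (fun d t n a => c d t a (node (q t) n)) (fun t => nodes (q t)).

(** The relations of [c] hold at a common point, whereas matrix multiplication evaluates the factors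
    at the nodes n + dz d and n. By [mesh] the difference is negligible. *)
Lemma disc_spec q : continuous q -> mesh c q -> nice (disc q) /\ asymptotic_morphism (disc q).
Proof.
move=> cq mq.
have N_local (t0 : R) : exists N', \forall t \near t0, (nodes (q t) <= N')%N by exact: nodes_local.
have e_supp d t n a : (nodes (q t) <= absz n)%N -> c d t a (node (q t) n) = 0.
  by move=> /leqW/node_end; exact: itv_vanish.
have e_cont d n : continuous (fun w : R * A => c d w.1 w.2 (node (q w.1) n)).
  apply: (@cont_comp _ _ _ (fun w : R * A => (c d w.1 w.2, node (q w.1) n))
    (fun w : suspension B * I => w.1 w.2)); last first.
    by apply: (@itv_uncurry_continuous _ _ _ _ id); exact: cont_id.
  apply: cont_pair; first exact: (nice_continuous (sys_nice sc d)).
  by apply: (@cont_comp _ _ _ fst (fun t : R => node (q t) n)); [exact: cont_fst|exact: node_continuous].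
have e_at0 d t n : c d t 0 (node (q t) n) = 0 by rewrite (nice_at0 (sys_nice sc d)).
have e_qlip : exists2 C, 0 <= C & forall (a : A) eps, 0 < eps -> \forall t \near +oo_R,
    forall d n b, `|c d t b (node (q t) n) - c d t a (node (q t) n)| <= C * `|b - a| + eps.
  have [C C0 hC] := fin_qlip (sys_nice sc); exists C => // a e e0.
  apply: filterS (hC a e e0) => t h d n b; apply: le_trans (h d b).
  exact: (itv_normE (c d t b - c d t a)).
have step2 T n d : `|set_val (node T (n + dz d)) - set_val (node T n)| <= 2 * (Num.max 1 T)^-1.
  by rewrite (le_trans (node_step T n d))// ler_peMl ?ler1n ?invr_ge0 ?(ltW (max_gt0 _)).
have near0 (u : R -> suspension B) e : 0 < e -> u t @[t --> +oo_R] --> (0 : suspension B) ->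
    \forall t \near +oo_R, forall x, `|u t x| <= e.
  move=> e0 /null_normP/(_ _ e0); apply: filterS => t h x.
  exact: le_trans (itv_normE _ _) h.
have e_lin d (k : R) a b : unif (fun t n => c d t (k *: a + b) (node (q t) n) -
    (k *: c d t a (node (q t) n) + c d t b (node (q t) n))).
  move=> e e0; apply: filterS (near0 _ _ e0 (sys_linear sc d k a b)) => t h n.
  exact: h.
have e_star d a : unif (fun t n => c d t (cstar a) (node (q t) n) -
    cstar (c (neg d) t a (node (q t) (n + dz d)))).
  move=> e e0; have e2 : 0 < e / 2 by rewrite divr_gt0.
  apply: filterS2 (near0 _ _ e2 (sys_star sc d a)) (mq a _ e2) => t h1 h2 n.
  rewrite -(subrKA (cstar (c (neg d) t a (node (q t) n)))) (splitr e).
  rewrite (le_trans (ler_normD _ _))// lerD//; first exact: h1.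
  by rewrite -cstarB cnorm_star distrC; by apply: h2; exact: step2.
have e_mul i a b : unif (fun t n => \sum_(w <- (graded_rel i).1)
      c w.1 t a (node (q t) (n + dz w.2)) ** c w.2 t b (node (q t) n)
    - (if (graded_rel i).2 is Some d then c d t (a ** b) (node (q t) n) else 0)).
  move=> e e0; have e4 : 0 < e / 4 by rewrite divr_gt0.
  have [C C0 hC] := fin_qlip (sys_nice sc); pose M := C * `|b| + 1.
  have M0 : 0 < M by rewrite ltr_wpDl// mulr_ge0.
  have eM : 0 < e / 4 / M by rewrite divr_gt0.
  apply: filterS3 (near0 _ _ e4 (sys_mul sc i a b)) (mq a _ eM) (hC 0 1 ltr01) => t h1 h2 h3 n.
  set x := node (q t) n.
  have bM d : `|c d t b x| <= M.
    rewrite (le_trans (itv_normE _ _))//; have := h3 d b.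
    by rewrite (nice_at0 (sys_nice sc d)) !subr0.
  have step d d' : `|(c d t a (node (q t) (n + dz d')) - c d t a x) ** c d' t b x| <= e / 4.
    rewrite (le_trans (cnormM _ _))// -(divfK (lt0r_neq0 M0) (e / 4)) ler_pM//.
    by apply: h2; exact: step2.
  have sumE (S : Type) (s : seq S) (F : S -> suspension B) z :
      (\sum_(i <- s) F i) z = \sum_(i <- s) F i z.
    exact: (big_morph (fun G : suspension B => G z) (fun G H => itvDE G H z) (itv0E _ _ z)).
  have h1x := h1 x.
  have E1 : (\sum_(w <- (graded_rel i).1) c w.1 t a ** c w.2 t b -
      (if (graded_rel i).2 is Some j then c j t (a ** b) else 0)) x =
    \sum_(w <- (graded_rel i).1) c w.1 t a x ** c w.2 t b x -
      (if (graded_rel i).2 is Some j then c j t (a ** b) x else 0).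
    by rewrite itvDE itvNE sumE; case: (graded_rel i).2.
  rewrite E1 in h1x; move: h1x; set tgt := if _ is Some _ then _ else _.
  set S1 := \sum_(w <- _) _ => h1x; set S2 := \sum_(w <- _) _.
  have S2E : S2 = S1 + \sum_(w <- (graded_rel i).1) (c w.1 t a (node (q t) (n + dz w.2)) - c w.1 t a x) ** c w.2 t b x.
    rewrite /S1 /S2 -big_split; apply: eq_bigr => w _ /=.
    by rewrite cmulBl subrKC.
  have -> : S2 - tgt = (S1 - tgt) + \sum_(w <- (graded_rel i).1) (c w.1 t a (node (q t) (n + dz w.2)) - c w.1 t a x) ** c w.2 t b x.
    by rewrite S2E addrAC.
  rewrite (le_trans (ler_normD _ _))//.
  have : `|\sum_(w <- (graded_rel i).1) (c w.1 t a (node (q t) (n + dz w.2)) - c w.1 t a x) ** c w.2 t b x| <= 3 * (e / 4).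
    rewrite (le_trans (ler_norm_sum _ _ _))//.
    rewrite (le_trans (ler_sum _ (fun w _ => step w.1 w.2)))//.
    rewrite big_const_seq count_predT iter_addr_0 -[leLHS]mulr_natl ler_wpM2r ?(ltW e4)// ler_nat.
    by case: i {E1 S2 S2E S1 tgt h1x h1} => [[[] ?]|].
  by move: h1x; lra.
split; [exact: (nice_assemble ri ro N_local e_supp e_cont e_at0 e_qlip)
  |exact: (asym_assemble ri ro N_local e_supp e_cont e_at0 e_qlip e_lin e_star e_mul)].
Qed.

End family.
End discretization.

(** * Homotopy invariance under reparametrization *)

Section reparametrization.
Variable R : realType.
Local Notation I := (unit_itv R).

Lemma near_ray (P : R -> Prop) : (\forall t \near +oo_R, P t) ->
  \forall t \near +oo_R, forall T, t <= T -> P T.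
Proof.
move=> [M [Mr MP]]; exists M; split=> // t Mt T tT; apply: MP.
exact: lt_le_trans tT.
Qed.

Variables (A B : realCstarType R) (phi : asym A B) (nphi : nice phi).
Variables (p : R -> R) (cp : continuous p) (pt : forall t, t <= p t).

Let path (x : I) (t : R) := (1 - set_val x) * t + set_val x * p t.

Let path_ge x t : t <= path x t.
Proof.
rewrite /path; have := val_itv_ge0 x; have := val_itv_le1 x.
move: (set_val x) => v v1 v0; rewrite mulrBl mul1r -addrA lerDl addrC -mulrBr.
by rewrite mulr_ge0// subr_ge0.
Qed.

Let cpath : continuous (fun w : R * I => path w.2 w.1).
Proof.
have c2 : continuous (fun w : R * I => set_val w.2 : R).
  by apply: (@cont_comp _ _ _ snd); [exact: cont_snd|exact: set_val_continuous].
apply: contD; apply: cont_mulr => //.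
- by apply: contB => //; exact: cst_continuous.
- exact: cont_fst.
- by apply: cont_comp; [exact: cont_fst|].
Qed.

Let cphi_path : continuous (fun w : (R * A) * I => phi (path w.2 w.1.1) w.1.2).
Proof.
apply: (@cont_comp _ _ _ (fun w : (R * A) * I => (path w.2 w.1.1, w.1.2)) (fun w => phi w.1 w.2));
  last exact: nice_continuous nphi.
apply: cont_pair; last by apply: cont_comp; [exact: cont_fst|exact: cont_snd].
apply: (@cont_comp _ _ _ (fun w : (R * A) * I => (w.1.1, w.2)) (fun w : R * I => path w.2 w.1)) => //.
by apply: cont_pair; [apply: cont_comp; exact: cont_fst|exact: cont_snd].
Qed.

Let H (t : R) (a : A) : cylinder B.
Proof.
refine (@mk_itv _ set0 _ (fun x => phi (path x t) a) _ _); last by [].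
apply: (@cont_comp _ _ _ (fun x : I => ((t, a), x)) (fun w : (R * A) * I => phi (path w.2 w.1.1) w.1.2));
  last exact: cphi_path.
by apply: cont_pair; [exact: cst_continuous|exact: cont_id].
Defined.

Let HE t a x : H t a x = phi (path x t) a. Proof. by []. Qed.

Let nH : nice H.
Proof.
split.
- exact: (@itv_curry_continuous R _ set0 B (fun w : R * A => H w.1 w.2)).
- by move=> t; apply/itv_eqP => x; exact: nice_at0.
have [C C0 PC] := nice_qlip nphi; exists C => // a e e0.
apply: filterS (near_ray (PC a e e0)) => t h b; apply/itv_normP => x.
by apply: h; exact: path_ge.
Qed.

Let null (u : R -> B) (v : R -> cylinder B) : u t @[t --> +oo_R] --> (0 : B) ->
  (forall t x, v t x = u (path x t)) -> v t @[t --> +oo_R] --> (0 : cylinder B).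
Proof.
move=> /null_normP u0 vu; apply/null_normP => e e0.
apply: filterS (near_ray (u0 e e0)) => t h; apply/itv_normP => x.
by rewrite vu; apply: h; exact: path_ge.
Qed.

Let aH : asymptotic_morphism H.
Proof.
by apply: nice_asym => // [k a b|a b|a];
  [apply: null (asym_linear (asymP phi) k a b) _|apply: null (asym_mul (asymP phi) a b) _
  |apply: null (asym_star (asymP phi) a) _].
Qed.

(** The times t and p(t) are joined linearly. All intermediate times are at least t, so that the
    asymptotic relations hold uniformly along the path. *)
Lemma reparam : exists psi : asym A B,
  [/\ forall t a, psi t a = phi (p t) a, nice psi & homotopic psi phi].
Proof.
have E0 t a : H t a (clamp 0) = phi t a.
  by rewrite HE /path set_val_clamp0 subr0 mul1r mul0r addr0.
have E1 t a : H t a (clamp 1) = phi (p t) a.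
  by rewrite HE /path set_val_clamp1 subrr mul0r mul1r add0r.
exists (asym_post (itv_ev set0 B (clamp 1)) (Asym aH)); split=> [t a||].
- exact: E1.
- exact: nice_post_hom.
- by apply: homotopic_sym; exists (Asym aH) => t a _; split; first exact: E0.
Qed.

End reparametrization.

Section fast_composites.
Variables (R : realType) (A B D : realCstarType R) (sepD : separable D).

Lemma niceD (V W : normedModType R) (u v : R -> V -> W) : nice u -> nice v ->
  nice (fun t a => u t a + v t a).
Proof.
move=> nu nv; have := nice_comb 1 nu nv.
by congr nice; apply/funext => t; apply/funext => a; rewrite scale1r.
Qed.

Variables (Psi : asym A B) (nPsi : nice Psi).

Lemma fast_add (c c' : R -> D -> A) : nice c -> nice c' ->
  fast (fun p => forall a, Psi (p t) (c t a + c' t a) - (Psi (p t) (c t a) + Psi (p t) (c' t a))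
    @[t --> +oo_R] --> (0 : B)).
Proof.
move=> nc nc'; have [E [cE dE]] := sepD.
apply: (@fast_null R D B E (fun T s a => Psi T (c s a + c' s a) - (Psi T (c s a) + Psi T (c' s a)))) => //.
  have F u := @fast_nice R A B Psi nPsi D sepD u.
  apply: fast_mono (fast_and (F _ (niceD nc nc')) (fast_and (F _ nc) (F _ nc'))) => p cp [h1 [h2 h3]].
  by apply: qcB; [exact: (qc_nice h1 (@cont_id D))|apply: qcD; [exact: (qc_nice h2 (@cont_id D))|exact: (qc_nice h3 (@cont_id D))]].
move=> a; exists (fun=> 0) => [e e0|S e e0]; first by apply: nearW => s; exact: ltW.
have q (u : R -> A) : continuous u -> qc (fun T s => Psi T (u s)) by move=> cu; exact: qc_nice.
have := @comp_null R B (fun T s => Psi T (c s a + c' s a) - (Psi T (c s a) + Psi T (c' s a))) _ _ S e e0.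
have H1 : qc (fun T s => Psi T (c s a + c' s a) - (Psi T (c s a) + Psi T (c' s a))).
  have c1 : continuous (c ^~ a) by exact: nice_continuous_t.
  have c2 : continuous (c' ^~ a) by exact: nice_continuous_t.
  by apply: qcB; [apply: q; exact: contD|apply: qcD; exact: q].
have H2 s : Psi T (c s a + c' s a) - (Psi T (c s a) + Psi T (c' s a)) @[T --> +oo_R] --> (0 : B).
  exact: asymD.
by move=> /(_ H1 H2); apply: filterS => T h s /h; rewrite add0r.
Qed.

Lemma fast_cong (c c' : R -> D -> A) : nice c -> nice c' ->
  (forall a, c t a - c' t a @[t --> +oo_R] --> (0 : A)) ->
  fast (fun p => forall a, Psi (p t) (c t a) - Psi (p t) (c' t a) @[t --> +oo_R] --> (0 : B)).
Proof.
move=> nc nc' cc; have [E [cE dE]] := sepD.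
apply: (@fast_null R D B E (fun T s a => Psi T (c s a) - Psi T (c' s a))) => //.
  have F u := @fast_nice R A B Psi nPsi D sepD u.
  apply: fast_mono (fast_and (F _ nc) (F _ nc')) => p cp [h1 h2].
  by apply: qcB; [exact: (qc_nice h1 (@cont_id D))|exact: (qc_nice h2 (@cont_id D))].
move=> a; have c1 : continuous (c ^~ a) by exact: nice_continuous_t.
  have c2 : continuous (c' ^~ a) by exact: nice_continuous_t.
have [C C0 PC] := comp_near nPsi c2 c1.
exists (fun s => C * `|c s a - c' s a|) => [e e0|S e e0]; last exact: PC.
have /null_normP/(_ _ e0) := cvg0Z C (cc a).
by apply: filterS => s; rewrite normrZ ger0_norm.
Qed.

Lemma fast_aeq (Psi' : asym A B) (nPsi' : nice Psi') (c : R -> D -> A) : nice c -> aeq Psi Psi' ->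
  fast (fun p => forall a, Psi (p t) (c t a) - Psi' (p t) (c t a) @[t --> +oo_R] --> (0 : B)).
Proof.
move=> nc pp; have [E [cE dE]] := sepD.
apply: (@fast_null R D B E (fun T s a => Psi T (c s a) - Psi' T (c s a))) => //.
  have h1 := @fast_nice R A B Psi nPsi D sepD c nc.
  have h2 := @fast_nice R A B Psi' nPsi' D sepD c nc.
  apply: fast_mono (fast_and h1 h2) => p cp [{}h1 {}h2].
  by apply: qcB; [exact: (qc_nice h1 (@cont_id D))|exact: (qc_nice h2 (@cont_id D))].
move=> a; have c1 : continuous (c ^~ a) by exact: nice_continuous_t.
exists (fun=> 0) => [e e0|S e e0]; first by apply: nearW => s; exact: ltW.
have := @comp_null R B (fun T s => Psi T (c s a) - Psi' T (c s a)) _ _ S e e0.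
have H1 : qc (fun T s => Psi T (c s a) - Psi' T (c s a)) by apply: qcB; exact: qc_nice.
by move=> /(_ H1 (fun s => pp (c s a))); apply: filterS => T h s /h; rewrite add0r.
Qed.

End fast_composites.

Section folding.
Variable R : realType.
Local Notation I := (unit_itv R).

Lemma fold_lip (x y : I) d : `|set_val x - set_val y| <= d -> `|set_val (fold x) - set_val (fold y)| <= 2 * d.
Proof.
move=> xy; rewrite (le_trans (clamp_lip _ _))// (le_trans (ler_dist_dist _ _))//.
rewrite [X in `|X|](_ : _ = 2 * (set_val x - set_val y)); last by ring.
rewrite normrM ger0_norm//.
by rewrite ler_wpM2l.
Qed.

Lemma fold_end (x : I) : endpoints x -> fold x = clamp 1.
Proof.
case=> ->; rewrite /fold ?set_val_clamp0 ?set_val_clamp1; congr clamp.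
  by rewrite mulr0 sub0r normrN normr1.
by rewrite (_ : 2 * 1 - 1 = 1 :> R) ?normr1//; lra.
Qed.

Lemma node_half (T : R) n : (1 / 2 < set_val (node T n)) = (0 < n).
Proof.
have M0 : 0 < Num.max 1 T by rewrite lt_max ltr01.
rewrite /node; move: (Num.max 1 T) M0 => M M0.
have [n0|n0] := ltP 0 n.
  have u0 : 0 < n%:~R / M by rewrite divr_gt0// ltr0z.
  by rewrite set_valE /=; move: u0; set u := _ / M; minmax.
have u0 : n%:~R / M <= 0 by rewrite mulr_le0_ge0 ?lerz0// invr_ge0 ltW.
apply/negbTE; rewrite -leNgt set_valE /=; move: u0; set u := _ / M.
by minmax.
Qed.

Lemma fold_node0 (T : R) : fold (node T 0) = clamp 0.
Proof.
rewrite /fold /node mul0r addr0; congr clamp.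
rewrite set_valE /= min_l ?max_r; try lra.
by rewrite mulrCA divff// mulr1 subrr normr0.
Qed.

End folding.

(** * Quantizing the suspension of a morphism *)

Section desuspension.
Variables (R : realType) (A B : realCstarType R) (sepA : separable A).
Local Notation I := (unit_itv R).
Variables (g : bool * bool -> R -> A -> cylinder A) (k : starhom A A) (gP : hs_data g k).
Variables (r : int -> multiplier B) (ri : forall n, is_isometry (r n)).
Hypothesis ro : forall i j x, i != j -> mult_adj (r i) (r j x) = 0.
Hypothesis r1 : hh (conj_hom (ri 1)) (starhom_id B).
Variables (phi : asym A B) (nphi : nice phi).
Variables (Psi : asym (suspension A) (suspension B)) (nPsi : nice Psi).
Hypothesis PsiS : aeq Psi (itv_asym endpoints nphi).

Let Phi : asym (cylinder A) (cylinder B) := itv_asym set0 nphi.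
Let nPhi : nice Phi := itv_fam_nice set0 nphi.
Let f (p : R -> R) q t a : cylinder B := Phi (p t) (g q t a).
Let c (p : R -> R) d t a : suspension B := Psi (p t) (loop gP d t a).

Let fast_f : fast (fun p => is_system hs_st hs_rel (hs_fam (f p))).
Proof.
apply: fast_mono (fast_system (itv_fam_nice set0 nPhi : nice (itv_asym set0 nPhi)) sepA (hs_system gP)) => p _.
apply: sys_ext => -[[] q] t a; by apply/itv_eqP => x; apply/itv_eqP.
Qed.

(** A loop contains sums of entries of [g], while phi is additive only asymptotically: the first
    hypothesis handles the right half of the loop, the next three the sum of four entries on the
    left. *)
Let near_conf p :
  (forall a, Phi (p t) (g (false, false) t a + g (true, true) t a) -
     (Phi (p t) (g (false, false) t a) + Phi (p t) (g (true, true) t a)) @[t --> +oo_R] --> (0 : cylinder B)) ->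
  (forall a, Phi (p t) (g (false, false) t a + g (false, true) t a) -
     (Phi (p t) (g (false, false) t a) + Phi (p t) (g (false, true) t a)) @[t --> +oo_R] --> (0 : cylinder B)) ->
  (forall a, Phi (p t) (g (true, false) t a + g (true, true) t a) -
     (Phi (p t) (g (true, false) t a) + Phi (p t) (g (true, true) t a)) @[t --> +oo_R] --> (0 : cylinder B)) ->
  (forall a, Phi (p t) (g (false, false) t a + g (false, true) t a + (g (true, false) t a + g (true, true) t a)) -
     (Phi (p t) (g (false, false) t a + g (false, true) t a) + Phi (p t) (g (true, false) t a + g (true, true) t a))
     @[t --> +oo_R] --> (0 : cylinder B)) ->
  (forall d a, c p d t a - itv_asym endpoints nphi (p t) (loop gP d t a) @[t --> +oo_R] --> (0 : suspension B)) ->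
  forall a e, 0 < e -> \forall t \near +oo_R, forall d x n,
    `|c p d t a x - conf (fun=> 1 / 2 < set_val x) (fun=> fold x) (fun=> fold x) (fun q => f p q t a) d n| <= e.
Proof.
move=> a1 a2 a3 a4 cS a e e0; have e5 : 0 < e / 5 by rewrite divr_gt0.
have /null_normP/(_ _ e5) h1 := a1 a; have /null_normP/(_ _ e5) h2 := a2 a.
have /null_normP/(_ _ e5) h3 := a3 a; have /null_normP/(_ _ e5) h4 := a4 a.
have h5 : \forall t \near +oo_R, forall d, `|c p d t a - itv_asym endpoints nphi (p t) (loop gP d t a)| <= e / 5.
  have H d : \forall t \near +oo_R, forall x : unit, `|c p d t a - itv_asym endpoints nphi (p t) (loop gP d t a)| <= e / 5.
    by have /null_normP/(_ _ e5) := cS d a; apply: filterS.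
  have := near_fin H; apply: filterS => t h d; exact: h d tt.
apply: filterS3 (filterI h1 h2) (filterI h3 h4) h5 => t [{}h1 {}h2] [{}h3 {}h4] {}h5 d x n.
rewrite -(subrKA (phi (p t) (loop gP d t a x))).
have l1 : `|c p d t a x - phi (p t) (loop gP d t a x)| <= e / 5.
  apply: le_trans (h5 d).
  exact: (itv_normE (c p d t a - itv_asym endpoints nphi (p t) (loop gP d t a)) x).
suff : `|phi (p t) (loop gP d t a x) - conf (fun=> 1 / 2 < set_val x) (fun=> fold x) (fun=> fold x)
    (fun q => f p q t a) d n| <= 4 * (e / 5).
  move=> l2; rewrite (le_trans (ler_normD _ _))//.
  by rewrite [leRHS](_ : _ = e / 5 + 4 * (e / 5)); [exact: lerD|field].
have e45 : 0 <= 4 * (e / 5) by rewrite mulr_ge0// ltW.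
rewrite (loopE _ _ _ _ _ n) /conf.
have le1 (y : B) : `|y| <= e / 5 -> `|y| <= 4 * (e / 5).
  by move=> hy; rewrite (le_trans hy)// ler_peMl ?ler1n// ltW.
clear l1; case: ifP => _; case: d => [[]|]; rewrite ?(nice_at0 nphi) ?subrr ?normr0//.
  apply: le1; apply: le_trans h1.
  exact: (itv_normE (Phi (p t) (g (false, false) t a + g (true, true) t a) -
     (Phi (p t) (g (false, false) t a) + Phi (p t) (g (true, true) t a))) (fold x)).
have k2 := le_trans (itv_normE (Phi (p t) (g (false, false) t a + g (false, true) t a) -
     (Phi (p t) (g (false, false) t a) + Phi (p t) (g (false, true) t a))) (fold x)) h2.
have k3 := le_trans (itv_normE (Phi (p t) (g (true, false) t a + g (true, true) t a) -
     (Phi (p t) (g (true, false) t a) + Phi (p t) (g (true, true) t a))) (fold x)) h3.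
have k4 := le_trans (itv_normE (Phi (p t) (g (false, false) t a + g (false, true) t a + (g (true, false) t a + g (true, true) t a)) -
     (Phi (p t) (g (false, false) t a + g (false, true) t a) + Phi (p t) (g (true, false) t a + g (true, true) t a))) (fold x)) h4.
set X1 := (X in `|X| <= _) in k2; set X2 := (X in `|X| <= _) in k3; set X3 := (X in `|X| <= _) in k4.
rewrite (_ : _ - _ = X1 + X2 + X3); last first.
  rewrite /X1 /X2 /X3 !(itvDE, itvNE) /f /Phi /=.
  by lmod_gen R B.
rewrite (le_trans (ler_normD _ _))// (le_trans (lerD (ler_normD _ _) (lexx _)))//.
rewrite (_ : 4 * (e / 5) = e / 5 + e / 5 + e / 5 + e / 5); last by ring.
by rewrite (ler_wpDr (ltW e5))// !lerD.
Qed.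

Section homotopy.
Variables (p q : R -> R) (cq : continuous q).
Hypothesis sf : is_system hs_st hs_rel (hs_fam (f p)).
Hypothesis nf : forall w, nice (f p w).
Hypothesis f_mesh : mesh (f p) q.

(** The slide, read backwards: the folded nodes at x = 1, the end of the path at x = 0. In [z] the
    indices n <= 0 stay at the base point throughout; since the component [(true, true)] at n uses z
    (n - 1), this leaves a term at n = 1. *)
Let y (t : R) n (x : I) : I := clamp (1 - set_val x * (1 - set_val (fold (node (q t) n)))).
Let z t n x := if 0 < n then y t n x else clamp 0.
Let F t a w := f p w t a.

Let cy n : continuous (fun w : R * I => y w.1 n w.2).
Proof.
have c1 : continuous (fun w : R * I => set_val w.2 : R).
  by apply: (@cont_comp _ _ _ snd); [exact: cont_snd|exact: set_val_continuous].
apply: (@cont_comp _ _ _ (fun w : R * I => 1 - set_val w.2 * (1 - set_val (fold (node (q w.1) n))))); last exact: clamp_continuous.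
apply: contB; first exact: cst_continuous.
apply: cont_mulr => //; apply: contB; first exact: cst_continuous.
apply: (@cont_comp _ _ _ (fun w : R * I => node (q w.1) n) (fun x => set_val (fold x))).
  by apply: (@cont_comp _ _ _ fst (fun t : R => node (q t) n)); [exact: cont_fst|exact: node_continuous].
apply: (@cont_comp I I R (@fold R) (fun x : I => set_val x)); last exact: set_val_continuous.
apply: (@cont_comp _ _ _ (fun x : I => `|2 * set_val x - 1| : R)); last exact: clamp_continuous.
apply: cont_norm; apply: contB; last exact: cst_continuous.
by apply: contZ; [exact: cst_continuous|exact: set_val_continuous].
Qed.

Let cz n : continuous (fun w : R * I => z w.1 n w.2).
Proof. by rewrite /z; case: (0 < n); [exact: cy|exact: cst_continuous]. Qed.

Let cF w (s : R -> I -> I) : continuous (fun v : R * I => s v.1 v.2) ->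
  continuous (fun v : (R * A) * I => F v.1.1 v.1.2 w (s v.1.1 v.2)).
Proof.
move=> cs; apply: (@cont_comp _ _ _ (fun v : (R * A) * I => (v.1, s v.1.1 v.2))
  (fun u : (R * A) * I => F u.1.1 u.1.2 w u.2)).
  apply: cont_pair; first exact: cont_fst.
  apply: (@cont_comp _ _ _ (fun v : (R * A) * I => (v.1.1, v.2)) (fun v : R * I => s v.1 v.2)) => //.
  by apply: cont_pair; [apply: cont_comp; exact: cont_fst|exact: cont_snd].
apply: (@itv_uncurry_continuous _ _ _ _ (fun u : R * A => F u.1 u.2 w)).
exact: nice_continuous (nf w).
Qed.

Let cE d n : continuous (fun v : (R * A) * I =>
  conf (fun n => 0 < n) (fun n => y v.1.1 n v.2) (fun n => z v.1.1 n v.2) (F v.1.1 v.1.2) d n).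
Proof.
rewrite /conf; case: (0 < n); last first.
  case: d => [d|] /=; first exact: cst_continuous.
  by apply: contD; apply: contD; apply: (cF _ (s := fun t => y t n)); exact: cy.
case: d => [[]|]; first by apply: (cF _ (s := fun t => y t n)); exact: cy.
  by apply: (cF _ (s := fun t => z t (n - 1))); exact: cz.
apply: contD; first by apply: (cF _ (s := fun t => y t n)); exact: cy.
by apply: (cF _ (s := fun t => z t (n - 1))); exact: cz.
Qed.

Let E (d : deg) (t : R) (n : int) (a : A) : cylinder B.
Proof.
refine (@mk_itv _ set0 _ (fun x => conf (fun n => 0 < n) (fun n => y t n x) (fun n => z t n x) (F t a) d n) _ _);
  last by [].
apply: (@cont_comp _ _ _ (fun x : I => ((t, a), x)) (fun v : (R * A) * I =>
  conf (fun n => 0 < n) (fun n => y v.1.1 n v.2) (fun n => z v.1.1 n v.2) (F v.1.1 v.1.2) d n)); last exact: cE.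
by apply: cont_pair; [exact: cst_continuous|exact: cont_id].
Defined.

Let EE d t n a x : E d t n a x =
  conf (fun n => 0 < n) (fun n => y t n x) (fun n => z t n x) (F t a) d n.
Proof. by []. Qed.

Let h_mono (n : int) : 0 < n -> 0 < n + 1. Proof. lia. Qed.
Let z_y t x (n : int) : 0 < n -> z t n x = y t n x. Proof. by rewrite /z => ->. Qed.
Let z_0 t x (n : int) : ~~ (0 < n) -> 0 < n + 1 -> z t n x = clamp 0.
Proof. by rewrite /z => /negbTE ->. Qed.
Let F_off t a : off (F t a).
Proof. by move=> i; rewrite /F /f /= (hs_off gP) (nice_at0 nphi). Qed.
Let F_at1 t a w : F t a w (clamp 1) = 0.
Proof. by rewrite /F /f /= (hs_at1 gP) (nice_at0 nphi). Qed.

Let y_end t n x : (nodes (q t) <= (absz n).+1)%N -> y t n x = clamp 1.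
Proof.
by move=> /node_end/fold_end; rewrite /y => ->; rewrite set_val_clamp1 subrr mulr0 subr0.
Qed.

Let E_supp d t n a : (nodes (q t) <= absz n)%N -> E d t n a = 0.
Proof.
move=> Nn; apply/itv_eqP => x; rewrite EE /conf (y_end x (leqW Nn)) !F_at1.
(* The margin of one index in [node_end] is spent on n - 1. *)
have zE : 0 < n -> z t (n - 1) x = clamp 1.
  move=> n0; have n1 : 0 < n - 1 by move: Nn; rewrite /nodes; lia.
  by rewrite /z n1 y_end//; lia.
case: ifP => [/zE ->|_]; last by case: d => //=; rewrite !addr0.
by rewrite !F_at1; case: d => [[]|]; rewrite ?addr0.
Qed.

Let r' n := itv_mult set0 (ri n).

Lemma E_asym : asymptotic_morphism (assemble r' E (fun t => nodes (q t))).
Proof.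
have ri' n : is_isometry (r' n) by exact: itv_mult_isometry.
have ro' i j G : i != j -> mult_adj (r' i) (r' j G) = 0.
  by move=> ij; apply/itv_eqP => x; exact: ro.
have N_local (t0 : R) : exists N', \forall t \near t0, (nodes (q t) <= N')%N by exact: nodes_local.
have e4 (e : R) : 0 < e -> 0 < e / 4 by move=> e0; rewrite divr_gt0.
have e4E (e : R) : e = 4 * (e / 4) by field.
apply: (asym_assemble ri' ro' N_local E_supp).
- move=> d n; apply: (@itv_curry_continuous R (R * A)%type set0 B (fun w : R * A => E d w.1 n w.2)).
  exact: cE d n.
- move=> d t n; apply/itv_eqP => x; rewrite EE /conf /F /f.
  have F0 w v : Phi (p t) (g w t 0) v = 0 by have := nice_at0 (nf w) t; rewrite /f => ->.
  by rewrite !F0 !addr0; case: ifP; case: d => [[]|].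
- have [C C0 hC] := fin_qlip nf; exists (4 * C) => [|a e e0]; first by rewrite mulr_ge0.
  apply: filterS (hC a _ (e4 _ e0)) => t h d n b; apply/itv_normP => x.
  rewrite [leRHS](_ : _ = 4 * (C * `|b - a| + e / 4)); last by field.
  apply: conf_dist => w v; apply: le_trans (h w b).
  exact: (itv_normE (f p w t b - f p w t a)).
- move=> d l a b e e0; apply: filterS (hs_near_lin sf l a b (e4 _ e0)) => t h n.
  by apply/itv_normP => x; rewrite (e4E e); exact: conf_lin.
- move=> d a e e0; apply: filterS (hs_near_star sf a (e4 _ e0)) => t h n.
  apply/itv_normP => x; rewrite (e4E e).
  by apply: conf_star; [exact: h_mono|exact: z_y|exact: z_0|exact: F_off|exact: F_off|exact: h].
- move=> i a b e e0; have e12 : 0 < e / 12 by rewrite divr_gt0.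
  apply: filterS (hs_near_mul sf a b e12) => t [h1 h2] n; apply/itv_normP => x.
  rewrite [leRHS](_ : _ = 12 * (e / 12)); last by field.
  have sumE (S : Type) (s : seq S) (G : S -> cylinder B) v :
      (\sum_(i <- s) G i) v = \sum_(i <- s) G i v.
    exact: (big_morph (fun H : cylinder B => H v) (fun G H => itvDE G H v) (itv0E _ _ v)).
  rewrite itvDE itvNE sumE.
  rewrite (_ : itv_fun (if _ is Some d then _ else _) x = if (graded_rel i).2 is Some d
    then conf (fun n => 0 < n) (fun n => y t n x) (fun n => z t n x) (F t (a ** b)) d n else 0); last first.
    by case: (graded_rel i).2.
  by apply: conf_mul; [exact: h_mono|exact: z_y|exact: z_0|exact: F_off|exact: F_off|exact: F_off|exact: h1|exact: h2].
Qed.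

Lemma E_at0 t a : assemble r' E (fun t => nodes (q t)) t a (clamp 0) =
  conj_hom (ri 1) (F t a (true, true) (clamp 0)).
Proof.
rewrite (assemble_ev ri); apply: assemble_at => // d n.
rewrite EE /conf.
have y1 m : y t m (clamp 0) = clamp 1 by rewrite /y set_val_clamp0 mul0r subr0.
rewrite !y1 !F_at1 !addr0 !add0r /z y1.
have [n0|n0] := ltP 0 n; last first.
  rewrite ifF; last by apply/negbTE/negP => /andP[_ /eqP n1]; lia.
  by case: d.
have [n1|n1] := ltP 0 (n - 1).
  rewrite !F_at1 ifF; last by apply/negbTE/negP => /andP[_ /eqP]; lia.
  by case: d => [[]|].
have -> : n = 1 by lia.
have Fo : F t a (false, true) (clamp 0) = 0 := F_off t a false.
by case: d => [[]|]; rewrite ?Fo.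
Qed.

Lemma E_at1 (chi : R -> A -> B) :
  (forall a e, 0 < e -> \forall t \near +oo_R, forall d x n,
    `|c p d t a x - conf (fun=> 1 / 2 < set_val x) (fun=> fold x) (fun=> fold x) (fun q => f p q t a) d n| <= e) ->
  (forall t a, chi t a = disc r (c p) q t a) ->
  forall a, chi t a - assemble r' E (fun t => nodes (q t)) t a (clamp 1) @[t --> +oo_R] --> (0 : B).
Proof.
move=> cf chiE a; apply/null_normP => e e0.
have e10 : 0 < e / 10 by rewrite divr_gt0.
apply: filterS2 (cf a _ e10) (f_mesh a e10) => t h1 h2.
rewrite chiE (assemble_ev ri) [leRHS](_ : _ = 5 * (e / 10 + e / 10)); last by field.
apply: assemble_dist => // [|d n]; first by rewrite addr_ge0// ltW.
set x := node (q t) n.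
rewrite -(subrKA (conf (fun=> 1 / 2 < set_val x) (fun=> fold x) (fun=> fold x) (fun q => f p q t a) d n)).
rewrite (le_trans (ler_normD _ _))// lerD//.
have yE m : y t m (clamp 1) = fold (node (q t) m).
  by rewrite /y set_val_clamp1 mul1r opprB addrCA subrr addr0 clampK.
rewrite EE /conf node_half yE.
have zE : 0 < n -> z t (n - 1) (clamp 1) = fold (node (q t) (n - 1)).
  rewrite /z yE => n0; case: ltP => // n1.
  have -> : n - 1 = 0 by lia.
  by rewrite fold_node0.
(* The configuration [E] evaluates the moved component at the node n - 1, and the loop at the node
   n; folding at most doubles their distance. *)
have near w : `|f p w t a (fold x) - f p w t a (fold (node (q t) (n - 1)))| <= e / 10.
  apply: h2; apply: fold_lip; rewrite -/x.
  have := node_step (q t) (n - 1) (Some true); rewrite /= subrK; exact.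
have z0 : `|0 : B| <= e / 10 by rewrite normr0 ltW.
have [n0|n0] := ltP 0 n; last by rewrite subrr.
rewrite (zE n0); case: d => [[]|].
- by rewrite subrr.
- exact: near (false, true).
- by rewrite opprD addrACA subrr add0r; exact: near (true, true).
Qed.

End homotopy.

(** The requirements on q are nested in those on p because the mesh must be fine for the composite,
    hence depends on p. [Psi] is only asymptotically the suspension of [phi], so that ends of
    regularized homotopies qualify. *)
Lemma fast_desuspension : fast (fun p => is_system neg graded_rel (fun d t a => Psi (p t) (loop gP d t a)) /\
  fast (fun q => mesh (fun d t a => Psi (p t) (loop gP d t a)) q /\
    forall chi : asym A B,
      (forall t a, chi t a = disc r (fun d t a => Psi (p t) (loop gP d t a)) q t a) ->
      homotopic chi phi)).
Proof.
have ng := hs_nice gP.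
have n2 w w' : nice (fun t a => g w t a + g w' t a) by exact: niceD.
have Fadd u u' := @fast_add R _ _ A sepA Phi nPhi u u'.
have F1 := Fadd _ _ (ng (false, false)) (ng (true, true)).
have F2 := Fadd _ _ (ng (false, false)) (ng (false, true)).
have F3 := Fadd _ _ (ng (true, false)) (ng (true, true)).
have F4 := Fadd _ _ (n2 (false, false) (false, true)) (n2 (true, false) (true, true)).
have F5 : fast (fun p => forall d a, c p d t a - itv_asym endpoints nphi (p t) (loop gP d t a)
    @[t --> +oo_R] --> (0 : suspension B)).
  apply: fast_fin => d; apply: (fast_aeq sepA nPsi (itv_fam_nice endpoints nphi : nice (itv_asym endpoints nphi))) => //.
  exact: sys_nice (loop_system gP) d.
have F6 : fast (fun p => forall a, phi (p t) (g (true, true) t a (clamp 0)) - phi (p t) (k a)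
    @[t --> +oo_R] --> (0 : B)).
  apply: (fast_cong sepA nphi (c := fun t a => g (true, true) t a (clamp 0)) (c' := fun=> k)).
  - by apply: (nice_post_hom (itv_ev set0 A (clamp 0))); exact: ng.
  - split=> [|t|]; last first.
    + exists 1 => // a e e0; apply: nearW => t b.
      by rewrite mul1r -starhomB (le_trans (starhom_contractive _ _))// lerDl ltW.
    + exact: starhom0.
    + by apply: (@cont_comp _ _ _ snd k); [exact: cont_snd|exact: starhom_continuous].
  - exact: hs_corner gP.
have F7 : fast (fun p => forall w, nice (f p w)).
  by apply: fast_fin => w; apply: fast_nice => //; exact: ng.
have F8 := fast_system nPsi sepA (loop_system gP).
have FF := fast_and F8 (fast_and fast_f (fast_and F7 (fast_and (fast_ge R) (fast_and F6 (fast_and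
  (fast_and F1 F2) (fast_and F3 (fast_and F4 F5))))))).
apply: fast_mono FF => p cp [sc [sf [nf [pt [pk [[a1 a2] [a3 [a4 a5]]]]]]]]; split=> //.
apply: fast_mono (fast_and (fast_mesh (sys_nice sc) sepA) (fast_mesh nf sepA)) => q cq [m1 m2].
split=> // chi chiE.
have nc := near_conf a1 a2 a3 a4 a5.
pose X := Asym (E_asym cq sf nf).
have h1 := E_at1 cq nf m2 nc chiE.
have h0 := E_at0 cq nf.
pose ev i := asym_post (itv_ev set0 B (clamp i)) X.
have e1 : homotopic chi (ev 1) by apply: aeq_homotopic; exact: h1.
have e10 : homotopic (ev 1) (ev 0) by apply: homotopic_sym; exists X.
apply: homotopic_trans e1 (homotopic_trans e10 _).
(* What remains is phi at time p(t), composed with [k] and conjugated by [r 1]: three modifications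
   that do not change the homotopy class. *)
have [psi [psiE npsi psi_phi]] := reparam nphi cp pt.
have e0 : homotopic (ev 0) (asym_post (conj_hom (ri 1)) (asym_pre k psi)).
  apply: aeq_homotopic => a; apply: cvg0_eq (cvg0_hom (conj_hom (ri 1)) (pk a)) => t _.
  by rewrite starhomB /= psiE; congr (_ - _); exact: h0.
apply: homotopic_trans e0 (homotopic_trans (hh_asym_post _ r1) _).
apply: homotopic_trans (homotopic_trans (hh_asym_pre npsi (hs_k gP)) _).
  exact: homotopic_ext.
by apply: homotopic_trans _ psi_phi; exact: homotopic_ext.
Qed.

End desuspension.

(** * The nullhomotopy of a homotopy symmetric algebra *)

Section perturbation_system.
Variables (R : realType) (J X : finType) (st : J -> J) (rel : X -> seq (J * J) * option J).
Variables (D A : realCstarType R) (c c' : J -> R -> D -> A).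
Hypothesis sc : is_system st rel c.
Hypothesis nc' : forall j, nice (c' j).
Hypothesis cc : forall j a, c' j t a - c j t a @[t --> +oo_R] --> (0 : A).

Let bounded (u : R -> D -> A) a : nice u -> exists2 M, 0 <= M & \forall t \near +oo_R, `|u t a| <= M.
Proof.
move=> nu; have [C C0 PC] := nice_qlip nu; exists (C * `|a| + 1); first by rewrite addr_ge0// mulr_ge0.
by apply: filterS (PC 0 1 ltr01) => t /(_ a); rewrite (nice_at0 nu) !subr0.
Qed.

Let null_mul (u v : R -> A) M : 0 <= M -> (\forall t \near +oo_R, `|u t| <= M) ->
  v t @[t --> +oo_R] --> (0 : A) -> u t ** v t @[t --> +oo_R] --> (0 : A) /\
  v t ** u t @[t --> +oo_R] --> (0 : A).
Proof.
move=> M0 uM /null_normP v0; split; apply/null_normP => e e0;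
  have d0 : 0 < e / (M + 1) by [rewrite divr_gt0// ltr_wpDl|rewrite divr_gt0// ltr_wpDl].
- apply: filterS2 uM (v0 _ d0) => t h1 h2.
  rewrite (le_trans (cnormM _ _))// (le_trans (ler_pM _ _ h1 h2))//.
  by rewrite mulrCA ler_piMr ?(ltW e0)// ler_pdivrMr ?ltr_wpDl// mul1r lerDl.
- apply: filterS2 uM (v0 _ d0) => t h1 h2.
  rewrite (le_trans (cnormM _ _))// (le_trans (ler_pM _ _ h2 h1))// mulrC.
  by rewrite mulrCA ler_piMr ?(ltW e0)// ler_pdivrMr ?ltr_wpDl// mul1r lerDl.
Qed.

Lemma sys_perturb : is_system st rel c'.
Proof.
have nc := sys_nice sc; split=> // [j k a b|j a|i a b].
- apply: cvg0_eq (cvg0D (sys_linear sc j k a b) (cvg0D (cc j (k *: a + b))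
    (cvg0N (cvg0D (cvg0Z k (cc j a)) (cc j b))))) => t _.
  by lmod_gen R A.
- apply: cvg0_eq (cvg0D (sys_star sc j a) (cvg0D (cc j (cstar a)) (cvg0N (cvg0_star (cc (st j) a))))) => t _.
  by rewrite cstarB; lmod_gen R A.
have h1 : (if (rel i).2 is Some j then c' j t (a ** b) else 0) -
    (if (rel i).2 is Some j then c j t (a ** b) else 0) @[t --> +oo_R] --> (0 : A).
  case: (rel i).2 => [j|]; first exact: cc.
  by rewrite subr0; exact: cvg_cst.
have h2 (q : J * J) : c' q.1 t a ** c' q.2 t b - c q.1 t a ** c q.2 t b @[t --> +oo_R] --> (0 : A).
  have [M M0 hM] := bounded b (nc' q.2); have [N N0 hN] := bounded a (nc q.1).
  have k1 := (null_mul M0 hM (cc q.1 a)).2; have k2 := (null_mul N0 hN (cc q.2 b)).1.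
  by apply: cvg0_eq (cvg0D k1 k2) => t _; calg R A.
have h3 (s : seq (J * J)) : \sum_(q <- s) c' q.1 t a ** c' q.2 t b - \sum_(q <- s) c q.1 t a ** c q.2 t b
    @[t --> +oo_R] --> (0 : A).
  elim: s => [|q s IH].
    apply: cvg0_eq (cvg_cst (0 : A)) => t _; by rewrite !big_nil subrr.
  by apply: cvg0_eq (cvg0D (h2 q) IH) => t _; rewrite !big_cons; lmod_gen R A.
apply: cvg0_eq (cvg0D (sys_mul sc i a b) (cvg0D (h3 (rel i).1) (cvg0N h1))) => t _.
by lmod_gen R A.
Qed.

End perturbation_system.

Section corners.
Variables (R : realType) (T : realCstarType R) (s : cuntz_pair T).

Definition leg (b : bool) : multiplier T := if b then cuntz1 s else cuntz2 s.

Lemma leg_adj b b' x : mult_adj (leg b) (leg b' x) = if b == b' then x else 0.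
Proof.
case: b; case: b' => /=.
- exact: cuntz1_isometry.
- exact: cuntz_adj12.
- exact: cuntz_adj21.
- exact: cuntz2_isometry.
Qed.

Lemma leg_isometry b : is_isometry (leg b). Proof. by move=> x; rewrite leg_adj eqxx. Qed.

Let proj b x := leg b (mult_adj (leg b) x).

Let projP b x y : cstar (proj b x) ** y = cstar x ** proj b y.
Proof. by rewrite /proj mult_adjP mult_adjP'. Qed.

Let proj_mul b x y : proj b (x ** y) = proj b x ** y.
Proof. by rewrite /proj mult_adjM mult_opM. Qed.

Let projL b (k : R) x y : proj b (k *: x + y) = k *: proj b x + proj b y.
Proof. by rewrite /proj mult_adjL mult_opL. Qed.

Let proj_norm b x : `|proj b x| <= `|x|.
Proof.
by rewrite /proj (isometry_norm (@leg_isometry b)) adj_norm_le//; exact: leg_isometry.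
Qed.

Let proj_sum x : proj true x + proj false x = x. Proof. exact: cuntz_sum. Qed.

(* the entries of [x] along the decomposition [1 = s1 s1^* + s2 s2^*] *)
Definition cut (q : bool * bool) (x : T) : T := proj q.1 (cstar (proj q.2 (cstar x))).

Lemma cutL q (k : R) x y : cut q (k *: x + y) = k *: cut q x + cut q y.
Proof. by rewrite /cut cstarD cstarZ projL cstarD cstarZ projL. Qed.

Lemma cut0 q : cut q 0 = 0.
Proof. by have := cutL q (-1) 0 0; rewrite scaler0 addr0 scaleN1r addNr. Qed.

Lemma cutB q x y : cut q (x - y) = cut q x - cut q y.
Proof. by rewrite addrC -scaleN1r cutL scaleN1r addrC. Qed.

Lemma cutD q x y : cut q (x + y) = cut q x + cut q y.
Proof. by rewrite -[x]scale1r cutL !scale1r. Qed.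

Lemma cut_norm q x : `|cut q x| <= `|x|.
Proof. by rewrite (le_trans (proj_norm _ _))// cnorm_star (le_trans (proj_norm _ _))// cnorm_star. Qed.

Let proj_comm b b' x : proj b (cstar (proj b' (cstar x))) = cstar (proj b' (cstar (proj b x))).
Proof.
apply: cmul_inj => z; rewrite -projP -!cstarM; congr cstar.
by rewrite -!proj_mul projP.
Qed.

Lemma cut_star i j x : cstar (cut (i, j) x) = cut (j, i) (cstar x).
Proof. by rewrite /cut /= proj_comm !cstarK. Qed.

Let cut_cut i l m j x y : cut (i, l) x ** cut (m, j) y =
  proj i (x ** proj l (proj m (cstar (proj j (cstar y))))).
Proof.
by rewrite /cut /= -proj_mul projP cstarK.
Qed.

Lemma cut_mul i j x y : cut (i, false) x ** cut (false, j) y + cut (i, true) x ** cut (true, j) y =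
  cut (i, j) (x ** y).
Proof.
have pp b z : proj b (proj b z) = proj b z by rewrite /proj leg_adj eqxx.
rewrite !cut_cut !pp addrC -[proj i _]scale1r -projL scale1r -cmulDr proj_sum /cut /=.
by congr (proj i _); rewrite cstarM proj_mul cstarM cstarK.
Qed.

Lemma cut_orth i l j x y : cut (i, l) x ** cut (~~ l, j) y = 0.
Proof.
rewrite cut_cut (_ : proj l _ = 0) ?cmulr0.
  by have := projL i (-1) 0 0; rewrite scaler0 addr0 scaleN1r addNr.
by rewrite /proj leg_adj; case: l; rewrite /= mult_op0.
Qed.

Lemma cut_conj q b x : cut q (mult_conj (leg b) x) = if q == (b, b) then mult_conj (leg b) x else 0.
Proof.
have pl b' z : proj b' (leg b z) = if b' == b then leg b z else 0.
  by rewrite /proj leg_adj; case: eqP => [->//|_]; rewrite mult_op0.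
have p0 b' : proj b' 0 = 0 by rewrite /proj mult_adj0 mult_op0.
have [_ _ st] := mult_conj_starhom (@leg_isometry b).
case: q => i j; rewrite /cut /= -st {1}/mult_conj pl xpair_eqE.
case: (j =P b) => [_|_]; last by rewrite cstar0 p0 andbF.
by rewrite -/(mult_conj _ _) -st cstarK {1}/mult_conj pl andbT.
Qed.

End corners.

Section symmetry_data.
Variables (R : realType) (K : compact_operators R) (e : rank_one_projection K).
Variables (A : realCstarType R) (sepA : separable A) (stA : stable K A).
Local Notation I := (unit_itv R).

(** A nullhomotopy of the corner embedding plus its inverse takes values in T. Its entries along the
    decomposition of the direct sum satisfy the matrix relations exactly, up to the defects of the
    homotopy, and the homomorphism [f] brings them back to [A]. *)
Lemma hs_data_exists : homotopy_symmetric e A ->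
  exists (g : bool * bool -> R -> A -> cylinder A) (k : starhom A A), hs_data g k.
Proof.
move=> [T [s [y hsA]]].
have [E [e00 EM Es Et]] := matrix_units e.
have [sA sA_pure] := stable_good e stA.
have [f [w [wi [_ fc]]]] := compression EM Es Et T sA_pure e00.
have [sT sT_pure] := tensor_good EM Es Et T.
have [H HP] : homotopic (direct_sum s (hom_asym (corner e T)) (hrepr y)) (asym_zero A T).
  by apply/hclassP; rewrite -haddE hreprK.
have [G [nG GH]] := asym_nice H sepA.
pose fcut q x := f (cut s q x).
have fcutB q x z : fcut q (x - z) = fcut q x - fcut q z by rewrite /fcut cutB starhomB.
have fcut_le q x : `|fcut q x| <= `|x| by rewrite (le_trans (starhom_contractive _ _))// cut_norm.
have fcut0 q : fcut q 0 = 0 by rewrite /fcut cut0 starhom0.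
have fcut_lip q x z : `|fcut q x - fcut q z| <= 1 * `|x - z| by rewrite -fcutB mul1r.
pose cyl q : cylinder T -> cylinder A := itv_map_fun (lipB_continuous (fcut_lip q)) (fcut0 q).
have cylE q F x : cyl q F x = fcut q (F x) by [].
have cylB q F F' : cyl q (F - F') = cyl q F - cyl q F' by apply/itv_eqP => x; exact: fcutB.
have cyl_le q F : `|cyl q F| <= `|F|.
  by apply/itv_normP => x; rewrite (le_trans (fcut_le _ _))//; exact: itv_normE.
have cyl0 q : cyl q 0 = 0 by apply/itv_eqP => x; exact: fcut0.
have cyl_lip q F F' : `|cyl q F - cyl q F'| <= 1 * `|F - F'| by rewrite -cylB mul1r.
pose g0 q t a := cyl q (G t a).
have ng0 q : nice (g0 q) by exact: nice_post (cyl_lip q) nG.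
have cyl_null q (u : R -> cylinder T) : u t @[t --> +oo_R] --> (0 : cylinder T) ->
    cyl q (u t) @[t --> +oo_R] --> (0 : cylinder A).
  by apply: cvg0_le => t _; exact: cyl_le.
(* Regularization spoils the exact boundary values. Linear corrections restore the vanishing at 1,
   and at 0 off the diagonal; they are null, hence preserve the asymptotic relations. *)
pose adj (q : bool * bool) (F : cylinder A) : cylinder A := F - itv_line (F (clamp 1)) -
  (if q.1 == q.2 then 0 else cyl_cst A (F (clamp 0)) - itv_line (F (clamp 0))).
have adjE (q : bool * bool) (F : cylinder A) (x : I) : adj q F x = F x - set_val x *: F (clamp 1) -
    (if q.1 == q.2 then 0 else F (clamp 0) - set_val x *: F (clamp 0)).
  by rewrite /adj; case: eqP.
have adjB (q : bool * bool) (F F' : cylinder A) : adj q F - adj q F' = adj q (F - F').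
  by apply/itv_eqP => x; rewrite itvDE itvNE !adjE; case: eqP => _; rewrite !(itvDE, itvNE); lmod_gen R A.
have adj_le (q : bool * bool) (F : cylinder A) : `|adj q F| <= 4 * `|F|.
  apply/itv_normP => x; rewrite adjE.
  have v0 := val_itv_ge0 x; have v1 := val_itv_le1 x.
  have line z : `|set_val x *: F z| <= `|F|.
    rewrite normrZ ger0_norm// (le_trans _ (itv_normE F z))// ler_piMl//.
  have h1 := itv_normE F x; have h2 := line (clamp 1); have h3 := line (clamp 0).
  have h4 := itv_normE F (clamp 0).
  rewrite (le_trans (ler_normB _ _))// (le_trans (lerD (ler_normB _ _) (lexx _)))//.
  have : `|if q.1 == q.2 then 0 else F (clamp 0) - set_val x *: F (clamp 0)| <= `|F| + `|F|.
    by case: eqP => _; [rewrite normr0 addr_ge0|rewrite (le_trans (ler_normB _ _))// lerD].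
  by move: h1 h2 => /=; lra.
have adj_lip (q : bool * bool) (F F' : cylinder A) : `|adj q F - adj q F'| <= 4 * `|F - F'| by rewrite adjB.
have adj0 (q : bool * bool) : adj q 0 = 0.
  by apply/itv_eqP => x; rewrite adjE !itv0E scaler0 subrr; case: eqP; rewrite ?subr0.
pose g q t a := adj q (g0 q t a).
have ng q : nice (g q) by apply: nice_post (adj_lip q) _.
have Gev t a x : 1 <= t -> `|G t a x - H t a x| <= `|G t a - H t a|.
  by move=> _; exact: (itv_normE (G t a - H t a)).
have G1 a : G t a (clamp 1) @[t --> +oo_R] --> (0 : T).
  apply: cvg0_le (GH a) => t t1; have := Gev t a (clamp 1) t1.
  by rewrite (HP t a t1).2 subr0.
have legE b : leg s b = if b then cuntz1 s else cuntz2 s by [].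
have H0 t a : 1 <= t -> H t a (clamp 0) = mult_conj (leg s true) (corner e T a) +
    mult_conj (leg s false) (hrepr y t a) by move=> t1; rewrite (HP t a t1).1.
have G0off a b : fcut (b, ~~ b) (G t a (clamp 0)) @[t --> +oo_R] --> (0 : A).
  apply: cvg0_le (GH a) => t t1; apply: le_trans (Gev t a (clamp 0) t1).
  have -> : fcut (b, ~~ b) (G t a (clamp 0)) = fcut (b, ~~ b) (G t a (clamp 0) - H t a (clamp 0)).
    rewrite fcutB (H0 _ _ t1) {3}/fcut cutD !cut_conj.
    by rewrite !ifF ?addr0 ?starhom0 ?subr0//; case: b.
  exact: fcut_le.
have gg0 q a : g q t a - g0 q t a @[t --> +oo_R] --> (0 : cylinder A).
  have h1 : fcut q (G t a (clamp 1)) @[t --> +oo_R] --> (0 : A).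
    by apply: cvg0_le (G1 a) => t _; exact: fcut_le.
  have h2 : (if q.1 == q.2 then 0 else fcut q (G t a (clamp 0))) @[t --> +oo_R] --> (0 : A).
    case: q {h1} => i j /=; have [_|ij] := eqVneq i j; first exact: cvg_cst.
    have -> : j = ~~ i by case: i j ij => [] [].
    exact: G0off.
  have /null_normP h1' := h1; have /null_normP h2' := h2.
  apply/null_normP => d d0; have d2 : 0 < d / 2 by rewrite divr_gt0.
  apply: filterS2 (h1' _ d2) (h2' _ d2) => t k1 k2; apply/itv_normP => x.
  have v0 := val_itv_ge0 x; have v1 := val_itv_le1 x.
  rewrite itvDE itvNE /g adjE !cylE.
  set Y := fcut q (G t a (clamp 1)); set Z := fcut q (G t a (clamp 0)).
  rewrite (_ : _ - _ = - (set_val x *: Y) - (1 - set_val x) *: (if q.1 == q.2 then 0 else Z)); last first.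
    by case: eqP => _; lmod_gen R A.
  rewrite (splitr d) (le_trans (ler_normB _ _))// normrN !normrZ lerD//.
    by rewrite ger0_norm// (le_trans _ k1)// ler_piMl.
  by rewrite ger0_norm ?subr_ge0// (le_trans _ k2)// ler_piMl// gerBl.
have fcut_mul i j x z : fcut (i, false) x ** fcut (false, j) z + fcut (i, true) x ** fcut (true, j) z =
    fcut (i, j) (x ** z) by rewrite /fcut -!starhomM -starhomD cut_mul.
have fcut_orth i l j x z : fcut (i, l) x ** fcut (~~ l, j) z = 0.
  by rewrite /fcut -starhomM cut_orth starhom0.
have fcutL q (c : R) x z : fcut q (c *: x + z) = c *: fcut q x + fcut q z.
  by rewrite /fcut cutL starhomL.
have prB w' (F F' : cylinder A) : pr A w' (F - F') = pr A w' F - pr A w' F' by exact: starhomB.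
have s0 : is_system hs_st hs_rel (hs_fam g0).
  split=> [[w' q]|[w' q] c a b|[w' [i j]] a|[[i j]|[i [l j]]] a b].
  - by apply: nice_post_hom; exact: ng0.
  - apply: cvg0_eq (cvg0_hom (pr A w') (cyl_null q _ (asym_linear (asymP G) c a b))) => t _.
    rewrite /hs_fam /= -starhomL -prB; congr (pr A w' _); apply/itv_eqP => x.
    by rewrite cylE !(itvDE, itvNE, itvZE) fcutB fcutL.
  - apply: cvg0_eq (cvg0_hom (pr A w') (cyl_null (i, j) _ (asym_star (asymP G) a))) => t _.
    rewrite /hs_fam /= -starhom_star -prB; congr (pr A w' _); apply/itv_eqP => x.
    rewrite cylE !(itvDE, itvNE) fcutB; congr (_ - _).
    by rewrite -[LHS]/(cstar (fcut (j, i) (G t a x))) /fcut -starhom_star cut_star.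
  - apply: cvg0_eq (cvg0_hom (pr A false) (cyl_null (i, j) _ (cvg0N (asym_mul (asymP G) a b)))) => t _.
    transitivity (pr A false (g0 (i, false) t a) ** pr A false (g0 (false, j) t b) +
        pr A false (g0 (i, true) t a) ** pr A false (g0 (true, j) t b) - pr A false (g0 (i, j) t (a ** b))).
      by rewrite /= !big_cons big_nil addr0.
    rewrite -!starhomM -starhomD -prB; congr (pr A false _).
    apply/itv_eqP => x; rewrite cylE !(itvDE, itvNE) !itv_mulE !cylE fcut_mul opprB fcutB.
    by [].
  - apply: cvg0_eq (cvg_cst (0 : cylinder (cylinder A))) => t _.
    rewrite /= !big_cons big_nil addr0 subr0; apply/itv_eqP => x; apply/itv_eqP => x'.
    exact: fcut_orth.
exists g, (starhom_comp f (starhom_comp (cuntz_hom1 s) (corner e T))); split.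
(* Conjugation by the first isometry of [s] is homotopic to the identity of T, and [f] composed with
   the corner embedding is a conjugation on [A]. *)
- have h1 : hh (cuntz_hom1 s) (starhom_id T) by exact: (hh_conj_id sT_pure).
  apply: hh_trans (hh_post f (hh_pre (corner e T) h1)) _.
  apply: hh_trans _ (hh_conj_id sA_pure (cuntz_seq_isometry sA 0)).
  by apply: hh_ext => b; exact: fc.
- apply: sys_perturb s0 _ _ => [[w' q]|[w' q] a]; first by apply: nice_post_hom; exact: ng.
  apply: cvg0_eq (cvg0_hom (pr A w') (gg0 q a)) => t _.
  by rewrite starhomB.
- exact: ng.
- move=> q t a; rewrite /g adjE set_val_clamp1 !scale1r subrr sub0r.
  by case: eqP => _; rewrite ?subrr oppr0.
- move=> t a i; rewrite /g adjE set_val_clamp0 !scale0r !subr0 ifF ?subrr//.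
  by case: i.
- move=> a; apply: cvg0_le (GH a) => t t1; apply: le_trans (Gev t a (clamp 0) t1).
  rewrite /g adjE set_val_clamp0 scale0r !subr0 cylE.
  have -> : starhom_comp f (starhom_comp (cuntz_hom1 s) (corner e T)) a = fcut (true, true) (H t a (clamp 0)).
    rewrite (H0 _ _ t1) /fcut cutD !cut_conj /= addr0.
    by [].
  by rewrite -fcutB fcut_le.
Qed.

End symmetry_data.

Section suspension_data.
Variables (R : realType) (A : realCstarType R) (g : bool * bool -> R -> A -> cylinder A).
Variables (k : starhom A A) (gP : hs_data g k).

Definition susp_data q t (F : suspension A) : cylinder (suspension A) :=
  swap endpoints set0 A (itv_fam (hs_nice gP q) t F).

(** With these data the loops of SA are the loops of A taken pointwise in the other variable, which
    is what allows the quantizations over A and over SA to be compared. *)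
Lemma hs_data_susp : hs_data susp_data (itv_map endpoints k).
Proof.
split.
- apply: hh_trans (hh_itv_map endpoints (hs_k gP)) _.
  by apply: hh_ext => F; apply/itv_eqP.
- have sy := sys_post (starhom_comp (itv_map set0 (swap endpoints set0 A)) (swap endpoints set0 (cylinder A)))
    (sys_itv endpoints (hs_system gP)).
  apply: sys_ext sy => -[w q] t F; apply/itv_eqP => x; apply/itv_eqP => x'; apply/itv_eqP => z.
  by case: w.
- by move=> q; apply: nice_post_hom; exact: itv_fam_nice.
- by move=> q t F; apply/itv_eqP => z; exact: hs_at1 gP q t (F z).
- by move=> t F i; apply/itv_eqP => z; exact: hs_off gP t (F z) i.
- move=> F; apply: itv_null => [|z]; last exact: hs_corner gP (F z).
  apply: (@qcB _ _ _ (fun t z => g (true, true) t (F z) (clamp 0)) (fun t z => k (F z))).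
    have n0 : nice (fun t a => g (true, true) t a (clamp 0)).
      by apply: (nice_post_hom (itv_ev set0 A (clamp 0))); exact: hs_nice gP _.
    exact: (qc_nice n0 (@itv_continuous _ _ _ F)).
  apply: (@qc_cst _ _ _ (fun z => k (F z))).
  by apply: (cont_comp (@itv_continuous _ _ _ F)); exact: starhom_continuous.
Qed.

End suspension_data.

(** * The quarter turn of the square *)

Section rotation.
Variables (R : realType) (C : realCstarType R).
Local Notation I := (unit_itv R).
Local Notation SS := (suspension (suspension C)).

(** In the coordinates of [-1, 1], a rotation with cosine and sine proportional to 1 - v and v.
    Dividing by [D v] rather than its square root also expands the square, so that no boundary point
    is carried to its interior; points outside are clamped to the boundary. *)
Let D (v : R) := (1 - v) ^+ 2 + v ^+ 2.
Let fst_rot (v u w : R) := ((1 - v) * u + v * w) / D v.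
Let snd_rot (v u w : R) := ((1 - v) * w - v * u) / D v.

Let D_gt0 v : 0 < D v.
Proof.
rewrite /D; have [->|v0] := eqVneq v 0; first by rewrite subr0 expr1n expr0n addr0.
by rewrite ltr_wpDl ?sqr_ge0// exprn_even_gt0.
Qed.

Let rot_boundary v u w : 0 <= v -> v <= 1 -> (u = 1 \/ u = -1) \/ (w = 1 \/ w = -1) ->
  (1 <= fst_rot v u w \/ fst_rot v u w <= -1) \/ (1 <= snd_rot v u w \/ snd_rot v u w <= -1).
Proof.
move=> v0 v1; rewrite /fst_rot /snd_rot.
rewrite !ler_pdivlMr// !ler_pdivrMr// !mulN1r !mul1r /D !expr2.
have v1' : 0 <= 1 - v by rewrite subr_ge0.
have h (x y : R) : 0 <= x -> 0 <= y -> 0 <= x * y by exact: mulr_ge0.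
case=> [[->|->]|[->|->]].
(* On the side u = 1, the first coordinate is at least 1 if w >= 2 v - 1, and the second is at most
   -1 if w <= 2 v - 1. The other sides are symmetric. *)
- have [k|/ltW k] := leP (2 * v - 1) w.
    by left; left; have := h v (w - (2 * v - 1)) v0 _; rewrite subr_ge0 => /(_ k); lra.
  by right; right; have := h (1 - v) ((2 * v - 1) - w) v1' _; rewrite subr_ge0 => /(_ k); lra.
- have [k|/ltW k] := leP (2 * v - 1) (- w).
    by left; right; have := h v (- w - (2 * v - 1)) v0 _; rewrite subr_ge0 => /(_ k); lra.
  by right; left; have := h (1 - v) ((2 * v - 1) + w) v1' _; rewrite -[w in X in _ -> X]opprK; rewrite -{1}[w]opprK subr_ge0 => /(_ k); lra.
- have [k|/ltW k] := leP (1 - 2 * v) u.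
    by left; left; have := h (1 - v) (u - (1 - 2 * v)) v1' _; rewrite subr_ge0 => /(_ k); lra.
  by right; left; have := h v ((1 - 2 * v) - u) v0 _; rewrite subr_ge0 => /(_ k); lra.
- have [k|/ltW k] := leP (1 - 2 * v) (- u).
    by left; right; have := h (1 - v) (- u - (1 - 2 * v)) v1' _; rewrite subr_ge0 => /(_ k); lra.
  by right; right; have := h v ((1 - 2 * v) - (- u)) v0 _; rewrite subr_ge0 => /(_ k); lra.
Qed.

Let co (x : I) : R := 2 * set_val x - 1.
Let pt (u : R) : I := clamp ((u + 1) / 2).

Let co_end x : endpoints x -> co x = 1 \/ co x = -1.
Proof.
by case=> ->; [right|left]; rewrite /co ?set_val_clamp0 ?set_val_clamp1; lra.
Qed.

Let pt_end u : 1 <= u \/ u <= -1 -> endpoints (pt u).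
Proof.
case=> h; [right|left]; apply: val_inj => /=; move: h; minmax.
Qed.

Let X (q : (I * I) * I) : I := pt (fst_rot (set_val q.1.1) (co q.1.2) (co q.2)).
Let Z (q : (I * I) * I) : I := pt (snd_rot (set_val q.1.1) (co q.1.2) (co q.2)).

Let cval (T : topologicalType) (f : T -> I) : continuous f -> continuous (fun x => set_val (f x) : R).
Proof. by move=> cf; apply: (cont_comp cf); exact: set_val_continuous. Qed.

Let cco (T : topologicalType) (f : T -> I) : continuous f -> continuous (fun x => co (f x)).
Proof.
move=> cf; apply: contB; last exact: cst_continuous.
by apply: contZ; [exact: cst_continuous|exact: cval].
Qed.

Let c1 : continuous (fun q : (I * I) * I => q.1.1).
Proof. by apply: cont_comp; exact: cont_fst. Qed.
Let c2 : continuous (fun q : (I * I) * I => q.1.2).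
Proof. by apply: cont_comp; [exact: cont_fst|exact: cont_snd]. Qed.
Let c3 : continuous (fun q : (I * I) * I => q.2).
Proof. exact: cont_snd. Qed.

Let cD : continuous (fun q : (I * I) * I => D (set_val q.1.1)).
Proof.
have c : continuous (fun q : (I * I) * I => 1 - set_val q.1.1 : R).
  by apply: contB; [exact: cst_continuous|exact: cval].
by apply: contD; apply: cont_mulr => //; exact: cval.
Qed.

Let cpt (f : (I * I) * I -> R) : continuous f ->
  continuous (fun q : (I * I) * I => pt (f q / D (set_val q.1.1))).
Proof.
move=> cf.
apply: (@cont_comp _ _ _ (fun q : (I * I) * I => (f q / D (set_val q.1.1) + 1) / 2 : R)); last exact: clamp_continuous.
apply: cont_mulr; last exact: cst_continuous.
apply: contD; last exact: cst_continuous.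
apply: cont_mulr => //; apply: cont_inv => // q; exact: lt0r_neq0.
Qed.

Let cX : continuous X.
Proof.
apply: cpt; apply: contD; apply: cont_mulr; [|exact: cco|exact: cval|exact: cco].
by apply: contB; [exact: cst_continuous|exact: cval].
Qed.
Let cZ : continuous Z.
Proof.
apply: cpt; apply: contB; apply: cont_mulr; [|exact: cco|exact: cval|exact: cco].
by apply: contB; [exact: cst_continuous|exact: cval].
Qed.

Let vanish (F : SS) v x z : endpoints x \/ endpoints z -> F (X ((v, x), z)) (Z ((v, x), z)) = 0.
Proof.
move=> xz.
have : (co x = 1 \/ co x = -1) \/ (co z = 1 \/ co z = -1).
  by case: xz => /co_end; [left|right].
move=> /(rot_boundary (val_itv_ge0 v) (val_itv_le1 v)).
by case=> /pt_end h; [rewrite (itv_vanish F h)|rewrite (itv_vanish _ h)].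
Qed.

Let jcont (F : SS) : continuous (fun q : (I * I) * I => F (X q) (Z q)).
Proof.
apply: (@cont_comp _ _ _ (fun q => (X q, Z q)) (fun w : I * I => F w.1 w.2)); last exact: joint_continuous.
exact: cont_pair.
Qed.

Let rot2 (F : SS) (vx : I * I) : suspension C.
Proof.
refine (@mk_itv _ endpoints C (fun z => F (X (vx, z)) (Z (vx, z))) _ _).
- apply: (@cont_comp _ _ _ (fun z : I => (vx, z)) (fun q : (I * I) * I => F (X q) (Z q))); last exact: jcont.
  by apply: cont_pair; [exact: cst_continuous|exact: cont_id].
- by case: vx => v x z ze; apply: vanish; right.
Defined.

Let crot2 F : continuous (rot2 F).
Proof. exact: (@itv_curry_continuous R (I * I)%type endpoints C (rot2 F) (@jcont F)). Qed.

Let rot1 (F : SS) (v : I) : SS.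
Proof.
refine (@mk_itv _ endpoints (suspension C) (fun x => rot2 F (v, x)) _ _).
- apply: (@cont_comp _ _ _ (fun x : I => (v, x)) (rot2 F)) => //.
  by apply: cont_pair; [exact: cst_continuous|exact: cont_id].
- by move=> x xe; apply/itv_eqP => z; apply: vanish; left.
Defined.

Let crot1 F : continuous (rot1 F).
Proof.
apply: (@itv_curry_continuous R I endpoints (suspension C) (rot1 F)).
suff -> : (fun p : I * I => rot1 F p.1 p.2) = rot2 F by exact: crot2.
by apply/funext => -[].
Qed.

Let rot_fun (F : SS) : cylinder SS := @mk_itv _ set0 SS (rot1 F) (@crot1 F) (fun _ f => match f with end).

Let rotE F v x z : rot_fun F v x z = F (X ((v, x), z)) (Z ((v, x), z)).
Proof. by []. Qed.

Let ev_starhom (F G : SS) k (x z : I) :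
  [/\ (k *: F + G) x z = k *: F x z + G x z, (F ** G) x z = F x z ** G x z &
     cstar F x z = cstar (F x z)].
Proof. by rewrite !(itvDE, itvZE, itv_mulE, itv_starE). Qed.

Let rot_starhom : is_starhom rot_fun.
Proof.
split=> [k F G|F G|F]; apply/itv_eqP => v; apply/itv_eqP => x; apply/itv_eqP => z.
- rewrite rotE (let: And3 h _ _ := ev_starhom F G k _ _ in h) -!rotE (itvDE (k *: rot_fun F)) (itvZE k (rot_fun F)).
  by case: (ev_starhom (rot_fun F v) (rot_fun G v) k x z) => ->.
- rewrite rotE (let: And3 _ h _ := ev_starhom F G 0 _ _ in h) -!rotE (itv_mulE (rot_fun F)).
  by case: (ev_starhom (rot_fun F v) (rot_fun G v) 0 x z) => _ -> _.
- rewrite rotE (let: And3 _ _ h := ev_starhom F F 0 _ _ in h) -!rotE (itv_starE (rot_fun F)).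
  by case: (ev_starhom (rot_fun F v) (rot_fun F v) 0 x z) => _ _ ->.
Qed.

Let rot_contractive F : `|rot_fun F| <= `|F|.
Proof.
apply/itv_normP => v; apply/itv_normP => x; apply/itv_normP => z.
by rewrite (le_trans (itv_normE (F (X (v, x, z))) (Z (v, x, z))))// itv_normE.
Qed.

Let rot : starhom SS (cylinder SS) := Starhom rot_starhom rot_contractive.

Let flip_fun (F : SS) : SS.
Proof.
refine (@mk_itv _ endpoints (suspension C) (fun x => F (clamp (1 - set_val x))) _ _).
- apply: (@cont_comp _ _ _ (fun x : I => clamp (1 - set_val x)) F); last exact: itv_continuous.
  apply: (@cont_comp _ _ _ (fun x : I => 1 - set_val x : R)); last exact: clamp_continuous.
  by apply: contB; [exact: cst_continuous|exact: set_val_continuous].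
- by move=> x [->|->]; rewrite ?set_val_clamp0 ?set_val_clamp1 ?subr0 ?subrr; apply: itv_vanish; [right|left].
Defined.

Let flip_starhom : is_starhom flip_fun.
Proof. by split=> [k F G|F G|F]; apply/itv_eqP. Qed.
Let flip_contractive F : `|flip_fun F| <= `|F|.
Proof. by apply/itv_normP => x; exact: (itv_normE F). Qed.

Definition flip : starhom SS SS := Starhom flip_starhom flip_contractive.

(* the quarter turn of the square, and its inverse *)
Definition turn : starhom SS SS := starhom_comp flip (swap endpoints endpoints C).
Definition unturn : starhom SS SS := starhom_comp (swap endpoints endpoints C) flip.

Lemma turnE F x z : turn F x z = F z (clamp (1 - set_val x)). Proof. by []. Qed.
Lemma rev_rev (x : I) : clamp (1 - set_val (clamp (1 - set_val x))) = x.
Proof.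
have -> : set_val (clamp (1 - set_val x) : I) = 1 - set_val x.
  by rewrite set_valE /= min_l ?max_r ?subr_ge0 ?gerBl ?val_itv_le1 ?val_itv_ge0.
by rewrite subKr clampK.
Qed.

Lemma hh_turn : hh turn (starhom_id SS).
Proof.
apply: hh_sym; apply: (hh_path (H := rot)) => F; apply/itv_eqP => x; apply/itv_eqP => z.
  change (F (X ((clamp 0, x), z)) (Z ((clamp 0, x), z)) = F x z).
  have E v u : fst_rot 0 u v = u by rewrite /fst_rot /D subr0 !mul1r mul0r addr0 expr1n expr0n addr0 divr1.
  have E' v u : snd_rot 0 u v = v by rewrite /snd_rot /D subr0 !mul1r mul0r subr0 expr1n expr0n addr0 divr1.
  rewrite /X /Z /= !set_val_clamp0 E E' /pt /co.
  by rewrite !subrK ![2 * _ / 2]mulrC !mulKf// !clampK.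
change (F (X ((clamp 1, x), z)) (Z ((clamp 1, x), z)) = F z (clamp (1 - set_val x))).
have E v u : fst_rot 1 u v = v by rewrite /fst_rot /D subrr mul0r mul1r add0r expr0n expr1n add0r divr1.
have E' v u : snd_rot 1 u v = - u by rewrite /snd_rot /D subrr mul0r mul1r sub0r expr0n expr1n add0r divr1.
rewrite /X /Z /= !set_val_clamp1 E E' /pt /co.
rewrite !subrK [2 * _ / 2]mulrC mulKf// clampK; congr (F z (clamp _)); lra.
Qed.

(** [unturn] is a left inverse of [turn], which is homotopic to the identity. *)
Lemma hh_unturn : hh unturn (starhom_id SS).
Proof.
apply: (@hh_trans _ _ _ _ (starhom_comp unturn (starhom_id SS))); first exact: hh_ext.
apply: hh_trans (hh_post unturn (hh_sym hh_turn)) _.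
apply: hh_ext => F; apply/itv_eqP => x; apply/itv_eqP => z.
by rewrite -[LHS]/(F x (clamp (1 - set_val (clamp (1 - set_val z))))) rev_rev.
Qed.

End rotation.

(** The swap reverses orientation, hence is not a rotation. But a flip of the coordinate on which S
    Psi acts pointwise commutes with S Psi; inserting two flips that cancel turns the swaps into
    [turn] and [unturn]. *)
Lemma flip_susp_homotopic (R : realType) (A B : realCstarType R)
  (Psi : asym (suspension A) (suspension B)) (nPsi : nice Psi)
  (Psi' : asym (suspension (suspension A)) (suspension (suspension B))) :
  (forall t F, Psi' t F = swap endpoints endpoints B (itv_asym endpoints nPsi t (swap endpoints endpoints A F))) ->
  homotopic Psi' (itv_asym endpoints nPsi).
Proof.
move=> PsiE; pose SP := itv_asym endpoints nPsi.
have nSP : nice SP by exact: itv_fam_nice.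
apply: homotopic_trans (_ : homotopic Psi' (asym_post (unturn B) (asym_pre (turn A) SP))) _.
  apply: homotopic_ext => t F _; rewrite PsiE; apply/itv_eqP => x; apply/itv_eqP => z.
  rewrite -[RHS]/(Psi t (turn A F (clamp (1 - set_val z))) x).
  rewrite -[LHS]/(Psi t (swap endpoints endpoints A F z) x).
  congr (Psi t _ x); apply/itv_eqP => y.
  by rewrite turnE rev_rev swapE.
apply: homotopic_trans (hh_asym_post _ (hh_unturn B)) _.
apply: homotopic_trans (homotopic_trans (hh_asym_pre nSP (hh_turn A)) _).
  exact: homotopic_ext.
exact: homotopic_ext.
Qed.

Lemma assemble_eq (R : realType) (A A' B : realCstarType R) (r : int -> multiplier B)
  (e : deg -> R -> int -> A -> B) (e' : deg -> R -> int -> A' -> B) (N : R -> nat) t a a' :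
  (forall d n, e d t n a = e' d t n a') -> assemble r e N t a = assemble r e' N t a'.
Proof.
move=> ee; rewrite /assemble; apply: mat_eq => m n _ _.
by apply: eq_bigr => d _; rewrite ee.
Qed.

(** * Bijectivity *)

Section disc_maps.
Variables (R : realType) (A B : realCstarType R) (sepA : separable A).
Local Notation I := (unit_itv R).
Variables (g : bool * bool -> R -> A -> cylinder A) (k : starhom A A) (gP : hs_data g k).
Variables (r : int -> multiplier B) (ri : forall n, is_isometry (r n)).
Hypothesis ro : forall i j x, i != j -> mult_adj (r i) (r j x) = 0.

Lemma disc_aeq (c c' : deg -> R -> A -> suspension B) q :
  (forall d a, c d t a - c' d t a @[t --> +oo_R] --> (0 : suspension B)) ->
  forall a, disc r c q t a - disc r c' q t a @[t --> +oo_R] --> (0 : B).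
Proof.
move=> cc a; apply/null_normP => e e0; have e5 : 0 < e / 5 by rewrite divr_gt0.
have H d : \forall t \near +oo_R, forall x, `|c d t a x - c' d t a x| <= e / 5.
  have /null_normP/(_ _ e5) := cc d a; apply: filterS => t h x.
  by apply: le_trans h; exact: (itv_normE (c d t a - c' d t a)).
have := near_fin H; apply: filterS => t h.
rewrite [leRHS](_ : _ = 5 * (e / 5)); last by field.
by apply: (assemble_dist ri ro _ (ltW e5)) => d n; exact: h.
Qed.

(** Exchanging the variables turns the homotopy into a morphism into the suspension of a cylinder;
    its quantization, with isometries acting pointwise on the cylinder, is the required homotopy. *)
Lemma fast_disc_homotopy (H : asym (suspension A) (cylinder (suspension B))) : nice H ->
  fast (fun p => fast (fun q => exists chi0 chi1 : asym A B,
    [/\ forall t a, chi0 t a = disc r (fun d t a => H (p t) (loop gP d t a) (clamp 0)) q t a,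
        forall t a, chi1 t a = disc r (fun d t a => H (p t) (loop gP d t a) (clamp 1)) q t a &
        homotopic chi0 chi1])).
Proof.
move=> nH; pose H' := asym_post (swap set0 endpoints B) H.
have nH' : nice H' by exact: nice_post_hom.
pose r' n := itv_mult set0 (ri n).
have ri' n : is_isometry (r' n) by exact: itv_mult_isometry.
have ro' i j G : i != j -> mult_adj (r' i) (r' j G) = 0.
  by move=> ij; apply/itv_eqP => x; exact: ro.
apply: fast_mono (fast_system nH' sepA (loop_system gP)) => p cp sc.
apply: fast_mono (fast_mesh (sys_nice sc) sepA) => q cq mq.
have [nX aX] := disc_spec ri' ro' sc cq mq.
pose X := Asym aX; pose ev i := asym_post (itv_ev set0 B (clamp i)) X.
have E i t a : ev i t a = disc r (fun d t a => H (p t) (loop gP d t a) (clamp i)) q t a.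
  exact: (assemble_ev ri).
exists (ev 0), (ev 1); split; [exact: E|exact: E|].
by exists X.
Qed.

End disc_maps.

Section bijectivity.
Variables (R : realType) (A B : realCstarType R) (sepA : separable A) (gB : good B).
Variables (g : bool * bool -> R -> A -> cylinder A) (k : starhom A A) (gP : hs_data g k).

Let isometries : exists (r : int -> multiplier B) (ri : forall n, is_isometry (r n)),
  (forall i j x, i != j -> mult_adj (r i) (r j x) = 0) /\ hh (conj_hom (ri 1)) (starhom_id B).
Proof.
have [s sp] := gB.
(* [pickle] codes the integers by natural numbers, the indices of [cuntz_seq]. *)
exists (fun n => cuntz_seq s (pickle n)), (fun n => cuntz_seq_isometry s (pickle n)).
split=> [i j x ij|]; last exact: (hh_conj_id sp).
rewrite cuntz_seq_adj ifF//; apply/negbTE; apply: contra ij => /eqP/(pcan_inj pickleK)/eqP.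
by [].
Qed.

Let aeq_ev (C D : realCstarType R) (H G : asym C (cylinder D)) x (chi : asym C D) : aeq G H ->
  (forall t a, 1 <= t -> H t a x = chi t a) -> aeq (asym_post (itv_ev set0 D x) G) chi.
Proof.
move=> GH Hx a; apply: cvg0_eq (cvg0_hom (itv_ev set0 D x) (GH a)) => t t1.
by rewrite starhomB /= Hx.
Qed.

Lemma suspension_injective (phi psi : asym A B) (np : nice phi) (nq : nice psi) :
  homotopic (itv_asym endpoints np) (itv_asym endpoints nq) -> homotopic phi psi.
Proof.
have [r [ri [ro r1]]] := isometries.
move=> [H HP]; have [G [nG GH]] := asym_nice H (separable_susp sepA).
pose ev x := asym_post (itv_ev set0 (suspension B) x) G.
have nev x : nice (ev x) by exact: nice_post_hom.
have a0 : aeq (ev (clamp 0)) (itv_asym endpoints np) by apply: aeq_ev GH _ => t a t1; exact: (HP t a t1).1.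
have a1 : aeq (ev (clamp 1)) (itv_asym endpoints nq) by apply: aeq_ev GH _ => t a t1; exact: (HP t a t1).2.
have F0 := fast_desuspension sepA gP ro r1 (nev _) a0.
have F1 := fast_desuspension sepA gP ro r1 (nev _) a1.
have F2 := fast_disc_homotopy sepA gP ri ro nG.
(* One p, and then one q, must serve for both ends and for the homotopy between them, so that the
   quantizations match. *)
have [p cp [[_ Q0] [[_ Q1] Q2]]] := fast_ex (fast_and F0 (fast_and F1 F2)).
have [q cq [[_ D0] [[_ D1] [chi0 [chi1 [E0 E1 h]]]]]] := fast_ex (fast_and Q0 (fast_and Q1 Q2)).
apply: homotopic_trans (homotopic_sym (D0 chi0 E0)) _.
exact: homotopic_trans h (D1 chi1 E1).
Qed.

Let conf_ev (D : realCstarType R) h y z (G : bool * bool -> unit_itv R -> suspension D) d n w :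
  (conf h y z G d n) w = conf h y z (fun q x => G q x w) d n.
Proof. by rewrite /conf; case: (h n); case: d => [[]|]. Qed.

Lemma suspension_surjective (Psi0 : asym (suspension A) (suspension B)) :
  exists (chi : asym A B) (nc : nice chi), homotopic (itv_asym endpoints nc) Psi0.
Proof.
have [r [ri [ro r1]]] := isometries.
have sepS := separable_susp sepA.
have [Psi [nPsi PP]] := asym_nice Psi0 sepS.
suff [chi [nc h]] : exists (chi : asym A B) (nc : nice chi), homotopic (itv_asym endpoints nc) Psi.
  by exists chi, nc; apply: homotopic_trans h (aeq_homotopic PP).
have nSP : nice (itv_asym endpoints nPsi) by exact: itv_fam_nice.
pose Psi' := asym_post (swap endpoints endpoints B) (asym_pre (swap endpoints endpoints A) (itv_asym endpoints nPsi)).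
have nPsi' : nice Psi' by apply: nice_post_hom; exact: nice_pre.
have [H HP] : homotopic Psi' (itv_asym endpoints nPsi) by exact: flip_susp_homotopic.
have [G [nG GH]] := asym_nice H (separable_susp sepS).
pose ev x := asym_post (itv_ev set0 (suspension (suspension B)) x) G.
have nev x : nice (ev x) by exact: nice_post_hom.
have a0 : aeq (ev (clamp 0)) Psi' by apply: aeq_ev GH _ => t a t1; exact: (HP t a t1).1.
have a1 : aeq (ev (clamp 1)) (itv_asym endpoints nPsi) by apply: aeq_ev GH _ => t a t1; exact: (HP t a t1).2.
pose gS := hs_data_susp gP.
pose rS n := itv_mult endpoints (ri n).
have riS n : is_isometry (rS n) by exact: itv_mult_isometry.
have roS i j F : i != j -> mult_adj (rS i) (rS j F) = 0.
  by move=> ij; apply/itv_eqP => x; exact: ro.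
have r1S : hh (conj_hom (riS 1)) (starhom_id (suspension B)).
  apply: (@hh_trans _ _ _ _ (itv_map endpoints (conj_hom (ri 1)))).
    by apply: hh_ext => F; apply/itv_eqP.
  apply: hh_trans (hh_itv_map endpoints r1) _.
  by apply: hh_ext => F; apply/itv_eqP.
have F1 := fast_desuspension sepS gS roS r1S (nev _) a1.
have F2 := fast_disc_homotopy sepS gS riS roS nG.
have F3 := fast_system nPsi sepA (loop_system gP).
have F4 : fast (fun p => forall d F, ev (clamp 0) (p t) (loop gS d t F) - Psi' (p t) (loop gS d t F)
    @[t --> +oo_R] --> (0 : suspension (suspension B))).
  apply: fast_fin => d; apply: (fast_aeq sepS (nev _) nPsi') a0.
  exact: sys_nice (loop_system gS) d.
have [p cp [[_ Q1] [Q2 [sc Q4]]]] := fast_ex (fast_and F1 (fast_and F2 (fast_and F3 F4))).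
have Q3 := fast_mesh (sys_nice sc) sepA.
have [q cq [[_ D1] [[chi0 [chi1 [E0 E1 h]]] mq]]] := fast_ex (fast_and Q1 (fast_and Q2 Q3)).
have [nchi achi] := disc_spec ri ro sc cq mq.
exists (Asym achi), nchi.
apply: homotopic_trans (homotopic_trans h (D1 chi1 E1)).
(* The suspension of the quantization of [Psi] equals the quantization of [Psi'], and G at 0 agrees
   with [Psi'] asymptotically along the loops. *)
apply: aeq_homotopic => F.
apply: cvg0_eq (cvg0N (disc_aeq riS roS q Q4 F)) => t _.
rewrite E0 opprB; congr (_ - _); apply/itv_eqP => z.
rewrite [RHS](assemble_ev ri); apply: assemble_eq => d n.
(* Swapping the variables of a loop of SA and evaluating at z gives the loop of A at F z, since
   configurations commute with evaluation. *)
have loopS : swap endpoints endpoints A (loop gS d t F) z = loop gP d t (F z).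
  apply/itv_eqP => y; rewrite swapE (loopE gS _ _ _ _ 0) (loopE gP _ _ _ _ 0) conf_ev.
  by [].
rewrite -[RHS]/(Psi (p t) (swap endpoints endpoints A (loop gS d t F) z) (node (q t) n)).
by rewrite loopS.
Qed.

End bijectivity.

Lemma inj_surj_bijective (X Y : Type) (f : X -> Y) : injective f -> (forall y, exists x, f x = y) ->
  bijective f.
Proof.
move=> fI fS; have [g gP] := choice fS; exists g => //.
by move=> x; apply: fI; exact: gP.
Qed.

Lemma hpost_retract (R : realType) (A B C : realCstarType R) (f : starhom C B) (g : starhom B C)
  (x : homotopy_classes A B) : hh (starhom_comp f g) (starhom_id B) -> hpost f (hpost g x) = x.
Proof.
move=> fg; rewrite -[x]hreprK !hpostE; apply/hclassP.
apply: homotopic_trans (homotopic_trans (hh_asym_post (hrepr x) fg) _); first exact: homotopic_ext.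
exact: homotopic_ext.
Qed.

(** * Independence of the direct sum from the isometries *)

Section intertwiner.
Variables (R : realType) (T : realCstarType R) (s : cuntz_pair T) (w1 w2 : multiplier T).
Hypotheses (i1 : is_isometry w1) (i2 : is_isometry w2).
Hypothesis w12 : forall x, mult_adj w1 (w2 x) = 0.

Let s1 := cuntz1 s.
Let s2 := cuntz2 s.

(* [w1 s1^* + w2 s2^*] *)
Lemma intertwiner_subproof x y : cstar (w1 (mult_adj s1 x) + w2 (mult_adj s2 x)) ** y =
  cstar x ** (s1 (mult_adj w1 y) + s2 (mult_adj w2 y)).
Proof. by rewrite cstarD cmulDl !mult_adjP !mult_adjP' -cmulDr. Qed.
Definition intertwiner := Multiplier intertwiner_subproof.

Lemma intertwiner_isometry : is_isometry intertwiner.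
Proof.
have w21 := adj_orth_sym w12.
by move=> x; rewrite /= !mult_adjD !i1 !i2 w12 w21 addr0 add0r cuntz_sum.
Qed.

(** Conjugation by the isometry [intertwiner] carries the direct sum taken with [s] to the one taken
    with w1 and w2. As it is homotopic to the identity, the two sums have the same class. *)
Lemma intertwiner_conj x y : mult_conj intertwiner (mult_conj s1 x + mult_conj s2 y) =
  mult_conj w1 x + mult_conj w2 y.
Proof.
have U1 z : intertwiner (s1 z) = w1 z.
  by rewrite /= cuntz1_isometry cuntz_adj21 mult_op0 addr0.
have U2 z : intertwiner (s2 z) = w2 z.
  by rewrite /= cuntz2_isometry cuntz_adj12 mult_op0 add0r.
have [_ _ st1] : is_starhom (mult_conj s1) := mult_conj_starhom (@cuntz1_isometry _ _ s).
have [_ _ st2] : is_starhom (mult_conj s2) := mult_conj_starhom (@cuntz2_isometry _ _ s).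
have conjE u z : mult_conj u z = u (cstar (u (cstar z))) by [].
rewrite [LHS]conjE (cstarD (mult_conj s1 x)) -st1 -st2 mult_opD.
rewrite (cstarD (intertwiner (mult_conj s1 _))) mult_opD.
rewrite [mult_conj s1 _]conjE [mult_conj s2 _]conjE U1 U2 !cstarK.
by rewrite [cstar (w1 _)]mult_comm [cstar (w2 _)]mult_comm U1 U2.
Qed.

End intertwiner.

Theorem theorem4p9 (R : realType) (K : compact_operators R)
  (e : rank_one_projection K) (A : realCstarType R)
  (sepA : separable A) (stA : stable K A) (hsA : homotopy_symmetric e A)
  (B : realCstarType R) (sepB : separable B) (stB : stable K B)
  (SBK : tensor_product (suspension B) K) :
  exists Sigma : homotopy_classes A B ->
                 homotopy_classes (suspension A) (suspension B),
    is_suspension_map Sigma /\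
    semigroup_isomorphism
      (fun x : homotopy_classes A B =>
         stabilization e SBK (Sigma x) : E_theory A SBK).
Proof.
have [Sigma [SigmaP SE]] := suspension_map B sepA; exists Sigma; split=> //.
have gB := stable_good e stB.
have [E [e00 EM Es Et]] := matrix_units e.
have [s0 s0_pure] := good_itv endpoints gB.
have [f [w [wi [cf fc]]]] := compression EM Es Et SBK s0_pure e00.
have [sT sT_pure] := tensor_good EM Es Et SBK.
(* The corner embedding is a homotopy equivalence with inverse [f], so that [stabilization] is
   bijective and bijectivity reduces to that of [Sigma]. *)
have cf_id : hh (starhom_comp (corner e SBK) f) (starhom_id SBK).
  by apply: hh_trans (hh_conj_id sT_pure wi); exact: hh_ext.
have fc_id : hh (starhom_comp f (corner e SBK)) (starhom_id (suspension B)).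
  by apply: hh_trans (hh_conj_id s0_pure (cuntz_seq_isometry s0 0)); exact: hh_ext.
have [g [k gP]] := hs_data_exists sepA stA hsA.
have rep (x : homotopy_classes A B) : exists (phi : asym A B) (np : nice phi), x = hclass phi.
  have [phi [np pp]] := asym_nice (hrepr x) sepA; exists phi, np.
  by rewrite -[LHS]hreprK; apply/hclassP/homotopic_sym/aeq_homotopic.
split.
- apply: inj_surj_bijective => [x y|y].
    move=> /(congr1 (hpost f)); rewrite /stabilization !(hpost_retract _ fc_id).
    have [phi [np ->]] := rep x; have [psi [nq ->]] := rep y.
    rewrite !(SE _ np) !(SE _ nq) => /hclassP h; apply/hclassP.
    exact: (suspension_injective sepA gB gP h).
  have [chi [nc h]] := suspension_surjective sepA gB gP (hrepr (hpost f y)).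
  exists (hclass chi); rewrite /stabilization (SE _ nc).
  have -> : hclass (itv_asym endpoints nc) = hpost f y by rewrite -[RHS]hreprK; apply/hclassP.
  exact: hpost_retract.
- have n0 : nice (asym_zero A B) by exact: nice_zero.
  rewrite /stabilization /hzero (SE _ n0) hpostE; apply/hclassP/homotopic_ext => t F _.
  rewrite /= -[RHS](starhom0 (corner e SBK)); congr (corner e SBK _).
  exact/itv_eqP.
move=> s s' x y.
have [phi [np ->]] := rep x; have [psi [nq ->]] := rep y.
have nd : nice (direct_sum s phi psi) by apply: niceD; exact: nice_post_hom.
rewrite haddE /stabilization (SE _ nd) (SE _ np) (SE _ nq) !hpostE haddE; apply/hclassP.
(* The pair [s] on [B] and the pair [s'] on [SBK] are unrelated. [s] acts pointwise on SB and then,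
   amplified, on [SBK], where the intertwiner compares it with [s']. *)
pose v1 := itv_mult endpoints (@cuntz1_isometry _ _ s).
pose v2 := itv_mult endpoints (@cuntz2_isometry _ _ s).
have v1i : is_isometry v1 by exact: itv_mult_isometry.
have v2i : is_isometry v2 by exact: itv_mult_isometry.
have [w1 [w1i w1E w1A]] := amplify EM Es Et SBK v1i.
have [w2 [w2i w2E w2A]] := amplify EM Es Et SBK v2i.
have w12 := amplify_orth Et w1i w2i.
have tens0 m : tp_tens SBK 0 m = 0.
  have := tensLl (tp_P SBK) (-1) 0 0 m.
  by rewrite scaler0 addr0 scaleN1r addNr.
have {}w12 z : mult_adj w1 (w2 z) = 0.
  apply: w12 => b i j; rewrite w2E w1A (_ : mult_adj v1 (v2 b) = 0) ?tens0//.
  by apply/itv_eqP => u; exact: cuntz_adj12.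
have tens_conj (v : multiplier (suspension B)) (u : multiplier SBK) b :
    (forall b i j, u (tp_tens SBK b (E i j)) = tp_tens SBK (v b) (E i j)) ->
    corner e SBK (mult_conj v b) = mult_conj u (corner e SBK b).
  move=> uE; rewrite /= /mult_conj -e00.
  by rewrite -(tens_star (tp_P SBK)) Es uE -(tens_star (tp_P SBK)) Es uE.
have h := hh_conj_id sT_pure (intertwiner_isometry s' w1i w2i w12).
apply: homotopic_trans (homotopic_trans (hh_asym_post _ h) _); last exact: homotopic_ext.
(* The two sides are now equal at every time: the corner embedding carries conjugation by v1 and v2
   to conjugation by their amplifications. *)
apply: homotopic_ext => t F _.
rewrite -[RHS]/(mult_conj (intertwiner s' w1 w2) (mult_conj (cuntz1 s') (corner e SBK (itv_asym endpoints np t F)) +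
   mult_conj (cuntz2 s') (corner e SBK (itv_asym endpoints nq t F)))).
rewrite intertwiner_conj -(tens_conj _ _ _ w1E) -(tens_conj _ _ _ w2E) -starhomD.
by congr (corner e SBK _); apply/itv_eqP.
Qed.
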